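(* Let $U_1,U_2$ be connected commutative unipotent algebraic groups over $k$ and let $\mathcal{L}$ be a bimultiplicative $\overline{\mathbb{Q}}_\ell$-local system on $U_1\times U_2$. Then the associated biadditive pairing $B:\pi_0(K_1)\times\pi_0(K_2)\to\mathbb{Q}_p/\mathbb{Z}_p$ is non-degenerate.
   Context: **Conventions.** $k$ is an algebraically closed field of characteristic $p>0$, $\ell\ne p$ is a prime, and $\psi:\mathbb{Q}_p/\mathbb{Z}_p\hookrightarrow\overline{\mathbb{Q}}_\ell^\times$ is a fixed injective character. All schemes are over $k$; unipotent algebraic groups are reduced and of finite type; $X_{\mathrm{perf}}$ denotes the perfectization of $X$. **Biextensions and Serre duality.** A biextension of $G_1\times G_2$ by a discrete commutative group $A$ is an $A$-torsor $\pi:E\to G_1\times G_2$ with trivializations along $1\times G_2$ and $G_1\times 1$ and two mutually compatible partial group laws, making $E$ a central extension of $G_1\times G_2$ by $A$ both as group over $G_2$ and as group over $G_1$. For a perfect connected commutative unipotent group $U$ (perfectization of a connected commutative unipotent algebraic group), the Serre dual $U^*$ is the perfect connected commutative unipotent group that is the moduli space of central extensions of $U$ by $\mathbb{Q}_p/\mathbb{Z}_p$. There are canonical isomorphisms $\mathrm{Hom}(U_{1,\mathrm{perf}},U_{2,\mathrm{perf}}^* )\cong\mathrm{Biext}(U_1,U_2)\cong\mathrm{Hom}(U_{2,\mathrm{perf}},U_{1,\mathrm{perf}}^* )$ (biextensions by $\mathbb{Q}_p/\mathbb{Z}_p$), with composite $f\mapsto f^*$; $f$ sends $x$ to the class of the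 restriction of the biextension to $\{x\}\times U_2$. A bimultiplicative local system on $U_1\times U_2$ is a $\overline{\mathbb{Q}}_\ell$-local system $\mathcal{L}$ with $(\mu_1\times\mathrm{id})^*\mathcal{L}\cong pr_{13}^*\mathcal{L}\otimes pr_{23}^*\mathcal{L}$ on $U_1\times U_1\times U_2$, $(\mathrm{id}\times\mu_2)^*\mathcal{L}\cong pr_{12}^*\mathcal{L}\otimes pr_{13}^*\mathcal{L}$ on $U_1\times U_2\times U_2$ ($\mu_i$ = multiplication), and a trivialization of the stalk at the identity. Via $\psi$ these correspond bijectively to biextensions $E$ of $U_1\times U_2$ by $\mathbb{Q}_p/\mathbb{Z}_p$. **The pairing $B$.** Let $E$ be the biextension by $\mathbb{Q}_p/\mathbb{Z}_p$ corresponding to $\mathcal{L}$, with homomorphisms $f,f^*$. Let $K_1\le U_1$, $K_2\le U_2$ be the reduced closed subgroups underlying $\ker f$, $\ker f^*$ (equivalently, $K_1$ consists of those $x$ with $\mathcal{L}|_{\{x\}\times U_2}$ trivial, and similarly $K_2$). The restrictions of $E$ to $K_1\times U_2$ and $U_1\times K_2$ have unique trivializations as biextensions, given by sections $\sigma_1$ and $\sigma_2$. Define $B:K_1\times K_2\to\mathbb{Q}_p/\mathbb{Z}_p$ by $\sigma_1(x,y)=B(x,y)\cdot\sigma_2(x,y)$; it is biadditive and factors through $\pi_0(K_1)\times\pi_0(K_2)$. *)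

(* Defs.v *)
From HB Require Import structures.
From mathcomp Require Import all_boot all_order all_algebra.
From mathcomp Require Import mxtens.
From mathcomp Require Import all_classical all_reals all_analysis.
Set Implicit Arguments.
Unset Strict Implicit.
Unset Printing Implicit Defensive.
Import Order.TTheory GRing.Theory Num.Theory.
Local Open Scope classical_set_scope.
Local Open Scope ring_scope.

(* All schemes in play are reduced, of finite type and affine over an
   algebraically closed field k (or, for torsors under a discrete group, disjoint
   unions of such), so they are handled as classical varieties: a set of k-points
   with its k-algebra of regular functions.  The points of an affine variety are
   required to be all the k-algebra morphisms from its coordinate ring to k. *)

Section Varieties.
Variable k : closedFieldType.

Definition subalgebra (X : Type) (P : set (X -> k)) : Prop :=
  [/\ forall c : k, P (fun _ => c),
      forall f g, P f -> P g -> P (fun x => f x + g x) &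
      forall f g, P f -> P g -> P (fun x => f x * g x)].

Definition generated_subalgebra (X : Type) (S : set (X -> k)) : set (X -> k) :=
  [set f | forall P, subalgebra P -> S `<=` P -> P f].

Definition algebra_point (X : Type) (O : set (X -> k)) (h : (X -> k) -> k) : Prop :=
  [/\ forall c : k, h (fun _ => c) = c,
      forall f g, O f -> O g -> h (fun x => f x + g x) = h f + h g &
      forall f g, O f -> O g -> h (fun x => f x * g x) = h f * h g].

Record is_affine_variety (X : Type) (O : set (X -> k)) : Prop := IsAffineVariety {
  aff_subalgebra : subalgebra O;
  aff_fingen : exists (n : nat) (g : 'I_n -> X -> k),
    O = generated_subalgebra (range g);
  aff_separated : forall x y : X, (forall f, O f -> f x = f y) -> x = y;
  aff_points : forall h, algebra_point O h ->
    exists x : X, forall f, O f -> h f = f x }.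

Record variety := Variety {
  vpts :> choiceType;
  regular : set (vpts -> k);
  variety_affine : is_affine_variety regular }.

Definition morphism (X Y : variety) (g : X -> Y) : Prop :=
  forall f, @regular Y f -> @regular X (f \o g).

Lemma generated_subalgebraP (X : Type) (S : set (X -> k)) :
  subalgebra (generated_subalgebra S).
Proof.
split=> [c|f g Hf Hg|f g Hf Hg] P HP HS; have [P0 PD PM] := HP.
- exact: P0.
- by apply: PD; [exact: Hf|exact: Hg].
- by apply: PM; [exact: Hf|exact: Hg].
Qed.

Definition prod_regular (X Y : variety) : set (X * Y -> k) :=
  generated_subalgebra
    ([set F | exists2 f, @regular X f & F = (fun z => f z.1)] `|`
     [set F | exists2 f, @regular Y f & F = (fun z => f z.2)]).

Lemma generated_comp (X Z : Type) (u : Z -> X) (S : set (X -> k))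
    (P : set (Z -> k)) :
  subalgebra P -> (forall f, S f -> P (f \o u)) ->
  forall f, generated_subalgebra S f -> P (f \o u).
Proof.
move=> [P0 PD PM] SP f Sf.
have := Sf [set f : X -> k | P (f \o u)]; apply=> //; split=> /=.
- by move=> c; exact: (P0 c).
- by move=> a b Pa Pb; exact: (PD _ _ Pa Pb).
- by move=> a b Pa Pb; exact: (PM _ _ Pa Pb).
Qed.

Lemma prod_affine (X Y : variety) : is_affine_variety (@prod_regular X Y).
Proof.
have regl f : @regular X f -> prod_regular (fun z : X * Y => f z.1).
  by move=> Hf P _; apply; left; exists f.
have regr f : @regular Y f -> prod_regular (fun z : X * Y => f z.2).
  by move=> Hf P _; apply; right; exists f.
have sub := generated_subalgebraP ([set F | exists2 f, @regular X f &
       F = (fun z : X * Y => f z.1)] `|`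
     [set F | exists2 f, @regular Y f & F = (fun z => f z.2)]).
split.
- exact: sub.
- have [n [g Hg]] := aff_fingen (variety_affine X).
  have [m [h Hh]] := aff_fingen (variety_affine Y).
  exists (n + m)%N, (fun (i : 'I_(n + m)) (z : X * Y) =>
     match fintype.split i with inl a => g a z.1 | inr b => h b z.2 end).
  apply/seteqP; split=> F HF P HP HS.
  + apply: (HF P HP) => {F HF} F [[f Hf ->]|[f Hf ->]].
    * rewrite Hg in Hf; apply: (@generated_comp _ (X * Y)%type fst _ P HP _ f Hf).
      move=> _ [i _ <-]; apply: HS; exists (fintype.unsplit (inl i)) => //.
      by apply/funext => z; rewrite fintype.unsplitK.
    * rewrite Hh in Hf; apply: (@generated_comp _ (X * Y)%type snd _ P HP _ f Hf).
      move=> _ [i _ <-]; apply: HS; exists (fintype.unsplit (inr i)) => //.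
      by apply/funext => z; rewrite fintype.unsplitK.
  + apply: (HF P HP) => {F HF} _ [i _ <-]; apply: HS.
    case: (fintype.split i) => a.
    * by left; exists (g a) => //; rewrite Hg => Q _; apply; exists a.
    * by right; exists (h a) => //; rewrite Hh => Q _; apply; exists a.
- move=> [x y] [x' y'] H; congr pair.
  + by apply: (aff_separated (variety_affine X)) => f /regl /H.
  + by apply: (aff_separated (variety_affine Y)) => f /regr /H.
- move=> h [h0 hD hM].
  have [|x Hx] := aff_points (variety_affine X) (h := fun f => h (fun z => f z.1)).
    by split=> [c|f g Hf Hg|f g Hf Hg]; [exact: h0|apply: hD|apply: hM]; exact: regl.
  have [|y Hy] := aff_points (variety_affine Y) (h := fun f => h (fun z => f z.2)).
    by split=> [c|f g Hf Hg|f g Hf Hg]; [exact: h0|apply: hD|apply: hM]; exact: regr.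
  have [s0 sD sM] := sub.
  exists (x, y) => F HF.
  suff [//] : [set F | prod_regular F /\ h F = F (x, y)] F.
  apply: HF => [|_ [[f Hf ->]|[f Hf ->]]]; last 2 first.
  + by split; [exact: regl|exact: Hx].
  + by split; [exact: regr|exact: Hy].
  split=> [c|f g [Rf Ef] [Rg Eg]|f g [Rf Ef] [Rg Eg]].
  + by split; [exact: s0|exact: h0].
  + by split; [exact: sD|rewrite hD// Ef Eg].
  + by split; [exact: sM|rewrite hM// Ef Eg].
Qed.

Definition prodv (X Y : variety) : variety :=
  @Variety (X * Y)%type (@prod_regular X Y) (prod_affine X Y).

Definition zariski (X : variety) : Type := vpts X.
HB.instance Definition _ (X : variety) := Choice.on (zariski X).

Definition zariski_open (X : variety) : set (set (zariski X)) :=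
  [set U | exists2 F : set (X -> k), F `<=` @regular X &
     U = [set x | exists2 f, F f & f x != 0]].

Lemma zariski_openT (X : variety) : zariski_open (X := X) setT.
Proof.
have [r0 _ _] := aff_subalgebra (variety_affine X).
exists [set (fun _ => 1)] => [_ ->|]; first exact: r0.
by apply/seteqP; split=> x // _; exists (fun _ => 1) => //; exact: oner_neq0.
Qed.

Lemma zariski_openI (X : variety) : setI_closed (zariski_open (X := X)).
Proof.
have [_ _ rM] := aff_subalgebra (variety_affine X).
move=> _ _ [F HF ->] [G HG ->].
exists [set h | exists f g, [/\ F f, G g & h = (fun x => f x * g x)]].
  by move=> _ [f [g [Ff Gg ->]]]; apply: rM; [exact: HF|exact: HG].
apply/seteqP; split=> x /=.
  move=> [[f Ff fx] [g Gg gx]]; exists (fun x => f x * g x).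
    by exists f, g.
  by rewrite mulf_neq0.
move=> [_ [f [g [Ff Gg ->]]]]; rewrite mulf_eq0 negb_or => /andP[fx gx].
by split; [exists f|exists g].
Qed.

Lemma zariski_open_bigU (X : variety) (I : Type) (f : I -> set (zariski X)) :
  (forall i, zariski_open (f i)) -> zariski_open (\bigcup_i f i).
Proof.
move=> H; exists [set h | exists i, exists2 F : set (X -> k),
    F `<=` @regular X /\ f i = [set x | exists2 f, F f & f x != 0] & F h].
  by move=> h [i [F [HF _] Fh]]; exact: HF.
apply/seteqP; split=> x /=.
  move=> [i _]; have [F HF E] := H i; rewrite E => -[h Fh hx].
  by exists h => //; exists i, F.
move=> [h [i [F [HF E] Fh]] hx]; exists i => //; rewrite E; by exists h.
Qed.

HB.instance Definition _ (X : variety) :=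
  isOpenTopological.Build (zariski X)
    (@zariski_openT X) (@zariski_openI X) (@zariski_open_bigU X).

Definition locally_constant (X : variety) (A : Type) (a : X -> A) : Prop :=
  forall v : A, open [set x : zariski X | a x = v].

(* The type of connected components of a subset K of X. *)
Definition pi0 (X : variety) (K : set X) : Type :=
  {C : set (zariski X) | exists2 x, K x & connected_component (K : set (zariski X)) x = C}.

Definition pi0_class (X : variety) (K : set X) (x : {x | K x}) : pi0 K :=
  exist _ (connected_component (K : set (zariski X)) (sval x))
    (ex_intro2 _ _ (sval x) (svalP x) erefl).

(* O(X)-linear maps O(Y) -> O(X), where O(X) acts on O(Y) through g : Y -> X. *)
Definition regular_linear (Y X : variety) (g : Y -> X)
    (phi : (Y -> k) -> (X -> k)) : Prop :=
  (forall f, @regular Y f -> @regular X (phi f)) /\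
  (forall a f f', @regular X a -> @regular Y f -> @regular Y f' ->
     phi (fun y => a (g y) * f y + f' y) = (fun x => a x * phi f x + phi f' x)).

(* O(Y) is a finitely generated projective O(X)-module, with dual basis
   (b i, phi i), and the trace form (f, h) |-> tr (f h) is perfect. *)
Definition finite_etale (Y X : variety) (g : Y -> X) : Prop :=
  morphism g /\
  exists (n : nat) (b : 'I_n -> Y -> k) (phi : 'I_n -> (Y -> k) -> (X -> k)),
  let tr f := fun x => \sum_i phi i (fun y => f y * b i y) x in
  [/\ forall i, @regular Y (b i) /\ regular_linear g (phi i),
      forall f, @regular Y f -> forall y, f y = \sum_i phi i f (g y) * b i y,
      forall h, @regular Y h ->
        (forall f, @regular Y f -> tr (fun y => f y * h y) = (fun _ => 0)) ->
        h = (fun _ => 0) &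
      forall theta, regular_linear g theta -> exists2 h, @regular Y h &
        forall f, @regular Y f -> theta f = tr (fun y => f y * h y)].

Record cover (X : variety) := Cover {
  cov_var :> variety;
  cov_map : cov_var -> X;
  cov_etale : finite_etale cov_map }.

Definition fibre (X : variety) (C : cover X) (x : X) : Type :=
  {c : C | cov_map c = x}.

(* The etale fundamental group: automorphisms of the fibre functor at x on
   finite etale covers. *)
Record pi1 (X : variety) (x : X) := Pi1 {
  mono :> forall C : cover X, fibre C x -> fibre C x;
  mono_bij : forall C, bijective (@mono C);
  mono_nat : forall (C D : cover X) (h : C -> D), morphism h ->
    (forall c, cov_map (h c) = cov_map c) ->
    forall (c : fibre C x) (d : fibre D x),
    sval d = h (sval c) -> sval (mono d) = h (sval (mono c)) }.

Definition pi1_id (X : variety) (x : X) : pi1 x.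
Proof.
by refine (@Pi1 X x (fun C c => c) _ _) => // C; exists id.
Defined.

Definition pi1_comp (X : variety) (x : X) (u v : pi1 x) : pi1 x.
Proof.
refine (@Pi1 X x (fun C c => u C (v C c)) _ _).
- by move=> C; exact: bij_comp (mono_bij u C) (mono_bij v C).
- move=> C D h hm hp c d E.
  by apply: mono_nat => //; apply: mono_nat.
Defined.

(* v = g_* u in pi1 X (g y), for u in pi1 Y y.  Since the map h factors through
   the pulled back cover C x_X Y, this determines v, and such a v exists. *)
Definition pi1_push (Y X : variety) (g : Y -> X) (y : Y) (x : X)
    (u : pi1 y) (v : pi1 x) : Prop :=
  forall (D : cover Y) (C : cover X) (h : D -> C), morphism h ->
    (forall d, cov_map (h d) = g (cov_map d)) ->
    forall (d : fibre D y) (c : fibre C x),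
    sval c = h (sval d) -> sval (v C c) = h (sval (u D d)).

(* Commutative algebraic groups, written additively. *)
Record calg_group := CAlgGroup {
  cag :> zmodType;
  cag_regular : set (cag -> k);
  cag_affine : is_affine_variety cag_regular;
  cag_var := Variety cag_affine;
  cag_addP : @morphism (prodv cag_var cag_var) cag_var (fun z => z.1 + z.2);
  cag_oppP : @morphism cag_var cag_var (fun x => - x) }.

(* A closed embedding into a group of upper unitriangular matrices. *)
Definition unipotent (G : calg_group) : Prop :=
  exists (n : nat) (r : G -> 'M[k]_n),
  [/\ forall x y, r (x + y) = r x *m r y,
      forall x (i j : 'I_n), (j <= i)%N -> r x i j = (i == j)%:R &
      @cag_regular G =
        generated_subalgebra [set f | exists i j, f = (fun x => r x i j)]].

Definition connected_group (G : calg_group) : Prop :=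
  connected [set: zariski (cag_var G)].

(* Torsors over X under the discrete torsion group A, in the etale topology.
   E is given by its k-points together with, for each affine variety T, the set
   of morphisms T -> E ("plots"), viewed as maps on k-points.  Because A is
   torsion and X is quasi-compact, such a torsor comes from a finite subgroup
   of A, so trivialization and descent along finite etale covers suffice. *)
Record torsor (X : variety) (A : zmodType) := Torsor {
  tot :> Type;
  plot : forall T : variety, (T -> tot) -> Prop;
  tproj : tot -> X;
  act : A -> tot -> tot;
  act0 : forall e, act 0 e = e;
  actD : forall a b e, act (a + b) e = act a (act b e);
  tproj_act : forall a e, tproj (act a e) = tproj e;
  act_simply_transitive : forall e e', tproj e = tproj e' ->
    exists! a, e' = act a e;
  plot_proj : forall (T : variety) (s : T -> tot), plot s -> morphism (tproj \o s);
  plot_comp : forall (T' T : variety) (g : T' -> T) (s : T -> tot),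
    morphism g -> plot s -> plot (s \o g);
  plot_descent : forall (T' T : variety) (g : T' -> T) (s : T -> tot),
    finite_etale g -> set_surj setT setT g -> plot (s \o g) -> plot s;
  plot_act : forall (T : variety) (s : T -> tot) (a : T -> A),
    plot s -> locally_constant a -> plot (fun t => act (a t) (s t));
  plot_diff : forall (T : variety) (s : T -> tot) (a : T -> A),
    plot s -> plot (fun t => act (a t) (s t)) -> locally_constant a;
  locally_trivial : exists (C : cover X) (s : C -> tot),
    [/\ set_surj setT setT (@cov_map X C), plot s &
        forall c, tproj (s c) = cov_map c] }.

(* A structure on E, over X, of central extension of G by A relative to a base S,
   when (q, b) identifies X with G x S. *)
Record relative_extension (X S : variety) (G A : zmodType) (E : torsor X A)
    (q : X -> G) (b : X -> S) := RelativeExtension {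
  rmul : E -> E -> E;
  rone : S -> E;
  rinv : E -> E;
  rmul_base : forall e e', b (tproj e) = b (tproj e') ->
    b (tproj (rmul e e')) = b (tproj e);
  rmul_proj : forall e e', b (tproj e) = b (tproj e') ->
    q (tproj (rmul e e')) = q (tproj e) + q (tproj e');
  rone_base : forall s, b (tproj (rone s)) = s;
  rone_proj : forall s, q (tproj (rone s)) = 0;
  rinv_base : forall e, b (tproj (rinv e)) = b (tproj e);
  rmulA : forall e e' e'', b (tproj e) = b (tproj e') ->
    b (tproj e') = b (tproj e'') ->
    rmul e (rmul e' e'') = rmul (rmul e e') e'';
  rmul1e : forall e, rmul (rone (b (tproj e))) e = e;
  rmule1 : forall e, rmul e (rone (b (tproj e))) = e;
  rmulVe : forall e, rmul (rinv e) e = rone (b (tproj e));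
  rmuleV : forall e, rmul e (rinv e) = rone (b (tproj e));
  rmul_actl : forall a e e', b (tproj e) = b (tproj e') ->
    rmul (act a e) e' = act a (rmul e e');
  rmul_actr : forall a e e', b (tproj e) = b (tproj e') ->
    rmul e (act a e') = act a (rmul e e');
  rmul_plot : forall (T : variety) (s s' : T -> E), plot s -> plot s' ->
    (forall t, b (tproj (s t)) = b (tproj (s' t))) ->
    plot (fun t => rmul (s t) (s' t));
  rone_plot : forall (T : variety) (s : T -> S), morphism s -> plot (rone \o s);
  rinv_plot : forall (T : variety) (s : T -> E), plot s -> plot (rinv \o s) }.

(* rone lawG (resp. lawH) is the trivialization along 0 x H (resp. G x 0). *)
Record biextension (G H : calg_group) (A : zmodType) := Biextension {
  bitor :> torsor (prodv (cag_var G) (cag_var H)) A;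
  lawG : @relative_extension _ (cag_var H) G A bitor fst snd;
  lawH : @relative_extension _ (cag_var G) H A bitor snd fst;
  interchange : forall e1 e2 e3 e4 : bitor,
    (tproj e1).2 = (tproj e2).2 -> (tproj e3).2 = (tproj e4).2 ->
    (tproj e1).1 = (tproj e3).1 -> (tproj e2).1 = (tproj e4).1 ->
    rmul lawH (rmul lawG e1 e2) (rmul lawG e3 e4) =
    rmul lawG (rmul lawH e1 e3) (rmul lawH e2 e4) }.

Section Pairing.
Variables (G H : calg_group) (A : zmodType) (E : biextension G H A).

(* k-points of ker f and ker f*: f sends x to the class of the central extension
   E_x of H by A, so x lies in ker f iff E_x splits.  The perfections have the
   same k-points, and a reduced closed subgroup is determined by these. *)
Definition K1 : set (cag_var G) :=
  [set x | exists s : cag_var H -> E,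
     [/\ plot s, forall y, tproj (s y) = (x, y) &
         forall y y' : H, s (y + y') = rmul (lawH E) (s y) (s y')]].

Definition K2 : set (cag_var H) :=
  [set y | exists s : cag_var G -> E,
     [/\ plot s, forall x, tproj (s x) = (x, y) &
         forall x x' : G, s (x + x') = rmul (lawG E) (s x) (s x')]].

(* A trivialization, as a biextension, of the restriction of E to L x M, where L
   and M are closed subgroups with their reduced structure; the values of sigma
   outside L x M are irrelevant. *)
Definition trivializes (L : set G) (M : set H) (sigma : G -> H -> E) : Prop :=
  [/\ forall x y, L x -> M y -> tproj (sigma x y) = (x, y),
      forall x x' y, L x -> L x' -> M y ->
        sigma (x + x') y = rmul (lawG E) (sigma x y) (sigma x' y),
      forall x y y', L x -> M y -> M y' ->
        sigma x (y + y') = rmul (lawH E) (sigma x y) (sigma x y') &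
      forall (T : variety) (u : T -> cag_var G) (v : T -> cag_var H),
        morphism u -> morphism v -> (forall t, L (u t)) -> (forall t, M (v t)) ->
        plot (fun t => sigma (u t) (v t))].

Definition associated_pairing (B : pi0 K1 -> pi0 K2 -> A)
    (sigma1 sigma2 : G -> H -> E) : Prop :=
  forall (x : {x | K1 x}) (y : {y | K2 y}),
    sigma1 (sval x) (sval y) =
    act (B (pi0_class x) (pi0_class y)) (sigma2 (sval x) (sval y)).

Definition biadditive_pairing (B : pi0 K1 -> pi0 K2 -> A) : Prop :=
  (forall (x x' x'' : {x | K1 x}) d, sval x'' = sval x + sval x' :> G ->
     B (pi0_class x'') d = B (pi0_class x) d + B (pi0_class x') d) /\
  (forall c (y y' y'' : {y | K2 y}), sval y'' = sval y + sval y' :> H ->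
     B c (pi0_class y'') = B c (pi0_class y) + B c (pi0_class y')).

Definition nondegenerate_pairing (B : pi0 K1 -> pi0 K2 -> A) : Prop :=
  (forall c, (forall d, B c d = 0) ->
     sval c = connected_component (K1 : set (zariski (cag_var G))) (0 : G)) /\
  (forall d, (forall c, B c d = 0) ->
     sval d = connected_component (K2 : set (zariski (cag_var H))) (0 : H)).

End Pairing.
End Varieties.

(* Q_p is characterized as a complete field for a multiplicative ultrametric norm
   with |p| = 1/p, in which Q is dense. *)
Record padic_field (R : realType) (p : nat) := PadicField {
  Qp :> fieldType;
  Qp_norm : Qp -> R;
  Qp_norm_ge0 : forall x, 0 <= Qp_norm x;
  Qp_norm_eq0 : forall x, Qp_norm x = 0 -> x = 0;
  Qp_normM : forall x y, Qp_norm (x * y) = Qp_norm x * Qp_norm y;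
  Qp_normD : forall x y, Qp_norm (x + y) <= Num.max (Qp_norm x) (Qp_norm y);
  Qp_normp : Qp_norm p%:R = p%:R^-1;
  Qp_dense : forall x (e : R), 0 < e -> exists q : rat, Qp_norm (x - ratr q) < e;
  Qp_complete : forall u : nat -> Qp,
    (forall e : R, 0 < e -> exists N, forall m n, (N <= m)%N -> (N <= n)%N ->
       Qp_norm (u m - u n) < e) ->
    exists l, forall e : R, 0 < e -> exists N, forall n, (N <= n)%N ->
       Qp_norm (u n - l) < e }.

Record QpmodZp (R : realType) (p : nat) := QpModZp {
  QZ :> zmodType;
  QZ_Qp : padic_field R p;
  QZ_proj : {additive QZ_Qp -> QZ};
  QZ_surj : forall a, exists x, QZ_proj x = a;
  QZ_ker : forall x, QZ_proj x = 0 <-> Qp_norm x <= 1 }.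

(* An algebraic closure of Q_l, with the norm extending that of Q_l. *)
Record Qlbar (R : realType) (l : nat) := QlBar {
  Qlb :> closedFieldType;
  Qlb_Ql : padic_field R l;
  Qlb_emb : {rmorphism Qlb_Ql -> Qlb};
  Qlb_alg : forall x, algebraicOver Qlb_emb x;
  Qlb_norm : Qlb -> R;
  Qlb_norm_ge0 : forall x, 0 <= Qlb_norm x;
  Qlb_norm_eq0 : forall x, Qlb_norm x = 0 -> x = 0;
  Qlb_normM : forall x y, Qlb_norm (x * y) = Qlb_norm x * Qlb_norm y;
  Qlb_normD : forall x y, Qlb_norm (x + y) <= Num.max (Qlb_norm x) (Qlb_norm y);
  Qlb_norm_emb : forall x, Qlb_norm (Qlb_emb x) = Qp_norm x }.

Section LocalSystems.
Variables (k : closedFieldType) (R : realType) (l : nat) (F : Qlbar R l).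

(* Q_l-bar local systems on a connected variety X, as continuous representations
   of pi1 X x on the stalk at x. *)
Record local_system (X : variety k) (x : X) := LocalSystem {
  ls_rank : nat;
  ls_rep : pi1 x -> 'M[F]_ls_rank;
  ls_rep1 : ls_rep (pi1_id x) = 1%:M;
  ls_repM : forall u v, ls_rep (pi1_comp u v) = ls_rep u *m ls_rep v;
  ls_continuous : forall e : R, 0 < e -> exists C : cover X,
    forall u : pi1 x, (forall c : fibre C x, u C c = c) ->
    forall i j, Qlb_norm (ls_rep u i j - (1%:M : 'M[F]_ls_rank) i j) < e }.

Arguments ls_rep {X x} L u : rename.

(* g^* L is isomorphic to (g1^* L) (x) (g2^* L), for g, g1, g2 : Y -> X all
   mapping y to x. *)
Definition pullback_iso_tensor (Y X : variety k) (y : Y) (x : X)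
    (L : local_system x) (g g1 g2 : Y -> X) : Prop :=
  exists (P : 'M[F]_(ls_rank L, ls_rank L * ls_rank L))
         (Q : 'M[F]_(ls_rank L * ls_rank L, ls_rank L)),
  [/\ P *m Q = 1%:M, Q *m P = 1%:M &
      forall (u : pi1 y) (v v1 v2 : pi1 x),
        pi1_push g u v -> pi1_push g1 u v1 -> pi1_push g2 u v2 ->
        ls_rep L v *m P = P *m (ls_rep L v1 *t ls_rep L v2)].

Definition bimultiplicative (U1 U2 : calg_group k)
    (L : @local_system (prodv (cag_var U1) (cag_var U2)) (0 : U1, 0 : U2)) : Prop :=
  [/\ @pullback_iso_tensor
        (prodv (prodv (cag_var U1) (cag_var U1)) (cag_var U2)) _
        (0 : U1, 0 : U1, 0 : U2) _ L
        (fun z => (z.1.1 + z.1.2 : U1, z.2))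
        (fun z => (z.1.1, z.2)) (fun z => (z.1.2, z.2)),
      @pullback_iso_tensor
        (prodv (cag_var U1) (prodv (cag_var U2) (cag_var U2))) _
        (0 : U1, (0 : U2, 0 : U2)) _ L
        (fun z => (z.1, z.2.1 + z.2.2 : U2))
        (fun z => (z.1, z.2.1)) (fun z => (z.1, z.2.2)) &
      (* a trivialization of the stalk at the identity *)
      exists (t : 'M[F]_(ls_rank L, 1)) (t' : 'M[F]_(1, ls_rank L)),
        t *m t' = 1%:M /\ t' *m t = 1%:M].

(* u acts on the fibre of E at x by a; every u in pi1 has exactly one such a when
   X is connected. *)
Definition monodromy (X : variety k) (x : X) (A : zmodType) (E : torsor X A)
    (u : pi1 x) (a : A) : Prop :=
  forall (C : cover X) (s : C -> E), plot s ->
    (forall c, tproj (s c) = cov_map c) ->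
    forall c : fibre C x, s (sval (u C c)) = act a (s (sval c)).

(* L is the local system induced from the A-torsor E through psi. *)
Definition induced_local_system (X : variety k) (x : X) (A : zmodType)
    (psi : A -> F) (E : torsor X A) (L : local_system x) : Prop :=
  forall (u : pi1 x) (a : A), monodromy E u a -> ls_rep L u = (psi a)%:M.

Definition injective_character (A : zmodType) (psi : A -> F) : Prop :=
  [/\ psi 0 = 1, forall a b, psi (a + b) = psi a * psi b & injective psi].

End LocalSystems.

(* Main.v *)
Require Import Defs.
From HB Require Import structures.
From mathcomp Require Import all_boot all_order all_algebra.
From mathcomp Require Import all_classical all_reals all_analysis.
From mathcomp Require Import zify ring.
Set Implicit Arguments.
Unset Strict Implicit.
Unset Printing Implicit Defensive.
Import Order.TTheory GRing.Theory Num.Theory.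
Local Open Scope classical_set_scope.
Local Open Scope ring_scope.

(* Filter [U1] by connected closed subgroups [W] with one-dimensional successive
   quotients [pi : W -> Ga].  Let [Y] be the group of those [y] for which [E] splits
   over [W x {y}].  If [Y'] is this group for [ker pi], the [p]-torsion of [E] over
   [W x Y'] becomes an Artin-Schreier torsor [F^p - F = alpha(y) pi(w)^(p^M)] with
   [alpha] additive, so [Y = ker alpha].  Since [sigma1] also solves this equation
   over [K1], where it must degenerate, one gets along the filtration
   [dim (K1 /\ W) + dim U2 <= dim W + dim Y], and in case of equality the points of
   [K1 /\ W] at which [sigma1] agrees with the trivialization over [W x Y] form the
   identity component.  For [W = U1] one has [Y = K2], and exchanging the roles of
   [U1] and [U2] gives the opposite inequality, hence equality. *)

(** * Extension of homomorphisms and the Nullstellensatz *)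

(** Why Artin-Schreier: [pi] is additive with values in characteristic [p], so multiplication by [p]
    maps [W] into [ker pi], where a trivialization is already known. Prescribing the [p]-th multiple
    of a point of [E] by that trivialization cuts [E] down to a torsor under the [p]-torsion of
    Q_p/Z_p, that is, under the prime field of [k], and over an affine variety such a torsor has an
    equation [F^p - F = phi]. The group structure in [w] makes the additivity defect of [phi] of the
    form [d^p - d], and this leaves a single monomial. The obstacle is that quotients such as
    [W / ker pi] are not constructed: a function constant on the fibres of [pi] is a polynomial in
    [pi] only after raising it to a power [p^n]. Frobenius being injective on points, this is
    harmless; it is the origin of the exponents [p^M]. Dimensions do not see the finite groups of
    components. Hence the equality clause carried through the induction, whose hard case is a
    duality statement for finite groups over the prime field. *)

Section PointExtension.
Variables (T : comNzRingType) (k : closedFieldType).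
Implicit Types (R S I : set T) (h : T -> k).

(** Everything is a predicate on one ambient ring: the domain [S / P] is never formed, and arguments
    run modulo [P]. A homomorphism is a total function [T -> k], meaningful only on the given
    subring. *)
Definition sub_ring S := [/\ S 1, forall x y, S x -> S y -> S (x - y) &
  forall x y, S x -> S y -> S (x * y)].

Definition ideal_of S I := [/\ I `<=` S, I 0, forall x y, I x -> I y -> I (x - y) &
  forall x y, S x -> I y -> I (x * y)].

Definition prime_ideal_of S I := [/\ ideal_of S I, ~ I 1 &
  forall x y, S x -> S y -> I (x * y) -> I x \/ I y].

Definition ring_hom_on S h := [/\ h 1 = 1,
  forall x y, S x -> S y -> h (x - y) = h x - h y &
  forall x y, S x -> S y -> h (x * y) = h x * h y].

Definition coefs_in S : set {poly T} := [set q | forall i, S q`_i].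

Definition adjoin S (x : T) : set T := [set y | exists2 q, coefs_in S q & y = q.[x]].

Section Closure.
Variables (S : set T) (rS : sub_ring S).
Let S1 := let: And3 h _ _ := rS in h.
Let SB := let: And3 _ h _ := rS in h.
Let SM := let: And3 _ _ h := rS in h.

Lemma sub_ring0 : S 0. Proof. by rewrite -(subrr 1); exact: SB. Qed.
Lemma sub_ringN x : S x -> S (- x).
Proof. by move=> Sx; rewrite -sub0r; apply: SB => //; exact: sub_ring0. Qed.
Lemma sub_ringD x y : S x -> S y -> S (x + y).
Proof. by move=> Sx Sy; rewrite -[y]opprK; apply: SB => //; exact: sub_ringN. Qed.
Lemma sub_ringX x n : S x -> S (x ^+ n).
Proof. by move=> Sx; elim: n => [|n IH]; rewrite ?expr0// exprS; exact: SM. Qed.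
Lemma sub_ring_sum (J : Type) (r : seq J) (P : pred J) F :
  (forall i, P i -> S (F i)) -> S (\sum_(i <- r | P i) F i).
Proof. by move=> H; elim/big_ind: _ => //; [exact: sub_ring0|exact: sub_ringD]. Qed.

Lemma coefs_inC c : S c -> coefs_in S c%:P.
Proof. by move=> Sc i; rewrite coefC; case: ifP => // _; exact: sub_ring0. Qed.
Lemma coefs_inX : coefs_in S 'X.
Proof. by move=> i; rewrite coefX; case: eqP => _; [exact: S1|exact: sub_ring0]. Qed.
Lemma coefs_inB q r : coefs_in S q -> coefs_in S r -> coefs_in S (q - r).
Proof. by move=> Sq Sr i; rewrite coefB; exact: SB. Qed.
Lemma coefs_inD q r : coefs_in S q -> coefs_in S r -> coefs_in S (q + r).
Proof. by move=> Sq Sr i; rewrite coefD; exact: sub_ringD. Qed.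
Lemma coefs_inM q r : coefs_in S q -> coefs_in S r -> coefs_in S (q * r).
Proof. by move=> Sq Sr i; rewrite coefM; apply: sub_ring_sum => j _; exact: SM. Qed.
Lemma coefs_inXn n : coefs_in S 'X^n.
Proof.
elim: n => [|n IH]; rewrite ?expr0 ?exprS; first exact: coefs_inC.
by apply: coefs_inM => //; exact: coefs_inX.
Qed.
Lemma coefs_inZ c q : S c -> coefs_in S q -> coefs_in S (c *: q).
Proof. by move=> Sc Sq i; rewrite coefZ; exact: SM. Qed.

Lemma adjoin_sub_ring x : sub_ring (adjoin S x).
Proof.
split.
- by exists 1%:P; [exact: coefs_inC|rewrite hornerC].
- move=> _ _ [q Sq ->] [r Sr ->]; exists (q - r); first exact: coefs_inB.
  by rewrite hornerD hornerN.
- move=> _ _ [q Sq ->] [r Sr ->]; exists (q * r); first exact: coefs_inM.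
  by rewrite hornerM.
Qed.

Lemma subset_adjoin x y : S y -> adjoin S x y.
Proof. by move=> Sy; exists y%:P; [exact: coefs_inC|rewrite hornerC]. Qed.
Lemma mem_adjoin x : adjoin S x x.
Proof. by exists 'X; [exact: coefs_inX|rewrite hornerX]. Qed.

Lemma adjoin_subset x S' : sub_ring S' -> S `<=` S' -> S' x ->
  forall y, adjoin S x y -> S' y.
Proof.
move=> rS' SS' Sx _ [q Sq ->]; rewrite horner_coef; have [_ _ SM'] := rS'.
elim/big_ind: _ => [|a b|i _].
- by have [? B' _] := rS'; rewrite -(subrr 1); exact: B'.
- move=> Sa Sb; have [? B' _] := rS'.
  rewrite -[b]opprK -[- b]sub0r -(subrr 1); apply: (B') => //.
  by apply: (B') => //; exact: (B').
- apply: (SM'); first exact/SS'.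
  by elim: (nat_of_ord i) => [|n IH]; [rewrite expr0; case: rS'|rewrite exprS; exact: SM'].
Qed.

Variables (m : {poly T}) (Sm : coefs_in S m).

(** The leading coefficient of [m] need not be invertible, so a power of it multiplies [q]. The
    bound on [size a] serves in [hom_extension], where a quotient has to be shorter than a minimal
    relation. *)
Lemma pseudo_division q : coefs_in S q -> m != 0 -> exists (N : nat) (a r : {poly T}),
  [/\ coefs_in S a, coefs_in S r, (size r < size m)%N,
      (size a <= (size q - size m).+1)%N & lead_coef m ^+ N *: q = a * m + r].
Proof.
move=> Sq m0; have [n] := ubnP (size q); elim: n q Sq => // n IH q Sq sq.
have [qm|mq] := ltnP (size q) (size m).
  exists 0%N, 0, q; split=> //; last by rewrite expr0 scale1r mul0r add0r.
    by move=> i; rewrite coef0; exact: sub_ring0.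
  by rewrite size_poly0.
have sm : (0 < size m)%N by rewrite size_poly_gt0.
set l := lead_coef m; set t := lead_coef q *: 'X^(size q - size m).
have St : coefs_in S t by apply: coefs_inZ; [exact: Sq|exact: coefs_inXn].
pose q1 := l *: q - t * m.
have Sq1 : coefs_in S q1.
  by apply: coefs_inB; [apply: coefs_inZ => //; exact: Sm|exact: coefs_inM].
have sq1 : (size q1 < size q)%N.
  have sq0 : (0 < size q)%N by exact: leq_trans mq.
  suff : (size q1 <= (size q).-1)%N by move: sq0; case: (size q).
  apply/leq_sizeP => j; rewrite leq_eqVlt => /orP[/eqP <-|hj].
    have nlt : ((size q).-1 < size q - size m)%N = false by move: mq sm; lia.
    rewrite coefB coefZ -scalerAl coefZ coefXnM nlt.
    rewrite -[q`_ _]/(lead_coef q) /l /lead_coef.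
    have -> : ((size q).-1 - (size q - size m) = (size m).-1)%N by move: mq sm; lia.
    by rewrite mulrC subrr.
  have hj' : (size q <= j)%N by move: hj; case: (size q) sq0.
  rewrite coefB coefZ -scalerAl coefZ coefXnM nth_default// mulr0.
  rewrite ltnNge (leq_trans (leq_subr _ _) hj')/= nth_default ?mulr0 ?subrr//.
  by rewrite leq_subRL ?(leq_trans (leq_subr _ _))// subnK.
have [N [a [r [Sa Sr sr sa E]]]] := IH q1 Sq1 (leq_trans sq1 sq).
exists N.+1, (a + l ^+ N *: t), r; split=> //.
- apply: coefs_inD => //; apply: coefs_inZ => //; apply: sub_ringX; exact: Sm.
- apply: leq_trans (size_polyD _ _) _; rewrite geq_max; apply/andP; split.
    apply: leq_trans sa _; rewrite ltnS; apply: leq_sub2r; exact: ltnW.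
  apply: leq_trans (size_scale_leq _ _) _.
  apply: leq_trans (size_scale_leq _ _) _; by rewrite size_polyXn.
- rewrite mulrDl -addrA [_ + r]addrC addrA -E exprSr -scalerA -/l.
  have -> : l *: q = q1 + t * m by rewrite /q1 subrK.
  by rewrite scalerDr scalerAl.
Qed.

End Closure.

Section OneStep.
Variables (S P R : set T) (x : T).
Hypotheses (rS : sub_ring S) (pP : prime_ideal_of S P) (rR : sub_ring R).
Hypotheses (RS : R `<=` S) (Sx : S x).
Let PS : P `<=` S. Proof. by case: pP => -[]. Qed.
Let P0 : P 0. Proof. by case: pP => -[]. Qed.
Let PB a b : P a -> P b -> P (a - b). Proof. by case: pP => -[_ _ H _] _ _; exact: H. Qed.
Let PM a b : S a -> P b -> P (a * b). Proof. by case: pP => -[_ _ _ H] _ _; exact: H. Qed.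
Let P1 : ~ P 1. Proof. by case: pP. Qed.
Let Pp a b : S a -> S b -> P (a * b) -> P a \/ P b.
Proof. by case: pP => _ _ H; exact: H. Qed.
Let PN a : P a -> P (- a). Proof. by move=> Pa; rewrite -sub0r; exact: PB. Qed.
Let PD a b : P a -> P b -> P (a + b).
Proof. by move=> Pa Pb; rewrite -[b]opprK; apply: PB => //; exact: PN. Qed.
Let PX a n : S a -> ~ P a -> ~ P (a ^+ n).
Proof.
move=> Sa nPa; elim: n => [|n IH]; rewrite ?expr0// exprS => /Pp[]//.
exact: sub_ringX.
Qed.
Let Psum (J : Type) (r : seq J) (Q : pred J) F :
  (forall i, Q i -> P (F i)) -> P (\sum_(i <- r | Q i) F i).
Proof. by move=> H; elim/big_ind: _. Qed.
Let RxS : adjoin R x `<=` S. Proof. exact: adjoin_subset. Qed.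
Let Rhx q : coefs_in R q -> adjoin R x q.[x]. Proof. by move=> Rq; exists q. Qed.
Let Shx q : coefs_in R q -> S q.[x]. Proof. by move=> Rq; apply: RxS; exact: Rhx. Qed.
Let PPh q : coefs_in P q -> P q.[x].
Proof.
move=> Pq; rewrite horner_coef; apply: Psum => i _; rewrite mulrC.
by apply: PM => //; exact: sub_ringX.
Qed.

Variable h : T -> k.
Hypotheses (hR : ring_hom_on R h) (hP : forall r, R r -> P r -> h r = 0).
Let h1 : h 1 = 1. Proof. by case: hR. Qed.
Let hB a b : R a -> R b -> h (a - b) = h a - h b.
Proof. by case: hR => _ H _; exact: H. Qed.
Let hM a b : R a -> R b -> h (a * b) = h a * h b.
Proof. by case: hR => _ _ H; exact: H. Qed.
Let h0 : h 0 = 0. Proof. by apply: hP => //; exact: sub_ring0. Qed.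
Let hD a b : R a -> R b -> h (a + b) = h a + h b.
Proof.
move=> Ra Rb; rewrite -[b]opprK hB//; last exact: sub_ringN.
by congr (_ + _); rewrite -[- b]sub0r hB ?h0 ?sub0r ?opprK//; exact: sub_ring0.
Qed.
Let hX a n : R a -> h (a ^+ n) = h a ^+ n.
Proof.
by move=> Ra; elim: n => [|n IH]; rewrite ?expr0// !exprS hM ?IH//; exact: sub_ringX.
Qed.
Let mapB q r : coefs_in R q -> coefs_in R r ->
  map_poly h (q - r) = map_poly h q - map_poly h r.
Proof. by move=> Rq Rr; apply/polyP => i; rewrite coefB !coef_map_id0// coefB hB. Qed.
Let mapM q r : coefs_in R q -> coefs_in R r ->
  map_poly h (q * r) = map_poly h q * map_poly h r.
Proof.
move=> Rq Rr; apply/polyP => i; rewrite coef_map_id0// !coefM.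
have [_ _ RM] := rR.
suff : R (\sum_(j < i.+1) q`_j * r`_(i - j)) /\
   h (\sum_(j < i.+1) q`_j * r`_(i - j)) =
   \sum_(j < i.+1) (map_poly h q)`_j * (map_poly h r)`_(i - j) by case.
elim/big_rec2: _ => [|j a b _ [Rb Eb]]; first by split=> //; exact: sub_ring0.
have Rqr : R (q`_j * r`_(i - j)) by exact: RM.
by split; [exact: sub_ringD|rewrite hD// Eb hM// !coef_map_id0].
Qed.
Let mapD q r : coefs_in R q -> coefs_in R r ->
  map_poly h (q + r) = map_poly h q + map_poly h r.
Proof. by move=> Rq Rr; apply/polyP => i; rewrite coefD !coef_map_id0// coefD hD. Qed.
Let mapZ c q : R c -> coefs_in R q -> map_poly h (c *: q) = h c *: map_poly h q.
Proof. by move=> Rc Rq; apply/polyP => i; rewrite coefZ !coef_map_id0// coefZ hM. Qed.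
Let mapP q : coefs_in R q -> coefs_in P q -> map_poly h q = 0.
Proof. by move=> Rq Pq; apply/polyP => i; rewrite coef_map_id0// coef0 hP. Qed.

Let mapC c : map_poly h c%:P = (h c)%:P.
Proof. by apply/polyP => i; rewrite coef_map_id0// !coefC; case: ifP. Qed.

(** The value of [h'] is read off any expression of the element as a polynomial in [x]; the
    assumption on [z] makes the choice immaterial. *)
Lemma extend_at z : (forall q, coefs_in R q -> P q.[x] -> (map_poly h q).[z] = 0) ->
  exists h' : T -> k, [/\ ring_hom_on (adjoin R x) h',
    forall q, coefs_in R q -> h' q.[x] = (map_poly h q).[z],
    forall r, R r -> h' r = h r & forall y, adjoin R x y -> P y -> h' y = 0].
Proof.
move=> Kz.
pose h' y := if pselect (adjoin R x y) is left e
  then (map_poly h (s2val (cid2 e))).[z] else 0.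
have E q : coefs_in R q -> h' q.[x] = (map_poly h q).[z].
  move=> Rq; rewrite /h'; case: pselect => [e|[]]; last by exists q.
  case: (cid2 e) => q' Rq' Eq' /=; apply/eqP; rewrite -subr_eq0 -hornerN -hornerD.
  rewrite -mapB// Kz//; first exact: coefs_inB.
  by rewrite hornerD hornerN Eq' subrr.
have [R1 RB RM] := rR.
exists h'; split=> //.
- split.
  + rewrite -[X in h' X](hornerC 1 x) E; last exact: coefs_inC.
    by rewrite mapC h1 hornerC.
  + move=> _ _ [q Rq ->] [r Rr ->].
    rewrite -hornerN -hornerD !E//; last exact: coefs_inB.
    by rewrite mapB// hornerD hornerN.
  + move=> _ _ [q Rq ->] [r Rr ->].
    rewrite -hornerM !E//; last exact: coefs_inM.
    by rewrite mapM// hornerM.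
- move=> r Rr; rewrite -{1}(hornerC r x) E; last exact: coefs_inC.
  by rewrite mapC hornerC.
- by move=> _ [q Rq ->] Pq; rewrite E// Kz.
Qed.

(** All relations on [x] being trivial modulo [P], every [z] is allowed; a non-root of the image of
    [q] keeps [v] alive. *)
Lemma extend_transcendental v : (forall q, coefs_in R q -> P q.[x] -> coefs_in P q) ->
  forall q, coefs_in R q -> q.[x] = v -> forall i, h q`_i != 0 ->
  exists h' : T -> k, [/\ ring_hom_on (adjoin R x) h', forall r, R r -> h' r = h r,
    forall y, adjoin R x y -> P y -> h' y = 0 & h' v != 0].
Proof.
move=> tr q Rq qv i hqi.
have : map_poly h q != 0.
  by apply: contra_neq hqi => E; rewrite -(coef_map_id0 _ _ h0) E coef0.
move=> /closed_nonrootP [z]; rewrite /root => qz.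
have [|h' [h'1 h'2 h'3 h'4]] := @extend_at z.
  by move=> r Rr Pr; rewrite mapP ?horner0//; exact: tr.
by exists h'; split=> //; rewrite -qv h'2.
Qed.

(** [m] is the minimal polynomial of [x] modulo [P]. Its image keeps its degree because the leading
    coefficient survives, so it has a root [z]. As [u] equals [v * s] modulo [P], [h u != 0] forces
    [h' v != 0]. *)
Lemma extend_algebraic m v s u : coefs_in R m -> (1 < size m)%N ->
  (forall q, coefs_in R q -> (size q < size m)%N -> P q.[x] -> coefs_in P q) ->
  P m.[x] -> adjoin R x v -> adjoin R x s -> R u -> P (u - v * s) ->
  h (lead_coef m) != 0 -> h u != 0 ->
  exists h' : T -> k, [/\ ring_hom_on (adjoin R x) h', forall r, R r -> h' r = h r,
    forall y, adjoin R x y -> P y -> h' y = 0 & h' v != 0].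
Proof.
move=> Rm sm mmin Pm Rv Rs Ru Pu hl hu.
have m0 : m != 0 by rewrite -size_poly_gt0 ltnW.
have /closed_rootP [z] : size (map_poly h m) != 1.
  rewrite size_poly_eq; first by rewrite gtn_eqF.
  by [].
rewrite /root => /eqP mz.
have [|h' [h'1 h'2 h'3 h'4]] := @extend_at z.
  move=> q Rq Pq; have [N [a [r [Ra Rr sr _ E]]]] := pseudo_division rR Rm Rq m0.
  have Rl : R (lead_coef m ^+ N) by apply: sub_ringX => //; exact: Rm.
  have Pr : coefs_in P r.
    apply: mmin => //; have -> : r = lead_coef m ^+ N *: q - a * m by rewrite E addrC addKr.
    rewrite hornerD hornerN hornerM hornerZ; apply: PB; apply: PM => //; first exact: RS.
    exact: Shx.
  have := congr1 (fun q => (map_poly h q).[z]) E; rewrite mapZ// mapD//; last exact: coefs_inM.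
  rewrite mapM// hornerD hornerM mz mulr0 add0r (mapP Rr Pr) horner0 hornerZ hX; last exact: Rm.
  by move=> /eqP; rewrite mulf_eq0 expf_eq0 (negbTE hl) andbF => /eqP.
exists h'; split=> //; have [_ h'B h'M] := h'1.
have [_ _ RxM] := adjoin_sub_ring rR x.
have Rxu : adjoin R x u by exact: (subset_adjoin rR x Ru).
have Rxvs : adjoin R x (v * s) by exact: RxM.
have : h' (u - v * s) = 0.
  by apply: h'4 => //; have [_ H _] := adjoin_sub_ring rR x; exact: H.
rewrite h'B// h'M// h'3//.
move=> /eqP; rewrite subr_eq0 => /eqP hE; apply: contra_neq hu => E.
by rewrite hE E mul0r.
Qed.

End OneStep.

Section Extension.
Variables (S P : set T) (rS : sub_ring S) (pP : prime_ideal_of S P).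
Let PS : P `<=` S. Proof. by case: pP => -[]. Qed.
Let P0 : P 0. Proof. by case: pP => -[]. Qed.
Let PB a b : P a -> P b -> P (a - b). Proof. by case: pP => -[_ _ H _] _ _; exact: H. Qed.
Let PM a b : S a -> P b -> P (a * b). Proof. by case: pP => -[_ _ _ H] _ _; exact: H. Qed.
Let P1 : ~ P 1. Proof. by case: pP. Qed.
Let Pp a b : S a -> S b -> P (a * b) -> P a \/ P b.
Proof. by case: pP => _ _ H; exact: H. Qed.
Let PN a : P a -> P (- a). Proof. by move=> Pa; rewrite -sub0r; exact: PB. Qed.
Let PD a b : P a -> P b -> P (a + b).
Proof. by move=> Pa Pb; rewrite -[b]opprK; apply: PB => //; exact: PN. Qed.
Let PX a n : S a -> ~ P a -> ~ P (a ^+ n).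
Proof.
move=> Sa nPa; elim: n => [|n IH]; rewrite ?expr0// exprS => /Pp[]//.
exact: sub_ringX.
Qed.

(** This lets a polynomial of minimal size be assumed to have its leading coefficient outside
    [P]. *)
Lemma drop_lead (R : set T) x (q : {poly T}) : sub_ring R -> R `<=` S -> S x ->
  coefs_in R q -> P (lead_coef q) -> ~ coefs_in P q -> exists q',
  [/\ coefs_in R q', P (q.[x] - q'.[x]), ~ coefs_in P q' & (size q' < size q)%N].
Proof.
move=> rR RS Sx Rq Pl nPq.
have q0 : q != 0 by apply/eqP => q0; apply: nPq => i; rewrite q0 coef0.
exists (q - lead_coef q *: 'X^((size q).-1)); split.
- by apply: coefs_inB => //; apply: coefs_inZ => //; [exact: Rq|exact: coefs_inXn].
- rewrite hornerD hornerN opprB addrC subrK hornerZ hornerXn mulrC.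
  by apply: PM => //; exact: sub_ringX.
- move=> H; apply: nPq => i; have := H i; rewrite coefB coefZ coefXn.
  case: eqP => [-> _|_]; last by rewrite mulr0 subr0.
  exact: Pl.
- have sq0 : (0 < size q)%N by rewrite size_poly_gt0.
  suff : (size (q - lead_coef q *: 'X^((size q).-1))%R <= (size q).-1)%N by move: sq0; case: (size q).
  apply/leq_sizeP => j; rewrite coefB coefZ coefXn leq_eqVlt => /orP[/eqP <-|hj].
    by rewrite eqxx mulr1 subrr.
  rewrite gtn_eqF// mulr0 subr0 nth_default//.
  by move: hj; case: (size q) sq0.
Qed.

(** Chevalley's extension theorem for one generator. If [x] is transcendental modulo [P], [u] is a
    coefficient of [v]. Otherwise [v] divides, modulo [P], some [c] of [R] outside [P], and [u] is
    [c] times the leading coefficient of the minimal relation. *)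
Lemma hom_extension (R : set T) (x v : T) : sub_ring R -> R `<=` S -> S x ->
  adjoin R x v -> ~ P v -> exists u, [/\ R u, ~ P u &
    forall h, ring_hom_on R h -> (forall r, R r -> P r -> h r = 0) -> h u != 0 ->
    exists h' : T -> k, [/\ ring_hom_on (adjoin R x) h', forall r, R r -> h' r = h r,
      forall y, adjoin R x y -> P y -> h' y = 0 & h' v != 0]].
Proof.
move=> rR RS Sx [qv Rqv vE] nPv.
have [_ _ RM] := rR.
have rRx := adjoin_sub_ring rR x.
have RxS : adjoin R x `<=` S by exact: adjoin_subset.
have Rh q : coefs_in R q -> S q.[x] by move=> Rq; apply: RxS; exists q.
have PPh q : coefs_in P q -> P q.[x].
  move=> Pq; rewrite horner_coef; elim/big_ind: _ => // i _; rewrite mulrC.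
  by apply: PM => //; exact: sub_ringX.
have [tr|] := pselect (forall q, coefs_in R q -> P q.[x] -> coefs_in P q).
  have /existsNP[i nPi] : ~ coefs_in P qv by move=> /PPh; rewrite -vE.
  exists qv`_i; split=> // h hR hP hu.
  exact: (extend_transcendental pP rR hR hP tr Rqv (esym vE) hu).
move=> /existsNP[q0 /not_implyP[Rq0 /not_implyP[Pq0 nq0]]].
pose Qm n := `[<exists q, [/\ coefs_in R q, P q.[x], ~ coefs_in P q & size q = n]>].
have exm : exists n, Qm n by exists (size q0); apply/asboolP; exists q0.
case: (ex_minnP exm) => nm /asboolP[m [Rm Pm nPm <-]] mmin {nm}.
have {}mmin q : coefs_in R q -> (size q < size m)%N -> P q.[x] -> coefs_in P q.
  move=> Rq sq Pq; apply: contrapT => nPq.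
  have : Qm (size q) by apply/asboolP; exists q.
  by move=> /mmin; rewrite leqNgt sq.
have nPl : ~ P (lead_coef m).
  move=> Pl; have [q' [Rq' Pq' nPq' sq']] := drop_lead rR RS Sx Rm Pl nPm.
  by apply: nPq'; apply: mmin => //; rewrite -[_.[x]](subKr m.[x]); exact: PB.
have m0 : m != 0 by apply/eqP => m0; apply: nPm => i; rewrite m0 coef0.
have sm : (1 < size m)%N.
  rewrite ltn_neqAle size_poly_gt0 m0 andbT eq_sym; apply/negP => /size_poly1P[c c0 mc].
  by apply: nPl; rewrite mc lead_coefC -(hornerC c x) -mc.
have Rl N : R (lead_coef m ^+ N) by apply: sub_ringX => //; exact: Rm.
(* Least size of a nonzero polynomial in [x] that is a multiple of [v] modulo [P]; it will turn out
   to be a constant. *)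
pose Qr n := `[<exists r s, [/\ coefs_in R r, ~ coefs_in P r, (size r < size m)%N,
   adjoin R x s /\ P (r.[x] - v * s) & size r = n]>].
have exr : exists n, Qr n.
  have [N [a [r [Ra Rr sr _ E]]]] := pseudo_division rR Rm Rqv m0.
  have Er : P (r.[x] - v * lead_coef m ^+ N).
    have -> : r = lead_coef m ^+ N *: qv - a * m by rewrite E addrC addKr.
    rewrite hornerD hornerN hornerM hornerZ -vE addrAC [v * _]mulrC subrr sub0r.
    by apply: PN; apply: PM => //; exact: Rh.
  exists (size r); apply/asboolP; exists r, (lead_coef m ^+ N); split=> //; last first.
    by split=> //; exact: subset_adjoin.
  move=> /PPh Pr; have : P (v * lead_coef m ^+ N) by rewrite -[v * _](subKr r.[x]); exact: PB.
  move=> /Pp[]//; first by apply: RxS; exists qv.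
    exact: RS.
  by apply: PX => //; apply: RS; exact: Rm.
case: (ex_minnP exr) => nr /asboolP[r [s [Rr nPr sr [Rs Prs] <-]]] rmin {nr}.
have nPlr : ~ P (lead_coef r).
  move=> Pl; have [q' [Rq' Pq' nPq' sq']] := drop_lead rR RS Sx Rr Pl nPr.
  suff : Qr (size q') by move=> /rmin; rewrite leqNgt sq'.
  apply/asboolP; exists q', s; split=> //; first exact: ltn_trans sr.
  split=> //; have -> : q'.[x] - v * s = (r.[x] - v * s) - (r.[x] - q'.[x]).
    by ring.
  exact: PB.
have r0 : r != 0 by apply/eqP => r0; apply: nPr => i; rewrite r0 coef0.
have sr1 : size r = 1.
  (* If [r] is not constant, the remainder of [m] by [r] is again a multiple of [v], and is shorter,
     so it vanishes modulo [P]. Then [a * r] vanishes at [x], against the minimality of [m]. *)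
  apply/eqP; rewrite eqn_leq size_poly_gt0 r0 andbT leqNgt; apply/negP => sr2.
  have [N [a [r' [Ra Rr' sr' sa E]]]] := pseudo_division rR Rr Rm r0.
  have Er : P (r'.[x] - v * (- a.[x] * s)).
    have -> : r'.[x] - v * (- a.[x] * s) =
        lead_coef r ^+ N * m.[x] - a.[x] * (r.[x] - v * s).
      have -> : r'.[x] = lead_coef r ^+ N * m.[x] - a.[x] * r.[x].
        by rewrite -hornerZ -hornerM E hornerD addrC addKr.
      by ring.
    by apply: PB; apply: PM => //; [apply: RS; apply: sub_ringX => //; exact: Rr|exact: Rh].
  have Pr' : coefs_in P r'.
    apply: contrapT => nPr'; suff : Qr (size r') by move=> /rmin; rewrite leqNgt sr'.
    apply/asboolP; exists r', (- a.[x] * s); split=> //; first exact: ltn_trans sr.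
    split=> //; have [_ _ RxM] := rRx; apply: RxM => //; apply: sub_ringN => //.
    by exists a.
  have Par : P (a.[x] * r.[x]).
    rewrite -hornerM; have -> : a * r = lead_coef r ^+ N *: m - r' by rewrite E addrK.
    rewrite hornerD hornerN hornerZ; apply: PB; last exact: PPh.
    by apply: PM => //; apply: RS; apply: sub_ringX => //; exact: Rr.
  have [Pa|Pr] := Pp (Rh _ Ra) (Rh _ Rr) Par; last by apply: nPr; exact: mmin.
  have sam : (size a < size m)%N.
    by move: sa sr2 sr; lia.
  have {}Pa := mmin _ Ra sam Pa.
  have : P (lead_coef r ^+ N * lead_coef m).
    rewrite /lead_coef -coefZ E coefD; apply: PD => //.
    by rewrite coefM; elim/big_ind: _ => // i _; rewrite mulrC; apply: PM => //; apply: RS; exact: Rr.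
  move=> /Pp[]//; [|by apply: RS; exact: Rm|apply: PX => //; by apply: RS; exact: Rr].
  by apply: RS; apply: sub_ringX => //; exact: Rr.
have /size_poly1P[c c0 rc] : size r == 1 by rewrite sr1.
have Rc : R c by have := Rr 0; rewrite rc coefC eqxx.
have nPc : ~ P c by move: nPlr; rewrite rc lead_coefC.
exists (lead_coef m * c); split; first by apply: RM => //; exact: Rm.
  by move=> /Pp[]//; apply: RS => //; exact: Rm.
move=> h hR hP; have [_ _ hM] := hR; rewrite hM//; last exact: Rm.
rewrite mulf_eq0 negb_or => /andP[hl hc].
apply: (extend_algebraic rS pP rR RS Sx hR hP (m := m) (v := v) (s := s) (u := c)) => //.
  by exists qv.
by rewrite -(hornerC c x) -rc.
Qed.

End Extension.

Fixpoint adjoin_seq (R : set T) (gs : seq T) : set T :=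
  if gs is g :: gs' then adjoin (adjoin_seq R gs') g else R.

Lemma adjoin_seq_sub_ring R gs : sub_ring R -> sub_ring (adjoin_seq R gs).
Proof. by move=> rR; elim: gs => //= g gs IH; exact: adjoin_sub_ring. Qed.

Lemma subset_adjoin_seq R gs x : sub_ring R -> R x -> adjoin_seq R gs x.
Proof.
move=> rR Rx; elim: gs => //= g gs IH.
by apply: subset_adjoin => //; exact: adjoin_seq_sub_ring.
Qed.

Lemma mem_adjoin_seq R gs g : sub_ring R -> g \in gs -> adjoin_seq R gs g.
Proof.
move=> rR; elim: gs => //= a gs IH; rewrite inE => /orP[/eqP ->|/IH H].
  by apply: mem_adjoin; exact: adjoin_seq_sub_ring.
by apply: subset_adjoin => //; exact: adjoin_seq_sub_ring.
Qed.

(** [u] is found by going down through the generators, [h'] by climbing back up. *)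
Lemma hom_extension_seq (S P : set T) (R : set T) (gs : seq T) (v : T) :
  sub_ring S -> prime_ideal_of S P -> sub_ring R -> R `<=` S -> {in gs, forall g, S g} ->
  adjoin_seq R gs v -> ~ P v -> exists u, [/\ R u, ~ P u &
    forall h, ring_hom_on R h -> (forall r, R r -> P r -> h r = 0) -> h u != 0 ->
    exists h' : T -> k, [/\ ring_hom_on (adjoin_seq R gs) h', forall r, R r -> h' r = h r,
      forall y, adjoin_seq R gs y -> P y -> h' y = 0 & h' v != 0]].
Proof.
move=> rS pP rR RS; elim: gs v => [|g gs IH] v /= gsS Rv nPv.
  by exists v; split=> // h hR hP hv; exists h.
have rR' := adjoin_seq_sub_ring gs rR.
have gsS' : {in gs, forall g, S g} by move=> a ags; apply: gsS; rewrite inE ags orbT.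
have R'S : adjoin_seq R gs `<=` S.
  elim: (gs) gsS' => //= a l IHl H; apply: adjoin_subset => //.
    by apply: IHl => b bl; apply: H; rewrite inE bl orbT.
  by apply: H; rewrite inE eqxx.
have Sg : S g by apply: gsS; rewrite inE eqxx.
have [u [Ru nPu H]] := hom_extension rS pP rR' R'S Sg Rv nPv.
have [u0 [Ru0 nPu0 H0]] := IH _ gsS' Ru nPu.
exists u0; split=> // h hR hP hu0.
have [h1 [h11 h12 h13 h14]] := H0 h hR hP hu0.
have [h2 [h21 h22 h23 h24]] := H h1 h11 h13 h14.
exists h2; split=> // r Rr; rewrite h22 ?h12//; exact: subset_adjoin_seq.
Qed.

End PointExtension.

Section Regular.
Variables (k : closedFieldType) (X : variety k).
Notation O := (@regular k X).
Implicit Types f g : X -> k.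

Lemma reg_cst c : O (fun _ => c). Proof. by case: (aff_subalgebra (variety_affine X)). Qed.
Lemma regD f g : O f -> O g -> O (fun x => f x + g x).
Proof. by case: (aff_subalgebra (variety_affine X)) => _ H _; exact: H. Qed.
Lemma regM f g : O f -> O g -> O (fun x => f x * g x).
Proof. by case: (aff_subalgebra (variety_affine X)) => _ _ H; exact: H. Qed.
Lemma regZ c f : O f -> O (fun x => c * f x).
Proof. exact: regM (reg_cst c). Qed.
Lemma regN f : O f -> O (fun x => - f x).
Proof. by move=> Hf; under eq_fun do rewrite -mulN1r; exact: regZ. Qed.
Lemma regB f g : O f -> O g -> O (fun x => f x - g x).
Proof. by move=> Hf Hg; apply: regD => //; exact: regN. Qed.
Lemma regX f n : O f -> O (fun x => f x ^+ n).
Proof.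
move=> Hf; elim: n => [|n IH]; first by under eq_fun do rewrite expr0; exact: reg_cst.
by under eq_fun do rewrite exprS; exact: regM.
Qed.
Lemma reg_sum (J : Type) (r : seq J) (P : pred J) (F : J -> X -> k) :
  (forall j, P j -> O (F j)) -> O (fun x => \sum_(j <- r | P j) F j x).
Proof.
move=> H; elim: r => [|j r IH].
  by under eq_fun do rewrite big_nil; exact: reg_cst.
under eq_fun do rewrite big_cons; case Pj : (P j) => //.
by apply: regD => //; exact: H.
Qed.
Lemma reg_poly (q : {poly k}) f : O f -> O (fun x => q.[f x]).
Proof.
move=> Hf; under eq_fun do rewrite horner_coef.
by apply: reg_sum => i _; apply: regZ; exact: regX.
Qed.

Definition reg_ideal (I : set (X -> k)) := [/\ I `<=` O, I (fun _ => 0),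
  forall f g, I f -> I g -> I (fun x => f x - g x) &
  forall f g, O f -> I g -> I (fun x => f x * g x)].

(** Krull's argument: an ideal maximal among those that contain no power of [f] is prime. *)
Lemma reg_ideal_proper (I : set (X -> k)) (f : X -> k) : O f -> reg_ideal I ->
  (forall n, ~ I (fun x => f x ^+ n)) -> exists J, [/\ reg_ideal J, I `<=` J,
    forall n, ~ J (fun x => f x ^+ n) &
    forall a b, O a -> O b -> J (fun x => a x * b x) -> J a \/ J b].
Proof.
move=> Of idI nI.
pose Q := {J | [/\ reg_ideal J, I `<=` J & forall n, ~ J (fun x => f x ^+ n)]}.
pose t0 : Q := exist _ I (And3 idI (@subset_refl _ _) nI).
pose R (s t : Q) := `[< sval s `<=` sval t >].
have [|||[J [idJ IJ nJ]] Jmax] := @ZL_preorder Q t0 R.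
- by move=> t; apply/asboolP.
- by move=> r s t /asboolP rs /asboolP st; apply/asboolP; exact: subset_trans st.
- move=> A totA; have [[s0 As0]|nA] := pselect (exists s, A s); last first.
    by exists t0 => s As; case: nA; exists s.
  pose U := [set g | exists2 s : Q, A s & sval s g].
  have idU : [/\ reg_ideal U, I `<=` U & forall n, ~ U (fun x => f x ^+ n)].
    split.
    - split.
      + by move=> g [s _]; case: (svalP s) => -[H _ _ _] _ _; exact: H.
      + by exists s0 => //; case: (svalP s0) => -[].
      + move=> g1 g2 [s As sg1] [t At tg2].
        have [/asboolP st|/asboolP ts] := totA _ _ As At.
          by exists t => //; case: (svalP t) => -[_ _ H _] _ _; apply: H => //; exact: st.
        by exists s => //; case: (svalP s) => -[_ _ H _] _ _; apply: H => //; exact: ts.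
      + move=> g1 g2 Og1 [s As sg2]; exists s => //.
        by case: (svalP s) => -[_ _ _ H] _ _; exact: H.
    - by move=> g Ig; exists s0 => //; case: (svalP s0) => _ H _; exact: H.
    - by move=> n [s _]; case: (svalP s) => _ _ H; exact: H.
  exists (exist _ U idU) => s As; apply/asboolP => g sg; by exists s.
exists J; split=> // a b Oa Ob Jab; apply: contrapT => /not_orP[nJa nJb].
have [JO J0 JB JM] := idJ.
have JN g : J g -> J (fun x => - g x).
  by move=> Jg; have := JB _ _ J0 Jg; under eq_fun do rewrite sub0r.
have JD g h : J g -> J h -> J (fun x => g x + h x).
  by move=> Jg Jh; have := JB _ _ Jg (JN _ Jh); under eq_fun do rewrite opprK.
(* By maximality, adding [c] to [J] brings in a power of [f]. Multiplying the relations for [a] and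
   [b] then puts a power of [f] in [J]. *)
have big c : O c -> ~ J c -> exists n h, O h /\ J (fun x => f x ^+ n - h x * c x).
  move=> Oc nJc; apply: contrapT => nex.
  pose U := [set g | O g /\ exists h, O h /\ J (fun x => g x - h x * c x)].
  have idU : [/\ reg_ideal U, I `<=` U & forall n, ~ U (fun x => f x ^+ n)].
    split.
    - split.
      + by move=> g [].
      + split; first exact: reg_cst.
        exists (fun _ => 0); split; first exact: reg_cst.
        by under eq_fun do rewrite mul0r subr0.
      + move=> g1 g2 [Og1 [h1 [Oh1 J1]]] [Og2 [h2 [Oh2 J2]]]; split; first exact: regB.
        exists (fun x => h1 x - h2 x); split; first exact: regB.
        have := JB _ _ J1 J2; congr J; apply/funext => x; ring.
      + move=> g1 g2 Og1 [Og2 [h [Oh Jh]]]; split; first exact: regM.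
        exists (fun x => g1 x * h x); split; first exact: regM.
        have := JM _ _ Og1 Jh; congr J; apply/funext => x; ring.
    - move=> g Ig; split; first by have [H _ _ _] := idI; exact: H.
      exists (fun _ => 0); split; first exact: reg_cst.
      by under eq_fun do rewrite mul0r subr0; exact: (IJ _ Ig).
    - by move=> n [_ [h [Oh Jh]]]; apply: nex; exists n, h.
  have /Jmax/asboolP/= : R (exist _ J (And3 idJ IJ nJ)) (exist _ U idU).
    apply/asboolP => g /= Jg; split; first exact: JO.
    exists (fun _ => 0); split; first exact: reg_cst.
    by under eq_fun do rewrite mul0r subr0.
  move=> UJ; apply: nJc; apply: UJ; split=> //; exists (fun _ => 1); split; first exact: reg_cst.
  by under eq_fun do rewrite mul1r subrr.
have [n [h [Oh Jh]]] := big a Oa nJa; have [m [h' [Oh' Jh']]] := big b Ob nJb.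
apply: (nJ (n + m)%N).
have H1 := JM _ _ (regX m Of) Jh.
have H2 := JM _ _ (regM Oh Oa) Jh'.
have H3 := JM _ _ (regM Oh Oh') Jab.
have := JD _ _ (JD _ _ H1 H2) H3; congr J; apply/funext => x; rewrite exprD; ring.
Qed.

(** Otherwise a prime ideal contains [I] and no power of [f]. Extending the identity of [k]
    generator by generator gives a homomorphism that kills this prime but not [f]; it is evaluation
    at a point because an affine variety has all its algebra points. *)
Lemma nullstellensatz (I : set (X -> k)) f : O f -> reg_ideal I ->
  (forall x, (forall g, I g -> g x = 0) -> f x = 0) -> exists n, I (fun x => f x ^+ n).
Proof.
move=> Of idI H; apply: contrapT => /forallNP nI.
have [[x0 _]|nX] := pselect (exists x : X, True); last first.
  apply: (nI 0%N); have [_ I0 _ _] := idI; congr I: I0; apply/funext => x.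
  by case: nX; exists x.
have [P [[PO P0 PB PM] IP nP primeP]] := reg_ideal_proper Of idI nI.
(* A base point is what makes [X -> k] a nonzero ring. *)
pose pX : pointedType := HB.pack (Choice.sort (vpts X)) (isPointed.Build (Choice.sort (vpts X)) x0).
pose T : comNzRingType := (pX -> k).
have rO : @sub_ring T O.
  by split; [exact: reg_cst|exact: regB|exact: regM].
have pP : @prime_ideal_of T O P.
  split; [by split|by move=> P1; apply: (nP 0%N); exact: P1|exact: primeP].
pose R : set T := [set g | exists c : k, g = (fun _ => c)].
have rR : @sub_ring T R.
  split; first by exists 1.
  - by move=> _ _ [c ->] [d ->]; exists (c - d).
  - by move=> _ _ [c ->] [d ->]; exists (c * d).
have [n [g Hg]] := aff_fingen (variety_affine X).
pose gs : seq T := [seq g i | i <- enum 'I_n].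
have gi i : O (g i) by rewrite Hg => Q sQ; apply; exists i.
have Of' : @adjoin_seq T R gs f.
  have := Of; rewrite Hg => /(_ (@adjoin_seq T R gs)); apply.
    have rA := @adjoin_seq_sub_ring T R gs rR.
    split.
    - by move=> c; apply: (@subset_adjoin_seq T R gs) => //; exists c.
    - by move=> a b Aa Ab; exact: (sub_ringD rA Aa Ab).
    - by move=> a b Aa Ab; case: rA => _ _ M; exact: (M _ _ Aa Ab).
  move=> _ [i _ <-]; apply: (@mem_adjoin_seq T R gs) => //.
  by apply/mapP; exists i => //; rewrite mem_enum.
have RO : R `<=` O by move=> _ [c ->]; exact: reg_cst.
have gsO : {in gs, forall g, O g} by move=> _ /mapP[i _ ->].
have nPf : ~ P f by move=> Pf; apply: (nP 1%N); under eq_fun do rewrite expr1.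
have [u [[c uc] nPu ext]] := @hom_extension_seq T k O P R gs f rO pP rR RO gsO Of' nPf.
(* On constant functions, evaluation at [x0] is the identity of [k]. *)
have [|||h [[h1 hB hM] hR hP hf]] := ext (fun a => a x0).
- by split.
- move=> _ [d ->] Pd; apply/eqP; apply: contra_notT (nP 0%N) => d0.
  have := PM _ _ (reg_cst d^-1) Pd; congr P; apply/funext => x.
  by rewrite mulVf.
- rewrite uc; apply/eqP => c0; apply: nPu; rewrite uc.
  by move: c0 P0 => /= ->.
have OA : O `<=` @adjoin_seq T R gs.
  move=> a; rewrite Hg => /(_ (@adjoin_seq T R gs)); apply.
    have rA := @adjoin_seq_sub_ring T R gs rR.
    split.
    - by move=> d; apply: (@subset_adjoin_seq T R gs) => //; exists d.
    - by move=> b1 b2 Aa Ab; exact: (sub_ringD rA Aa Ab).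
    - by move=> b1 b2 Aa Ab; case: rA => _ _ M; exact: (M _ _ Aa Ab).
  move=> _ [i _ <-]; apply: (@mem_adjoin_seq T R gs) => //.
  by apply/mapP; exists i => //; rewrite mem_enum.
have h0 : h (fun _ => 0) = 0 by rewrite hR//; exists 0.
have hN b : O b -> h (fun x => - b x) = - h b.
  move=> Ob; have := hB (fun _ => 0) b (OA _ (reg_cst 0)) (OA _ Ob).
  rewrite h0 => E; rewrite -[RHS]sub0r -E; congr h; apply/funext => x.
  by rewrite -[LHS]sub0r.
have [x Hx] : exists x : X, forall a, O a -> h a = a x.
  apply: (aff_points (variety_affine X)); split.
  - by move=> d; rewrite hR//; exists d.
  - move=> a b Oa Ob; have := hB a (fun x => - b x) (OA _ Oa) (OA _ (regN Ob)).
    rewrite hN// => E; rewrite -[X in _ = _ + X]opprK -E; congr h; apply/funext => x.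
    by rewrite -[b x]opprK.
  - by move=> a b Oa Ob; exact: (hM _ _ (OA _ Oa) (OA _ Ob)).
move: hf; rewrite Hx// H ?eqxx// => a Ia; rewrite -Hx; last by have [/(_ _ Ia)] := idI.
by apply: hP; [apply: OA; have [/(_ _ Ia)] := idI|exact: IP].
Qed.

End Regular.

(** * Affine varieties and finite etale maps *)

Definition subpoint (X : Type) (Z : set X) : Type := {x | Z x}.
HB.instance Definition _ (X : Type) (Z : set X) := gen_eqMixin (subpoint Z).
HB.instance Definition _ (X : Type) (Z : set X) := gen_choiceMixin (subpoint Z).

Section Varieties2.
Variable k : closedFieldType.
Implicit Types X Y T : variety k.

Lemma morphism_id X : morphism (fun x : X => x). Proof. by []. Qed.

Lemma morphism_comp X Y T (f : Y -> T) (g : X -> Y) :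
  morphism f -> morphism g -> morphism (fun x => f (g x)).
Proof. by move=> mf mg h Oh; exact: (mg _ (mf _ Oh)). Qed.

Lemma morphism_cst X Y (y : Y) : morphism (fun _ : X => y).
Proof. by move=> h Oh; exact: reg_cst. Qed.

Lemma prod_regularl X Y (f : X -> k) : regular f ->
  @regular _ (prodv X Y) (fun z => f z.1).
Proof. by move=> Of P _; apply; left; exists f. Qed.

Lemma prod_regularr X Y (f : Y -> k) : regular f ->
  @regular _ (prodv X Y) (fun z => f z.2).
Proof. by move=> Of P _; apply; right; exists f. Qed.

Lemma morphism_fst X Y : @morphism _ (prodv X Y) X fst.
Proof. by move=> f; exact: prod_regularl. Qed.

Lemma morphism_snd X Y : @morphism _ (prodv X Y) Y snd.
Proof. by move=> f; exact: prod_regularr. Qed.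

Lemma morphism_pair X Y T (f : T -> X) (g : T -> Y) : morphism f -> morphism g ->
  @morphism _ T (prodv X Y) (fun t => (f t, g t)).
Proof.
move=> mf mg h; apply: (@generated_comp _ _ _ (fun t : T => (f t, g t)) _ (@regular _ T)).
  exact: aff_subalgebra (variety_affine T).
by move=> _ [[a Oa ->]|[a Oa ->]]; [exact: mf|exact: mg].
Qed.

Lemma prod_regularP X Y (F : X * Y -> k) : @regular _ (prodv X Y) F ->
  exists (J : finType) (a : J -> X -> k) (b : J -> Y -> k),
    [/\ forall j, regular (a j), forall j, regular (b j) &
        forall x y, F (x, y) = \sum_j a j x * b j y].
Proof.
pose P : set (X * Y -> k) := [set F | exists (J : finType) (a : J -> X -> k) (b : J -> Y -> k),
    [/\ forall j, regular (a j), forall j, regular (b j) &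
        forall x y, F (x, y) = \sum_j a j x * b j y]].
move=> /(_ P); apply.
  split.
  - move=> c; exists unit, (fun _ _ => c), (fun _ _ => 1); split=> [_|_|x y]; try exact: reg_cst.
    by rewrite (big_pred1 tt) ?mulr1//; case.
  - move=> F1 F2 [J [a [b [Oa Ob E]]]] [J' [a' [b' [Oa' Ob' E']]]].
    exists (J + J')%type, (fun j => match j with inl i => a i | inr i => a' i end),
      (fun j => match j with inl i => b i | inr i => b' i end); split.
    + by case=> i; [exact: Oa|exact: Oa'].
    + by case=> i; [exact: Ob|exact: Ob'].
    + by move=> x y; rewrite E E' big_sumType.
  - move=> F1 F2 [J [a [b [Oa Ob E]]]] [J' [a' [b' [Oa' Ob' E']]]].
    exists (J * J')%type, (fun j x => a j.1 x * a' j.2 x), (fun j x => b j.1 x * b' j.2 x); split.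
    + by move=> j; exact: regM.
    + by move=> j; exact: regM.
    + move=> x y; rewrite E E' big_distrlr pair_big.
      by apply: eq_bigr => j _; rewrite mulrACA.
move=> _ [[f Of ->]|[f Of ->]].
  exists unit, (fun _ => f), (fun _ _ => 1); split=> [_|_|x y]; try exact: reg_cst; first by [].
  by rewrite (big_pred1 tt) ?mulr1//; case.
exists unit, (fun _ _ => 1), (fun _ => f); split=> [_|_|x y]; try exact: reg_cst; first by [].
by rewrite (big_pred1 tt) ?mul1r//; case.
Qed.

Lemma prod_regular_sum X Y (J : finType) (a : J -> X -> k) (b : J -> Y -> k) :
  (forall j, regular (a j)) -> (forall j, regular (b j)) ->
  @regular _ (prodv X Y) (fun z => \sum_j a j z.1 * b j z.2).
Proof.
move=> Oa Ob; apply: reg_sum => j _.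
by apply: regM; [exact: prod_regularl|exact: prod_regularr].
Qed.

(** [Z] is the zero locus of its own ideal, a form that avoids choosing equations. *)
Definition zclosed X (Z : set X) := forall x : X,
  (forall f, regular f -> (forall z, Z z -> f z = 0) -> f x = 0) -> Z x.

Lemma zclosedT X : zclosed [set: X]. Proof. by []. Qed.

Lemma zclosedI X (Z Z' : set X) : zclosed Z -> zclosed Z' -> zclosed (Z `&` Z').
Proof.
move=> cZ cZ' x H; split; [apply: cZ|apply: cZ'] => f Of fz; apply: H => // z [];
  by [move=> /fz|move=> _ /fz].
Qed.

Lemma zclosed_preim X Y (g : X -> Y) (Z : set Y) : morphism g -> zclosed Z ->
  zclosed (g @^-1` Z).
Proof. by move=> mg cZ x H; apply: cZ => f Of fz; apply: (H (f \o g)) => [|z]; [exact: mg|exact: fz]. Qed.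

Lemma zclosed0 X (f : X -> k) : regular f -> zclosed [set x | f x = 0].
Proof. by move=> Of x H; exact: H. Qed.

Lemma zclosed1 X (x0 : X) : zclosed [set x0].
Proof.
move=> x H; apply: (aff_separated (variety_affine X)) => f Of.
apply/eqP; rewrite -subr_eq0; apply/eqP; apply: (H (fun x => f x - f x0)).
  by apply: regB => //; exact: reg_cst.
by move=> z ->; rewrite subrr.
Qed.

Lemma zclosed_eq X Y (f g : X -> Y) : morphism f -> morphism g -> zclosed [set x | f x = g x].
Proof.
move=> mf mg x H; apply: (aff_separated (variety_affine Y)) => h Oh.
apply/eqP; rewrite -subr_eq0; apply/eqP; apply: (H (fun x => h (f x) - h (g x))).
  by apply: regB; [exact: mf|exact: mg].
by move=> z ->; rewrite subrr.
Qed.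

Definition sub_regular X (Z : set X) : set (subpoint Z -> k) :=
  [set f | exists2 F, regular F & f = (fun z => F (sval z))].

Lemma sub_affine X (Z : set X) : zclosed Z -> is_affine_variety (@sub_regular X Z).
Proof.
move=> cZ.
have sub : subalgebra (@sub_regular X Z).
  split.
  - by move=> c; exists (fun _ => c) => //; exact: reg_cst.
  - by move=> _ _ [f Of ->] [g Og ->]; exists (fun x => f x + g x) => //; exact: regD.
  - by move=> _ _ [f Of ->] [g Og ->]; exists (fun x => f x * g x) => //; exact: regM.
split=> //.
- have [n [g Hg]] := aff_fingen (variety_affine X).
  exists n, (fun i z => g i (sval z)); apply/seteqP; split=> f.
    move=> [F OF ->] P sP SP; move: OF; rewrite Hg => OF.
    apply: (@generated_comp _ _ _ (fun z : subpoint Z => sval z) _ P sP _ F OF).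
    by move=> _ [i _ <-]; apply: SP; exists i.
  apply=> // _ [i _ <-]; exists (g i) => //; rewrite Hg => P _; apply; by exists i.
- move=> [x Zx] [y Zy] H; apply: eq_exist; apply: (aff_separated (variety_affine X)) => f Of.
  by apply: (H (fun z => f (sval z))); exists f.
- move=> h [h1 hD hM].
  have [|x Hx] := aff_points (variety_affine X) (h := fun F => h (fun z => F (sval z))).
    split; first by move=> c; exact: h1.
    + by move=> f g Of Og; apply: hD; [exists f|exists g].
    + by move=> f g Of Og; apply: hM; [exists f|exists g].
  have Zx : Z x.
    apply: cZ => f Of fz; rewrite -Hx// -[RHS](h1 0); congr h.
    by apply/funext => z; apply: fz; exact: svalP.
  by exists (exist _ x Zx) => _ [F OF ->]; rewrite Hx.
Qed.

Definition subv X (Z : set X) (cZ : zclosed Z) : variety k :=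
  Variety (vpts := subpoint Z) (sub_affine cZ).

Lemma morphism_sval X (Z : set X) (cZ : zclosed Z) : @morphism _ (subv cZ) X sval.
Proof. by move=> f Of; exists f. Qed.

Lemma morphism_sub X (Z : set X) (cZ : zclosed Z) T (g : T -> subv cZ) :
  morphism (fun t => sval (g t)) -> morphism g.
Proof. by move=> mg _ [F OF ->]; exact: mg. Qed.

End Varieties2.

(** The characteristic polynomial is a power of ['X]. *)
Lemma trace_eigen0 (k : closedFieldType) n (A : 'M[k]_n) :
  (forall a, eigenvalue A a -> a = 0) -> \tr A = 0.
Proof.
case: n A => [|n] A H; first by rewrite /mxtrace big_ord0.
have [r Er] := closed_field_poly_normal (char_poly A).
have r0 : {in r, forall z, z = 0}.
  move=> z zr; apply: H; rewrite eigenvalue_root_char Er rootZ.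
    by rewrite root_prod_XsubC.
  by rewrite (monicP (char_poly_monic A)) oner_eq0.
rewrite (monicP (char_poly_monic A)) scale1r in Er.
have sr : size r = n.+1.
  by have := size_char_poly A; rewrite {1}Er size_prod_XsubC => -[].
have Ep : \prod_(z <- r) ('X - z%:P) = 'X^(size r) :> {poly k}.
  elim: r r0 {Er sr} => [|z r IH] H0; first by rewrite big_nil.
  rewrite big_cons IH; last by move=> w wr; apply: H0; rewrite inE wr orbT.
  by rewrite (H0 z) ?inE ?eqxx// subr0 -exprS.
have := char_poly_trace A (ltn0Sn n).
rewrite Er Ep sr coefXn /= ltn_eqF// => /eqP.
by rewrite eq_sym oppr_eq0 => /eqP.
Qed.

Lemma regular_linear_sum (k : closedFieldType) (Y X : variety k) (g : Y -> X) phi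
    (J : finType) (a : J -> X -> k) (f : J -> Y -> k) :
  morphism g -> regular_linear g phi -> (forall j, regular (a j)) -> (forall j, regular (f j)) ->
  forall x, phi (fun y => \sum_j a j (g y) * f j y) x = \sum_j a j x * phi (f j) x.
Proof.
move=> mg [_ lin] Oa Of x.
have phi0 : phi (fun _ => 0) = fun _ => 0.
  have := lin (fun _ => 1) (fun _ => 0) (fun _ => 0) (reg_cst _ _) (reg_cst _ _) (reg_cst _ _).
  under eq_fun do rewrite mul1r addr0; move=> E; apply/funext => x'.
  by have := congr1 (fun u => u x' - phi (fun=> 0) x') E; rewrite /= mul1r subrr addrK.
elim: (index_enum J) => [|j r IH].
  by under eq_fun do rewrite big_nil; rewrite phi0 big_nil.
under eq_fun do rewrite big_cons.
rewrite lin//; first by rewrite IH big_cons.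
by apply: reg_sum => i _; apply: regM => //; exact: (mg _ (Oa i)).
Qed.

(** * Traces and descent along finite etale maps *)

Section FiniteEtale.
Variables (k : closedFieldType) (Y X : variety k) (g : Y -> X).
Hypothesis etg : finite_etale g.
Hypothesis sg : set_surj setT setT g.

Let mg : morphism g. Proof. by case: etg. Qed.

(** The [h i] represent the coordinates [phi i] through the perfect trace form. Each coordinate
    thereby becomes a trace, and traces depend only on values along the fibre ([tr_fibre0]). *)
Record etale_basis (n : nat) (b : 'I_n -> Y -> k) (phi : 'I_n -> (Y -> k) -> (X -> k))
    (h : 'I_n -> Y -> k) : Prop := EtaleBasis {
  eb_b : forall i, regular (b i);
  eb_h : forall i, regular (h i);
  eb_phi : forall i f, regular f -> regular (phi i f);
  eb_lin : forall i (J : finType) (a : J -> X -> k) (f : J -> Y -> k),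
    (forall j, regular (a j)) -> (forall j, regular (f j)) ->
    forall x, phi i (fun y => \sum_j a j (g y) * f j y) x = \sum_j a j x * phi i (f j) x;
  eb_dual : forall f, regular f -> forall y, f y = \sum_i phi i f (g y) * b i y;
  eb_trace : forall i f, regular f ->
    forall x, phi i f x = \sum_j phi j (fun y => f y * h i y * b j y) x }.

Lemma etale_basisP : exists n b phi h, @etale_basis n b phi h.
Proof.
have [_ [n [b [phi [Hb Hdual Hnd Hperf]]]]] := etg.
have /choice[h Hh] : forall i, exists hi : Y -> k, regular hi /\ forall f, regular f ->
    phi i f = fun x => \sum_j phi j (fun y => f y * hi y * b j y) x.
  by move=> i; have [hi Ohi Hi] := Hperf _ (Hb i).2; exists hi.
exists n, b, phi, h; split.
- by move=> i; have [] := Hb i.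
- by move=> i; have [] := Hh i.
- by move=> i f Of; have [_ [+ _]] := Hb i; exact.
- by move=> i J a f Oa Of x; have [_ rl] := Hb i; rewrite regular_linear_sum.
- exact: Hdual.
- by move=> i f Of x; have [_ ->] := Hh i.
Qed.

Section Basis.
Variables (n : nat) (b : 'I_n -> Y -> k) (phi : 'I_n -> (Y -> k) -> (X -> k)) (h : 'I_n -> Y -> k).
Hypothesis EB : etale_basis b phi h.

Let tr (f : Y -> k) x := \sum_j phi j (fun y => f y * b j y) x.

Lemma eb_scal i a f x : regular a -> regular f ->
  phi i (fun y => a (g y) * f y) x = a x * phi i f x.
Proof.
move=> Oa Of; have := @eb_lin _ _ _ _ EB i unit (fun _ => a) (fun _ => f) (fun=> Oa) (fun=> Of) x.
rewrite (big_pred1 tt); last by case.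
by move=> <-; congr (phi i _ x); apply/funext => y; rewrite (big_pred1 tt)//; case.
Qed.

Lemma eb_add i f f' x : regular f -> regular f' ->
  phi i (fun y => f y + f' y) x = phi i f x + phi i f' x.
Proof.
move=> Of Of'.
have := @eb_lin _ _ _ _ EB i bool (fun _ _ => 1) (fun c => if c then f else f')
  (fun=> reg_cst _ _) _ x.
rewrite big_bool !mul1r => <-; last by case.
by congr (phi i _ x); apply/funext => y; rewrite big_bool !mul1r.
Qed.

Let M (f : Y -> k) x : 'M[k]_n := \matrix_(i, j) phi i (fun y => f y * b j y) x.

Let trE f x : tr f x = \tr (M f x).
Proof. by rewrite /tr /mxtrace; apply: eq_bigr => i _; rewrite mxE. Qed.

Let Ob := eb_b EB.
Let phiO := eb_phi EB.

Let MM f f' x : regular f -> regular f' -> M (fun y => f y * f' y) x = M f x *m M f' x.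
Proof.
move=> Of Of'; apply/matrixP => i j; rewrite !mxE.
transitivity (phi i (fun y => \sum_l phi l (fun y => f' y * b j y) (g y) * (f y * b l y)) x).
  congr (phi i _ x); apply/funext => y.
  rewrite -mulrA (@eb_dual _ _ _ _ EB (fun y => f' y * b j y)); last exact: regM.
  by rewrite mulr_sumr; apply: eq_bigr => l _; ring.
rewrite (@eb_lin _ _ _ _ EB i _ (fun l => phi l (fun y => f' y * b j y)) (fun l y => f y * b l y)); last 2 first.
- by move=> l; apply: phiO; exact: regM.
- by move=> l; exact: regM.
by apply: eq_bigr => l _; rewrite !mxE mulrC.
Qed.

(** [M f x] is the matrix of multiplication by [f] on the fibre algebra at [x]. By the
    Nullstellensatz a function vanishing on the fibre acts nilpotently, so its trace is zero. *)
Lemma tr_fibre0 f x : regular f -> (forall y, g y = x -> f y = 0) -> tr f x = 0.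
Proof.
move=> Of fx0; rewrite trE.
(* The functions acting as zero on the fibre algebra. Every [a (g y) - a x] is among them, so the
   zeros of [I] lie over [x]. *)
pose I : set (Y -> k) := [set f | regular f /\ M f x = 0].
have idI : reg_ideal I.
  split.
  - by move=> ? [].
  - split; first exact: reg_cst.
    apply/matrixP => i j; rewrite !mxE.
    transitivity (phi i (fun y => 0 * b j y) x) => //.
    by rewrite (@eb_scal i (fun=> 0)) ?mul0r//; exact: reg_cst.
  - move=> f1 f2 [R1 M1] [R2 M2]; split; first exact: regB.
    apply/matrixP => i j; rewrite !mxE.
    transitivity (phi i (fun y => f1 y * b j y + -1 * (f2 y * b j y)) x).
      by congr (phi i _ x); apply/funext => y; ring.
    rewrite eb_add; [|exact: regM|by apply: regZ; exact: regM].
    rewrite (@eb_scal i (fun=> -1)); [|exact: reg_cst|exact: regM].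
    by move/matrixP/(_ i j): M1; move/matrixP/(_ i j): M2; rewrite !mxE => -> ->; rewrite mulr0 addr0.
  - move=> f1 f2 R1 [R2 M2]; split; first exact: regM.
    by rewrite MM// M2 mulmx0.
have [N [_ HN]] : exists N, I (fun y => f y ^+ N).
  apply: nullstellensatz => // y Hy; apply: fx0.
  apply: (aff_separated (variety_affine X)) => a Oa.
  apply/eqP; rewrite -subr_eq0; apply/eqP; apply: (Hy (fun y => a (g y) - a x)).
  have Oax : regular (fun x' => a x' - a x) by apply: regB => //; exact: reg_cst.
  split; first exact: (mg Oax).
  apply/matrixP => i j; rewrite !mxE (@eb_scal i (fun x' => a x' - a x))//.
  by rewrite subrr mul0r.
apply: trace_eigen0 => c /eigenvalueP[v vE v0].
have vN m : v *m M (fun y => f y ^+ m.+1) x = c ^+ m.+1 *: v.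
  elim: m => [|m IH]; first by rewrite expr1 -vE; congr (_ *m M _ x); apply/funext => y; rewrite expr1.
  have -> : (fun y => f y ^+ m.+2) = (fun y => f y * f y ^+ m.+1).
    by apply/funext => y; rewrite exprS.
  by rewrite MM//; [rewrite mulmxA vE -scalemxAl IH scalerA -exprS|exact: regX].
have HN1 : M (fun y => f y ^+ N.+1) x = 0.
  have -> : (fun y => f y ^+ N.+1) = (fun y => f y * f y ^+ N) by apply/funext => y; rewrite exprS.
  by rewrite MM//; [rewrite HN mulmx0|exact: regX].
have := vN N; rewrite HN1 mulmx0 => /esym/eqP; rewrite scaler_eq0 (negbTE v0) orbF expf_eq0 /=.
by move/eqP.
Qed.

Lemma phi_fibre0 f x i : regular f -> (forall y, g y = x -> f y = 0) -> phi i f x = 0.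
Proof.
move=> Of fx0; rewrite (@eb_trace _ _ _ _ EB i)//; apply: tr_fibre0.
  by apply: regM => //; exact: (eb_h EB).
by move=> y /fx0 ->; rewrite mul0r.
Qed.

Lemma phi_fibre f f' x i : regular f -> regular f' -> (forall y, g y = x -> f y = f' y) ->
  phi i f x = phi i f' x.
Proof.
move=> Of Of' E; apply/eqP; rewrite -subr_eq0; apply/eqP.
rewrite -(mulN1r (phi i f' x)) -(@eb_scal i (fun=> -1))//; last exact: reg_cst.
rewrite -eb_add//; last exact: regZ.
apply: phi_fibre0; first by apply: regD => //; exact: regZ.
by move=> y /E ->; rewrite mulN1r subrr.
Qed.

End Basis.
End FiniteEtale.

Section EtaleDescent.
Variables (k : closedFieldType) (Y X : variety k) (g : Y -> X).
Hypothesis etg : finite_etale g.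
Hypothesis sg : set_surj setT setT g.

Let mg : morphism g. Proof. by case: etg. Qed.

Let surj_g x : exists y, g y = x.
Proof. by have [//|y _ <-] := sg (t := x); exists y. Qed.

(* A normalized trace: averaging over the fibres of [g]. *)
Lemma fibre_average : exists t : (Y -> k) -> X -> k,
  [/\ forall f, regular f -> regular (t f),
      forall (J : finType) (a : J -> X -> k) (f : J -> Y -> k),
        (forall j, regular (a j)) -> (forall j, regular (f j)) ->
        forall x, t (fun y => \sum_j a j (g y) * f j y) x = \sum_j a j x * t (f j) x,
      forall f f' x, regular f -> regular f' -> (forall y, g y = x -> f y = f' y) ->
        t f x = t f' x &
      forall c x, t (fun _ => c) x = c].
Proof.
have [n [b [phi [h EB]]]] := etale_basisP etg.
have Ob := eb_b EB; have Oh := eb_h EB; have phiO := eb_phi EB.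
pose tr f x := \sum_j phi j (fun y => f y * b j y) x.
have trO f : regular f -> regular (tr f).
  by move=> Of; apply: reg_sum => j _; apply: phiO; exact: regM.
have trL (J : finType) (a : J -> X -> k) (f : J -> Y -> k) :
    (forall j, regular (a j)) -> (forall j, regular (f j)) ->
    forall x, tr (fun y => \sum_j a j (g y) * f j y) x = \sum_j a j x * tr (f j) x.
  move=> Oa Of x; rewrite /tr; under [RHS]eq_bigr do rewrite mulr_sumr.
  rewrite exchange_big; apply: eq_bigr => i _ /=.
  rewrite -(@eb_lin _ _ _ _ _ _ _ _ EB i J a (fun j y => f j y * b i y))//; last first.
    by move=> j; exact: regM.
  by congr (phi i _ x); apply/funext => y; rewrite mulr_suml; apply: eq_bigr => j _; rewrite mulrA.
have trF f f' x : regular f -> regular f' -> (forall y, g y = x -> f y = f' y) ->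
    tr f x = tr f' x.
  move=> Of Of' E; apply: eq_bigr => j _; apply: (phi_fibre etg EB); [exact: regM|exact: regM|].
  by move=> y /E ->.
have trS a f x : regular a -> regular f -> tr (fun y => a (g y) * f y) x = a x * tr f x.
  move=> Oa Of; have := trL unit (fun=> a) (fun=> f) (fun=> Oa) (fun=> Of) x.
  rewrite (big_pred1 tt); last by case.
  by move=> <-; congr (tr _ x); apply/funext => y; rewrite (big_pred1 tt)//; case.
(* The traces form an ideal. If all of them vanish at [x], so do the coordinates of the function 1
   there, and 1 would vanish at a point over [x]. So 1 is a trace, and [f1] normalizes. *)
have [f1 Of1 Ef1] : exists2 f, regular f & forall x, tr f x = 1.
  pose I := [set a : X -> k | exists2 f, regular f & a = tr f].
  have idI : reg_ideal I.
    split.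
    - by move=> _ [f Of ->]; exact: trO.
    - exists (fun=> 0); first exact: reg_cst.
      apply/funext => x; rewrite -[LHS](mul0r (tr (fun=> 0) x)) -(trS (fun=> 0))//; try exact: reg_cst.
      by congr (tr _ x); apply/funext => y; rewrite mul0r.
    - move=> _ _ [f Of ->] [f' Of' ->]; exists (fun y => f y - f' y); first exact: regB.
      apply/funext => x.
      have := trL bool (fun c _ => if c then 1 else -1) (fun c => if c then f else f') _ _ x.
      rewrite !big_bool mul1r mulN1r => <-; last 2 first.
      + by case; exact: reg_cst.
      + by case.
      by congr (tr _ x); apply/funext => y; rewrite big_bool mul1r mulN1r.
    - move=> a _ Oa [f Of ->]; exists (fun y => a (g y) * f y).
        by apply: regM => //; exact: (mg Oa).
      by apply/funext => x; rewrite trS.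
  have [N [f Of Ef]] : exists N, I (fun x : X => 1 ^+ N).
    apply: (nullstellensatz (f := fun=> 1)) => //; first exact: reg_cst.
    move=> x Hx; have [y yx] := surj_g x.
    have := @eb_dual _ _ _ _ _ _ _ _ EB (fun=> 1) (reg_cst _ _) y; move=> ->.
    rewrite big1// => i _; rewrite yx (@eb_trace _ _ _ _ _ _ _ _ EB)//; last exact: reg_cst.
    rewrite -/(tr (fun y => 1 * h i y) x) (Hx (tr _)) ?mul0r//.
    by exists (fun y => 1 * h i y) => //; exact: regZ.
  by exists f => // x; rewrite -Ef expr1n.
exists (fun f => tr (fun y => f y * f1 y)); split.
- by move=> f Of; apply: trO; exact: regM.
- move=> J a f Oa Of x; rewrite -(trL J a (fun j y => f j y * f1 y))//; last first.
    by move=> j; exact: regM.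
  by congr (tr _ x); apply/funext => y; rewrite mulr_suml; apply: eq_bigr => j _; rewrite mulrA.
- move=> f f' x Of Of' E; apply: trF; [exact: regM|exact: regM|].
  by move=> y /E ->.
- by move=> c x; rewrite (trS (fun=> c)) ?Ef1 ?mulr1//; exact: reg_cst.
Qed.

(** [f] is the fibre average of its own pullback. *)
Lemma regular_descent (f : X -> k) : regular (fun y => f (g y)) -> regular f.
Proof.
move=> Ofg; have [t [tO _ tF t1]] := fibre_average.
suff -> : f = t (fun y => f (g y)) by exact: tO.
apply/funext => x; rewrite -[LHS](t1 _ x); apply: tF => //; first exact: reg_cst.
by move=> y ->.
Qed.

Variables (T : variety k) (xi : T -> X).
Hypothesis mxi : morphism xi.

Definition fibre_product : set (prodv T Y) := [set z | xi z.1 = g z.2].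

Lemma zclosed_fibre_product : zclosed fibre_product.
Proof.
apply: zclosed_eq; last by apply: morphism_comp => //; exact: morphism_snd.
by apply: morphism_comp => //; exact: morphism_fst.
Qed.

Definition pullv : variety k := subv zclosed_fibre_product.
Definition pull_map (z : pullv) : T := (sval z).1.
Definition pull_lift (z : pullv) : Y := (sval z).2.

Lemma pull_comm z : xi (pull_map z) = g (pull_lift z). Proof. exact: (svalP z). Qed.

Lemma morphism_pull_map : morphism pull_map.
Proof.
apply: (@morphism_comp _ _ _ _ (fst : prodv T Y -> T)); first exact: morphism_fst.
exact: morphism_sval.
Qed.

Lemma morphism_pull_lift : morphism pull_lift.
Proof.
apply: (@morphism_comp _ _ _ _ (snd : prodv T Y -> Y)); first exact: morphism_snd.
exact: morphism_sval.
Qed.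

Lemma surj_pull_map : set_surj setT setT pull_map.
Proof.
move=> t _; have [y yx] := surj_g (xi t).
by exists (exist _ (t, y) (esym yx)).
Qed.

(** Base change of the dual basis. A function on the fibre product is extended to [T * Y] and
    [phi i] is applied to its slices; by [phi_fibre] the result does not depend on the extension. *)
Lemma etale_pull_map : finite_etale pull_map.
Proof.
have [n [b [phi [h EB]]]] := etale_basisP etg.
have Ob := eb_b EB; have Oh := eb_h EB; have phiO := eb_phi EB.
have [ext Hext] : exists ext : (pullv -> k) -> (T * Y -> k), forall F, regular F ->
    @regular _ (prodv T Y) (ext F) /\ F = (fun z => ext F (sval z)).
  have /choice[ext H] : forall F : pullv -> k, exists E : T * Y -> k, regular F ->
      @regular _ (prodv T Y) E /\ F = (fun z => E (sval z)).
    move=> F; have [[E OE EF]|nF] := pselect (regular F); first by exists E.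
    by exists (fun=> 0).
  by exists ext.
pose psi i F t := phi i (fun y => ext F (t, y)) (xi t).
have slice (E : T * Y -> k) t : @regular _ (prodv T Y) E -> regular (fun y => E (t, y)).
  move=> OE; apply: (@morphism_pair _ _ _ _ (fun=> t) (fun y => y) _ _ E OE) => //.
  exact: morphism_cst.
have psiE i E t : @regular _ (prodv T Y) E ->
    psi i (fun z : pullv => E (sval z)) t = phi i (fun y => E (t, y)) (xi t).
  move=> OE; have [|OE' EE] := Hext (fun z : pullv => E (sval z)); first by exists E.
  apply: (phi_fibre etg EB); [exact: slice|exact: slice|].
  move=> y gy; have := congr1 (fun u => u (exist _ (t, y) (esym gy) : pullv)) EE.
  by move=> /= ->.
have psiO i F : regular F -> regular (psi i F).
  case=> E OE ->.
  have [J [a [c [Oa Oc EE]]]] := prod_regularP OE.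
  suff -> : psi i (fun z : pullv => E (sval z)) = (fun t => \sum_j a j t * phi i (c j) (xi t)).
    by apply: reg_sum => j _; apply: regM => //; exact: (mxi (phiO _ _ _)).
  apply/funext => t; rewrite psiE//.
  rewrite -(@eb_lin _ _ _ _ _ _ _ _ EB i J (fun j _ => a j t) c)//; last by move=> j; exact: reg_cst.
  by congr (phi i _ _); apply/funext => y; rewrite EE.
have psi_lin i : regular_linear pull_map (psi i).
  split; first exact: psiO.
  move=> a F F' Oa [E OE ->] [E' OE' ->]; apply/funext => t.
  have -> : (fun y : pullv => a (pull_map y) * E (sval y) + E' (sval y)) =
      (fun z : pullv => (fun w => a w.1 * E w + E' w) (sval z)) by [].
  have OB : @regular _ (prodv T Y) (fun w => a w.1 * E w + E' w).
    by apply: (@regD _ (prodv T Y)) => //; apply: (@regM _ (prodv T Y)) => //; exact: prod_regularl.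
  rewrite (psiE i (fun w => a w.1 * E w + E' w) t OB) !psiE//.
  have R2 := slice _ t OE'; have R1 := slice _ t OE.
  rewrite (eb_add EB i (xi t) (regZ (a t) R1) R2).
  by rewrite (eb_scal EB i (xi t) (reg_cst _ (a t)) R1).
have b'O i : regular (fun z : pullv => b i (pull_lift z)) by exact: (morphism_pull_lift (Ob i)).
have h'O i : regular (fun z : pullv => h i (pull_lift z)) by exact: (morphism_pull_lift (Oh i)).
pose tr F t := \sum_i psi i (fun z => F z * b i (pull_lift z)) t.
have dual F : regular F -> forall z, F z = \sum_i psi i F (pull_map z) * b i (pull_lift z).
  move=> [E OE ->] z; under eq_bigr do rewrite psiE// pull_comm.
  rewrite -(@eb_dual _ _ _ _ _ _ _ _ EB (fun y => E (pull_map z, y)))//; last exact: slice.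
  by rewrite -surjective_pairing.
have psitr i F t : regular F -> psi i F t = tr (fun z => F z * h i (pull_lift z)) t.
  move=> [E OE ->]; rewrite psiE// (@eb_trace _ _ _ _ _ _ _ _ EB)//; last exact: slice.
  apply: eq_bigr => j _.
  have -> : (fun z : pullv => E (sval z) * h i (pull_lift z) * b j (pull_lift z)) =
    (fun z : pullv => (fun w => E w * h i w.2 * b j w.2) (sval z)) by [].
  rewrite (psiE j (fun w => E w * h i w.2 * b j w.2))//.
  apply: (@regM _ (prodv T Y)); last exact: prod_regularr.
  by apply: (@regM _ (prodv T Y)) => //; exact: prod_regularr.
split; first exact: morphism_pull_map.
exists n, (fun i z => b i (pull_lift z)), psi; split=> //.
- move=> F OF HF; apply/funext => z; rewrite dual// big1// => i _.
  rewrite psitr//.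
  have -> : tr (fun z => F z * h i (pull_lift z)) = tr (fun z => h i (pull_lift z) * F z).
    by congr tr; apply/funext => z'; rewrite mulrC.
  have -> : tr (fun z => h i (pull_lift z) * F z) (pull_map z) = 0.
    exact: (congr1 (fun u => u (pull_map z)) (HF _ (h'O i))).
  by rewrite mul0r.
- move=> theta [thO thL].
  (* Expand in the dual basis: [h i] represents the coordinate [psi i], so this combination
     represents [theta]. *)
  exists (fun z => \sum_i theta (fun z => b i (pull_lift z)) (pull_map z) * h i (pull_lift z)).
    apply: reg_sum => i _; apply: regM => //; apply: (morphism_pull_map _).
    exact: (thO _ (b'O i)).
  move=> F OF; apply/funext => t.
  have -> : theta F t = theta (fun z => \sum_i psi i F (pull_map z) * b i (pull_lift z)) t.
    by congr (theta _ t); apply/funext => z; exact: dual.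
  rewrite (regular_linear_sum morphism_pull_map (a := fun i => psi i F)
    (f := fun i z => b i (pull_lift z)))//; last by move=> i; exact: psiO.
  transitivity (\sum_i \sum_j theta (fun z => b i (pull_lift z)) t *
      psi j (fun z => F z * h i (pull_lift z) * b j (pull_lift z)) t).
    by apply: eq_bigr => i _; rewrite psitr// mulr_suml; apply: eq_bigr => j _; rewrite mulrC.
  rewrite exchange_big; apply: eq_bigr => j _ /=.
  rewrite -(regular_linear_sum morphism_pull_map
    (a := fun i => theta (fun z => b i (pull_lift z)))
    (f := fun i z => F z * h i (pull_lift z) * b j (pull_lift z)))//; last 2 first.
  + by move=> i; exact: (thO _ (b'O i)).
  + by move=> i; apply: regM => //; exact: regM.
  congr (psi j _ t); apply/funext => z; rewrite mulr_sumr mulr_suml.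
  by apply: eq_bigr => i _; ring.
Qed.

End EtaleDescent.

Section LocallyConstant.
Variable k : closedFieldType.
Implicit Types X Y : variety k.

Lemma zariski_openP X (U : set (zariski X)) : open U <-> @zclosed _ X (~` U).
Proof.
split.
  move=> [F FO ->] x H [f Ff fx]; move: fx; rewrite H ?eqxx//; first exact: FO.
  by move=> z /= nz; apply/eqP; apply: contra_notT nz => fz; exists f.
move=> cU; exists [set f | regular f /\ forall z, ~ U z -> f z = 0]; first by move=> f [].
apply/seteqP; split=> x /=.
  move=> Ux; apply: contrapT => nf; apply: (cU x _ Ux) => f Of fz.
  by apply/eqP; apply: contra_notT nf => fx; exists f.
by move=> [f [_ fz] fx]; apply: contrapT => /fz fx0; rewrite fx0 eqxx in fx.
Qed.

Definition irreducible_variety X := forall f g : X -> k, regular f -> regular g ->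
  (forall x, f x * g x = 0) -> (forall x, f x = 0) \/ (forall x, g x = 0).

Lemma locally_constant_map X (A B : Type) (u : A -> B) (a : X -> A) :
  locally_constant a -> locally_constant (fun x => u (a x)).
Proof.
move=> la v; have -> : [set x : zariski X | u (a x) = v] =
    \bigcup_(w in [set w | u w = v]) [set x : zariski X | a x = w].
  by apply/seteqP; split=> x /=; [move=> <-; exists (a x)|move=> [w /= <- ->]].
by apply: bigcup_open => w _; exact: la.
Qed.

Lemma locally_constant_const X (A : Type) (a : X -> A) : irreducible_variety X ->
  locally_constant a -> forall x y, a x = a y.
Proof.
move=> iX la x y; apply: contrapT => axy.
have /zariski_openP cx := la (a x); have /zariski_openP cy := la (a y).
have [f [Of fz fx]] : exists f, [/\ regular f, forall z, a z <> a x -> f z = 0 & f x != 0].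
  apply: contrapT => nf; have [] // := cx x _ erefl => f Of fz.
  by apply/eqP; apply: contra_notT nf => fx; exists f.
have [g [Og gz gy]] : exists f, [/\ regular f, forall z, a z <> a y -> f z = 0 & f y != 0].
  apply: contrapT => nf; have [] // := cy y _ erefl => f' Of' fz'.
  by apply/eqP; apply: contra_notT nf => fx'; exists f'.
have [z|f0|g0] := iX f g Of Og.
- have [az|naz] := pselect (a z = a x); last by rewrite fz ?mul0r.
  by rewrite gz ?mulr0// az.
- by rewrite f0 eqxx in fx.
- by rewrite g0 eqxx in gy.
Qed.

(** The functions vanishing on [U] and those vanishing off [U] have no common zero, so 1 is a sum
    [f + g] of one of each, and [g] is the indicator. *)
Lemma indicator_regular X (U : set X) : zclosed U -> zclosed (~` U) ->
  exists f, [/\ regular f, forall x, U x -> f x = 1 & forall x, ~ U x -> f x = 0].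
Proof.
move=> cU cU'.
pose I := [set h : X -> k | exists f g, [/\ regular f, regular g,
  h = (fun x => f x + g x), forall x, U x -> f x = 0 & forall x, ~ U x -> g x = 0]].
have idI : reg_ideal I.
  split.
  - by move=> _ [f [g [Of Og -> _ _]]]; exact: regD.
  - exists (fun=> 0), (fun=> 0); split=> //; try exact: reg_cst.
    by apply/funext => x; rewrite addr0.
  - move=> _ _ [f [g [Of Og -> fU gU]]] [f' [g' [Of' Og' -> fU' gU']]].
    exists (fun x => f x - f' x), (fun x => g x - g' x); split; [exact: regB|exact: regB|..].
    + by apply/funext => x; ring.
    + by move=> x Ux; rewrite fU// fU'// subr0.
    + by move=> x Ux; rewrite gU// gU'// subr0.
  - move=> a _ Oa [f [g [Of Og -> fU gU]]].
    exists (fun x => a x * f x), (fun x => a x * g x); split; [exact: regM|exact: regM|..].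
    + by apply/funext => x; ring.
    + by move=> x Ux; rewrite fU// mulr0.
    + by move=> x Ux; rewrite gU// mulr0.
have [N [f [g [Of Og E fU gU]]]] : exists N, I (fun x : X => 1 ^+ N).
  apply: (nullstellensatz (f := fun=> 1)) => //; first exact: reg_cst.
  move=> x Hx; have [Ux|nUx] := pselect (U x).
    exfalso; have : (~` U) x; last by apply.
    apply: cU' => g Og gU; apply: Hx; exists (fun=> 0), g; split=> //; first exact: reg_cst.
    by apply/funext => z; rewrite add0r.
  exfalso; apply: nUx; apply: cU => f Of fU; apply: Hx.
  exists f, (fun=> 0); split=> //; first exact: reg_cst.
  by apply/funext => z; rewrite addr0.
have E1 x : 1 = f x + g x by have := congr1 (fun u => u x) E; rewrite /= expr1n.
exists g; split=> //; by move=> x Ux; rewrite (E1 x) fU// add0r.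
Qed.

Lemma locally_constant_clopen X (A : Type) (a : X -> A) (v : A) : locally_constant a ->
  @zclosed _ X [set x | a x = v] /\ @zclosed _ X (~` [set x | a x = v]).
Proof.
move=> la; split; last by apply/zariski_openP; exact: la.
have -> : [set x | a x = v] = ~` [set x | asbool (a x = v) = false].
  by apply/seteqP; split=> x /=; [move=> /asboolP -> //|move=> H; apply/asboolP; case: (asbool _) H].
by apply/zariski_openP; exact: (locally_constant_map (fun w => asbool (w = v)) la).
Qed.

Lemma locally_constant_regular X (A : eqType) (s : seq A) (u : A -> k) (a : X -> A) :
  locally_constant a -> (forall x, a x \in s) -> regular (fun x => u (a x)).
Proof.
move=> la as_.
have /choice[e He] : forall v : A, exists f : X -> k, [/\ regular f,
    forall x, a x = v -> f x = 1 & forall x, a x <> v -> f x = 0].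
  by move=> v; have [] := locally_constant_clopen v la => c1 c2; exact: indicator_regular.
have -> : (fun x => u (a x)) = (fun x => \sum_(v <- undup s) u v * e v x).
  apply/funext => x; rewrite (bigD1_seq (a x)) ?undup_uniq ?mem_undup//=.
  have [_ E1 _] := He (a x); rewrite (E1 x erefl) mulr1 big1 ?addr0// => v /eqP nv.
  by have [_ _ E0] := He v; rewrite E0 ?mulr0//; exact: nesym.
by apply: reg_sum => v _; apply: regZ; have [] := He v.
Qed.

Lemma regular_locally_constant X (s : seq k) (f : X -> k) : regular f ->
  (forall x, f x \in s) -> locally_constant f.
Proof.
move=> Of fs v; apply/zariski_openP.
(* All values being in [s], [f] avoids [v] exactly where the product of the [f - w] over the other
   values vanishes. *)
have -> : ~` [set x : zariski X | f x = v] =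
    [set x : X | \prod_(w <- s | w != v) (f x - w) = 0].
  apply/seteqP; split=> x /= => [nv|/eqP].
    rewrite (big_rem (f x)) //=; case: eqP => // _.
    by rewrite subrr mul0r.
  by move=> + fv; rewrite prodf_seq_eq0 => /hasP[w _ /andP[/eqP wv]];
    rewrite fv subr_eq0 => /eqP/esym.
apply: zclosed0.
elim: s {fs} => [|w s IH].
  by under eq_fun do rewrite big_nil; exact: reg_cst.
under eq_fun do rewrite big_cons; case: (w != v) => //.
by apply: regM => //; apply: regB => //; exact: reg_cst.
Qed.

End LocallyConstant.

(** * Closed subgroups of unipotent groups *)

Lemma left_kernel (k : fieldType) (J : finType) (b : 'I_(#|J|.+1) -> J -> k) :
  exists2 v : 'I_(#|J|.+1) -> k, (exists i, v i != 0) & forall j, \sum_i v i * b i j = 0.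
Proof.
pose B : 'M[k]_(#|J|.+1, #|J|) := \matrix_(i, j) b i (enum_val j).
have /rowV0Pn[v /sub_kermxP vB v0] : kermx B != 0.
  rewrite -mxrank_eq0 mxrank_ker subn_eq0 -ltnNge ltnS.
  exact: rank_leq_col.
exists (v 0); first by apply/existsP; apply: contraNT v0;
  rewrite negb_exists => /forallP H; apply/eqP/rowP => i; rewrite mxE; apply/eqP; have := H i; rewrite negbK.
move=> j; have /rowP/(_ (enum_rank j)) := vB; rewrite !mxE => E; rewrite -[RHS]E.
by apply: eq_bigr => i _; rewrite mxE enum_rankK.
Qed.

Section Groups.
Variables (k : closedFieldType) (G : calg_group k).
Notation O := (@regular k (cag_var G)).
Implicit Types (N H S : set G) (f g : G -> k).

Lemma reg_shift f u : O f -> O (fun x => f (x + u)).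
Proof.
move=> Of; have mp : @morphism k (cag_var G) (prodv (cag_var G) (cag_var G)) (fun x => (x, u)).
  by apply: morphism_pair => //; exact: morphism_cst.
exact: (mp _ (@cag_addP k G f Of)).
Qed.

Lemma reg_opp f : O f -> O (fun x => f (- x)).
Proof. exact: (@cag_oppP k G f). Qed.

Lemma shift_expand f : O f -> exists (J : finType) (a b : J -> G -> k),
  [/\ forall j, O (a j), forall j, O (b j) & forall x u, f (x + u) = \sum_j a j x * b j u].
Proof.
move=> Of; have [J [a [b [Oa Ob E]]]] := prod_regularP (@cag_addP k G f Of).
by exists J, a, b.
Qed.

Definition zsubgroup N := [/\ @zclosed k (cag_var G) N, N 0 & forall x y, N x -> N y -> N (x - y)].

Lemma zsubgroup_closed N : zsubgroup N -> @zclosed k (cag_var G) N. Proof. by case. Qed.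
Lemma zsubgroup0 N : zsubgroup N -> N 0. Proof. by case. Qed.
Lemma zsubgroupB N x y : zsubgroup N -> N x -> N y -> N (x - y).
Proof. by case=> _ _; exact. Qed.
Lemma zsubgroupN N x : zsubgroup N -> N x -> N (- x).
Proof. by move=> sN Nx; rewrite -sub0r; apply: zsubgroupB => //; exact: zsubgroup0. Qed.
Lemma zsubgroupD N x y : zsubgroup N -> N x -> N y -> N (x + y).
Proof. by move=> sN Nx Ny; rewrite -[y]opprK; apply: zsubgroupB => //; exact: zsubgroupN. Qed.
Lemma zsubgroupMn N x n : zsubgroup N -> N x -> N (x *+ n).
Proof.
move=> sN Nx; elim: n => [|n IH]; first by rewrite mulr0n; exact: zsubgroup0.
by rewrite mulrS; exact: zsubgroupD.
Qed.
Lemma zsubgroupT : zsubgroup [set: G]. Proof. by split. Qed.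
Lemma zsubgroup_triv : zsubgroup [set (0 : G)].
Proof. by split=> [||x y -> ->]; rewrite ?subrr//; exact: zclosed1. Qed.
Lemma zsubgroupI N H : zsubgroup N -> zsubgroup H -> zsubgroup (N `&` H).
Proof.
move=> sN sH; split; first by apply: zclosedI; exact: zsubgroup_closed.
  by split; exact: zsubgroup0.
by move=> x y [Nx Hx] [Ny Hy]; split; exact: zsubgroupB.
Qed.

Definition additive_on N f := forall x y, N x -> N y -> f (x + y) = f x + f y.

Lemma additive_on0 N f : zsubgroup N -> additive_on N f -> f 0 = 0.
Proof.
move=> sN af; have := af 0 0 (zsubgroup0 sN) (zsubgroup0 sN); rewrite addr0 => E.
by apply: (addrI (f 0)); rewrite addr0 -E.
Qed.
Lemma additive_onN N f x : zsubgroup N -> additive_on N f -> N x -> f (- x) = - f x.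
Proof.
move=> sN af Nx; apply/eqP; rewrite -addr_eq0 -af//; last exact: zsubgroupN.
by rewrite addNr (additive_on0 sN).
Qed.
Lemma additive_onB N f x y : zsubgroup N -> additive_on N f -> N x -> N y ->
  f (x - y) = f x - f y.
Proof. by move=> sN af Nx Ny; rewrite af ?(additive_onN sN)//; exact: zsubgroupN. Qed.
Lemma additive_on_sub N H f : H `<=` N -> additive_on N f -> additive_on H f.
Proof. by move=> HN af x y Hx Hy; apply: af; exact: HN. Qed.

Definition ker_on N f : set G := [set x | N x /\ f x = 0].

Lemma zsubgroup_ker N f : zsubgroup N -> O f -> additive_on N f -> zsubgroup (ker_on N f).
Proof.
move=> sN Of af; split.
- exact: (zclosedI (zsubgroup_closed sN) (zclosed0 Of)).
- by split; [exact: zsubgroup0|exact: (additive_on0 sN)].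
- move=> x y [Nx fx] [Ny fy]; split; first exact: zsubgroupB.
  by rewrite (additive_onB sN)// fx fy subrr.
Qed.

Definition finite_index H N := exists s : seq G, forall x, N x -> exists2 a, a \in s & H (x - a).

Lemma finite_index_refl N : zsubgroup N -> finite_index N N.
Proof.
by move=> sN; exists [:: 0] => x Nx; exists 0; rewrite ?inE ?subr0.
Qed.

Lemma finite_index_trans H N M : zsubgroup N -> zsubgroup M -> N `<=` M -> H `<=` N ->
  finite_index H N -> finite_index N M -> finite_index H M.
Proof.
move=> sN sM NM HN [s Hs] [t Ht]; exists [seq a + b | a <- s, b <- t] => x Mx.
have [b bt Nxb] := Ht x Mx; have [a as_ Hxba] := Hs _ Nxb.
exists (a + b); first by apply/allpairsP; exists (a, b).
by rewrite opprD addrA addrAC.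
Qed.

Lemma finite_indexI H N D : zsubgroup H -> zsubgroup D -> D `<=` N -> finite_index H N ->
  finite_index (H `&` D) D.
Proof.
move=> sH sD DN [s Hs].
(* Each representative whose coset meets [D] is moved into [D]. *)
have /choice[c Hc] : forall a, exists d, forall x, D x -> H (x - a) -> D d /\ H (d - a).
  move=> a; have [[d [Dd Hd]]|nd] := pselect (exists d, D d /\ H (d - a)); first by exists d.
  by exists 0 => x Dx Hx; case: nd; exists x.
exists [seq c a | a <- s] => x Dx; have [a as_ Hxa] := Hs x (DN _ Dx).
have [Dc Hca] := Hc a x Dx Hxa.
exists (c a); first exact: map_f.
split; last exact: zsubgroupB.
have -> : x - c a = (x - a) - (c a - a) by rewrite opprB addrA subrK.
exact: zsubgroupB.
Qed.

(** An algebraic form of connectedness. It yields irreducibility in a unipotent group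
    ([conn_domain]), hence topological connectedness ([domain_connected]); [connected_group_conn]
    recovers it from the topology for the whole group. *)
Definition conn N := zsubgroup N /\ forall H, zsubgroup H -> H `<=` N -> finite_index H N -> N `<=` H.

Definition infinite_image N f := ~ exists s : seq k, forall x, N x -> f x \in s.

Lemma infinite_image_distinct N f n : infinite_image N f ->
  exists u : nat -> G, (forall i, (i < n)%N -> N (u i)) /\
    forall i j, (i < n)%N -> (j < n)%N -> f (u i) = f (u j) -> i = j.
Proof.
move=> inf; elim: n => [|n [u [Nu Hu]]]; first by exists (fun=> 0).
have [x [Nx Hx]] : exists x, N x /\ forall i, (i < n)%N -> f x <> f (u i).
  apply: contrapT => nx; apply: inf; exists [seq f (u i) | i <- iota 0 n] => x Nx.
  apply: contrapT => xn; apply: nx; exists x; split=> // i ni E; apply: xn.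
  by apply/mapP; exists i; rewrite // mem_iota.
exists (fun i => if (i < n)%N then u i else x); split.
  by move=> i _; case: ifP => // /Nu.
move=> i j; rewrite !ltnS (leq_eqVlt i) (leq_eqVlt j) => /orP[/eqP ->|ni] /orP[/eqP ->|nj] //.
- by rewrite ltnn nj => /Hx; case.
- by rewrite ltnn ni => /esym/Hx; case.
- by rewrite ni nj; exact: Hu.
Qed.

Lemma poly_infinite_image N f (q : {poly k}) : infinite_image N f ->
  (forall x, N x -> q.[f x] = 0) -> q = 0.
Proof.
move=> inf Hq; apply/eqP; apply: contra_notT inf => q0.
have [s Es] := closed_field_poly_normal q; exists s => x /Hq.
rewrite Es hornerZ => /eqP; rewrite mulf_eq0 lead_coef_eq0 (negbTE q0) /=.
by rewrite -[_ == 0]/(root _ _) root_prod_XsubC.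
Qed.

(* If [f] misses the value [c], then [1 / (f - c)] is regular by the
   Nullstellensatz, and its translates are linearly independent. *)
Lemma additive_surj N f : zsubgroup N -> O f -> additive_on N f -> infinite_image N f ->
  forall c, exists2 x, N x & f x = c.
Proof.
move=> sN Of af inf c; apply: contrapT => nc.
pose I := [set h : G -> k | O h /\ exists2 q, O q & forall x, N x -> h x = q x * (f x - c)].
have Ofc : O (fun x => f x - c) by apply: regB => //; exact: reg_cst.
have idI : @reg_ideal k (cag_var G) I.
  split; first by move=> h [].
  - by split; [exact: reg_cst|exists (fun=> 0); [exact: reg_cst|move=> x _; rewrite mul0r]].
  - move=> h h' [Oh [q Oq E]] [Oh' [q' Oq' E']]; split; first exact: regB.
    by exists (fun x => q x - q' x); [exact: regB|move=> x Nx; rewrite E// E'// mulrBl].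
  - move=> a h Oa [Oh [q Oq E]]; split; first exact: regM.
    by exists (fun x => a x * q x); [exact: regM|move=> x Nx; rewrite E// mulrA].
have [n [_ [q Oq Eq]]] : exists n, I (fun=> 1 ^+ n).
  apply: (@nullstellensatz k (cag_var G) _ (fun=> 1)) => //; first exact: reg_cst.
  move=> x Hx; case: nc; exists x.
    apply: (zsubgroup_closed sN) => h Oh hz; apply: Hx; split=> //.
    by exists (fun=> 0); [exact: reg_cst|move=> z /hz ->; rewrite mul0r].
  apply/eqP; rewrite -subr_eq0; apply/eqP; apply: (Hx (fun x => f x - c)); split=> //.
  by exists (fun=> 1); [exact: reg_cst|move=> z _; rewrite mul1r].
have {}Eq x : N x -> q x * (f x - c) = 1 by move=> /Eq; rewrite expr1n.
have [J [a [b [Oa Ob E]]]] := shift_expand Oq.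
have [u [Nu Hu]] := infinite_image_distinct #|J|.+1 inf.
have [v [i0 vi0] vb] := left_kernel (fun i : 'I_(#|J|.+1) => fun j => b j (u i)).
(* A nontrivial combination of translates of [1 / (f - c)] vanishes; [P] is its numerator in the
   variable [f x]. At [c - f (u i0)] only the term of index [i0] survives, and it is nonzero. *)
pose P : {poly k} := \sum_i v i *: \prod_(l | l != i) ('X + (f (u l) - c)%:P).
have P0 : P = 0.
  apply: (poly_infinite_image inf) => x Nx.
  have -> : P.[f x] = \prod_(l < #|J|.+1) (f (x + u l) - c) * \sum_i v i * q (x + u i).
    rewrite /P horner_sum mulr_sumr; apply: eq_bigr => i _.
    have Ei : q (x + u i) * (f (x + u i) - c) = 1.
      by apply: Eq; apply: zsubgroupD => //; exact: Nu.
    rewrite hornerZ horner_prod [in RHS](bigD1 i)//=.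
    transitivity (v i * \prod_(l < #|J|.+1 | l != i) (f (x + u l) - c)).
      congr (_ * _); apply: eq_bigr => l _.
      by rewrite hornerD hornerX hornerC af ?addrA//; exact: Nu.
    by rewrite -[LHS]mulr1 -Ei; ring.
  suff -> : \sum_i v i * q (x + u i) = 0 by rewrite mulr0.
  under eq_bigr do rewrite E mulr_sumr.
  rewrite exchange_big big1// => j _.
  under eq_bigr do rewrite mulrCA.
  by rewrite -mulr_sumr vb mulr0.
have := congr1 (fun p => p.[c - f (u i0)]) P0; rewrite horner0 /P horner_sum (bigD1 i0)//=.
rewrite [X in _ + X]big1 => [|i ii0]; last first.
  rewrite hornerZ horner_prod (bigD1 i0) 1?eq_sym//= hornerD hornerX hornerC.
  by rewrite addrA subrK subrr mul0r mulr0.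
rewrite addr0 hornerZ horner_prod => /eqP; rewrite mulf_eq0 (negbTE vi0) /=.
move=> /prodf_eq0[l li0]; rewrite hornerD hornerX hornerC => /eqP E0.
have E1 : f (u l) = f (u i0) by apply/subr0_eq; rewrite -[RHS]E0; ring.
by move/eqP: li0; apply; apply/val_inj; exact: (Hu _ _ (ltn_ord l) (ltn_ord i0) E1).
Qed.

End Groups.

(** * Weights, fixed vectors, and irreducibility of connected subgroups *)

Section Unipotent.
Variables (k : closedFieldType) (G : calg_group k).
Notation O := (@regular k (cag_var G)).
Implicit Types (N H S : set G) (f g : G -> k).

Section Weights.
Variables (n : nat) (r : G -> 'M[k]_n).
Hypothesis rD : forall x y, r (x + y) = r x *m r y.
Hypothesis rT : forall x (i j : 'I_n), (j <= i)%N -> r x i j = (i == j)%:R.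
Hypothesis rO : O = generated_subalgebra [set f | exists i j, f = (fun x => r x i j)].

(* The entry [(i, j)] has weight [j - i]. *)
Inductive weight : nat -> (G -> k) -> Prop :=
| weight_cst d c : weight d (fun _ => c)
| weight_coord d (i j : 'I_n) : (j - i <= d)%N -> weight d (fun x => r x i j)
| weight_add d f g : weight d f -> weight d g -> weight d (fun x => f x + g x)
| weight_mul d e d' f g : (d + e <= d')%N -> weight d f -> weight e g ->
    weight d' (fun x => f x * g x).

(** Weight at most [d - 1], where weight [-1] means zero. *)
Let lower d f := if d is e.+1 then weight e f else f = (fun=> 0).

Lemma weightW d d' f : (d <= d')%N -> weight d f -> weight d' f.
Proof.
move=> + wf; elim: wf d' => {d f}.
- by move=> d c d' _; exact: weight_cst.
- by move=> d i j ij d' dd'; apply: weight_coord; exact: leq_trans dd'.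
- by move=> d f g _ IHf _ IHg d' dd'; apply: weight_add; [exact: IHf|exact: IHg].
- move=> d e d1 f g de wf _ wg _ d' dd'.
  by apply: weight_mul wf wg; exact: leq_trans dd'.
Qed.

Lemma coord_reg i j : O (fun x => r x i j).
Proof. by rewrite rO => P _; apply; exists i, j. Qed.

Lemma weight_reg d f : weight d f -> O f.
Proof.
elim=> {d f}.
- by move=> d c; exact: (@reg_cst k (cag_var G)).
- by move=> d i j _; exact: coord_reg.
- by move=> d f g _ Of _ Og; exact: (@regD k (cag_var G)).
- by move=> d e d' f g _ _ Of _ Og; exact: (@regM k (cag_var G)).
Qed.

Lemma reg_weight f : O f -> exists d, weight d f.
Proof.
rewrite rO => /(_ [set f | exists d, weight d f]); apply.
  split.
  - by move=> c; exists 0%N; exact: weight_cst.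
  - move=> a b [d wa] [e wb]; exists (d + e)%N; apply: weight_add.
      by apply: weightW wa; exact: leq_addr.
    by apply: weightW wb; exact: leq_addl.
  - by move=> a b [d wa] [e wb]; exists (d + e)%N; exact: weight_mul wa wb.
by move=> _ [i [j ->]]; exists (j - i)%N; exact: weight_coord.
Qed.

Let weight_sum d (J : Type) (s : seq J) (P : pred J) (F : J -> G -> k) :
  (forall j, P j -> weight d (F j)) -> weight d (fun x => \sum_(j <- s | P j) F j x).
Proof.
move=> HF; elim: s => [|j s IH].
  by under eq_fun do rewrite big_nil; exact: weight_cst.
under eq_fun do rewrite big_cons; case Pj : (P j) => //.
by apply: weight_add => //; exact: HF.
Qed.

Let lowerW d f : lower d f -> weight d f.
Proof. by case: d => [/= ->|d]; [exact: weight_cst|exact: weightW]. Qed.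

Let lowerD d f g : lower d f -> lower d g -> lower d (fun x => f x + g x).
Proof.
case: d => [/= -> ->|d wf wg]; last exact: weight_add.
by apply/funext => x; rewrite addr0.
Qed.

Let lowerM d e d' f g : (d + e <= d')%N -> weight d f -> lower e g -> lower d' (fun x => f x * g x).
Proof.
move=> de wf; case: e de => [|e] /= de => [->|wg].
  case: d' {de} => [|d'] /=; first by apply/funext => x; rewrite mulr0.
  by under eq_fun do rewrite mulr0; exact: weight_cst.
by case: d' de => [|d']; [rewrite addnS|rewrite addnS ltnS => de; exact: weight_mul wf wg].
Qed.

(** In [r (x + u) = r x *m r u] with [r u] unitriangular, the entry [(i, j)] changes only by entries
    [(i, l)] with [l < j], which have smaller weight. *)
Lemma weight_shift d f u : weight d f -> lower d (fun x => f (x + u) - f x).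
Proof.
elim=> {d f}.
- move=> d c; under eq_fun do rewrite subrr.
  by case: d => // d; exact: weight_cst.
- move=> d i j ij.
  have -> : (fun x => r (x + u) i j - r x i j) =
      (fun x => \sum_(l < n | l != j) r x i l * r u l j).
    apply/funext => x; rewrite rD mxE (bigD1 j)//= (rT u (leqnn j)) eqxx mulr1.
    by rewrite addrAC subrr add0r.
  case: d ij => [|d] ij.
    have ji : (j <= i)%N by rewrite -subn_eq0 -leqn0.
    apply/funext => x; apply: big1 => l lj.
    have [jl|lj'] := leqP j l.
      by rewrite (rT u jl) (negbTE lj) mulr0.
    have li : (l <= i)%N by exact: leq_trans (ltnW lj') ji.
    rewrite (rT x li); case: eqP => [il|_]; last by rewrite mul0r.
    by move: lj'; rewrite -il ltnNge ji.
  apply: weight_sum => l lj.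
  have [jl|lj'] := leqP j l.
    by under eq_fun do rewrite (rT u jl) (negbTE lj) mulr0; exact: weight_cst.
  apply: (@weight_mul d 0 d); [by rewrite addn0| |exact: weight_cst].
  apply: weight_coord; move: ij lj'; lia.
- move=> d f g _ lf _ lg.
  have -> : (fun x => f (x + u) + g (x + u) - (f x + g x)) =
    (fun x => (f (x + u) - f x) + (g (x + u) - g x)) by apply/funext => x; ring.
  exact: lowerD.
- move=> d e d' f g de wf lf wg lg.
  have -> : (fun x => f (x + u) * g (x + u) - f x * g x) =
    (fun x => f x * (g (x + u) - g x) + (g x * (f (x + u) - f x) +
       (f (x + u) - f x) * (g (x + u) - g x))) by apply/funext => x; ring.
  apply: lowerD; first exact: lowerM wf lg.
  apply: lowerD; first by apply: lowerM wg lf; rewrite addnC.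
  by apply: lowerM lg; [exact: de|exact: lowerW].
Qed.

(* The entries on the minimal superdiagonal where [N] is nontrivial are additive. *)
Inductive flag : set G -> Prop :=
| flag_triv N : N `<=` [set 0] -> flag N
| flag_step N f : O f -> additive_on N f -> flag (ker_on N f) -> flag N.

Let done_at (D : pred ('I_n * 'I_n)) : set G :=
  [set x | forall ij, D ij -> (ij.1 < ij.2)%N -> r x ij.1 ij.2 = 0].

Let flag_done m (D : pred ('I_n * 'I_n)) : (#|predC D| <= m)%N -> flag (done_at D).
Proof.
elim: m D => [|m IH] D Dm.
  apply: flag_triv => x Hx; apply: (aff_separated (variety_affine (cag_var G))) => f.
  rewrite -[@regular k _]/O rO => /(_ [set f | f x = f 0]); apply.
    split=> // a b /=; first by move=> -> ->.
    by move=> -> ->.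
  move=> _ [i [j ->]] /=; have [ji|ij] := leqP j i; first by rewrite !rT.
  have r0 : r 0 *m r 0 = r 0 by rewrite -rD addr0.
  have D1 : forall ij, D ij.
    move=> ij'; have := Dm; rewrite leqn0 => /eqP/card0_eq/(_ ij').
    by rewrite !inE => /negbFE.
  (* [r 0] is idempotent and unitriangular, hence the identity; the induction is on the distance to
     the diagonal. *)
  have r0E : forall m' (a b : 'I_n), (b - a <= m')%N -> (a < b)%N -> r 0 a b = 0.
    elim=> [|m' IHm] a b abm ab; first by move: abm ab; lia.
    have := r0; move=> /matrixP/(_ a b); rewrite mxE (bigD1 a)//= (bigD1 b)/=; last first.
      by rewrite -val_eqE /= gtn_eqF.
    rewrite (rT 0 (leqnn a)) eqxx mul1r (rT 0 (leqnn b)) eqxx mulr1 big1 ?addr0 => [E|l].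
      by apply: (addrI (r 0 a b)); rewrite E addr0.
    move=> /andP[la lb]; have [al|al] := ltnP a l; last first.
      by rewrite (rT 0 al) eq_sym (negbTE la) mul0r.
    have [lb'|lb'] := ltnP l b; last by rewrite (rT 0 lb') (negbTE lb) mulr0.
    by rewrite IHm ?mul0r//; move: abm lb' al; lia.
  by rewrite (Hx (i, j))//= (r0E (j - i)%N).
have [/existsP[ij0 ij0D]|] := boolP [exists ij, ~~ D ij]; last first.
  rewrite negb_exists => /forallP H; apply: IH; rewrite eq_card0// => ij.
  by rewrite !inE; have := H ij; rewrite negbK => ->.
pose Q (ij : 'I_n * 'I_n) := ~~ D ij.
(* With [j - i] minimal outside [D], the intermediate entries [(i, l)] vanish on [done_at D], so the
   entry [(i, j)] is additive there. *)
have [[i j] /= Dij ijmin] := @arg_minnP _ ij0 Q (fun ij => ij.2 - ij.1)%N ij0D.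
pose D' : pred ('I_n * 'I_n) := fun ij => D ij || (ij == (i, j)).
have D'm : (#|predC D'| <= m)%N.
  rewrite -ltnS; apply: leq_trans Dm; apply: proper_card; apply/properP; split.
    by apply/fintype.subsetP => ij; rewrite !inE /D' negb_or => /andP[].
  by exists (i, j); rewrite !inE // /D' eqxx orbT.
have [ji|lij] := leqP j i.
  have <- : done_at D' = done_at D.
    apply/seteqP; split=> x Hx ij Dij' lij; first by apply: Hx; rewrite // /D' Dij'.
    move: Dij'; rewrite /D' => /orP[/Hx|/eqP E]; first exact.
    by move: lij; rewrite E /= ltnNge ji.
  exact: IH.
apply: (@flag_step _ (fun x => r x i j)); first exact: coord_reg.
  move=> x y Hx Hy; rewrite rD mxE (bigD1 i)//= (bigD1 j)/=; last first.
    by rewrite -val_eqE /= gtn_eqF.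
  rewrite (rT x (leqnn i)) eqxx mul1r (rT y (leqnn j)) eqxx mulr1 big1 ?addr0 1?addrC// => l.
  move=> /andP[li lj]; have [al|al] := ltnP i l; last first.
    by rewrite (rT x al) eq_sym (negbTE li) mul0r.
  have [lb'|lb'] := ltnP l j; last by rewrite (rT y lb') (negbTE lj) mulr0.
  rewrite (Hx (i, l)) ?mul0r//=; apply: contraT => nD.
  by have := ijmin (i, l) nD => /=; move: al lb'; lia.
have -> : ker_on (done_at D) (fun x => r x i j) = done_at D'.
  apply/seteqP; split=> x.
    by move=> [Hx r0] ij /orP[/Hx|/eqP -> _]; [exact|exact: r0].
  move=> Hx; split; last by apply: (Hx (i, j)); rewrite // /D' eqxx orbT.
  by move=> ij Dij'; apply: Hx; rewrite /D' Dij'.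
exact: IH.
Qed.

Lemma flagT : flag [set: G].
Proof.
have -> : [set: G] = done_at pred0 by apply/seteqP; split.
exact: flag_done (leqnn _).
Qed.

End Weights.

Lemma unipotent_flag : unipotent G -> flag [set: G].
Proof. by move=> [n [r [rD rT rO]]]; exact: flagT rD rT rO. Qed.

Lemma flag_sub N H : H `<=` N -> flag N -> flag H.
Proof.
move=> + fN; elim: fN H => {N} [N N0|N f Of af _ IH] H HN.
  by apply: flag_triv => x /HN /N0.
apply: (@flag_step _ f) => //; first exact: additive_on_sub af.
by apply: IH => x [Hx fx]; split=> //; exact: HN.
Qed.

Hypothesis uG : unipotent G.

Lemma unipotent_weight : exists wt : nat -> set (G -> k),
  [/\ forall f, O f -> exists d, wt d f, forall d f, wt d f -> O f,
      forall f, wt 0%N f -> forall u x, f (x + u) = f x &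
      forall d f, wt d.+1 f -> forall u, wt d (fun x => f (x + u) - f x)].
Proof.
have [n [r [rD rT rO]]] := uG; exists (weight r); split.
- exact: reg_weight.
- exact: weight_reg.
- move=> f wf u x; apply/eqP; rewrite -subr_eq0.
  by have /= -> := congr1 (fun h => h x) (weight_shift rD rT u wf).
- by move=> d f wf u; exact: (weight_shift rD rT u wf).
Qed.

(** A unipotent action fixes a nonzero vector: among the elements of [M] that do not vanish on [N],
    take one of minimal weight. Its differences under [S] have smaller weight, so they vanish on
    [N]. *)
Lemma unipotent_fixed N S (M : set (G -> k)) : M `<=` O ->
  (forall f g, M f -> M g -> M (fun x => f x - g x)) ->
  (forall s f, S s -> M f -> M (fun x => f (x + s))) ->
  (exists2 f, M f & exists2 x, N x & f x != 0) ->
  exists f, [/\ M f, exists2 x, N x & f x != 0 &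
    forall s x, S s -> N x -> f (x + s) = f x].
Proof.
move=> MO MB MS [f0 Mf0 nf0]; have [wt [wtO Owt wt0 wtS]] := unipotent_weight.
pose Q d := `[<exists f, [/\ M f, wt d f & exists2 x, N x & f x != 0]>].
have exQ : exists d, Q d by have [d wf0] := wtO _ (MO _ Mf0); exists d; apply/asboolP; exists f0.
case: (ex_minnP exQ) => d /asboolP[f [Mf wf nf]] dmin.
exists f; split=> // s x Ss Nx.
case: d wf dmin => [|d] wf dmin; first exact: wt0.
apply/eqP; rewrite -subr_eq0; apply: contraT => nz.
suff : Q d by move=> /dmin; rewrite ltnn.
apply/asboolP; exists (fun x => f (x + s) - f x); split; last by exists x.
  by apply: MB => //; exact: MS.
exact: wtS.
Qed.

Definition domain_on N := forall f g, O f -> O g -> (forall x, N x -> f x * g x = 0) ->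
  (forall x, N x -> f x = 0) \/ (forall x, N x -> g x = 0).

Lemma not_finite_index_seq H N m : zsubgroup H -> zsubgroup N -> H `<=` N -> ~ finite_index H N ->
  exists u : nat -> G, (forall i, (i < m)%N -> N (u i)) /\
    forall i j, (i < m)%N -> (j < m)%N -> H (u i - u j) -> i = j.
Proof.
move=> sH sN HN nfi; elim: m => [|m [u [Nu Hu]]]; first by exists (fun=> 0).
have [x [Nx Hx]] : exists x, N x /\ forall i, (i < m)%N -> ~ H (x - u i).
  apply: contrapT => nx; apply: nfi; exists [seq u i | i <- iota 0 m] => x Nx.
  apply: contrapT => xn; apply: nx; exists x; split=> // i ni E; apply: xn.
  by exists (u i) => //; apply/mapP; exists i; rewrite // mem_iota.
exists (fun i => if (i < m)%N then u i else x); split.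
  by move=> i _; case: ifP => // /Nu.
move=> i j; rewrite !ltnS (leq_eqVlt i) (leq_eqVlt j) => /orP[/eqP ->|ni] /orP[/eqP ->|nj] //.
- by rewrite ltnn nj => /Hx; case.
- by rewrite ltnn ni => /(zsubgroupN sH); rewrite opprB => /Hx; case.
- by rewrite ni nj; exact: Hu.
Qed.

(* For a zero divisor [f] of minimal weight, with [f g = 0], translates of [g] by
   points in distinct cosets of the stabilizer of [f] are orthogonal. *)
Lemma conn_domain N : conn N -> domain_on N.
Proof.
move=> [sN cN] f0 g0 Of0 Og0 fg0; apply: contrapT => /not_orP[nf0 ng0].
have nz h : ~ (forall x, N x -> h x = 0) -> exists2 x, N x & h x != 0.
  move=> nh; apply: contrapT => nx; apply: nh => x Nx; apply/eqP.
  by apply: contra_notT nx => hx; exists x.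
have [wt [wtO Owt wt0 wtS]] := unipotent_weight.
pose Q d := `[<exists f g, [/\ wt d f, O g, forall x, N x -> f x * g x = 0,
  exists2 x, N x & f x != 0 & exists2 x, N x & g x != 0]>].
have exQ : exists d, Q d.
  by have [d wf0] := wtO _ Of0; exists d; apply/asboolP; exists f0, g0; split=> //; exact: nz.
case: (ex_minnP exQ) => d /asboolP[f [g [wf Og fg nf ng]]] dmin {exQ f0 g0 Of0 Og0 fg0 nf0 ng0}.
have Of := Owt _ _ wf.
pose H : set G := [set w | N w /\ forall x, N x -> f (x + w) = f x].
have sH : zsubgroup H.
  split.
  - apply: (zclosedI (zsubgroup_closed sN)) => w Hw x Nx.
    apply/eqP; rewrite -subr_eq0; apply/eqP; apply: (Hw (fun w => f (x + w) - f x)).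
      apply: (@regB k (cag_var G)); last exact: reg_cst.
      by under eq_fun do rewrite addrC; exact: reg_shift.
    by move=> w' /(_ x Nx) ->; rewrite subrr.
  - by split; [exact: zsubgroup0|move=> x _; rewrite addr0].
  - move=> w w' [Nw fw] [Nw' fw']; split; first exact: zsubgroupB.
    move=> x Nx; have Nxw : N (x - w') by exact: zsubgroupB.
    by rewrite addrA addrAC fw// -(fw' _ Nxw) subrK.
(* [f (x + w) - f x] has smaller weight and is annihilated by [g x * g (x + w)], so by minimality
   one of the two vanishes on [N]; it is not the first, since [w] does not stabilize [f]. *)
have orth w x : N w -> ~ H w -> N x -> g x * g (x + w) = 0.
  move=> Nw nHw Nx; apply/eqP; apply: contraT => gg.
  have nl : exists2 x, N x & f (x + w) - f x != 0.
    apply: contrapT => nx; apply: nHw; split=> // z Nz; apply/eqP; rewrite -subr_eq0.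
    by apply: contra_notT nx => hx; exists z.
  case: d wf dmin => [|d] wf dmin.
    by have [z _] := nl; rewrite wt0// subrr eqxx.
  suff : Q d by move=> /dmin; rewrite ltnn.
  apply/asboolP; exists (fun x => f (x + w) - f x), (fun x => g x * g (x + w)).
  split=> //; [exact: wtS|by apply: (@regM k (cag_var G)) => //; exact: reg_shift| |by exists x].
  move=> z Nz; have Nzw : N (z + w) by exact: zsubgroupD.
  have -> : (f (z + w) - f z) * (g z * g (z + w)) =
    (f (z + w) * g (z + w)) * g z - (f z * g z) * g (z + w) by ring.
  by rewrite !fg// !mul0r subrr.
(* A stabilizer of finite index is all of [N]; then [f] is a nonzero constant on [N] and cannot
   annihilate [g]. *)
have [fi|nfi] := pselect (finite_index H N).
  have NH := cN H sH (fun x => @proj1 _ _) fi.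
  have [x0 Nx0 fx0] := nf; have [x1 Nx1 gx1] := ng.
  have : f x1 * g x1 = 0 by exact: fg.
  have [_ /(_ 0 (zsubgroup0 sN))] := NH _ Nx1; rewrite add0r => ->.
  have [_ /(_ 0 (zsubgroup0 sN))] := NH _ Nx0; rewrite add0r => <-.
  by move/eqP; rewrite mulf_eq0 (negbTE fx0) (negbTE gx1).
(* Otherwise there are arbitrarily many pairwise orthogonal translates of [g], although the
   translates span a finite-dimensional space. Multiplying a linear relation by one translate
   isolates the square of a nonzero value. *)
have [J [a [b [Oa Ob E]]]] := shift_expand Og.
have [u [Nu Hu]] := not_finite_index_seq #|J|.+1 sH sN (fun x => @proj1 _ _) nfi.
have [v [i0 vi0] vb] := left_kernel (fun i : 'I_(#|J|.+1) => fun j => b j (u i)).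
have [x Nx gx] := ng.
have [z [Nz zE]] : exists z, N z /\ z + u i0 = x.
  by exists (x - u i0); rewrite subrK; split=> //; apply: zsubgroupB => //; exact: Nu.
have : (\sum_i v i * g (z + u i)) * g (z + u i0) = 0.
  suff -> : \sum_i v i * g (z + u i) = 0 by rewrite mul0r.
  under eq_bigr do rewrite E mulr_sumr.
  rewrite exchange_big big1// => j _.
  under eq_bigr do rewrite mulrCA.
  by rewrite -mulr_sumr vb mulr0.
rewrite mulr_suml (bigD1 i0)//= [X in _ + X]big1 => [|i ii0]; last first.
  have -> : z + u i0 = z + u i + (u i0 - u i) by rewrite -addrA [u i + _]addrC subrK.
  rewrite -mulrA orth ?mulr0//; [by apply: zsubgroupB => //; exact: Nu| |].
    by move=> /(Hu _ _ (ltn_ord i0) (ltn_ord i))/val_inj E0; rewrite E0 eqxx in ii0.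
  by apply: zsubgroupD => //; exact: Nu.
by rewrite addr0 zE => /eqP; rewrite !mulf_eq0 (negbTE vi0) (negbTE gx).
Qed.

End Unipotent.

(** * Identity components and invariant functions *)

Section Components.
Variables (k : closedFieldType) (G : calg_group k).
Notation O := (@regular k (cag_var G)).
Implicit Types (N H S : set G) (f g : G -> k).

Lemma finite_index_ker N f : zsubgroup N -> O f -> additive_on N f -> ~ infinite_image N f ->
  finite_index (ker_on N f) N.
Proof.
move=> sN Of af /contrapT[s Hs].
have /choice[c Hc] : forall a : k, exists d, forall x, N x -> f x = a -> N d /\ f d = a.
  move=> a; have [[d [Nd fd]]|nd] := pselect (exists d, N d /\ f d = a); first by exists d.
  by exists 0 => x Nx fx; case: nd; exists x.
exists [seq c a | a <- s] => x Nx; have [Nc fc] := Hc (f x) x Nx erefl.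
exists (c (f x)); first by apply: map_f; exact: Hs.
by split; [exact: zsubgroupB|rewrite (additive_onB sN)// fc subrr].
Qed.

Lemma conn_finite_image N f : conn N -> O f -> additive_on N f -> ~ infinite_image N f ->
  forall x, N x -> f x = 0.
Proof.
move=> [sN cN] Of af nf x Nx; have sK := zsubgroup_ker sN Of af.
by have [] := cN _ sK (fun x => @proj1 _ _) (finite_index_ker sN Of af nf) x Nx.
Qed.

Lemma conn_onto N f x0 : conn N -> O f -> additive_on N f -> N x0 -> f x0 != 0 ->
  infinite_image N f.
Proof.
move=> cN Of af Nx0 fx0; apply: contrapT => nf.
by move: fx0; rewrite (conn_finite_image cN Of af nf Nx0) eqxx.
Qed.

Lemma infinite_image_finite_index N H f : zsubgroup N -> H `<=` N -> additive_on N f ->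
  finite_index H N -> infinite_image N f -> infinite_image H f.
Proof.
move=> sN HN af [s Hs] inf [t Ht]; apply: inf.
exists [seq a + f b | a <- t, b <- [seq b <- s | `[< N b >]]] => x Nx; have [b bs Hb] := Hs x Nx.
have Nb : N b by rewrite -[b](subKr x); apply: zsubgroupB => //; exact: HN.
apply/allpairsP; exists (f (x - b), b); split=> //=; first exact: Ht.
  by rewrite mem_filter bs andbT; apply/asboolP.
by rewrite (additive_onB sN)// subrK.
Qed.

Definition id_comp N : set G := [set x | forall H, zsubgroup H -> H `<=` N -> finite_index H N -> H x].

(** Induction along the flag. The minimal subgroup [M] of [ker f] lies in every candidate, so a
    candidate is controlled by its image under [f] and by the representatives of [ker f] modulo [M]
    that it contains. *)
Lemma minimal_finite_index N : flag N -> zsubgroup N -> exists N0, [/\ zsubgroup N0, N0 `<=` N,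
  finite_index N0 N & forall H, zsubgroup H -> H `<=` N -> finite_index H N -> N0 `<=` H].
Proof.
elim=> {N} [N N0|N f Of af fl IH] sN.
  exists N; split=> //; first exact: finite_index_refl.
  by move=> H sH _ _ x /N0 ->; exact: zsubgroup0.
have sK := zsubgroup_ker sN Of af.
have [M [sM MK fiM minM]] := IH sK.
have KN : ker_on N f `<=` N by move=> x [].
have MN : M `<=` N by exact: subset_trans KN.
have minM' H : zsubgroup H -> H `<=` N -> finite_index H N -> M `<=` H.
  move=> sH HN fiH x Mx.
  by have [] := minM _ (zsubgroupI sH sK) (fun x => @proj2 _ _) (finite_indexI sH sK KN fiH) x Mx.
have [inf|nf] := pselect (infinite_image N f); last first.
  exists M; split=> //; apply: (@finite_index_trans _ _ _ (ker_on N f)) => //.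
  exact: finite_index_ker.
have [s Hs] := fiM.
(* Take [H] containing as few representatives of [ker f] modulo [M] as possible; its intersection
   with another candidate then contains the same ones. *)
pose Q m := `[<exists H, [/\ zsubgroup H, H `<=` N, finite_index H N &
  size [seq a <- s | `[< H a >]] = m]>].
have exQ : exists m, Q m.
  by exists (size [seq a <- s | `[< N a >]]); apply/asboolP; exists N; split=> //; exact: finite_index_refl.
case: (ex_minnP exQ) => m /asboolP[H [sH HN fiH <-]] mmin {m exQ}.
exists H; split=> // H' sH' HN' fiH' x Hx.
have sI := zsubgroupI sH sH'.
have fiI : finite_index (H `&` H') N.
  have fiI' : finite_index (H `&` H') H by rewrite setIC; exact: (finite_indexI sH' sH HN fiH').
  exact: (finite_index_trans sH sN HN (fun x => @proj1 _ _) fiI' fiH).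
have IN : H `&` H' `<=` N by move=> ? [/HN].
have eqs : {in s, forall a, H a -> H' a}.
  have : Q (size [seq a <- s | `[< (H `&` H') a >]]) by apply/asboolP; exists (H `&` H').
  move=> /mmin; rewrite !size_filter => le a as_ Ha; apply: contrapT => nHa.
  move: le; rewrite leqNgt => /negP; apply.
  have -> : count (fun a => `[< H a >]) s =
      (count (fun a => `[< (H `&` H') a >]) s + count (fun a => `[< H a >] && ~~ `[< H' a >]) s)%N.
    rewrite -count_predUI [X in (_ + X)%N](_ : _ = 0%N) ?addn0; last first.
      apply/eqP; rewrite -leqn0 leqNgt -has_count; apply/hasPn => b _ /=.
      by apply/negP => /andP[/asboolP[_ Hb'] /andP[_ /asboolP]].
    apply: eq_count => b /=; apply/asboolP/idP => [Hb|/orP[/asboolP[]//|/andP[/asboolP]//]].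
    have [Hb'|nHb'] := pselect (H' b); apply/orP; [left; exact/asboolP|right].
    by apply/andP; split; [exact/asboolP|exact/asboolPn].
  rewrite -[X in (X < _)%N]addn0 ltn_add2l -has_count; apply/hasP; exists a => //.
  by apply/andP; split; [exact/asboolP|exact/asboolPn].
have infI := infinite_image_finite_index sN IN af fiI inf.
(* [f] is still onto on the intersection, so [x] can be moved into [ker f], where the
   representatives decide membership. *)
have [y [Hy Hy'] fy] := additive_surj sI Of (additive_on_sub IN af) infI (f x).
have Kxy : ker_on N f (x - y).
  by split; [apply: zsubgroupB => //; exact: HN|rewrite (additive_onB sN) ?fy ?subrr//; exact: HN].
have [a as_ Mxya] := Hs _ Kxy.
have Ha : H a.
  rewrite -[a](subKr (x - y)); apply: zsubgroupB => //; first exact: zsubgroupB.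
  exact: (minM' H).
have Hxy : H' (x - y).
  rewrite -[x - y](subrK a); apply: zsubgroupD => //; first exact: (minM' H').
  exact: eqs.
by rewrite -[x](subrK y); exact: zsubgroupD.
Qed.

Hypothesis uG : unipotent G.

Lemma id_compP N : zsubgroup N -> [/\ conn (id_comp N), id_comp N `<=` N & finite_index (id_comp N) N].
Proof.
move=> sN; have flN : flag N by apply: flag_sub (unipotent_flag uG).
have [M [sM MN fiM minM]] := minimal_finite_index flN sN.
have -> : id_comp N = M.
  by apply/seteqP; split=> x; [apply|move=> Mx H sH HN fiH; exact: (minM H)].
split=> //; split=> // H sH HM fiH; apply: minM => //; first exact: subset_trans MN.
exact: finite_index_trans fiM.
Qed.

Lemma conn_sub_id_comp N D : zsubgroup N -> conn D -> D `<=` N -> D `<=` id_comp N.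
Proof.
move=> sN [sD cD] DN x Dx H sH HN fiH.
by have [] := cD _ (zsubgroupI sH sD) (fun x => @proj2 _ _) (finite_indexI sH sD DN fiH) x Dx.
Qed.

Lemma id_comp_conn N : conn N -> id_comp N = N.
Proof.
move=> cN; have sN := cN.1; have [cN0 N0N fi] := id_compP sN.
by apply/seteqP; split=> //; case: cN => _; apply=> //; exact: cN0.1.
Qed.

Lemma id_comp_sub N H : zsubgroup N -> zsubgroup H -> H `<=` N -> id_comp H `<=` id_comp N.
Proof.
move=> sN sH HN; have [cH HH _] := id_compP sH.
by apply: conn_sub_id_comp => //; exact: subset_trans HN.
Qed.

(* If [h] is nonzero it is onto, and where [h x = 1] the equation forces [f x = 0]. *)
Lemma artin_schreier_trivial (p q : nat) N f h c : prime p -> (0 < q)%N -> conn N -> O h ->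
  additive_on N h ->
  (forall x, N x -> h x ^+ p - h x = c * f x ^+ q) -> (forall x, N x -> f x = 0 -> h x = 0) ->
  (forall x, N x -> h x = 0) /\ (forall x, N x -> c * f x ^+ q = 0).
Proof.
move=> pp q0 cN Oh ah E ker0.
suff h0 x : N x -> h x = 0.
  by split=> // x Nx; rewrite -E// h0// subr0 expr0n; case: p pp {E}.
apply: conn_finite_image => // inf.
have [y Ny hy] := additive_surj cN.1 Oh ah inf 1.
have /eqP := E y Ny; rewrite hy expr1n subrr eq_sym mulf_eq0 expf_eq0 q0 /= => /orP[/eqP c0|/eqP f0].
  apply: inf; pose P : {poly k} := 'X^p - 'X.
  have P0 : P != 0.
    rewrite -size_poly_gt0 size_polyDl ?size_polyXn// size_polyN size_polyX ltnS.
    exact: prime_gt1.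
  have [s Es] := closed_field_poly_normal P; exists s => z Nz.
  rewrite -root_prod_XsubC -(rootZ _ _ (a := lead_coef P)) ?lead_coef_eq0// -Es.
  by rewrite rootE /P !hornerE E// c0 mul0r.
by have := ker0 y Ny f0; rewrite hy => /eqP; rewrite oner_eq0.
Qed.

Lemma domain_cancel N f g : domain_on N -> O f -> O g -> (exists2 x, N x & f x != 0) ->
  (forall x, N x -> f x * g x = 0) -> forall x, N x -> g x = 0.
Proof.
move=> dN Of Og [x Nx fx] fg; have [f0|//] := dN f g Of Og fg.
by rewrite f0 ?eqxx in fx.
Qed.

(* Galois descent: in a relation of minimal support the ratios of the [g j] are
   invariant, and the ideal of their common denominators contains an invariant. *)
Lemma invariant_relation N S (J : finType) (f g : J -> G -> k) : zsubgroup N -> domain_on N ->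
  zsubgroup S -> S `<=` N -> (forall j, O (f j)) -> (forall j, O (g j)) ->
  (forall s w, S s -> N w -> \sum_j f j (w + s) * g j w = 0) ->
  (exists j, exists2 w, N w & g j w != 0) ->
  exists b : J -> G -> k, [/\ forall j, O (b j),
    forall j s w, S s -> N w -> b j (w + s) = b j w,
    exists j, exists2 w, N w & b j w != 0 &
    forall w, N w -> \sum_j f j w * b j w = 0].
Proof.
move=> sN dN sS SN Of Og0 rel0 ng0.
pose supp (g : J -> G -> k) := [pred j | `[< exists2 w, N w & g j w != 0 >]].
pose Q m := `[<exists g : J -> G -> k, [/\ forall j, O (g j),
  forall s w, S s -> N w -> \sum_j f j (w + s) * g j w = 0,
  exists j, exists2 w, N w & g j w != 0 & #|supp g| = m]>].
have exQ : exists m, Q m by exists #|supp g|; apply/asboolP; exists g.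
case: (ex_minnP exQ) => m /asboolP[{rel0 ng0 Og0}g [Og rel [j0 nj0] <-]] mmin {m exQ}.
(* If a ratio [g i / g j0] were not invariant, [g'] would be a nonzero relation of smaller support,
   the index [j0] having been lost. *)
have prop s i w : S s -> N w -> g j0 w * g i (w + s) = g j0 (w + s) * g i w.
  move=> Ss Nw; apply/eqP; rewrite -subr_eq0; apply: contraT => nz.
  pose g' i w := g j0 w * g i (w + s) - g j0 (w + s) * g i w.
  have Og' l : O (g' l).
    by apply: (@regB k (cag_var G)); apply: (@regM k (cag_var G)) => //; exact: reg_shift.
  suff : Q #|supp g'|.
    move=> /mmin; rewrite leqNgt => /negP[]; apply: proper_card; apply/properP; split.
      apply/fintype.subsetP => l /asboolP[z Nz g'z]; apply/asboolP; apply: contrapT => nl.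
      have l0 y : N y -> g l y = 0.
        by move=> Ny; apply/eqP; apply: contra_notT nl => ?; exists y.
      move: g'z; rewrite /g' l0 ?l0 ?mulr0 ?subrr ?eqxx//; apply: zsubgroupD => //; exact: SN.
    exists j0; first exact/asboolP.
    by apply/asboolP => -[z Nz]; rewrite /g' mulrC subrr eqxx.
  apply/asboolP; exists g'; split=> //; last by exists i, w.
  move=> s' z Ss' Nz; rewrite /g'.
  transitivity (g j0 z * (\sum_j f j ((z + s) + (s' - s)) * g j (z + s)) -
     g j0 (z + s) * \sum_j f j (z + s') * g j z).
    rewrite !mulr_sumr -sumrB; apply: eq_bigr => l _.
    have -> : z + s + (s' - s) = z + s' by rewrite -addrA [s + _]addrC subrK.
    by ring.
  rewrite !rel ?mulr0 ?subrr//; [exact: zsubgroupB|by apply: zsubgroupD => //; exact: SN].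
have gj0 s : S s -> exists2 w, N w & g j0 (w + s) != 0.
  move=> Ss; have [w Nw gw] := nj0; exists (w - s); last by rewrite subrK.
  by apply: zsubgroupB => //; exact: SN.
(* The common denominators of the ratios [g i / g j0]: a nonzero space stable under [S], so it
   contains an invariant. *)
pose M := [set H : G -> k | O H /\ forall i, exists c, O c /\ forall w, N w -> H w * g i w = c w * g j0 w].
have [b [[Ob /choice[c Hc]] nb binv]] : exists b, [/\ M b, exists2 w, N w & b w != 0 &
    forall s w, S s -> N w -> b (w + s) = b w].
  apply: (@unipotent_fixed _ G uG N S M).
  - by move=> ? [].
  - move=> h h' [Oh Eh] [Oh' Eh']; split; first exact: (@regB k (cag_var G)).
    move=> i; have [c [Oc Ec]] := Eh i; have [c' [Oc' Ec']] := Eh' i.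
    exists (fun x => c x - c' x); split; first exact: (@regB k (cag_var G)).
    by move=> w Nw; rewrite !mulrBl Ec// Ec'.
  - move=> s h Ss [Oh Eh]; split; first exact: reg_shift.
    move=> i; have [c [Oc Ec]] := Eh i; exists (fun x => c (x + s)); split; first exact: reg_shift.
    move=> w Nw; apply/eqP; rewrite -subr_eq0; apply/eqP; move: w Nw.
    apply: (@domain_cancel N (fun w => g j0 (w + s))); [done|exact: reg_shift| |exact: gj0|].
      apply: (@regB k (cag_var G)); apply: (@regM k (cag_var G)) => //; exact: reg_shift.
    move=> w Nw; have Nws : N (w + s) by apply: zsubgroupD => //; exact: SN.
    rewrite mulrBr; apply/eqP; rewrite subr_eq0; apply/eqP.
    rewrite mulrCA -prop// mulrCA Ec// ; ring.
  - exists (g j0) => //; split=> // i; exists (g i); split=> // w _; exact: mulrC.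
exists c; split.
- by move=> j; have [] := Hc j.
- move=> i s w Ss Nw; have [Oc Ec] := Hc i; apply/eqP; rewrite -subr_eq0; apply/eqP; move: w Nw.
  apply: (@domain_cancel N (g j0)) => //.
    by apply: (@regB k (cag_var G)) => //; exact: reg_shift.
  apply: (@domain_cancel N (fun w => g j0 (w + s))); [done|exact: reg_shift| |exact: gj0|].
    apply: (@regM k (cag_var G)) => //.
    by apply: (@regB k (cag_var G)) => //; exact: reg_shift.
  move=> w Nw; have Nws : N (w + s) by apply: zsubgroupD => //; exact: SN.
  have E1 := Ec _ Nws; have E2 := Ec _ Nw; rewrite binv// in E1.
  transitivity (g j0 w * (c i (w + s) * g j0 (w + s)) - g j0 (w + s) * (c i w * g j0 w)); first by ring.
  by rewrite -E1 -E2 mulrCA prop//; ring.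
- exists j0; have [w Nw bw] := nb; exists w => //; apply: contra_neq bw => c0.
  have [Oc Ec] := Hc j0.
  suff : forall x, N x -> b x - c j0 x = 0 by move=> /(_ w Nw); rewrite c0 subr0.
  apply: (@domain_cancel N (g j0)) => //; first exact: (@regB k (cag_var G)).
  by move=> x Nx; rewrite mulrBr mulrC Ec// mulrC subrr.
- have Oc j : O (c j) by have [] := Hc j.
  apply: (@domain_cancel N (g j0)) => //.
    by apply: reg_sum => j _; exact: (@regM k (cag_var G)).
  move=> w Nw; transitivity (b w * \sum_j f j (w + 0) * g j w).
    rewrite addr0 !mulr_sumr; apply: eq_bigr => i _; have [_ Ec] := Hc i.
    by rewrite mulrCA [g j0 w * _]mulrC -Ec//; ring.
  by rewrite rel ?mulr0//; exact: zsubgroup0.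
Qed.

End Components.

(** * Artin-Schreier equations *)

Section FrobeniusPolynomials.
Variables (p : nat) (k : closedFieldType).
Hypothesis chp : p \in [pchar k].
Implicit Types (D P : {poly k}).

Let pp : prime p. Proof. exact: pcharf_prime chp. Qed.
Let p0 : (0 < p)%N. Proof. exact: prime_gt0. Qed.

Lemma frobD (R : comNzRingType) n (x y : R) : p \in [pchar R] ->
  (x + y) ^+ (p ^ n) = x ^+ (p ^ n) + y ^+ (p ^ n).
Proof.
move=> chR; apply: exprDn_pchar; rewrite (eq_pnat _ (pcharf_eq chR)).
by rewrite pnatX pnat_id ?(pcharf_prime chR).
Qed.

Lemma frob_sum (R : comNzRingType) n (J : Type) (r : seq J) (Q : pred J) (F : J -> R) :
  p \in [pchar R] -> (\sum_(j <- r | Q j) F j) ^+ (p ^ n) = \sum_(j <- r | Q j) F j ^+ (p ^ n).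
Proof.
move=> chR; elim/big_rec2: _ => [|j a b _ <-]; last by rewrite frobD.
by rewrite expr0n expn_eq0 eqn0Ngt p0.
Qed.

Lemma frobN (R : comNzRingType) n (x : R) : p \in [pchar R] -> (- x) ^+ (p ^ n) = - x ^+ (p ^ n).
Proof.
move=> chR; apply/eqP; rewrite -addr_eq0 -frobD// addNr expr0n expn_eq0.
by rewrite eqn0Ngt (prime_gt0 (pcharf_prime chR)).
Qed.

Lemma frobB (R : comNzRingType) n (x y : R) : p \in [pchar R] ->
  (x - y) ^+ (p ^ n) = x ^+ (p ^ n) - y ^+ (p ^ n).
Proof. by move=> chR; rewrite frobD// frobN. Qed.

Lemma frob_inj n : injective (fun x : k => x ^+ (p ^ n)).
Proof.
move=> x y /eqP; rewrite -subr_eq0 -frobB// expf_eq0 => /andP[_].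
by rewrite subr_eq0 => /eqP.
Qed.

Lemma pchar_polyk : p \in [pchar {poly k}].
Proof. by rewrite inE pp /= -polyC_natr (pcharf0 chp). Qed.

Lemma coef_frob P n i : (P ^+ (p ^ n))`_i =
  if (p ^ n %| i)%N then P`_(i %/ p ^ n) ^+ (p ^ n) else 0.
Proof.
have pn0 : (0 < p ^ n)%N by rewrite expn_gt0 p0.
elim/poly_ind: P i => [|P c IH] i.
  by rewrite expr0n expn_eq0 eqn0Ngt p0 !coef0 expr0n expn_eq0 eqn0Ngt p0 if_same.
rewrite frobD ?pchar_polyk// exprMn -polyC_exp coefD coefC coefMXn; case: ltnP => [ip|pi].
  case: eqP => [->|/eqP i0]; first by rewrite dvdn0 div0n coefD coefMX eqxx coefC eqxx !add0r.
  by rewrite add0r ifF//; apply: contraNF i0 => /dvdn_leq; case: i ip => // i ip /(_ isT); rewrite leqNgt ip.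
have i0 : (0 < i)%N by exact: leq_trans pi.
rewrite (gtn_eqF i0) addr0 IH dvdn_subl ?dvdnn//.
case: (boolP (p ^ n %| i)%N) => // pni.
have dE : (i %/ p ^ n = ((i - p ^ n) %/ p ^ n).+1)%N.
  by rewrite -{1}(subnK pi) divnDr ?dvdnn// divnn pn0 addn1.
by rewrite dE coefD coefMX /= coefC /= addr0.
Qed.

(** An obstruction to being of the form [D ^+ p - D], read on the exponents that are powers of [p]:
    the coefficients are brought to a common Frobenius level, so that on [D ^+ p - D] the sum
    telescopes. *)
Definition frob_trace A P := \sum_(a < A.+1) P`_(p ^ a) ^+ (p ^ (A - a)).

Lemma frob_trace0 A D : (size D <= p ^ A)%N -> frob_trace A (D ^+ p - D) = 0.
Proof.
move=> sD; rewrite /frob_trace.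
under eq_bigr do rewrite coefB frobB//.
rewrite sumrB big_ord_recl [X in _ - X]big_ord_recr /= subnn !expn0 expr1.
have cD i : (D ^+ p)`_i = if (p %| i)%N then D`_(i %/ p) ^+ p else 0.
  by have := coef_frob D 1 i; rewrite expn1.
rewrite cD dvdn1 gtn_eqF ?prime_gt1// expr0n expn_eq0 eqn0Ngt p0 add0r.
rewrite (nth_default 0 sD) addr0; apply/eqP; rewrite subr_eq0; apply/eqP.
apply: eq_bigr => a _; rewrite /bump /= add1n cD expnS dvdn_mulr ?dvdnn//.
rewrite mulKn// -exprM -expnS; congr (_ ^+ (p ^ _)); have := ltn_ord a; lia.
Qed.

(** The polynomial [P(t + s) - P(t) - P(s)] in [t], written through the Taylor expansion with
    divided derivatives so that its coefficients are explicit in [s]. *)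
Definition additivity_defect P s : {poly k} := \poly_(j < size P) (P^`N(j)).[s] - P - (P.[s])%:P.

Lemma additivity_defectE P s t : (additivity_defect P s).[t] = P.[t + s] - P.[t] - P.[s].
Proof.
rewrite /additivity_defect !hornerD !hornerN hornerC horner_poly; congr (_ - _ - _).
by rewrite [t + s]addrC (nderiv_taylor _ (mulrC s t)).
Qed.

Lemma additivity_defect_coef P s j : (0 < j)%N ->
  (additivity_defect P s)`_j = (P^`N(j)).[s] - P`_j.
Proof.
move=> j0; rewrite /additivity_defect !coefB coefC gtn_eqF// subr0 coef_poly.
case: ltnP => // sj; congr (_ - _).
have -> : P^`N(j) = 0 by apply/polyP => i; rewrite coef_nderivn coef0 nth_default ?mul0rn// (leq_trans sj)// leq_addr.
by rewrite horner0.
Qed.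

(** [frob_trace] of the defect vanishes for every [s] in [T]; this is a polynomial condition on [s],
    so it holds identically. Its coefficient of degree [(i - 1) * p ^ B] is a sum over [b] of terms
    in the coefficients of [P] of index [i * p ^ b]. Those with [b > 0] vanish by hypothesis, and
    [b = 0] leaves a power of [i] times the coefficient of index [i]. *)
Lemma additive_mod_frobenius P (T : set k) :
  (forall i, (p %| i)%N -> P`_i = 0) ->
  (forall Q : {poly k}, (forall s, T s -> Q.[s] = 0) -> Q = 0) ->
  (forall s, T s -> exists D n q, D ^+ p - D = (additivity_defect P s \Po 'X^(p ^ q)) ^+ (p ^ n)) ->
  forall i, i != 1 -> P`_i = 0.
Proof.
move=> Pp Tinf HT i i1.
have [|npi] := boolP (p %| i)%N; first exact: Pp.
have i0 : (1 < i)%N by case: i i1 npi => [|[|i]]//; rewrite dvdn0.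
pose B := (size P).+1.
have sB : (size P <= p ^ B)%N.
  by apply: leq_trans (leqnSn _) _; apply: ltnW; apply: ltn_expl; exact: prime_gt1.
have bigb b s : (B <= b)%N -> (additivity_defect P s)`_(p ^ b) = 0.
  move=> Bb; have sb : (size P <= p ^ b)%N.
    by apply: leq_trans sB _; rewrite leq_exp2l ?prime_gt1.
  rewrite additivity_defect_coef ?expn_gt0 ?p0// (nth_default 0 sb) subr0.
  have -> : P^`N(p ^ b) = 0.
    by apply/polyP => j; rewrite coef_nderivn coef0 nth_default ?mul0rn// (leq_trans sb)// leq_addr.
  by rewrite horner0.
pose R : {poly k} := \sum_(b < B) (P^`N(p ^ b) - (P`_(p ^ b))%:P) ^+ (p ^ (B - b)).
have R0 : R = 0.
  apply: Tinf => s /HT[D [n [q E]]].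
  (* Composition with ['X^(p ^ q)] and the [p ^ n]-th power together shift the exponents by [e];
     [size D] makes [A] large enough for [frob_trace0]. *)
  pose e := (q + n)%N; pose A := (e + B + size D)%N.
  have sD : (size D <= p ^ A)%N.
    apply: leq_trans (ltnW (ltn_expl _ (prime_gt1 pp))) _.
    by rewrite leq_exp2l ?prime_gt1// /A leq_addl.
  have := frob_trace0 sD; rewrite E /frob_trace => T0.
  apply: (@frob_inj (n + size D)%N); rewrite expr0n expn_eq0 eqn0Ngt p0 /=.
  rewrite -[RHS]T0 /R horner_sum frob_sum//.
  have cE a : ((additivity_defect P s \Po 'X^(p ^ q)) ^+ (p ^ n))`_(p ^ a) =
      if (e <= a)%N then (additivity_defect P s)`_(p ^ (a - e)) ^+ (p ^ n) else 0.
    rewrite coef_frob dvdn_Pexp2l ?prime_gt1//.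
    have [na|an] := leqP n a; last first.
      by rewrite ifF//; apply/negbTE; rewrite -ltnNge; apply: leq_trans an _; rewrite leq_addl.
    rewrite -expnB// coef_comp_poly_Xn ?expn_gt0 ?p0// dvdn_Pexp2l ?prime_gt1//.
    have -> : (q <= a - n)%N = (e <= a)%N by rewrite /e; lia.
    case: leqP => ea; last by rewrite expr0n expn_eq0 eqn0Ngt p0.
    have qan : (q <= a - n)%N by move: ea; rewrite /e; lia.
    by rewrite -(expnB p0 qan); congr (_`_(p ^ _) ^+ _); rewrite /e; lia.
  under [RHS]eq_bigr do rewrite cE.
  rewrite (bigID (fun a : 'I_A.+1 => e <= a < e + B)%N) /= [X in _ + X]big1 ?addr0; last first.
    move=> a; case: (leqP e a) => [ea|_ _]; last by rewrite expr0n expn_eq0 eqn0Ngt p0.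
    rewrite /= -leqNgt => Ba; rewrite bigb; last by rewrite leq_subRL.
    by rewrite -exprM -expnD expr0n expn_eq0 eqn0Ngt p0.
  rewrite (reindex_onto (fun b : 'I_B => inord (e + b) : 'I_A.+1)
     (fun a : 'I_A.+1 => inord (a - e) : 'I_B)) /=; last first.
    move=> a /andP[ea aB]; apply/val_inj => /=.
    have aeB : (a - e < B)%N by rewrite ltn_subLR.
    by rewrite (inordK aeB) subnKC// inordK.
  have eb (b : 'I_B) : (e + b < A.+1)%N.
    by rewrite ltnS /A -addnA leq_add2l; have := ltn_ord b; lia.
  rewrite [RHS](eq_bigl xpredT) => [|b]; last first.
    rewrite inordK ?eb// leq_addr ltn_add2l ltn_ord /= addKn; apply/eqP/val_inj.
    by rewrite /= inordK.
  apply: eq_bigr => b _.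
  rewrite inordK ?eb// leq_addr addKn additivity_defect_coef ?expn_gt0 ?p0//.
  rewrite horner_exp hornerD hornerN hornerC -!exprM -!expnD; congr (_ ^+ (p ^ _)).
  by rewrite /A -addnA subnDl addnCA addnBAC// ltnW.
have := congr1 (fun Q : {poly k} => Q`_((i - 1) * p ^ B)) R0.
have cR (b : 'I_B) : ((P^`N(p ^ b) - (P`_(p ^ b))%:P) ^+ (p ^ (B - b)))`_((i - 1) * p ^ B) =
    (P`_(i * p ^ b) *+ 'C(i * p ^ b, p ^ b)) ^+ (p ^ (B - b)).
  have bB : (b <= B)%N by exact: ltnW.
  have EB : ((i - 1) * p ^ B = ((i - 1) * p ^ b) * p ^ (B - b))%N.
    by rewrite -mulnA -expnD subnKC.
  rewrite coef_frob EB dvdn_mull ?dvdnn// mulnK ?expn_gt0 ?p0//.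
  rewrite coefB coefC gtn_eqF ?subr0; last by rewrite muln_gt0 subn_gt0 i0 expn_gt0 p0.
  rewrite coef_nderivn; congr ((P`_ _ *+ 'C(_, _)) ^+ _);
    by rewrite -{1}(mul1n (p ^ b)%N) -mulnDl subnKC// ltnW.
rewrite coef0 /R coef_sum; under eq_bigr do rewrite cR.
rewrite (bigD1 (ord0 : 'I_B))//= [X in _ + X = _]big1 => [|b b0].
  rewrite addr0 expn0 muln1 bin1 => /eqP; rewrite expf_eq0 => /andP[_].
  by rewrite -mulr_natr mulf_eq0 -(dvdn_pcharf chp) (negbTE npi) orbF => /eqP.
rewrite Pp ?mul0rn ?expr0n ?expn_eq0 ?eqn0Ngt ?p0//.
apply: dvdn_mull; case: b b0 => -[|b] //= _ _; exact: dvdn_exp.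
Qed.

End FrobeniusPolynomials.

Section KernelInvariants.
Variables (p : nat) (k : closedFieldType) (G : calg_group k).
Hypothesis chp : p \in [pchar k].
Notation O := (@regular k (cag_var G)).
Implicit Types (N H S : set G) (f g : G -> k).

Let pp : prime p. Proof. exact: pcharf_prime chp. Qed.
Let p0 : (0 < p)%N. Proof. exact: prime_gt0. Qed.

Definition fibre_const N (pi : G -> k) f := forall w u, N w -> N u -> pi w = pi u -> f w = f u.

(** Since [pi] is onto, each root of [a] is a root of [b], and the common factor cancels in a
    domain. *)
Lemma rational_poly N pi f (a b : {poly k}) : zsubgroup N -> domain_on N -> O pi ->
  additive_on N pi -> infinite_image N pi -> O f -> a != 0 ->
  (forall x, N x -> f x * a.[pi x] = b.[pi x]) -> exists q : {poly k}, forall x, N x -> f x = q.[pi x].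
Proof.
move=> sN dN Opi api inf Of; have [n] := ubnP (size a).
elim: n a b => // n IH a b sa a0 E.
have [/size_poly1P[c c0 ac]|] := boolP (size a == 1).
  exists (c^-1 *: b) => x Nx; rewrite hornerZ -E// ac hornerC mulrCA mulVf ?mulr1//.
move=> /closed_rootP[z az].
have [y Ny fy] := additive_surj sN Opi api inf z.
have bz : root b z by rewrite rootE -fy -E// fy (rootP az) mulr0.
have [a' Ea] := factor_theorem _ _ az; have [b' Eb] := factor_theorem _ _ bz.
have a'0 : a' != 0 by apply: contra_neq a0 => a'0; rewrite Ea a'0 mul0r.
apply: (IH a' b') => //.
  by move: sa; rewrite Ea size_mul ?polyXsubC_eq0// size_XsubC addn2 ltnS.
move=> x Nx; apply/eqP; rewrite -subr_eq0; apply/eqP; move: x Nx.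
apply: (@domain_cancel _ _ N (fun x => pi x - z)) => //.
- by apply: (@regB k (cag_var G)) => //; exact: reg_cst.
- apply: (@regB k (cag_var G)); last exact: (@reg_poly k (cag_var G)).
  by apply: (@regM k (cag_var G)) => //; exact: (@reg_poly k (cag_var G)).
- have [y' Ny' fy'] := additive_surj sN Opi api inf (z + 1).
  by exists y' => //; rewrite fy' addrC addKr oner_eq0.
- move=> x Nx; have := E x Nx; rewrite Ea Eb !hornerM !hornerXsubC => E'.
  by rewrite mulrBr [(_ - _) * b'.[_]]mulrC -E'; ring.
Qed.

(* [f(w) - f(u)] vanishes on the zero locus of [pi(w) - pi(u)], so by the
   Nullstellensatz a power of it is divisible by [pi(w) - pi(u)]. *)
Lemma fibre_const_poly N pi f : zsubgroup N -> domain_on N -> O pi -> additive_on N pi ->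
  infinite_image N pi -> O f -> fibre_const N pi f ->
  exists n (q : {poly k}), forall x, N x -> f x ^+ (p ^ n) = q.[pi x].
Proof.
move=> sN dN Opi api inf Of fc.
pose X := prodv (cag_var G) (cag_var G).
pose I := [set F : X -> k | regular F /\ exists2 Q : X -> k, regular Q &
  forall w u, N w -> N u -> F (w, u) = Q (w, u) * (pi w - pi u)].
have Opp : @regular k X (fun z => pi z.1 - pi z.2).
  by apply: regB; [exact: prod_regularl|exact: prod_regularr].
have Off : @regular k X (fun z => f z.1 - f z.2).
  by apply: regB; [exact: prod_regularl|exact: prod_regularr].
have idI : @reg_ideal k X I.
  split; first by move=> h [].
  - split; [exact: reg_cst|exists (fun=> 0); [exact: reg_cst|]].
    by move=> w u _ _; rewrite mul0r.
  - move=> h h' [Oh [q Oq E]] [Oh' [q' Oq' E']]; split; first exact: regB.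
    by exists (fun x => q x - q' x); [exact: regB|move=> w u Nw Nu; rewrite E// E'// mulrBl].
  - move=> a h Oa [Oh [q Oq E]]; split; first exact: regM.
    by exists (fun x => a x * q x); [exact: regM|move=> w u Nw Nu; rewrite E// mulrA].
have [m [_ [Q0 OQ0 EQ0]]] : exists m, I (fun z => (f z.1 - f z.2) ^+ m).
  apply: (nullstellensatz Off idI) => -[w u] Hx /=.
  have Nw : N w.
    apply: (zsubgroup_closed sN) => h Oh hz; apply: (Hx (fun z => h z.1)).
    split; first exact: prod_regularl.
    by exists (fun=> 0); [exact: reg_cst|move=> w' u' /hz -> _; rewrite mul0r].
  have Nu : N u.
    apply: (zsubgroup_closed sN) => h Oh hz; apply: (Hx (fun z => h z.2)).
    split; first exact: prod_regularr.
    by exists (fun=> 0); [exact: reg_cst|move=> w' u' _ /hz ->; rewrite mul0r].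
  rewrite (fc w u) ?subrr//; apply/eqP; rewrite -subr_eq0; apply/eqP.
  apply: (Hx (fun z => pi z.1 - pi z.2)); split=> //.
  by exists (fun=> 1); [exact: reg_cst|move=> w' u' _ _; rewrite mul1r].
(* The exponent is raised from [m] to [p ^ m], so that the power of a difference becomes a
   difference of powers. *)
exists m; have mp : (m <= p ^ m)%N by apply: ltnW; apply: ltn_expl; exact: prime_gt1.
pose f1 x := f x ^+ (p ^ m).
have Of1 : O f1 by exact: (@regX k (cag_var G)).
pose Q1 (z : X) := Q0 z * (f z.1 - f z.2) ^+ (p ^ m - m).
have OQ1 : regular Q1 by apply: regM => //; exact: regX.
have EQ1 w u : N w -> N u -> f1 w - f1 u = Q1 (w, u) * (pi w - pi u).
  move=> Nw Nu; rewrite /f1 -frobB// -{1}(subnKC mp) exprD EQ0// /Q1 /=; ring.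
have [J [a [b [Oa Ob E]]]] := prod_regularP OQ1.
have [u [Nu Hu]] := infinite_image_distinct #|J|.+1 inf.
have [v [i0 vi0] vb] := left_kernel (fun i : 'I_(#|J|.+1) => fun j => b j (u i)).
(* A linear relation between the functions [x |-> Q1 (x, u i)] eliminates [Q1]. Clearing the
   denominators [pi x - pi (u i)] by Lagrange products exhibits [f1] as a rational function of
   [pi]. *)
pose L i : {poly k} := \prod_(l < #|J|.+1 | l != i) ('X - (pi (u l))%:P).
have Lz i j : i != j -> (L i).[pi (u j)] = 0.
  by move=> ij; rewrite horner_prod (bigD1 j) 1?eq_sym//= hornerXsubC subrr mul0r.
apply: (@rational_poly N pi f1 (\sum_i v i *: L i) (\sum_i (v i * f1 (u i)) *: L i)) => //.
  apply/eqP => /(congr1 (fun q : {poly k} => q.[pi (u i0)])).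
  rewrite horner0 horner_sum (bigD1 i0)//= [X in _ + X]big1 ?addr0 => [|i ii0]; last first.
    by rewrite hornerZ Lz// mulr0.
  rewrite hornerZ => /eqP; rewrite mulf_eq0 (negbTE vi0) /= horner_prod => /prodf_eq0[l li0].
  rewrite hornerXsubC subr_eq0 => /eqP/esym E1.
  by move/eqP: li0; apply; apply/val_inj; exact: (Hu _ _ (ltn_ord l) (ltn_ord i0) E1).
move=> x Nx; apply/eqP; rewrite -subr_eq0 !horner_sum mulr_sumr -sumrB; apply/eqP.
transitivity ((\prod_(l < #|J|.+1) (pi x - pi (u l))) * \sum_i v i * Q1 (x, u i)).
  rewrite mulr_sumr; apply: eq_bigr => i _.
  have Lx : (L i).[pi x] = \prod_(l < #|J|.+1 | l != i) (pi x - pi (u l)).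
    by rewrite horner_prod; apply: eq_bigr => l _; rewrite hornerXsubC.
  rewrite !hornerZ Lx [in RHS](bigD1 i)//=.
  have := EQ1 _ _ Nx (Nu _ (ltn_ord i)) => E1.
  transitivity (v i * (f1 x - f1 (u i)) * \prod_(l < #|J|.+1 | l != i) (pi x - pi (u l))); first by ring.
  by rewrite E1; ring.
suff -> : \sum_i v i * Q1 (x, u i) = 0 by rewrite mulr0.
under eq_bigr do rewrite E mulr_sumr.
rewrite exchange_big big1// => j _.
under eq_bigr do rewrite mulrCA.
by rewrite -mulr_sumr vb mulr0.
Qed.

Lemma frob_fixed_root n (x : k) : x ^+ p = x -> x ^+ (p ^ n) = x.
Proof.
by move=> xp; elim: n => [|n IH]; rewrite ?expr1// expnS exprM xp.
Qed.

(** The values are among the finitely many roots of ['X^p - 'X], and on a domain one factor of the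
    product over these roots vanishes identically. *)
Lemma frob_fixed_const N f : domain_on N -> O f -> (forall x, N x -> f x ^+ p = f x) ->
  forall x y, N x -> N y -> f x = f y.
Proof.
move=> dN Of fp.
pose P : {poly k} := 'X^p - 'X.
have P0 : P != 0.
  rewrite -size_poly_gt0 size_polyDl ?size_polyXn// size_polyN size_polyX ltnS.
  exact: prime_gt1.
have [s Es] := closed_field_poly_normal P.
have : forall x, N x -> \prod_(z <- s) (f x - z) = 0.
  move=> x Nx; have : P.[f x] = 0 by rewrite /P !hornerE fp// subrr.
  rewrite Es hornerZ => /eqP; rewrite mulf_eq0 lead_coef_eq0 (negbTE P0) horner_prod => /eqP E.
  by rewrite -[RHS]E; apply: eq_bigr => z _; rewrite hornerXsubC.
elim: s {Es} => [|z s IH] E x y Nx Ny.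
  by have := E x Nx; rewrite big_nil => /eqP; rewrite oner_eq0.
have := dN (fun x => f x - z) (fun x => \prod_(z <- s) (f x - z)).
case.
- by apply: (@regB k (cag_var G)) => //; exact: reg_cst.
- elim: (s) => [|z' s' IHs].
    by under eq_fun do rewrite big_nil; exact: reg_cst.
  under eq_fun do rewrite big_cons; apply: (@regM k (cag_var G)) => //.
  by apply: (@regB k (cag_var G)) => //; exact: reg_cst.
- by move=> w Nw; have := E w Nw; rewrite big_cons.
- by move=> E0; rewrite -(subrK z (f x)) E0// -(subrK z (f y)) E0.
- by move=> E0; exact: IH.
Qed.

(** With [i + 1 = j * p ^ v] and [j] prime to [p], a term [h ^+ p - h] trades the monomial for its
    [p ^ (m - v)]-th power, in which [pi] has exponent [j * p ^ m]. The result is a polynomial in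
    [pi ^+ (p ^ m)] with exponents prime to [p]; [additive_mod_frobenius] makes it linear, so [M] is
    [m]. *)
Lemma artin_schreier_linear N pi (Y : variety k) m (c : 'I_m -> Y -> k) :
  zsubgroup N -> domain_on N -> O pi -> additive_on N pi -> infinite_image N pi ->
  (forall i, regular (c i)) ->
  let phi w y := \sum_(i < m) c i y * pi w ^+ i.+1 in
  (forall y u, N u -> exists d, [/\ O d, fibre_const N pi d &
     forall w, N w -> d w ^+ p - d w = phi (w + u) y - phi w y - phi u y]) ->
  exists M (alpha : Y -> k) (h : G -> Y -> k),
    [/\ regular alpha, @regular k (prodv (cag_var G) Y) (fun z => h z.1 z.2),
        forall w u y, pi w = pi u -> h w y = h u y,
        forall w y, pi w = 0 -> h w y = 0 &
        forall w y, phi w y = h w y ^+ p - h w y + alpha y * pi w ^+ (p ^ M)].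
Proof.
move=> sN dN Opi api inf Oc phi Hphi.
pose v (i : 'I_m) := logn p i.+1.
have vm i : (v i <= m)%N.
  have : (p ^ v i <= i.+1)%N by apply: dvdn_leq => //; exact: pfactor_dvdnn.
  by have := ltn_expl (v i) (prime_gt1 pp); have := ltn_ord i; lia.
pose j (i : 'I_m) := (i.+1 %/ p ^ v i)%N.
have jv i : (j i * p ^ v i = i.+1)%N by rewrite divnK// pfactor_dvdnn.
have pj i : ~~ (p %| j i)%N.
  apply/negP => /dvdnP[q Eq]; have := pfactor_dvdn (v i).+1 pp (ltn0Sn i).
  by rewrite -{1}(jv i) Eq -mulnA -expnS dvdn_mull// ltnn.
pose s i := (m - v i)%N.
pose x i w y := c i y * pi w ^+ i.+1.
pose h w y := - \sum_(i < m) \sum_(l < s i) x i w y ^+ (p ^ l).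
pose Th y : {poly k} := \sum_(i < m) (c i y ^+ (p ^ s i)) *: 'X^(j i).
have ThE w y : (Th y).[pi w ^+ (p ^ m)] = \sum_(i < m) x i w y ^+ (p ^ s i).
  rewrite horner_sum; apply: eq_bigr => i _; rewrite hornerZ hornerXn exprMn -!exprM.
  congr (_ * _ ^+ _); rewrite -(jv i) -mulnA -expnD /s subnKC//; exact: mulnC.
have tele i w y : x i w y - x i w y ^+ (p ^ s i) =
    \sum_(l < s i) x i w y ^+ (p ^ l) - \sum_(l < s i) x i w y ^+ (p ^ l.+1).
  elim: (s i) => [|n IH]; first by rewrite !big_ord0 expr1 !subrr.
  by rewrite !big_ord_recr /= opprD addrACA -IH; ring.
have hE w y : h w y ^+ p - h w y = \sum_(i < m) (x i w y - x i w y ^+ (p ^ s i)).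
  have frs (J : finType) (F : J -> k) : (\sum_j F j) ^+ p = \sum_j F j ^+ p.
    have := @frob_sum p k chp _ 1 _ (index_enum J) predT F chp.
    by rewrite expn1.
  have frn (a : k) : (- a) ^+ p = - a ^+ p by have := @frobN p _ 1 a chp; rewrite expn1.
  rewrite /h frn frs opprK addrC -sumrB.
  apply: eq_bigr => i _; rewrite frs tele; congr (_ - _).
  by apply: eq_bigr => l _; rewrite -exprM -expnSr.
have phiE w y : phi w y = h w y ^+ p - h w y + (Th y).[pi w ^+ (p ^ m)].
  by rewrite hE ThE -big_split; apply: eq_bigr => i _; rewrite /= subrK.
have Oh : @regular k (prodv (cag_var G) Y) (fun z => h z.1 z.2).
  apply: (@regN k (prodv (cag_var G) Y)); apply: (@reg_sum k (prodv (cag_var G) Y)) => i _.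
  apply: (@reg_sum k (prodv (cag_var G) Y)) => l _; apply: regX; apply: regM.
    exact: prod_regularr.
  by apply: regX; exact: prod_regularl.
have hc w u y : pi w = pi u -> h w y = h u y by move=> E; rewrite /h /x E.
have Oh1 y : O (fun w => h w y).
  apply: (@morphism_pair _ (cag_var G) Y _ id (fun=> y) _ _ _ Oh) => //; exact: morphism_cst.
have Th1 y i : i != 1 -> (Th y)`_i = 0.
  apply: (additive_mod_frobenius chp (T := [set pi u ^+ (p ^ m) | u in N])).
  - move=> n pn; rewrite coef_sum big1// => l _; rewrite coefZ coefXn.
    by case: eqP => [E|]; rewrite ?mulr0//; have := pj l; rewrite -E pn.
  - move=> Q HQ; have Q0 : Q \Po 'X^(p ^ m) = 0.
      apply: (poly_infinite_image inf) => u Nu; rewrite horner_comp hornerXn.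
      by apply: HQ; exists u.
    apply/polyP => n; have := congr1 (fun q : {poly k} => q`_(n * p ^ m)) Q0.
    have pm0 : (0 < p ^ m)%N by rewrite expn_gt0 p0.
    by rewrite coef_comp_poly_Xn// dvdn_mull// mulnK// !coef0.
  - move=> _ [u Nu <-]; have [d [Od dc dE]] := Hphi y u Nu.
    (* [d'] solves the defect equation for [Th] instead of [phi] and is still constant on fibres, so
       a Frobenius power of it is a polynomial [D] in [pi]. *)
    pose d' w := d w - (h (w + u) y - h w y - h u y).
    have Od' : O d'.
      apply: (@regB k (cag_var G)) => //; apply: (@regB k (cag_var G)); last exact: reg_cst.
      by apply: (@regB k (cag_var G)) => //; exact: (@reg_shift k G (fun w => h w y)).
    have dc' : fibre_const N pi d'.
      move=> w w' Nw Nw' E; rewrite /d' (dc w w')// (hc w w')// (hc (w + u) (w' + u))//.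
      by rewrite !api// E.
    have [n [D ED]] := fibre_const_poly sN dN Opi api inf Od' dc'.
    exists D, n, m; apply/eqP; rewrite -subr_eq0; apply/eqP.
    apply: (poly_infinite_image inf) => w Nw.
    rewrite !hornerD !hornerN !horner_exp horner_comp hornerXn additivity_defectE -ED//.
    rewrite -frobD// -api// addrC.
    have -> : (Th y).[pi (w + u) ^+ (p ^ m)] - (Th y).[pi w ^+ (p ^ m)] - (Th y).[pi u ^+ (p ^ m)] =
        d' w ^+ p - d' w.
      have frp a b : (a - b) ^+ p = a ^+ p - b ^+ p :> k by have := frobB 1 a b chp; rewrite expn1.
      rewrite /d' !frp.
      transitivity ((d w ^+ p - d w) - ((h (w + u) y ^+ p - h (w + u) y) - (h w y ^+ p - h w y)
        - (h u y ^+ p - h u y))); last by ring.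
      by rewrite dE// !phiE; ring.
    by rewrite frobB// -!exprM [(p * _)%N]mulnC addrC subrr.
exists m, (fun y => (Th y)`_1), h; split=> //.
- under eq_fun do rewrite coef_sum; apply: reg_sum => i _.
  under eq_fun do rewrite coefZ mulrC; apply: regZ; exact: regX.
- move=> w y pw; rewrite /h big1 ?oppr0// => i _; apply: big1 => l _.
  by rewrite /x pw expr0n mulr0 expr0n expn_eq0 eqn0Ngt p0.
- move=> w y; rewrite phiE; congr (_ + _).
  have -> : Th y = (Th y)`_1 *: 'X.
    apply/polyP => i; rewrite coefZ coefX; case: eqP => [->|/eqP i1]; first by rewrite mulr1.
    by rewrite mulr0 Th1.
  by rewrite hornerZ hornerX coefZ coefX mulr1.
Qed.

End KernelInvariants.

(** * Connected filtrations and dimension *)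

Section Filtrations.
Variables (p : nat) (k : closedFieldType) (G : calg_group k).
Hypothesis chp : p \in [pchar k].
Hypothesis uG : unipotent G.
Notation O := (@regular k (cag_var G)).
Implicit Types (N H S : set G) (f g : G -> k).

Let p0 : (0 < p)%N. Proof. exact: prime_gt0 (pcharf_prime chp). Qed.

(** Suppose the invariant functions do not see [a]. For [u - w] in [S] or in [a + S], write
    [f0 (u - w)], up to an invariant factor, with as few products as possible. As [f0] vanishes on
    [S] there is a relation with [S]-invariant coefficients; these are then [a]-invariant too, and
    serve to eliminate one product. *)
Lemma invariants_separate N S a : zsubgroup N -> domain_on N -> zsubgroup S -> S `<=` N -> N a -> ~ S a ->
  exists f, [/\ O f, forall s w, S s -> N w -> f (w + s) = f w &
    exists2 w, N w & f (w + a) != f w].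
Proof.
move=> sN dN sS SN Na nSa; apply: contrapT => nsep.
have inva f : O f -> (forall s w, S s -> N w -> f (w + s) = f w) -> forall w, N w -> f (w + a) = f w.
  move=> Of fS w Nw; apply/eqP; apply: contra_notT nsep => fa.
  by exists f; split=> //; exists w.
have [f0 [Of0 f0S f0a]] : exists f, [/\ O f, forall s, S s -> f s = 0 & f a != 0].
  apply: contrapT => nf; apply: nSa; apply: (zsubgroup_closed sS) => f Of fS.
  by apply/eqP; apply: contra_notT nf => fa; exists f.
pose Q m := `[<exists (f g : 'I_m -> G -> k) (b : G -> k),
  [/\ (forall i, O (f i)) /\ (forall i, O (g i)), O b,
    forall s w, S s -> N w -> b (w + s) = b w, exists2 w, N w & b w != 0 &
    forall w u, N w -> N u -> S (u - w) \/ S (u - w - a) ->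
      b w * f0 (u - w) = \sum_i f i u * g i w]>].
have exQ : exists m, Q m.
  have [J [c [d [Oc Od E]]]] := shift_expand Of0.
  exists #|J|; apply/asboolP; exists (fun i => c (enum_val i)), (fun i w => d (enum_val i) (- w)), (fun=> 1).
  split=> //; [split=> i //; exact: reg_opp|exact: reg_cst|by exists 0; [exact: zsubgroup0|exact: oner_neq0]|].
  move=> w u Nw Nu _; rewrite mul1r E (reindex_onto enum_val enum_rank) /=; last by move=> j _; rewrite enum_rankK.
  by apply: eq_big => [i|//]; rewrite enum_valK eqxx.
case: (ex_minnP exQ) => m /asboolP[f [g [b [[Of Og] Ob bS [w0 Nw0 bw0] E]]]] mmin {exQ}.
(* If all [g j] vanish, the pair [w0], [w0 + a] contradicts [f0 a != 0]. *)
have nz : exists j, exists2 w, N w & g j w != 0.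
  apply: contrapT => nz; have Nwa : N (w0 + a) by exact: zsubgroupD.
  have := E w0 (w0 + a) Nw0 Nwa; rewrite [w0 + a]addrC addrK subrr => /(_ (or_intror (zsubgroup0 sS))).
  rewrite big1 => [/eqP|i _]; first by rewrite mulf_eq0 (negbTE bw0) (negbTE f0a).
  suff -> : g i w0 = 0 by rewrite mulr0.
  by apply/eqP; apply: contra_notT nz => gi; exists i, w0.
have rel s w : S s -> N w -> \sum_i f i (w + s) * g i w = 0.
  move=> Ss Nw; rewrite -E//; last 2 first.
  - by apply: zsubgroupD => //; exact: SN.
  - by left; rewrite addrC addKr.
  by rewrite [w + s]addrC addrK f0S// mulr0.
have [c [Oc cS [j1 [w1 Nw1 cw1]] crel]] := invariant_relation uG sN dN sS SN Of Og rel nz.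
case: m f g Of Og E rel nz mmin c Oc cS j1 cw1 crel => [|m] f g Of Og E rel nz mmin c Oc cS j1 cw1 crel.
  by case: j1 {cw1}.
suff : Q m by move=> /mmin; rewrite ltnn.
have cinv j w u : N w -> N u -> S (u - w) \/ S (u - w - a) -> c j u = c j w.
  move=> Nw Nu [Su|Su]; first by rewrite -(cS j (u - w) w)// addrC subrK.
  have -> : u = w + (u - w - a) + a by rewrite -addrA subrK addrC subrK.
  rewrite (inva _ (Oc j) (cS j)) ?cS//.
  by apply: zsubgroupD => //; exact: SN.
apply/asboolP; exists (fun i => f (lift j1 i)),
  (fun i w => c j1 w * g (lift j1 i) w - c (lift j1 i) w * g j1 w), (fun w => c j1 w * b w); split.
- by split=> i //; apply: (@regB k (cag_var G)); exact: (@regM k (cag_var G)).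
- exact: (@regM k (cag_var G)).
- by move=> s w Ss Nw; rewrite cS// bS.
- apply: contrapT => nb; have [w Nw|c0|b0] := dN (c j1) b (Oc j1) Ob.
  + by apply/eqP; apply: contra_notT nb => cb; exists w.
  + by rewrite c0 ?eqxx in cw1.
  + by rewrite b0 ?eqxx in bw0.
- move=> w u Nw Nu Su; rewrite -mulrA E// (bigD1_ord j1)//=.
  have := crel u Nu; rewrite (bigD1_ord j1)//= => C.
  have {}C : f j1 u * c j1 w = - \sum_i f (lift j1 i) u * c (lift j1 i) w.
    apply/eqP; rewrite -addr_eq0 -[X in _ == X]C; apply/eqP; congr (_ + _); first by rewrite (cinv j1 w u).
    by apply: eq_bigr => i _; rewrite (cinv (lift j1 i) w u).
  rewrite mulrDr mulrA [c j1 w * _]mulrC C mulNr mulr_suml mulr_sumr addrC -sumrB.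
  by apply: eq_bigr => i _; ring.
Qed.

(** [N / S] covers [N / ker pi] cyclically with degree [p]. An invariant function growing by 1 along
    [a] can be corrected to satisfy [g ^+ p - g = q(pi)]; [artin_schreier_linear] reduces the right
    side to [alpha * pi ^+ (p ^ M)], and then [g] is additive because its defect is fixed by
    Frobenius. *)
Lemma kernel_shrink N pi S a : conn N -> O pi -> additive_on N pi -> infinite_image N pi ->
  zsubgroup S -> S `<=` ker_on N pi -> ker_on N pi a -> ~ S a -> S (a *+ p) ->
  (forall x, ker_on N pi x -> exists j, S (x - a *+ j)) ->
  exists g, [/\ O g, additive_on N g, infinite_image N g & ker_on N g = S].
Proof.
move=> cN Opi api inf sS SK [Na pa] nSa Spa kerS.
have sN := cN.1; have dN := conn_domain uG cN.
have SN : S `<=` N by move=> s /SK[].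
have [f1 [Of1 f1S [w1 Nw1 f1a]]] := invariants_separate sN dN sS SN Na nSa.
(* Among the differences [f (w + a) - f w] of invariant functions, choose one fixed by all
   translations: a nonzero constant on [N]. *)
have [d [[f2 Of2 [f2S dE]] [w2 Nw2 dw2] dN']] : exists d, [/\ (exists2 f, O f &
     (forall s w, S s -> N w -> f (w + s) = f w) /\ d = (fun w => f (w + a) - f w)),
     exists2 w, N w & d w != 0 & forall u w, N u -> N w -> d (w + u) = d w].
  apply: (@unipotent_fixed _ G uG N N [set d | exists2 f, O f &
     (forall s w, S s -> N w -> f (w + s) = f w) /\ d = (fun w => f (w + a) - f w)]).
  - by move=> _ [f Of [_ ->]]; apply: (@regB k (cag_var G)) => //; exact: reg_shift.
  - move=> _ _ [f Of [fS ->]] [f' Of' [fS' ->]]; exists (fun x => f x - f' x).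
      exact: (@regB k (cag_var G)).
    split; first by move=> s w Ss Nw; rewrite fS// fS'.
    by apply/funext => x; ring.
  - move=> u _ Nu [f Of [fS ->]]; exists (fun x => f (x + u)); first exact: reg_shift.
    split; first by move=> s w Ss Nw; rewrite addrAC (fS s)//; exact: zsubgroupD.
    by apply/funext => x; rewrite [x + a + u]addrAC.
  - exists (fun w => f1 (w + a) - f1 w); first by exists f1.
    by exists w1; rewrite // subr_eq0.
have [c c0 dc] : exists2 c, c != 0 & forall w, N w -> d w = c.
  exists (d w2) => // w Nw; have := dN' (w - w2) w2 (zsubgroupB sN Nw Nw2) Nw2.
  by rewrite addrC subrK.
pose g0 w := c^-1 * f2 w.
have Og0 : O g0 by exact: (@regZ k (cag_var G)).
have g0S s w : S s -> N w -> g0 (w + s) = g0 w by move=> Ss Nw; rewrite /g0 f2S.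
have g0a w : N w -> g0 (w + a) = g0 w + 1.
  move=> Nw; rewrite /g0 -(mulVf c0) -(dc _ Nw) dE -mulrDr; congr (_ * _); ring.
have Nja j : N (a *+ j) by exact: zsubgroupMn.
have ext (h : G -> k) : (forall s w, S s -> N w -> h (w + s) = h w) -> (forall w, N w -> h (w + a) = h w + 1) ->
    forall w u, N w -> N u -> pi w = pi u -> exists j, forall z, N z -> h (w + z) = h (u + z) + j%:R.
  move=> hS ha w u Nw Nu E; have Kwu : ker_on N pi (w - u).
    by split; [exact: zsubgroupB|rewrite (additive_onB sN)// E subrr].
  have [j Sj] := kerS _ Kwu; exists j => z Nz.
  have hj i : h (u + z + a *+ i) = h (u + z) + i%:R.
    elim: i => [|i IH]; first by rewrite !addr0.
    rewrite mulrSr addrA ha; last by apply: zsubgroupD => //; exact: zsubgroupD.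
    by rewrite IH -natr1 addrA.
  have -> : w + z = (u + z + a *+ j) + (w - u - a *+ j).
    have {1}-> : w = (w - u - a *+ j) + a *+ j + u by rewrite !subrK.
    by rewrite [RHS]addrC -!addrA; do 3 congr (_ + _); rewrite addrC -addrA.
  by rewrite hS// ?hj//; apply: zsubgroupD => //; exact: zsubgroupD.
have g0ext := ext g0 g0S g0a.
have frp a' b' : (a' - b') ^+ p = a' ^+ p - b' ^+ p :> k by have := @frobB p _ 1 a' b' chp; rewrite expn1.
have frpD a' b' : (a' + b') ^+ p = a' ^+ p + b' ^+ p :> k by have := @frobD p _ 1 a' b' chp; rewrite expn1.
have frnat j : (j%:R : k) ^+ p = j%:R by exact: pFrobenius_aut_nat chp j.
pose phi0 w := g0 w ^+ p - g0 w.
have Ophi0 : O phi0 by apply: (@regB k (cag_var G)) => //; exact: (@regX k (cag_var G)).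
have phi0c : fibre_const N pi phi0.
  move=> w u Nw Nu E; have [j Hj] := g0ext _ _ Nw Nu E.
  have := Hj 0 (zsubgroup0 sN); rewrite !addr0 /phi0 => ->.
  by rewrite frpD frnat; ring.
have [n [q Eq]] := fibre_const_poly chp sN dN Opi api inf Ophi0 phi0c.
(* The added sum telescopes and replaces [phi0] by its [p ^ n]-th power, which is a polynomial in
   [pi]. *)
pose g1 w := g0 w + \sum_(l < n) phi0 w ^+ (p ^ l).
have Og1 : O g1.
  apply: (@regD k (cag_var G)) => //; apply: (@reg_sum k (cag_var G)) => l _; exact: (@regX k (cag_var G)).
have g1E w : N w -> g1 w ^+ p - g1 w = q.[pi w].
  move=> Nw; rewrite -Eq// /g1.
  elim: (n) => [|m IH]; first by rewrite big_ord0 addr0 expr1.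
  rewrite big_ord_recr /= addrA frpD opprD addrACA IH -exprM -expnSr; ring.
pose g2 w := g1 w - g1 0.
have Og2 : O g2 by apply: (@regB k (cag_var G)) => //; exact: reg_cst.
have phi0S s w : S s -> N w -> phi0 (w + s) = phi0 w by move=> Ss Nw; rewrite /phi0 g0S.
have phi0a w : N w -> phi0 (w + a) = phi0 w.
  by move=> Nw; rewrite /phi0 g0a// frpD expr1n; ring.
have g2S s w : S s -> N w -> g2 (w + s) = g2 w.
  by move=> Ss Nw; rewrite /g2 /g1 g0S// phi0S.
have g2a w : N w -> g2 (w + a) = g2 w + 1.
  by move=> Nw; rewrite /g2 /g1 g0a// phi0a//; ring.
have g2ext := ext g2 g2S g2a.
have N0 := zsubgroup0 sN.
(* There is no genuine parameter here: the coefficients are constant over an arbitrary variety, and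
   the outcome is read at its point 0. *)
pose c2 (i : 'I_(size q)) (_ : cag_var G) := q`_i.+1.
have phiE w y : N w -> g2 w ^+ p - g2 w = \sum_(i < size q) c2 i y * pi w ^+ i.+1.
  move=> Nw; rewrite /g2 frp.
  transitivity (q.[pi w] - q.[pi 0]); first by rewrite -!g1E//; ring.
  rewrite (additive_on0 sN api) horner_coef0 (@horner_coef_wide _ (size q).+1)// big_ord_recl expr0 mulr1.
  by rewrite addrAC subrr add0r.
have [|y u Nu|M [alpha [h [Oalpha Oh hc h0 E]]]] :=
    @artin_schreier_linear p k G chp N pi (cag_var G) (size q) c2 sN dN Opi api inf.
- by move=> i; exact: reg_cst.
- exists (fun w => g2 (w + u) - g2 w - g2 u); split.
  + apply: (@regB k (cag_var G)); last exact: reg_cst.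
    by apply: (@regB k (cag_var G)) => //; exact: reg_shift.
  + move=> w w' Nw Nw' Eww; have [j Hj] := g2ext _ _ Nw Nw' Eww.
    have H0 := Hj 0 N0; rewrite !addr0 in H0; rewrite (Hj u Nu) H0; ring.
  + move=> w Nw; rewrite -!phiE//; last exact: zsubgroupD.
    by rewrite !frp; ring.
pose g w := g2 w - h w 0.
have Oh1 : O (fun w => h w 0).
  by apply: (@morphism_pair _ (cag_var G) (cag_var G) _ id (fun=> 0) _ _ _ Oh) => //; exact: morphism_cst.
have Og : O g by exact: (@regB k (cag_var G)).
have pi0 := additive_on0 sN api.
have piS s w : S s -> N w -> pi (w + s) = pi w.
  by move=> Ss Nw; have [Ns ps] := SK _ Ss; rewrite api// ps addr0.
have gS s w : S s -> N w -> g (w + s) = g w.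
  by move=> Ss Nw; rewrite /g g2S// (hc (w + s) w)// piS.
have ga w : N w -> g (w + a) = g w + 1.
  by move=> Nw; rewrite /g g2a// (hc (w + a) w) ?api ?pa ?addr0//; ring.
have gE w : N w -> g w ^+ p - g w = alpha 0 * pi w ^+ (p ^ M).
  move=> Nw; have := E w 0; rewrite -phiE// => Ew; rewrite /g frp.
  transitivity ((g2 w ^+ p - g2 w) - (h w 0 ^+ p - h w 0)); first by ring.
  by rewrite Ew; ring.
have g00 : g 0 = 0 by rewrite /g h0// /g2 subrr subrr.
have ag : additive_on N g.
  move=> w u Nw Nu; apply/eqP; rewrite -subr_eq0 opprD addrA; apply/eqP.
  have -> : 0 = g (0 + u) - g 0 - g u by rewrite add0r g00 subr0 subrr.
  apply: (@frob_fixed_const p k G chp N (fun w => g (w + u) - g w - g u)) => //.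
    apply: (@regB k (cag_var G)); last exact: reg_cst.
    by apply: (@regB k (cag_var G)) => //; exact: reg_shift.
  move=> z Nz; apply/eqP; rewrite -subr_eq0 2!frp.
  have Nzu : N (z + u) by exact: zsubgroupD.
  have := gE _ Nzu; rewrite api// frobD// mulrDr -!gE// => Ez.
  apply/eqP; transitivity ((g (z + u) ^+ p - g (z + u)) - ((g z ^+ p - g z) + (g u ^+ p - g u))); first by ring.
  by rewrite Ez subrr.
have ga1 : g a = 1 by rewrite -[a]add0r ga// g00 add0r.
have ginf : infinite_image N g by apply: (conn_onto cN Og ag Na); rewrite ga1 oner_neq0.
exists g; split=> //; apply/seteqP; split=> x; last first.
  by move=> Sx; split; [exact: SN|rewrite -[x]add0r gS].
(* [alpha 0] is nonzero, for otherwise [g] would be constant although [g a = 1] and [g 0 = 0]; so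
   [g x = 0] forces [pi x = 0]. *)
move=> [Nx gx]; have piM : pi x = 0.
  have [al0|al0] := eqVneq (alpha 0) 0.
    have : g a = g 0.
      apply: (@frob_fixed_const p k G chp N) => // z Nz.
      by apply/eqP; rewrite -subr_eq0 gE// al0 mul0r.
    by rewrite ga1 g00 => /eqP; rewrite oner_eq0.
  have := gE x Nx; rewrite gx subr0 expr0n eqn0Ngt p0 => /esym/eqP.
  by rewrite mulf_eq0 (negbTE al0) expf_eq0 => /andP[_ /eqP].
have [j Sj] := kerS x (conj Nx piM).
have : g x = j%:R.
  rewrite -[x in LHS](subrK (a *+ j)) ag//; last exact: SN.
  rewrite -[x - a *+ j]add0r gS// g00 add0r.
  by elim: (j) => [|i IH]; [rewrite g00|rewrite mulrSr ag// IH ga1 natr1].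
rewrite gx => /esym/eqP; rewrite -(dvdn_pcharf chp) => /dvdnP[i Ej].
rewrite -[x](subrK (a *+ j)); apply: zsubgroupD => //.
by rewrite Ej mulnC mulrnA; exact: zsubgroupMn.
Qed.

End Filtrations.

(** * Additive functions with connected kernel, and dimension *)

Section Dimension.
Variables (p : nat) (k : closedFieldType) (G : calg_group k).
Hypothesis chp : p \in [pchar k].
Hypothesis uG : unipotent G.
Notation O := (@regular k (cag_var G)).
Implicit Types (N H S : set G) (f g : G -> k).
Let p0 : (0 < p)%N. Proof. exact: prime_gt0 (pcharf_prime chp). Qed.

Lemma zclosedU (X : variety k) (Z Z' : set X) : zclosed Z -> zclosed Z' -> zclosed (Z `|` Z').
Proof.
move=> cZ cZ' x H; apply: contrapT => /not_orP[nZ nZ'].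
have nf (W : set X) : zclosed W -> ~ W x ->
      exists f : X -> k, [/\ regular f, forall z, W z -> f z = 0 & f x != 0].
  move=> cW nW; apply: contrapT => nex; apply: nW; apply: cW => f Of fz.
  by apply/eqP; apply: contra_notT nex => fx; exists f.
have [f [Of fz fx]] := nf _ cZ nZ; have [g [Og gz gx]] := nf _ cZ' nZ'.
have := H _ (regM Of Og) => /(_ _)/eqP; rewrite mulf_eq0 (negbTE fx) (negbTE gx) /=.
by move=> E; have // : false; apply: E => z [/fz ->|/gz ->]; rewrite ?mul0r ?mulr0.
Qed.

Lemma zclosed_shift N a : @zclosed k (cag_var G) N -> @zclosed k (cag_var G) [set x | N (x - a)].
Proof.
move=> cN.
have ms : @morphism k (cag_var G) (cag_var G) (fun x => x - a) by move=> f; exact: reg_shift.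
exact: (zclosed_preim ms cN).
Qed.

Fixpoint extend_by (C : set G) (l : seq G) : set G :=
  if l is a :: l' then [set x | exists j : nat, extend_by C l' (x - a *+ j)] else C.

Lemma extend_by_sub C l : C `<=` extend_by C l.
Proof. by elim: l => //= a l IH x Cx; exists 0%N; rewrite subr0; exact: IH. Qed.

Lemma extend_by_zsubgroup C l : zsubgroup C -> {in l, forall a, C (a *+ p)} -> zsubgroup (extend_by C l).
Proof.
move=> sC; elim: l => //= a l IH Cl.
have sE := IH (fun b bl => Cl b (mem_behead (s := a :: l) bl)).
have Ea : extend_by C l (a *+ p) by apply: extend_by_sub; apply: Cl; rewrite inE eqxx.
(* [a *+ p] is already in the smaller group, so the multiples below [p] suffice; this makes the
   union of translates finite, hence closed. *)
have red x j : extend_by C l (x - a *+ j) -> extend_by C l (x - a *+ (j %% p)).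
  rewrite {1}(divn_eq j p) mulrnDr opprD addrA addrAC => Ex.
  rewrite -[_ - _](subrK (a *+ (j %/ p * p))); apply: zsubgroupD => //.
  by rewrite mulnC mulrnA; exact: zsubgroupMn.
split.
- have -> : [set x | exists j : nat, extend_by C l (x - a *+ j)] =
      [set x | exists2 j, (j < p)%N & extend_by C l (x - a *+ j)].
    apply/seteqP; split=> x [j]; last by exists j.
    by move=> /red Ex; exists (j %% p)%N; rewrite ?ltn_mod.
  elim: (p) => [|m IHm].
    by move=> x Hx; have := Hx (fun=> 1) (reg_cst _ _) => /(_ _)/eqP; rewrite oner_eq0 => E;
      have // : false; apply: E => z [].
  have -> : [set x | exists2 j, (j < m.+1)%N & extend_by C l (x - a *+ j)] =
      [set x | exists2 j, (j < m)%N & extend_by C l (x - a *+ j)] `|` [set x | extend_by C l (x - a *+ m)].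
    apply/seteqP; split=> x.
      move=> [j]; rewrite ltnS leq_eqVlt => /orP[/eqP -> ?|jm ?]; [by right|by left; exists j].
    by move=> [[j jm Ej]|Em]; [exists j => //; exact: ltnW|exists m].
  by apply: zclosedU => //; apply: zclosed_shift; exact: zsubgroup_closed.
- by exists 0%N; rewrite subr0; exact: zsubgroup0.
- move=> x y [i /red Ex] [j /red Ey]; exists (i %% p + (p - j %% p))%N.
  rewrite mulrnDr mulrnBr; last by rewrite ltnW// ltn_mod.
  have -> : x - y - (a *+ (i %% p) + (a *+ p - a *+ (j %% p))) =
      (x - a *+ (i %% p)) - (y - a *+ (j %% p)) - a *+ p.
    rewrite !opprD !opprK !addrA [LHS]addrAC; congr (_ + _ - _).
    by rewrite addrAC.
  by apply: zsubgroupB => //; exact: zsubgroupB.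
Qed.

Lemma flag_additive N : flag N -> (exists2 x, N x & x != 0) ->
  exists f, [/\ O f, additive_on N f & exists2 x, N x & f x != 0].
Proof.
elim=> {N} [N N0 [x /N0 ->]|N f Of af _ IH nN]; first by rewrite eqxx.
have [[x Nx fx]|nf] := pselect (exists2 x, N x & f x != 0); first by exists f; split=> //; exists x.
suff KN : ker_on N f = N by rewrite KN in IH; exact: IH.
apply/seteqP; split=> x; first by case.
by move=> Nx; split=> //; apply/eqP; apply: contra_notT nf => fx; exists x.
Qed.

(** From any nonzero additive [f], the finite group of components of [ker f] is removed one
    generator at a time by [kernel_shrink]. *)
Lemma exists_conn_kernel N : conn N -> (exists2 x, N x & x != 0) ->
  exists f, [/\ O f, additive_on N f, infinite_image N f & conn (ker_on N f)].
Proof.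
move=> cN nN; have sN := cN.1.
have [f [Of af [x Nx fx]]] := flag_additive (flag_sub (fun _ _ => I) (unipotent_flag uG)) nN.
have inf := conn_onto cN Of af Nx fx.
have sK := zsubgroup_ker sN Of af.
have [cC CK [s Hs]] := id_compP uG sK; set C := id_comp _ in cC CK Hs.
(* The [y] with [y *+ p] in [C] form a closed subgroup of finite index, since [y *+ p] lies in
   [ker f], which has finitely many cosets of [C]; and [N] is connected. *)
have pC y : N y -> C (y *+ p).
  pose M : set G := [set y | N y /\ C (y *+ p)].
  have pK y' : N y' -> ker_on N f (y' *+ p).
    move=> Ny'; split; first exact: zsubgroupMn.
    have fn j : f (y' *+ j) = f y' *+ j.
      elim: j => [|j IH]; first by rewrite (additive_on0 sN).
      by rewrite mulrS af// ?IH ?mulrS//; exact: zsubgroupMn.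
    by rewrite fn -mulr_natr (pcharf0 chp) mulr0.
  have sM : zsubgroup M.
    split.
    - apply: (@zclosedI k (cag_var G) N) => //; first exact: zsubgroup_closed.
      suff mp : @morphism k (cag_var G) (cag_var G) (fun y => y *+ p).
        exact: (zclosed_preim mp (zsubgroup_closed cC.1)).
      elim: (p) => [|j IH]; first by under eq_fun do rewrite mulr0n; exact: morphism_cst.
      under eq_fun do rewrite mulrS.
      exact: (morphism_comp (@cag_addP k G) (@morphism_pair k (cag_var G) (cag_var G) _ _ _ (@morphism_id _ _) IH)).
    - by split; [exact: zsubgroup0|rewrite mul0rn; exact: zsubgroup0 cC.1].
    - move=> y1 y2 [N1 C1] [N2 C2]; split; first exact: zsubgroupB.
      by rewrite mulrnBl; exact: zsubgroupB cC.1 _ _.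
  suff : N `<=` M by move=> NM /NM[].
  apply: cN.2 => //; first by move=> ? [].
  have /choice[c Hc] : forall a, exists d, forall y, N y -> C (y *+ p - a) -> N d /\ C (d *+ p - a).
    move=> a; have [[d [Nd Cd]]|nd] := pselect (exists d, N d /\ C (d *+ p - a)); first by exists d.
    by exists 0 => z Nz Cz; case: nd; exists z.
  exists [seq c a | a <- s] => z Nz; have [a as_ Ca] := Hs _ (pK z Nz).
  have [Nc Cc] := Hc a z Nz Ca; exists (c a); first exact: map_f.
  split; first exact: zsubgroupB.
  have -> : (z - c a) *+ p = (z *+ p - a) - (c a *+ p - a) by rewrite mulrnBl opprB addrA subrK.
  exact: zsubgroupB cC.1 _ _.
pose s' := [seq a <- s | `[< ker_on N f a >]].
have s'K a : a \in s' -> ker_on N f a by rewrite mem_filter => /andP[/asboolP].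
suff H l : {in l, forall a, ker_on N f a} -> forall g, O g -> additive_on N g -> infinite_image N g ->
    ker_on N g = extend_by C l -> exists h, [/\ O h, additive_on N h, infinite_image N h & ker_on N h = C].
  have [|h [Oh ah ih Eh]] := H s' s'K f Of af inf.
    apply/seteqP; split=> y; last first.
      have : {in s', forall a, ker_on N f a} by [].
      elim: s' {s'K} y => [|a l IH] y lK /=; first exact: CK.
      move=> [j /IH Ky]; rewrite -[y](subrK (a *+ j)); apply: zsubgroupD => //.
        by apply: Ky => b bl; apply: lK; rewrite inE bl orbT.
      by apply: zsubgroupMn => //; apply: lK; rewrite inE eqxx.
    move=> Ky; have [a as_ Cya] := Hs _ Ky.
    have as' : a \in s'.
      rewrite mem_filter as_ andbT; apply/asboolP.
      by rewrite -[a](subKr y); apply: zsubgroupB => //; exact: CK.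
    elim: s' as' {s'K} => // b l IH; rewrite inE => /orP[/eqP <-|/IH El] /=.
      by exists 1%N; rewrite mulr1n; exact: extend_by_sub.
    by exists 0%N; rewrite subr0.
  by exists h; split=> //; rewrite Eh.
elim: l => [|a l IH] lK g Og ag ig Eg /=; first by exists g.
have lK' : {in l, forall b, ker_on N f b} by move=> b bl; apply: lK; rewrite inE bl orbT.
have Ka : ker_on N f a by apply: lK; rewrite inE eqxx.
have sE : zsubgroup (extend_by C l).
  by apply: extend_by_zsubgroup cC.1 _ => b /lK' [Nb _]; exact: pC.
have [Ea|nEa] := pselect (extend_by C l a).
  apply: (IH lK' g) => //; rewrite Eg; apply/seteqP; split=> y /=; last by exists 0%N; rewrite subr0.
  by move=> [j Ej]; rewrite -[y](subrK (a *+ j)); apply: zsubgroupD => //; exact: zsubgroupMn.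
have [||||j|h [Oh ah ih Eh]] := @kernel_shrink p k G chp uG N g (extend_by C l) a cN Og ag ig sE.
- by rewrite Eg => y /= Ey; exists 0%N; rewrite subr0.
- by rewrite Eg /=; exists 1%N; rewrite mulr1n subrr; exact: zsubgroup0.
- by [].
- by apply: extend_by_sub; apply: pC; case: Ka.
- by rewrite Eg.
- exact: (IH lK' h).
Qed.

(** Dimension as the length of a chain in which each term is the identity component of the kernel of
    an additive function on the previous one. It is a relation; independence of the chain is
    [hasdim_unique]. *)
Inductive hasdim : set G -> nat -> Prop :=
| hasdim0 : hasdim [set 0] 0
| hasdimS N f n : conn N -> O f -> additive_on N f -> infinite_image N f ->
    hasdim (id_comp (ker_on N f)) n -> hasdim N n.+1.

Lemma infinite_or_zero N f : conn N -> O f -> additive_on N f ->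
  infinite_image N f \/ forall x, N x -> f x = 0.
Proof.
move=> cN Of af; have [|nf] := pselect (infinite_image N f); [by left|right].
exact: conn_finite_image.
Qed.

Lemma hasdim_exists N : conn N -> exists n, hasdim N n.
Proof.
move=> cN; have : flag N by apply: flag_sub (unipotent_flag uG).
move=> fl; suff : forall D, conn D -> D `<=` N -> exists n, hasdim D n by apply.
elim: fl => {cN N} [N N0|N f Of af _ IH] D cD DN.
  exists 0%N; have -> : D = [set 0]; last exact: hasdim0.
  by apply/seteqP; split=> x; [move=> /DN/N0|move=> ->; exact: zsubgroup0 cD.1].
have afD := additive_on_sub DN af.
have [inf|f0] := infinite_or_zero cD Of afD; last first.
  by apply: IH => // x Dx; split; [exact: DN|exact: f0].
have sK := zsubgroup_ker cD.1 Of afD.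
have [cC CK _] := id_compP uG sK.
have [|n hn] := IH _ cC; first by move=> x /CK[Dx fx]; split=> //; exact: DN.
by exists n.+1; exact: hasdimS hn.
Qed.

Lemma finite_index_zero H N f : zsubgroup N -> additive_on N f -> H `<=` N -> finite_index H N ->
  (forall x, H x -> f x = 0) -> exists s : seq k, forall x, N x -> f x \in s.
Proof.
move=> sN af HN [s Hs] f0; exists [seq f a | a <- s] => x Nx; have [a as_ Ha] := Hs x Nx.
apply/mapP; exists a => //; apply/eqP; rewrite -subr_eq0.
have Na : N a by rewrite -[a](subKr x); apply: zsubgroupB => //; exact: HN.
by rewrite -(additive_onB sN)// f0.
Qed.

Lemma id_comp_kerE N f : zsubgroup N -> O f -> additive_on N f ->
  id_comp (ker_on (id_comp N) f) = id_comp (ker_on N f).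
Proof.
move=> sN Of af; have [cC CN _] := id_compP uG sN.
have afC := additive_on_sub CN af.
have sK := zsubgroup_ker sN Of af; have sK' := zsubgroup_ker cC.1 Of afC.
apply/seteqP; split; first by apply: id_comp_sub => // x [/CN].
have [cK KK _] := id_compP uG sK.
apply: conn_sub_id_comp => // x Kx; split; last by case: (KK _ Kx).
by apply: (conn_sub_id_comp sN cK) => // y /KK[].
Qed.

(** If [f] were nonzero on the identity component of [ker g], it would be onto there, so this
    component and [ker f] would together generate [N]. But [g] has finitely many values on [ker f],
    against its infinite image. *)
Lemma id_comp_ker_eq N f g : conn N -> O f -> O g -> additive_on N f -> additive_on N g ->
  infinite_image N g -> (forall x, id_comp (ker_on N f) x -> g x = 0) ->
  id_comp (ker_on N f) = id_comp (ker_on N g).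
Proof.
move=> cN Of Og af ag ig g0; have sN := cN.1.
have sKf := zsubgroup_ker sN Of af; have sKg := zsubgroup_ker sN Og ag.
have [cF FK fiF] := id_compP uG sKf; have [cE EK fiE] := id_compP uG sKg.
have FN x : id_comp (ker_on N f) x -> N x by move=> /FK[].
have EN x : id_comp (ker_on N g) x -> N x by move=> /EK[].
apply/seteqP; split.
  by apply: conn_sub_id_comp => // x Fx; split; [exact: FN|exact: g0].
apply: conn_sub_id_comp => // x Ex; split; first exact: EN.
have [inf|-> //] := infinite_or_zero cE Of (additive_on_sub EN af).
case: ig; have agK : additive_on (ker_on N f) g by apply: additive_on_sub ag => ? [].
have [s Hs] := finite_index_zero sKf agK FK fiF g0.
exists s => y Ny; have [z Ez fz] := additive_surj cE.1 Of (additive_on_sub EN af) inf (f y).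
have [Nz gz] := EK _ Ez.
rewrite -[g y]subr0 -gz -(additive_onB sN)//; apply: Hs; split; first exact: zsubgroupB.
by rewrite (additive_onB sN)// fz subrr.
Qed.

(** An exchange argument: any [g] with infinite image can head the chain. Either the two kernels
    have the same identity component, or both chains can be continued through the component of the
    common kernel. *)
Lemma hasdim_ker N n g : hasdim N n -> O g -> additive_on N g -> infinite_image N g ->
  exists2 m, n = m.+1 & hasdim (id_comp (ker_on N g)) m.
Proof.
move=> hN; elim: hN g => {N n} [g Og ag ig|N f n cN Of af inf hn IH g Og ag ig].
  by case: ig; exists [:: g 0] => x ->; rewrite inE.
have sN := cN.1.
have sKf := zsubgroup_ker sN Of af; have sKg := zsubgroup_ker sN Og ag.
have [cF FK fiF] := id_compP uG sKf; have [cE EK fiE] := id_compP uG sKg.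
have FN x : id_comp (ker_on N f) x -> N x by move=> /FK[].
have EN x : id_comp (ker_on N g) x -> N x by move=> /EK[].
exists n => //.
have [igF|g0] := infinite_or_zero cF Og (additive_on_sub FN ag); last first.
  by rewrite -(id_comp_ker_eq cN Of Og af ag ig g0).
have [ifE|f0] := infinite_or_zero cE Of (additive_on_sub EN af); last first.
  have E := id_comp_ker_eq cN Og Of ag af inf f0.
  case: igF; exists [:: 0] => x; rewrite -E => /EK[_ ->]; by rewrite inE.
have [m -> hm] := IH g Og (additive_on_sub FN ag) igF.
apply: (@hasdimS _ f) => //; first exact: additive_on_sub af.
suff <- : id_comp (ker_on (id_comp (ker_on N f)) g) = id_comp (ker_on (id_comp (ker_on N g)) f) by [].
rewrite !id_comp_kerE//; first by congr id_comp; apply/seteqP; split=> x [[]].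
- by apply: additive_on_sub af => ? [].
- by apply: additive_on_sub ag => ? [].
Qed.

Lemma hasdim_unique N n m : hasdim N n -> hasdim N m -> n = m.
Proof.
move=> hn; elim: hn m => {N n} [|N f n cN Of af inf _ IH] m hm.
  have : [set (0 : G)] = [set 0] by []; case: {1}[set 0] m / hm => // N f m _ _ _ inf _ E.
  by case: inf; exists [:: f 0] => x; rewrite E => ->; rewrite inE.
by have [m' -> hm'] := hasdim_ker hm Of af inf; congr S; exact: IH.
Qed.

End Dimension.

(** * Torsors and biextensions *)

Section Torsors.
Variables (k : closedFieldType) (X : variety k) (A : zmodType) (E : torsor X A).
Implicit Types (e : E) (a : A).

Lemma act_inj e a b : act a e = act b e -> a = b.
Proof.
move=> ab; have [c [_ cu]] := act_simply_transitive (esym (tproj_act a e)).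
by rewrite -(cu a erefl) -(cu b ab).
Qed.

Definition tdiff e e' : A :=
  if pselect (exists a, e' = act a e) is left h then sval (cid h) else 0.

Lemma tdiffE e e' : tproj e = tproj e' -> e' = act (tdiff e e') e.
Proof.
move=> ee'; rewrite /tdiff; case: pselect => [h|[]]; first exact: (svalP (cid h)).
by have [a [Ea _]] := act_simply_transitive ee'; exists a.
Qed.

(** The trivializing cover of [E] is pulled back along [xi]. *)
Lemma torsor_lift (T : variety k) (xi : T -> X) : morphism xi -> exists (T' : variety k) (g : T' -> T) (u : T' -> E),
  [/\ finite_etale g, set_surj setT setT g, plot u & forall t, tproj (u t) = xi (g t)].
Proof.
move=> mxi; have [C [s [sC ps Es]]] := locally_trivial E.
have etC := cov_etale C.
exists (pullv etC mxi), (pull_map (etg := etC) (mxi := mxi)), (fun z => s (pull_lift z)).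
split.
- exact: etale_pull_map.
- exact: surj_pull_map.
- by apply: plot_comp ps; exact: morphism_pull_lift.
- by move=> z; rewrite Es pull_comm.
Qed.

Lemma plot_const (T : variety k) e : plot (fun _ : T => e).
Proof.
have [C [s [sC ps Es]]] := locally_trivial E.
have [//|c _ cE] := sC (tproj e).
have E1 : tproj (s c) = tproj e by rewrite Es.
rewrite (tdiffE E1).
apply: (@plot_act _ _ _ E T (fun=> s c) (fun=> tdiff (s c) e)).
  by apply: (plot_comp (g := fun _ : T => c) _ ps); exact: morphism_cst.
move=> v; have [->|nv] := pselect (v = tdiff (s c) e).
  by have -> : [set x : zariski T | tdiff (s c) e = tdiff (s c) e] = setT by [apply/seteqP; split]; exact: openT.
have -> : [set x : zariski T | tdiff (s c) e = v] = set0; last exact: open0.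
by apply/seteqP; split=> x //= /esym.
Qed.

Lemma tdiff_locally_constant (T : variety k) (s s' : T -> E) : plot s -> plot s' ->
  (forall t, tproj (s t) = tproj (s' t)) -> locally_constant (fun t => tdiff (s t) (s' t)).
Proof.
move=> ps ps' Ess; apply: (plot_diff ps).
suff -> : (fun t => act (tdiff (s t) (s' t)) (s t)) = s' by [].
by apply/funext => t; rewrite -tdiffE.
Qed.

(** Local constancy of [a] can be read on the translate by [a] of the constant plot [e0], and plots
    descend. *)
Lemma locally_constant_descent (e0 : E) (T T' : variety k) (g : T' -> T) (a : T -> A) :
  finite_etale g -> set_surj setT setT g -> locally_constant (fun t => a (g t)) -> locally_constant a.
Proof.
move=> eg sg la; apply: (plot_diff (s := fun=> e0)); first exact: plot_const.
apply: (plot_descent eg sg).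
exact: (plot_act (plot_const _ e0) la).
Qed.

End Torsors.

Section RelativeExtensions.
Variables (k : closedFieldType) (X S : variety k) (G A : zmodType) (E : torsor X A).
Variables (q : X -> G) (b : X -> S) (L : relative_extension E q b).
Implicit Types e : E.
Local Notation q' e := (q (tproj e)).
Local Notation b' e := (b (tproj e)).
Local Notation "e *+* e'" := (rmul L e e') (at level 50).

Lemma rmulK e e' : b' e = b' e' -> rinv L e *+* (e *+* e') = e'.
Proof.
move=> ee'; rewrite rmulA ?rinv_base//.
by rewrite rmulVe ee' rmul1e.
Qed.

Lemma rmul_injl e e' e'' : b' e = b' e' -> b' e = b' e'' -> e *+* e' = e *+* e'' -> e' = e''.
Proof. by move=> h1 h2 E1; rewrite -(rmulK h1) E1 rmulK. Qed.

Lemma rone_idem e : e *+* e = e -> e = rone L (b' e).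
Proof.
move=> ee; apply: (@rmul_injl e) => //; first by rewrite rone_base.
by rewrite ee rmule1.
Qed.

Lemma act_mul a a' e e' : b' e = b' e' -> act a e *+* act a' e' = act (a + a') (e *+* e').
Proof.
move=> ee'; rewrite rmul_actl ?tproj_act// rmul_actr// -actD//.
Qed.

Fixpoint nmul n e : E := if n is m.+1 then e *+* nmul m e else rone L (b' e).

Lemma nmul_base n e : b' (nmul n e) = b' e.
Proof. by elim: n => [|n IH] /=; rewrite ?rone_base// rmul_base. Qed.

Lemma nmul_proj n e : q' (nmul n e) = q' e *+ n.
Proof. by elim: n => [|n IH] /=; rewrite ?rone_proj// rmul_proj ?nmul_base// IH mulrS. Qed.

Lemma nmul_act n a e : nmul n (act a e) = act (a *+ n) (nmul n e).
Proof.
elim: n => [|n IH] /=; first by rewrite mulr0n act0 tproj_act.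
by rewrite IH act_mul ?nmul_base// mulrS.
Qed.

Lemma nmul_plot n (T : variety k) (s : T -> E) : morphism b -> plot s -> plot (fun t => nmul n (s t)).
Proof.
move=> mb ps; elim: n => [|n IH] /=.
  by apply: (rone_plot L); exact: (morphism_comp mb (plot_proj ps)).
by apply: rmul_plot => // t; rewrite nmul_base.
Qed.

Lemma morph_nmul n (H : zmodType) (s : H -> E) (Q : H -> Prop) y : (forall x x', Q x -> Q x' -> Q (x + x')) -> Q 0 ->
  (forall x, Q x -> b' (s x) = y) -> (forall x x', Q x -> Q x' -> s (x + x') = s x *+* s x') ->
  forall x, Q x -> nmul n (s x) = s (x *+ n).
Proof.
move=> QD Q0 sb sD x Qx.
have Qn m : Q (x *+ m) by elim: m => [|m IH]; rewrite ?mulr0n ?mulrS//; exact: QD.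
elim: n => [|n IH] /=; last by rewrite IH mulrS sD.
by rewrite mulr0n (sb x Qx) -(sb 0 Q0) [RHS]rone_idem// -sD// addr0.
Qed.

Hypothesis comm : forall e e', b' e = b' e' -> e *+* e' = e' *+* e.

Lemma rmulACA e1 e2 e3 e4 y : b' e1 = y -> b' e2 = y -> b' e3 = y -> b' e4 = y ->
  (e1 *+* e2) *+* (e3 *+* e4) = (e1 *+* e3) *+* (e2 *+* e4).
Proof.
move=> h1 h2 h3 h4.
rewrite -!rmulA ?rmul_base ?h1 ?h2 ?h3 ?h4//; congr (_ *+* _).
by rewrite !rmulA ?h2 ?h3 ?h4// (comm (e := e2))// h2 h3.
Qed.

Lemma nmul_mul n e e' : b' e = b' e' -> nmul n (e *+* e') = nmul n e *+* nmul n e'.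
Proof.
move=> ee'; elim: n => [|n IH] /=.
  by rewrite rmul_base// -ee'; have := rmule1 L (rone L (b' e)); rewrite rone_base => ->.
by rewrite IH (@rmulACA _ _ _ _ (b' e)) ?nmul_base.
Qed.

End RelativeExtensions.

Lemma morphism_mulrn (k : closedFieldType) (G : calg_group k) n :
  @morphism k (cag_var G) (cag_var G) (fun x => x *+ n).
Proof.
elim: n => [|n IH]; first by under eq_fun do rewrite mulr0n; exact: morphism_cst.
under eq_fun do rewrite mulrS.
exact: (morphism_comp (@cag_addP k G) (@morphism_pair k (cag_var G) (cag_var G) _ _ _ (@morphism_id _ _) IH)).
Qed.

Lemma irreducible_sub (k : closedFieldType) (G : calg_group k) (D : set G)
  (cD : @zclosed k (cag_var G) D) : domain_on D -> irreducible_variety (subv cD).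
Proof.
move=> dD _ _ [f Of ->] [g Og ->] fg.
have [x Dx|f0|g0] := dD f g Of Og.
- exact: (fg (exist _ x Dx)).
- by left=> -[x Dx]; exact: f0.
- by right=> -[x Dx]; exact: g0.
Qed.

Lemma irreducible_domain (k : closedFieldType) (G : calg_group k) :
  @domain_on k G setT -> irreducible_variety (cag_var G).
Proof.
move=> dG f g Of Og fg; have [x _|f0|g0] := dG f g Of Og; first exact: fg.
  by left=> x; exact: f0.
by right=> x; exact: g0.
Qed.

Section Biextensions.
Variables (k : closedFieldType) (U1 U2 : calg_group k) (A : zmodType) (E : biextension U1 U2 A).
Local Notation V1 := (cag_var U1).
Local Notation V2 := (cag_var U2).
Local Notation q1 e := ((@tproj _ _ _ E e).1 : U1).
Local Notation q2 e := ((@tproj _ _ _ E e).2 : U2).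
Local Notation "e *1 e'" := (rmul (lawG E) e e') (at level 50).
Local Notation "e *2 e'" := (rmul (lawH E) e e') (at level 50).
Local Notation one1 := (rone (lawG E)).
Local Notation one2 := (rone (lawH E)).
Implicit Types e : E.

Lemma tproj_eq e x y : q1 e = x -> q2 e = y -> tproj e = (x, y).
Proof. by move=> <- <-; exact: surjective_pairing. Qed.

Lemma mul1_proj e e' : q2 e = q2 e' -> tproj (e *1 e') = (q1 e + q1 e', q2 e).
Proof. by move=> h; apply: tproj_eq; [exact: (rmul_proj (lawG E))|exact: (rmul_base (lawG E))]. Qed.

Lemma mul2_proj e e' : q1 e = q1 e' -> tproj (e *2 e') = (q1 e, q2 e + q2 e').
Proof. by move=> h; apply: tproj_eq; [exact: (rmul_base (lawH E))|exact: (rmul_proj (lawH E))]. Qed.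

(** The commutator with [e'] depends only on the base point, because [A] acts centrally. It is a
    locally constant function on the irreducible [U1], zero at the unit. *)
Lemma mul1_comm : irreducible_variety V1 -> forall e e', q2 e = q2 e' -> e *1 e' = e' *1 e.
Proof.
move=> irr e e' ee'; set y := q2 e'.
have mxi : @morphism k V1 (prodv V1 V2) (fun w => (w, y)) by apply: morphism_pair => //; exact: morphism_cst.
have [T [g [u [eg sg pu Eu]]]] := torsor_lift E mxi.
have pr_comm e1 e2 : q2 e1 = q2 e2 -> tproj (e1 *1 e2) = tproj (e2 *1 e1).
  by move=> h; rewrite !mul1_proj// h addrC.
have /choice[pk Hpk] : forall w : V1, exists e, tproj e = (w, y).
  by move=> w; have [//|t _ <-] := sg w; exists (u t).
pose kap w := tdiff (e' *1 pk w) (pk w *1 e').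
have kE e1 : q2 e1 = y -> e1 *1 e' = act (kap (q1 e1)) (e' *1 e1).
  move=> h1; have Et : tproj (pk (q1 e1)) = tproj e1 by rewrite Hpk -h1 -surjective_pairing.
  have h2 : q2 (pk (q1 e1)) = y by rewrite Et.
  have -> : e1 = act (tdiff (pk (q1 e1)) e1) (pk (q1 e1)) by exact: tdiffE.
  rewrite rmul_actl// rmul_actr// tproj_act Et.
  rewrite {1}(tdiffE (e := e' *1 pk (q1 e1)) (e' := pk (q1 e1) *1 e')); last by rewrite pr_comm ?h2.
  by rewrite -!actD addrC.
have lk : locally_constant (X := V1) kap.
  apply: (locally_constant_descent e eg sg).
  have p1 : plot (fun t => e' *1 u t).
    by apply: rmul_plot => // [|t]; [exact: plot_const|rewrite Eu].
  have p2 : plot (fun t => u t *1 e').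
    by apply: rmul_plot => // [|t]; [exact: plot_const|rewrite Eu].
  have := tdiff_locally_constant p1 p2 (fun t => pr_comm _ _ _) => lc.
  suff -> : (fun t => kap (g t)) = (fun t => tdiff (e' *1 u t) (u t *1 e')).
    by apply: lc => t; rewrite Eu.
  apply/funext => t; apply: (@act_inj _ _ _ _ (e' *1 u t)).
  rewrite -tdiffE; last by rewrite pr_comm// Eu.
  by rewrite kE ?Eu.
have k0 : kap 0 = 0.
  apply: (@act_inj _ _ _ _ (e' *1 one1 y)); rewrite act0.
  have h0 : q2 (one1 y) = y by exact: (rone_base (lawG E)).
  have := kE (one1 y) h0; rewrite (rone_proj (lawG E)) => <-.
  by rewrite /y (rmul1e (lawG E)) (rmule1 (lawG E)).
by rewrite kE// (locally_constant_const irr lk _ 0) k0 act0.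
Qed.

Lemma section0 (D : set U1) (s : U1 -> E) y : zsubgroup D -> (forall x, D x -> tproj (s x) = (x, y)) ->
  (forall x x', D x -> D x' -> s (x + x') = s x *1 s x') -> s 0 = one1 y.
Proof.
move=> sD Ps sDD; have D0 := zsubgroup0 sD.
have := Ps 0 D0 => /(congr1 snd) /= => <-.
by apply: (@rone_idem _ _ _ _ _ _ _ _ (lawG E)); rewrite -sDD// addr0.
Qed.

(** Two splittings differ by a locally constant function on an irreducible variety, and this
    function is zero at 0. *)
Lemma section_unique (D : set U1) (cD : @zclosed k V1 D) (s s' : U1 -> E) y : zsubgroup D -> domain_on D ->
  plot (fun t : subv cD => s (sval t)) -> plot (fun t : subv cD => s' (sval t)) ->
  (forall x, D x -> tproj (s x) = (x, y)) -> (forall x, D x -> tproj (s' x) = (x, y)) ->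
  (forall x x', D x -> D x' -> s (x + x') = s x *1 s x') ->
  (forall x x', D x -> D x' -> s' (x + x') = s' x *1 s' x') ->
  forall x, D x -> s x = s' x.
Proof.
move=> sD dD ps ps' Ps Ps' sDD sDD' x Dx.
have D0 := zsubgroup0 sD.
have Ess (t : subv cD) : tproj (s (sval t)) = tproj (s' (sval t)).
  by case: t => t Dt /=; rewrite Ps// Ps'.
have lc := tdiff_locally_constant ps ps' Ess.
have := locally_constant_const (irreducible_sub dD) lc (exist _ x Dx) (exist _ 0 D0) => /= Ed.
have s0 := section0 sD Ps sDD; have s0' := section0 sD Ps' sDD'.
have d0 : tdiff (s 0) (s' 0) = 0.
  by apply: (@act_inj _ _ _ _ (s 0)); rewrite -tdiffE ?act0 ?Ps ?Ps'// s0.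
by rewrite (tdiffE (e := s x) (e' := s' x)) ?Ed ?d0 ?act0// Ps// Ps'.
Qed.

(** By the interchange law, the product of two units of the first law is idempotent for it, hence a
    unit. *)
Lemma one1_mul2 y y' : one1 (y + y') = one1 y *2 one1 y'.
Proof.
have Z1 x : q1 (one1 x) = 0 by exact: (rone_proj (lawG E)).
have Z2 x : q2 (one1 x) = x by exact: (rone_base (lawG E)).
have H : q1 (one1 y) = q1 (one1 y') by rewrite !Z1.
have -> : one1 (y + y') = one1 (q2 (one1 y *2 one1 y')) by rewrite mul2_proj//= !Z2.
apply/esym; apply: (rone_idem (L := lawG E)); rewrite -Defs.interchange//.
have I1 x : one1 x *1 one1 x = one1 x by rewrite -{2}(Z2 x) (rmule1 (lawG E)).
by rewrite !I1.
Qed.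

(** * Reduction to the [p]-torsion of [A], identified with the prime field by [iota] *)

Section ArtinSchreier.
Variables (p : nat) (iota : A -> k).
Hypothesis chp : p \in [pchar k].
Hypothesis Adiv : forall a : A, exists b, b *+ p = a.
Hypothesis iotaD : forall a b : A, a *+ p = 0 -> b *+ p = 0 -> iota (a + b) = iota a + iota b.
Hypothesis iota_inj : forall a : A, a *+ p = 0 -> iota a = 0 -> a = 0.
Hypothesis iotaF : forall a : A, a *+ p = 0 -> iota a ^+ p = iota a.
Hypothesis iota_surj : forall x : k, x ^+ p = x -> exists2 a, a *+ p = 0 & iota a = x.

Lemma frob_fixed_seq : exists s : seq k, forall x : k, x ^+ p = x -> x \in s.
Proof.
pose P : {poly k} := 'X^p - 'X.
have P0 : P != 0.
  rewrite -size_poly_gt0 size_polyDl ?size_polyXn// size_polyN size_polyX ltnS.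
  exact: prime_gt1 (pcharf_prime chp).
have [s Es] := closed_field_poly_normal P; exists s => x xp.
have : P.[x] = 0 by rewrite /P !hornerE xp subrr.
rewrite Es hornerZ => /eqP; rewrite mulf_eq0 lead_coef_eq0 (negbTE P0) /=.
by rewrite -[_ == 0]/(root _ _) root_prod_XsubC.
Qed.

Lemma iota_regular (X : variety k) (a : X -> A) : locally_constant a -> (forall x, a x *+ p = 0) ->
  regular (fun x => iota (a x)).
Proof.
move=> la ap; have [s Hs] := frob_fixed_seq.
apply: (locally_constant_regular id (s := s) (locally_constant_map iota la)) => x.
by apply: Hs; exact: iotaF.
Qed.

Lemma regular_frob_lc (X : variety k) (f : X -> k) : regular f -> (forall x, f x ^+ p = f x) ->
  locally_constant f.
Proof.
move=> Of fp; have [s Hs] := frob_fixed_seq.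
by apply: (regular_locally_constant (s := s)) => // x; exact: Hs.
Qed.

Variables (W' W : set U1) (Y : set U2) (sigma : U1 -> U2 -> E).
Hypothesis irr1 : irreducible_variety V1.
Hypothesis sW : zsubgroup W.
Hypothesis sY : zsubgroup Y.
Hypothesis sW' : zsubgroup W'.
Hypothesis pW : forall w, W w -> W' (w *+ p).
Hypothesis W'W : W' `<=` W.
Hypothesis trs : trivializes W' Y sigma.

Let comm1 := mul1_comm irr1.
Let sP x y : W' x -> Y y -> tproj (sigma x y) = (x, y). Proof. by case: trs => H _ _ _; exact: H. Qed.
Let sD1 x x' y : W' x -> W' x' -> Y y -> sigma (x + x') y = sigma x y *1 sigma x' y.
Proof. by case: trs => _ H _ _; exact: H. Qed.
Let sD2 x y y' : W' x -> Y y -> Y y' -> sigma x (y + y') = sigma x y *2 sigma x y'.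
Proof. by case: trs => _ _ H _; exact: H. Qed.
Let splot (T : variety k) (u : T -> V1) (v : T -> V2) : morphism u -> morphism v ->
  (forall t, W' (u t)) -> (forall t, Y (v t)) -> plot (fun t => sigma (u t) (v t)).
Proof. by case: trs => _ _ _ H; exact: H. Qed.

(* The reduction of [E] to a torsor under the [p]-torsion of [A]. *)
Definition ptors e := [/\ W (q1 e), Y (q2 e) & nmul (lawG E) p e = sigma (q1 e *+ p) (q2 e)].

Lemma ptors_act a e : ptors e -> a *+ p = 0 -> ptors (act a e).
Proof. by move=> [We Ye Pe] ap; split; rewrite ?tproj_act// nmul_act ap act0 Pe. Qed.

Lemma ptors_tdiff e e' : ptors e -> ptors e' -> tproj e = tproj e' -> tdiff e e' *+ p = 0.
Proof.
move=> [_ _ Pe] [_ _ Pe'] ee'; apply: (@act_inj _ _ _ _ (nmul (lawG E) p e)).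
by rewrite -nmul_act -tdiffE// Pe' Pe act0 ee'.
Qed.

Lemma ptors_sigma x y : W' x -> Y y -> ptors (sigma x y).
Proof.
move=> Wx Yy; split; rewrite ?sP//=; first exact: W'W.
apply: (@morph_nmul _ _ _ _ _ _ _ _ (lawG E) p U1 (fun x => sigma x y) W' y) => //.
- by move=> *; exact: zsubgroupD.
- exact: zsubgroup0.
- by move=> z Wz; rewrite sP.
- by move=> z z' Wz Wz'; rewrite sD1.
Qed.

Lemma ptors_mul1 e e' : ptors e -> ptors e' -> q2 e = q2 e' -> ptors (e *1 e').
Proof.
move=> [We Ye Pe] [We' Ye' Pe'] ee'; split; rewrite ?mul1_proj//=; first exact: zsubgroupD.
by rewrite nmul_mul// Pe Pe' mulrnDl sD1 ?ee'//; exact: pW.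
Qed.

Lemma nmul_mul2 n e e' : q1 e = q1 e' -> nmul (lawG E) n (e *2 e') = nmul (lawG E) n e *2 nmul (lawG E) n e'.
Proof.
move=> ee'; elim: n => [|n IH] /=.
  by rewrite mul2_proj//= one1_mul2.
have N1 e1 m : q1 (nmul (lawG E) m e1) = q1 e1 *+ m by exact: (nmul_proj (lawG E) m e1).
have N2 e1 m : q2 (nmul (lawG E) m e1) = q2 e1 by exact: (nmul_base (lawG E) m e1).
by rewrite IH -Defs.interchange ?N1 ?N2 ?ee'.
Qed.

Lemma ptors_mul2 e e' : ptors e -> ptors e' -> q1 e = q1 e' -> ptors (e *2 e').
Proof.
move=> [We Ye Pe] [We' Ye' Pe'] ee'; split; rewrite ?mul2_proj//=; first exact: zsubgroupD.
by rewrite nmul_mul2// Pe Pe' ee' sD2//; exact: pW.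
Qed.

(** A local section fails the condition of [ptors] by a locally constant element of [A]; dividing
    this element by [p] gives the correction. *)
Lemma ptors_lift (T : variety k) (xi : T -> prodv V1 V2) : morphism xi ->
  (forall t, W (xi t).1) -> (forall t, Y (xi t).2) ->
  exists (T' : variety k) (g : T' -> T) (u : T' -> E),
  [/\ finite_etale g, set_surj setT setT g, plot u, forall t, tproj (u t) = xi (g t) & forall t, ptors (u t)].
Proof.
move=> mxi Wxi Yxi; have [T' [g [u [eg sg pu Eu]]]] := torsor_lift E mxi.
exists T', g; have mg : morphism g by case: eg.
have mx1 : @morphism k T' V1 (fun t => (xi (g t)).1 *+ p).
  apply: (morphism_comp (@morphism_mulrn k U1 p)).
  exact: (morphism_comp (morphism_comp (@morphism_fst k V1 V2) mxi) mg).
have mx2 : @morphism k T' V2 (fun t => (xi (g t)).2).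
  exact: (morphism_comp (morphism_comp (@morphism_snd k V1 V2) mxi) mg).
have pn : plot (fun t => nmul (lawG E) p (u t)) by apply: nmul_plot => //; exact: morphism_snd.
have psi := splot mx1 mx2 (fun t => pW (Wxi _)) (fun t => Yxi _).
have Et t : tproj (nmul (lawG E) p (u t)) = tproj (sigma ((xi (g t)).1 *+ p) (xi (g t)).2).
  rewrite sP//; last exact: pW.
  apply: tproj_eq; first by rewrite (nmul_proj (lawG E)) Eu.
  by rewrite (nmul_base (lawG E)) Eu.
have la := tdiff_locally_constant pn psi Et.
have /choice[dv Hdv] := Adiv.
exists (fun t => act (dv (tdiff (nmul (lawG E) p (u t)) (sigma ((xi (g t)).1 *+ p) (xi (g t)).2))) (u t)).
split=> //.
- by apply: (plot_act pu); exact: (locally_constant_map dv la).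
- by move=> t; rewrite tproj_act.
- move=> t; split; rewrite ?tproj_act ?Eu//.
  by rewrite nmul_act Hdv -tdiffE.
Qed.

Lemma zclosed_WY : @zclosed k (prodv V1 V2) [set z | W z.1 /\ Y z.2].
Proof.
apply: zclosedI.
  exact: (zclosed_preim (@morphism_fst k V1 V2) (zsubgroup_closed sW)).
exact: (zclosed_preim (@morphism_snd k V1 V2) (zsubgroup_closed sY)).
Qed.

(** An Artin-Schreier coordinate: it trivializes the additive-group torsor induced from [ptors]
    through [iota]. Only its values on [ptors] matter. *)
Definition as_function (F : E -> k) :=
  (forall a e, ptors e -> a *+ p = 0 -> F (act a e) = F e + iota a) /\
  (forall (T : variety k) (u : T -> E), plot u -> (forall t, ptors (u t)) -> regular (fun t => F (u t))).

(* Averaging the cocycle of [ptors] over a finite etale cover. *)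
Lemma as_function_exists : exists F, as_function F.
Proof.
pose X0 := subv zclosed_WY; pose xi0 (z : X0) : prodv V1 V2 := sval z.
have mxi0 : morphism xi0 by exact: morphism_sval.
have [C [g0 [s [eg sg ps Es Ps]]]] := ptors_lift mxi0 (fun z => (svalP z).1) (fun z => (svalP z).2).
have mg0 : morphism g0 by case: eg.
pose V := pullv eg mg0.
pose dl (z : V) := tdiff (s (pull_lift z)) (s (pull_map z)).
have Edl (z : V) : tproj (s (pull_lift z)) = tproj (s (pull_map z)) by rewrite !Es pull_comm.
have ldl : locally_constant dl.
  apply: tdiff_locally_constant => //.
  - by apply: (plot_comp _ ps); exact: morphism_pull_lift.
  - by apply: (plot_comp _ ps); exact: morphism_pull_map.
have [F OF EF] : regular (fun z : V => iota (dl z)).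
  by apply: iota_regular => // z; exact: ptors_tdiff.
have [t [tO tL tF t1]] := fibre_average eg sg.
have slice c : regular (fun c' => F (c, c')).
  by apply: (@morphism_pair _ _ _ _ (fun=> c) (fun y => y) _ _ F OF) => //; exact: morphism_cst.
(* The average over [c'] of the cocycle comparing [s c] with [s c']; within a fibre, differences of
   [gam] are the cocycle itself ([gamE]). *)
pose gam c := t (fun c' => F (c, c')) (g0 c).
have Ogam : regular gam.
  have [J [a [b [Oa Ob Eab]]]] := prod_regularP OF.
  suff -> : gam = (fun c => \sum_j a j c * t (b j) (g0 c)).
    by apply: reg_sum => j _; apply: regM => //; exact: (mg0 _ (tO _ (Ob j))).
  apply/funext => c; rewrite -(tL J (fun j _ => a j c) b)//; last by move=> j; exact: reg_cst.
  by congr (t _ _); apply/funext => c'; rewrite Eab.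
have FE c c' : g0 c = g0 c' -> F (c, c') = iota (tdiff (s c') (s c)).
  by move=> h; have := congr1 (fun u => u (exist _ (c, c') h : V)) EF.
have tD f c x : regular f -> t (fun y => f y + c) x = t f x + c.
  move=> Of; have := tL bool (fun _ _ => 1) (fun b => if b then f else fun=> c) _ _ x.
  rewrite big_bool /= !mul1r t1 => <-; last 2 first.
  - by move=> b; exact: (@reg_cst _ X0).
  - by case; [exact: Of|exact: reg_cst].
  by congr (t _ x); apply/funext => y; rewrite big_bool !mul1r.
have gamE c1 c2 : g0 c1 = g0 c2 -> gam c1 = gam c2 + iota (tdiff (s c2) (s c1)).
  move=> h; rewrite /gam h -tD//; apply: tF => //; first by apply: regD => //; exact: reg_cst.
  move=> c' hc'; rewrite !FE ?hc'//; rewrite -iotaD; last 2 first.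
  - by apply: ptors_tdiff => //; rewrite !Es hc'.
  - by apply: ptors_tdiff => //; rewrite !Es h.
  congr iota; apply: (@act_inj _ _ _ _ (s c')); rewrite -tdiffE ?Es ?hc' ?h//.
  by rewrite addrC actD -tdiffE ?Es ?hc'// -tdiffE// !Es h.
pose over e c := xi0 (g0 c) = tproj e.
have ov e : ptors e -> exists c, over e c.
  move=> [We Ye _]; have [//|c _ Ec] := sg (exist _ (tproj e) (conj We Ye) : X0).
  by exists c; rewrite /over Ec.
(* Two choices of [c] over [e] change [gam] and the torsor difference by opposite amounts. *)
pose G e := if pselect (exists c, over e c) is left h then gam (sval (cid h)) + iota (tdiff (s (sval (cid h))) e) else 0.
have GE e c : ptors e -> over e c -> G e = gam c + iota (tdiff (s c) e).
  move=> Pe oc; rewrite /G; case: pselect => [h|[]]; last by exists c.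
  case: (cid h) => c' oc' /=.
  have hcc : g0 c' = g0 c.
    have : sval (g0 c') = sval (g0 c) by exact: (etrans oc' (esym oc)).
    by case: (g0 c') (g0 c) => [x Hx] [y Hy] /= Exy; apply: eq_exist.
  have h1 : tproj (s c') = tproj e by rewrite Es.
  have h2 : tproj (s c) = tproj e by rewrite Es.
  have h3 : tproj (s c) = tproj (s c') by rewrite h1.
  rewrite (gamE c' c)// -addrA -iotaD; [|exact: ptors_tdiff|exact: ptors_tdiff].
  congr (_ + iota _); apply: (@act_inj _ _ _ _ (s c)).
  by rewrite addrC actD -!tdiffE.
exists G; split.
- move=> a e Pe ap; have [c oc] := ov e Pe.
  have oc' : over (act a e) c by rewrite /over tproj_act.
  have h : tproj (s c) = tproj e by rewrite Es.
  rewrite (GE e c)// (GE (act a e) c)//; last exact: ptors_act.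
  rewrite -addrA -iotaD//; last exact: ptors_tdiff.
  congr (_ + iota _); apply: (@act_inj _ _ _ _ (s c)).
  by rewrite addrC actD -!tdiffE// tproj_act.
- move=> T u pu Pu.
  have WYu v : W (tproj (u v)).1 /\ Y (tproj (u v)).2 by case: (Pu v).
  pose xi v : X0 := exist _ (tproj (u v)) (WYu v).
  have mxi : morphism xi by apply: morphism_sub; exact: (plot_proj pu).
  apply: (regular_descent (@etale_pull_map _ _ _ _ eg _ _ mxi) (@surj_pull_map _ _ _ _ eg sg _ _ mxi)).
  have Ez (z : pullv eg mxi) : tproj (s (pull_lift z)) = tproj (u (pull_map z)).
    by rewrite Es -pull_comm.
  have -> : (fun z : pullv eg mxi => G (u (pull_map z))) =
     (fun z => gam (pull_lift z) + iota (tdiff (s (pull_lift z)) (u (pull_map z)))).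
    by apply/funext => z; apply: GE => //; rewrite /over -pull_comm.
  apply: regD; first exact: (morphism_pull_lift eg mxi Ogam).
  apply: iota_regular; last by move=> z; exact: ptors_tdiff.
  apply: tdiff_locally_constant => //.
  + by apply: (plot_comp _ ps); exact: morphism_pull_lift.
  + by apply: (plot_comp _ pu); exact: morphism_pull_map.
Qed.

End ArtinSchreier.
End Biextensions.

(** * Cocycles and normal forms *)

Section Cocycles.
Variables (k : closedFieldType) (G : calg_group k).
Hypothesis uG : unipotent G.
Notation VG := (cag_var G).
Notation O := (@regular k VG).
Variables (N S : set G) (V : variety k) (Y : set V) (c : G -> G -> V -> k).
Hypotheses (sN : zsubgroup N) (dN : domain_on N) (sS : zsubgroup S) (SN : S `<=` N).
Hypothesis c_regular : exists2 F, @regular k (prodv VG (prodv VG V)) F &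
  forall s w y, S s -> N w -> Y y -> c s w y = F (s, (w, y)).
Hypothesis c_cocycle : forall s t w y, S s -> S t -> N w -> Y y ->
  c (s + t) w y = c t (w + s) y + c s w y.
Notation OV := (@regular k (prodv VG V)).

Lemma prodv_shift (g : G * V -> k) s : OV g -> OV (fun z => g (z.1 + s, z.2)).
Proof.
move=> Og; have := @morphism_pair k VG V (prodv VG V) (fun z => (z.1 : G) + s) snd _ _ g Og; apply.
  apply: (@morphism_comp k (prodv VG V) VG VG (fun x => x + s) fst); last exact: morphism_fst.
  by move=> f Of; exact: reg_shift.
exact: morphism_snd.
Qed.

Lemma prodv_slice (g : G * V -> k) y : OV g -> O (fun x => g (x, y)).
Proof.
by move=> Og; apply: (@morphism_pair k VG V VG (fun x => x) (fun=> y) _ _ g Og) => //; exact: morphism_cst.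
Qed.

(** The number [m] of products that express [c], up to an invariant denominator, with dependence on
    [s] only through [w + s]. Some [m] exists because [c] is regular and [s] is the difference of
    [w + s] and [w]. *)
Definition cocycle_rank m := exists (b : G -> k) (f : 'I_m -> G -> k) (g : 'I_m -> G * V -> k) (g0 : G * V -> k),
  [/\ O b /\ (exists2 x, N x & b x != 0), forall s w, S s -> N w -> b (w + s) = b w,
      (forall i, O (f i)), (forall i, OV (g i)) /\ OV g0 &
      forall s w y, S s -> N w -> Y y -> b w * c s w y = g0 (w, y) + \sum_(i < m) f i (w + s) * g i (w, y)].

Lemma cocycle_rank_exists : exists m, cocycle_rank m.
Proof.
have [F OF cF] := c_regular.
pose xi (z : prodv VG (prodv VG V)) : prodv VG (prodv VG V) := ((z.1 : G) - (z.2.1 : G), z.2).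
have mxi : morphism xi.
  apply: morphism_pair; last exact: morphism_snd.
  have m1 : @morphism k (prodv VG (prodv VG V)) VG fst by exact: morphism_fst.
  have m2 : @morphism k (prodv VG (prodv VG V)) VG (fun z => z.2.1).
    exact: (morphism_comp (@morphism_fst k VG V) (@morphism_snd k VG (prodv VG V))).
  exact: (morphism_comp (@cag_addP k G) (morphism_pair m1 (morphism_comp (@cag_oppP k G) m2))).
have [J [a [d [Oa Od Ead]]]] := prod_regularP (mxi _ OF).
exists #|J|, (fun=> 1), (fun i => a (enum_val i)), (fun i => d (enum_val i)), (fun=> 0); split => //.
- split; first exact: reg_cst.
  by exists 0; [exact: zsubgroup0|exact: oner_neq0].
- by split=> //; exact: (@reg_cst _ (prodv VG V)).
- move=> s w y Ss Nw Yy; rewrite mul1r add0r cF//.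
  have := Ead (w + s) (w, y); rewrite /= /xi /= addrAC subrr add0r => ->.
  by rewrite [LHS](reindex _ (onW_bij _ (enum_val_bij J))).
Qed.

(** The cocycle identity for [s + t] at [v - s] is a linear relation between 1 and the
    [f i (v + t)], with coefficients [gg] independent of [t]. If all these coefficients vanish,
    [b * c] is the coboundary of [- g0]; otherwise a relation with invariant coefficients eliminates
    one product. *)
Lemma cocycle_rank_boundary m : cocycle_rank m -> exists (b : G -> k) (h : G * V -> k),
  [/\ O b, exists2 x, N x & b x != 0, forall s w, S s -> N w -> b (w + s) = b w, OV h &
      forall s w y, S s -> N w -> Y y -> b w * c s w y = h (w + s, y) - h (w, y)].
Proof.
elim: m => [|m IH] [b [f [g [g0 [[Ob nb] ib Of [Og Og0] E]]]]].
- exists b, (fun=> 0); split => //; first exact: (@reg_cst _ (prodv VG V)).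
  move=> s w y Ss Nw Yy.
  have E' t v : S t -> N v -> b v * c t v y = g0 (v, y) by move=> St Nv; rewrite E// big_ord0 addr0.
  have S0 := zsubgroup0 sS.
  have := c_cocycle S0 S0 Nw Yy; rewrite !addr0 => /eqP; rewrite -subr_eq subrr eq_sym => /eqP c0.
  by rewrite subrr E'// -(E' 0)// c0 mulr0.
(* The index 0 stands for the constant function 1. *)
pose f' (j : 'I_m.+2) : G -> k := oapp f (fun=> 1) (unlift ord0 j).
pose gg y s (j : 'I_m.+2) (v : G) : k := oapp (fun i => g i (v, y) - g i (v - s, y))
   (g0 (v, y) + \sum_i f i v * g i (v - s, y)) (unlift ord0 j).
have sum0 (F : 'I_m.+2 -> k) : \sum_j F j = F ord0 + \sum_(i < m.+1) F (lift ord0 i) by rewrite big_ord_recl.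
have [[y [s [Yy Ss [j nz]]]]|H0] := pselect (exists y s, [/\ Y y, S s &
    exists j, exists2 v, N v & gg y s j v != 0]); last first.
  exists b, (fun z => - g0 z); split=> //; first exact: (@regN _ (prodv VG V)).
  move=> s w y Ss Nw Yy; rewrite E// opprK addrC; congr (_ + _).
  have Nws : N (w + s) by apply: zsubgroupD => //; exact: SN.
  have : gg y s ord0 (w + s) = 0.
    apply/eqP/negPn/negP => nz; apply: H0; exists y, s; split=> //; exists ord0.
    by exists (w + s).
  rewrite /gg unlift_none /= addrK => /eqP; rewrite addr_eq0 => /eqP ->.
  by rewrite opprK.
have [||||] := @invariant_relation k G uG N S 'I_m.+2 f' (gg y s) sN dN sS SN.
- move=> i; rewrite /f'; case: unliftP => [i' _|_] /=; [exact: Of|exact: (@reg_cst _ VG)].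
- move=> i; rewrite /gg; case: unliftP => [i' _|_] /=.
    apply: (@regB _ VG); first exact: prodv_slice.
    by apply: (reg_shift (f := fun x => g i' (x, y))); exact: prodv_slice.
  apply: (@regD _ VG); first exact: prodv_slice.
  apply: (@reg_sum _ VG) => i' _; apply: (@regM _ VG); first exact: Of.
  by apply: (reg_shift (f := fun x => g i' (x, y))); exact: prodv_slice.
- move=> t v St Nv; rewrite sum0 /f' /gg unlift_none /= mul1r.
  rewrite [X in _ + X](eq_bigr (fun i => f i (v + t) * g i (v, y) - f i (v + t) * g i (v - s, y))); last first.
    by move=> i _; rewrite liftK /= mulrBr.
  rewrite sumrB.
  have Nvs : N (v - s) by apply: zsubgroupB => //; exact: SN.
  have E1 := E _ _ _ (zsubgroupD sS Ss St) Nvs Yy.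
  have E2 := E _ _ _ St Nv Yy.
  have E3 := E _ _ _ Ss Nvs Yy.
  move: E1; rewrite c_cocycle// mulrDr subrK E3 -[v in b (v - s)]/v.
  have -> : b (v - s) = b v by rewrite -(ib s (v - s))// subrK.
  rewrite E2.
  have -> : v - s + (s + t) = v + t by rewrite addrA subrK.
  rewrite (_ : v - s + s = v) ?subrK// => E1.
  set A1 := \sum_i f i v * _ in E1 *; set A2 := \sum_i f i (v + t) * g i (v, y) in E1 *.
  set A3 := \sum_i f i (v + t) * _ in E1 *.
  apply/eqP; rewrite addrA subr_eq0; apply/eqP.
  move: E1; set a := g0 (v, y); set a' := g0 (v - s, y) => E1.
  have : a + A2 + (a' + A1) - a' = a' + A3 - a' by rewrite E1.
  rewrite [a' + A3]addrC addrK => <-; ring.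
- by exists j.
move=> B [OB iB nB EB].
(* A relation supported on the index 0 would kill the constant 1, so some [f i] occurs and can be
   eliminated. *)
have [i nbi] : exists i : 'I_m.+1, exists2 w, N w & B (lift ord0 i) w != 0.
  apply: contrapT => nB'; have [j' [w Nw]] := nB.
  have B0 i v : N v -> B (lift ord0 i) v = 0.
    by move=> Nv; apply/eqP/negPn/negP => nz'; apply: nB'; exists i, v.
  have [i ->|->] := unliftP ord0 j'; first by rewrite B0// eqxx.
  have := EB w Nw; rewrite sum0 /f' unlift_none /= mul1r big1 ?addr0; first by move=> ->; rewrite eqxx.
  by move=> i _; rewrite B0// mulr0.
apply: IH; exists (fun w => B (lift ord0 i) w * b w), (fun j => f (lift i j)),
  (fun j z => B (lift ord0 i) z.1 * g (lift i j) z - B (lift ord0 (lift i j)) z.1 * g i z),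
  (fun z => B (lift ord0 i) z.1 * g0 z - B ord0 z.1 * g i z).
have OBV j' : OV (fun z => B j' z.1) by exact: prod_regularl.
split => //.
- split; first exact: (@regM _ VG).
  apply: contrapT => nz'.
  have H w : N w -> B (lift ord0 i) w * b w = 0.
    by move=> Nw; apply/eqP/negPn/negP => nz''; apply: nz'; exists w.
  have [x Nx /eqP] := nb; apply.
  exact: (domain_cancel dN (OB _) Ob nbi H).
- by move=> t w St Nw; rewrite iB// ib.
- by split=> [j'|]; apply: (@regB _ (prodv VG V)); apply: (@regM _ (prodv VG V)).
move=> t w y' St Nw Yy' /=; rewrite -mulrA E//.
have Nwt : N (w + t) by apply: zsubgroupD => //; exact: SN.
have := EB _ Nwt; rewrite sum0 /f' unlift_none /= mul1r.
under eq_bigr do rewrite liftK /=.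
rewrite !(bigD1_ord i)//= !iB//.
under eq_bigr do rewrite iB//.
move=> /eqP; rewrite addrCA addr_eq0 => /eqP Ei.
under [in RHS]eq_bigr do rewrite mulrBr.
rewrite sumrB.
have -> : \sum_(j < m) f (lift i j) (w + t) * (B (lift ord0 (lift i j)) w * g i (w, y')) =
   (\sum_(j < m) f (lift i j) (w + t) * B (lift ord0 (lift i j)) w) * g i (w, y').
  by rewrite big_distrl; apply: eq_bigr => j' _; rewrite mulrA.
have -> : \sum_(j < m) f (lift i j) (w + t) * (B (lift ord0 i) w * g (lift i j) (w, y')) =
   B (lift ord0 i) w * (\sum_(j < m) f (lift i j) (w + t) * g (lift i j) (w, y')).
  by rewrite big_distrr; apply: eq_bigr => j' _; rewrite mulrCA.
move: Ei; set a := \sum_(j < m) _ * B _ _; set e := \sum_(j < m) _ => Ei.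
have -> : B (lift ord0 i) w * (g0 (w, y') + (f i (w + t) * g i (w, y') + e)) =
  B (lift ord0 i) w * g0 (w, y') + (f i (w + t) * B (lift ord0 i) w) * g i (w, y') + B (lift ord0 i) w * e by ring.
by rewrite Ei; ring.
Qed.

Hypothesis c_shift : forall w0, N w0 -> exists2 m, OV m & forall s w y, S s -> N w -> Y y ->
  c s (w + w0) y - c s w y = m (w + s, y) - m (w, y).

(* The numerators [b] such that [b c] is a coboundary form a translation-stable
   space, so [1] is one of them up to a scalar. *)
Lemma cocycle_boundary : exists2 h, OV h &
  forall s w y, S s -> N w -> Y y -> c s w y = h (w + s, y) - h (w, y).
Proof.
have [m /cocycle_rank_boundary[b0 [h0 [Ob0 nb0 ib0 Oh0 E0]]]] := cocycle_rank_exists.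
pose M : set (G -> k) := [set b | [/\ O b, forall s w, S s -> N w -> b (w + s) = b w &
   exists2 h, OV h & forall s w y, S s -> N w -> Y y -> b w * c s w y = h (w + s, y) - h (w, y)]].
have [||||b [[Ob _ [h Oh Eh]] [x Nx nx] ib]] := @unipotent_fixed k G uG N N M.
- by move=> b [].
- move=> b b' [Ob ib [h Oh Eh]] [Ob' ib' [h' Oh' Eh']]; split; first exact: (@regB _ VG).
    by move=> s w Ss Nw; rewrite ib// ib'.
  exists (fun z => h z - h' z); first exact: (@regB _ (prodv VG V)).
  by move=> s w y Ss Nw Yy; rewrite mulrBl Eh// Eh'//; ring.
- move=> w0 b Nw0 [Ob ib [h Oh Eh]]; split; first exact: reg_shift.
    by move=> s w Ss Nw /=; rewrite addrAC (ib s)//; exact: (zsubgroupD sN).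
  have [m' Om Em] := c_shift Nw0.
  exists (fun z => h (z.1 + w0, z.2) - b (z.1 + w0) * m' z).
    apply: (@regB _ (prodv VG V)); first exact: prodv_shift.
    apply: (@regM _ (prodv VG V)) => //.
    by apply: (prod_regularl (X := VG) (f := fun x => b (x + w0))); exact: reg_shift.
  move=> s w y Ss Nw Yy /=.
  have -> : c s w y = c s (w + w0) y - (m' (w + s, y) - m' (w, y)) by rewrite -Em//; ring.
  have -> : b (w + s + w0) = b (w + w0) by rewrite addrAC (ib s)//; exact: (zsubgroupD sN).
  rewrite mulrBr Eh//; last exact: zsubgroupD.
  by rewrite [w + w0 + s]addrAC; ring.
- by exists b0 => //; split=> //; exists h0.
have bE w : N w -> b w = b 0 by move=> Nw; rewrite -{1}[w]add0r ib//; exact: zsubgroup0.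
have nb : b 0 != 0 by rewrite -(bE x).
exists (fun z => (b 0)^-1 * h z); first exact: (@regZ _ (prodv VG V)).
by move=> s w y Ss Nw Yy; rewrite -mulrBr -Eh// bE// mulKf.
Qed.

End Cocycles.

(** Dependent second factors are eliminated one at a time. *)
Lemma independent_expansion (k : fieldType) (X V : Type) (Y : set V) m (a : 'I_m -> X -> k) (d : 'I_m -> V -> k) :
  exists m' (u : 'I_m' -> 'I_m -> k) (s : 'I_m' -> 'I_m),
  (forall x y, Y y -> \sum_j a j x * d j y = \sum_i (\sum_j u i j * a j x) * d (s i) y) /\
  (forall v : 'I_m' -> k, (forall y, Y y -> \sum_i v i * d (s i) y = 0) -> forall i, v i = 0).
Proof.
elim: m a d => [|m IH] a d.
  by exists 0, (fun i _ => 0), (fun i => i); split=> [x y _|v _ []//]; rewrite !big_ord0.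
have [H|/existsNP[v /not_implyP[Hv /existsNP[i vi]]]] := pselect (forall v : 'I_m.+1 -> k, (forall y, Y y -> \sum_i v i * d i y = 0) -> forall i, v i = 0).
  exists m.+1, (fun i j => (i == j)%:R), (fun i => i); split=> // x y Yy.
  apply: eq_bigr => i _; congr (_ * _); rewrite (bigD1 i)//= eqxx mul1r big1 ?addr0// => j /negPf.
  by rewrite eq_sym => ->; rewrite mul0r.
have {}vi : v i != 0 by exact/eqP.
have [m' [u [s [E I]]]] := IH (fun j x => a (lift i j) x - v (lift i j) / v i * a i x) (fun j => d (lift i j)).
exists m', (fun i' j => if unlift i j is Some j' then u i' j' else - \sum_j' u i' j' * (v (lift i j') / v i)),
  (fun i' => lift i (s i')); split=> // x y Yy.
transitivity (\sum_(j < m) (a (lift i j) x - v (lift i j) / v i * a i x) * d (lift i j) y).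
  have := Hv y Yy; rewrite (bigD1_ord i)//= => /eqP; rewrite addr_eq0 => /eqP Ei.
  have {}Ei : d i y = - (\sum_(j < m) v (lift i j) * d (lift i j) y) / v i.
    by rewrite -Ei mulrAC divff// mul1r.
  under [RHS]eq_bigr do rewrite mulrBl.
  rewrite sumrB (bigD1_ord i)//= addrC; congr (_ + _).
  rewrite Ei mulNr mulrN; congr (- _); rewrite mulr_suml mulr_sumr.
  by apply: eq_bigr => j _; ring.
rewrite E//; apply: eq_bigr => i' _; congr (_ * _).
rewrite [RHS](bigD1_ord i)//= unlift_none.
under [X in _ = _ + X]eq_bigr do rewrite liftK.
under eq_bigr do rewrite mulrBr.
rewrite sumrB addrC; congr (_ + _).
by rewrite mulNr mulr_suml; congr (- _); apply: eq_bigr => j _; ring.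
Qed.

(** Once the functions of [y] are linearly independent on [Y], constancy on fibres passes from [F]
    to each coefficient [a i], and [fibre_const_poly] applies to these; [n] dominates their
    exponents. *)
Lemma fibre_const_family (p : nat) (k : closedFieldType) (G : calg_group k) (N : set G) (pi : G -> k)
    (V : variety k) (Y : set V) (F : G * V -> k) : p \in [pchar k] ->
  zsubgroup N -> domain_on N -> @regular k (cag_var G) pi -> additive_on N pi -> infinite_image N pi ->
  @regular k (prodv (cag_var G) V) F ->
  (forall w u y, N w -> N u -> Y y -> pi w = pi u -> F (w, y) = F (u, y)) ->
  exists n m (c : 'I_m -> V -> k), (forall i, regular (c i)) /\
    forall w y, N w -> Y y -> F (w, y) ^+ (p ^ n) = \sum_(i < m) c i y * pi w ^+ i.
Proof.
move=> chp sN dN Opi api ipi OF fF.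
have [J [a0 [d0 [Oa0 Od0 E0]]]] := prod_regularP OF.
have [m [u [s [E I]]]] := independent_expansion Y (fun i : 'I_#|J| => a0 (enum_val i)) (fun i => d0 (enum_val i)).
pose a i (x : G) := \sum_j u i j * a0 (enum_val j) x; pose d i := d0 (enum_val (s i)).
have FE x y : Y y -> F (x, y) = \sum_i a i x * d i y.
  by move=> Yy; rewrite E0 -E// [LHS](reindex _ (onW_bij _ (enum_val_bij J))).
have Oa i : @regular k (cag_var G) (a i).
  by apply: (@reg_sum _ (cag_var G)) => j _; apply: (@regZ _ (cag_var G)).
have fa i : fibre_const N pi (a i).
  move=> w v Nw Nv wv; apply/eqP; rewrite -subr_eq0; apply/eqP.
  apply: (I (fun i => a i w - a i v)) => y Yy.
  under eq_bigr do rewrite mulrBl.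
  by rewrite sumrB -!FE// (fF w v)// subrr.
have pa i : exists n (q : {poly k}), forall x, N x -> a i x ^+ (p ^ n) = q.[pi x].
  exact: (fibre_const_poly chp sN dN Opi api ipi (Oa i) (fa i)).
have /choice[nn /choice[q Eq]] := pa.
pose n := \sum_i nn i; pose Q i := q i ^+ (p ^ (n - nn i)).
have EQ i x : N x -> a i x ^+ (p ^ n) = (Q i).[pi x].
  move=> Nx; rewrite /Q horner_exp -Eq// -exprM -expnD subnKC//.
  by rewrite /n (bigD1 i)//= leq_addr.
pose M := \sum_i size (Q i).
exists n, M, (fun i y => \sum_j (Q j)`_i * d j y ^+ (p ^ n)); split.
  by move=> i; apply: reg_sum => j _; apply: regZ; apply: regX; exact: Od0.
move=> w y Nw Yy; rewrite FE// (frob_sum chp)//.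
under [RHS]eq_bigr do rewrite mulr_suml.
rewrite exchange_big /=; apply: eq_bigr => j _.
rewrite exprMn EQ// (@horner_coef_wide _ M); last by rewrite /M (bigD1 j)//= leq_addr.
by rewrite mulr_suml; apply: eq_bigr => i _; rewrite mulrAC.
Qed.

Lemma regular_extend (k : closedFieldType) (X : variety k) (Z : set X) (cZ : zclosed Z) (v : X -> k) :
  @regular k (subv cZ) (fun z => v (sval z)) -> exists2 g, regular g & forall x, Z x -> g x = v x.
Proof.
move=> [g Og E]; exists g => // x Zx.
by have := congr1 (fun u => u (exist _ x Zx)) E => /= ->.
Qed.

Section NormalForm.
Variables (k : closedFieldType) (U1 U2 : calg_group k) (A : zmodType) (E : biextension U1 U2 A).
Local Notation V1 := (cag_var U1).
Local Notation V2 := (cag_var U2).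
Local Notation q1 e := ((@tproj _ _ _ E e).1 : U1).
Local Notation q2 e := ((@tproj _ _ _ E e).2 : U2).
Local Notation "e *1 e'" := (rmul (lawG E) e e') (at level 50).
Local Notation "e *2 e'" := (rmul (lawH E) e e') (at level 50).
Implicit Types e : E.

Variables (p : nat) (iota : A -> k).
Hypothesis chp : p \in [pchar k].
Hypothesis Adiv : forall a : A, exists b, b *+ p = a.
Hypothesis iotaD : forall a b : A, a *+ p = 0 -> b *+ p = 0 -> iota (a + b) = iota a + iota b.
Hypothesis iotaF : forall a : A, a *+ p = 0 -> iota a ^+ p = iota a.

Hypothesis uG : unipotent U1.
Hypothesis irr1 : irreducible_variety V1.
Variables (W : set U1) (Y : set U2) (sigma : U1 -> U2 -> E) (pi : U1 -> k).
Hypotheses (cW : conn W) (Opi : @regular k V1 pi) (api : additive_on W pi) (ipi : infinite_image W pi).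
Hypothesis sY : zsubgroup Y.
Hypothesis trs : trivializes (ker_on W pi) Y sigma.
Notation W' := (ker_on W pi).

Let pp : prime p. Proof. exact: pcharf_prime chp. Qed.
Let sW : zsubgroup W. Proof. by case: cW. Qed.
Let sW' : zsubgroup W'. Proof. exact: zsubgroup_ker. Qed.
Let W'W : W' `<=` W. Proof. by move=> x []. Qed.
Let dW : domain_on W. Proof. exact: conn_domain. Qed.
Let cY : @zclosed k V2 Y. Proof. exact: zsubgroup_closed. Qed.
Let cWc : @zclosed k V1 W. Proof. exact: zsubgroup_closed. Qed.
Let cWY := zclosed_WY sW sY.
Let W0 : W 0. Proof. exact: zsubgroup0. Qed.
Let W'0 : W' 0. Proof. exact: zsubgroup0. Qed.

Lemma kill_p w : W w -> W' (w *+ p).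
Proof.
move=> Ww; split; first exact: zsubgroupMn.
have H n : pi (w *+ n) = pi w *+ n.
  elim: n => [|n IH]; first by rewrite !mulr0n (additive_on0 sW api).
  by rewrite !mulrS api ?IH//; exact: zsubgroupMn.
by rewrite H mulrn_pchar.
Qed.

Notation P := (ptors p W Y sigma).
Let comm1 := mul1_comm (E := E) irr1.
Let sP x y : W' x -> Y y -> tproj (sigma x y) = (x, y). Proof. by case: trs => H _ _ _; exact: H. Qed.
Let sD1 x x' y : W' x -> W' x' -> Y y -> sigma (x + x') y = sigma x y *1 sigma x' y.
Proof. by case: trs => _ H _ _; exact: H. Qed.
Let sD2 x y y' : W' x -> Y y -> Y y' -> sigma x (y + y') = sigma x y *2 sigma x y'.
Proof. by case: trs => _ _ H _; exact: H. Qed.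
Let Psig x y : W' x -> Y y -> P (sigma x y).
Proof. exact: (ptors_sigma p sW' W'W trs). Qed.
Let Pmul e e' : P e -> P e' -> q2 e = q2 e' -> P (e *1 e').
Proof. exact: (ptors_mul1 irr1 sW kill_p trs). Qed.
Let Pmul2 e e' : P e -> P e' -> q1 e = q1 e' -> P (e *2 e').
Proof. exact: (ptors_mul2 sY kill_p trs). Qed.
Let Plift := ptors_lift Adiv kill_p trs.

Lemma ptors_exists w y : W w -> Y y -> exists2 e, P e & tproj e = (w, y).
Proof.
move=> Ww Yy.
have [T' [g [u [_ sg _ Eu Pu]]]] := Plift (T := V1) (@morphism_cst k V1 (prodv V1 V2) (w, y)) (fun=> Ww) (fun=> Yy).
by have [//|t _ _] := sg (0 : U1); exists (u t).
Qed.

(** [ptors] acquires sections after a surjective finite etale map, along which regularity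
    descends. *)
Lemma descend1 (T : variety k) (xi : T -> prodv V1 V2) (Psi : E -> k) (v : T -> k) : morphism xi ->
  (forall t, W (xi t).1) -> (forall t, Y (xi t).2) ->
  (forall (T' : variety k) (u : T' -> E), plot u -> (forall t, P (u t)) -> regular (fun t => Psi (u t))) ->
  (forall t e, P e -> tproj e = xi t -> Psi e = v t) -> regular v.
Proof.
move=> mxi Wxi Yxi H vE; have [T' [g [u [eg sg pu Eu Pu]]]] := Plift mxi Wxi Yxi.
apply: (regular_descent eg sg); rewrite (_ : (fun y => v (g y)) = fun y => Psi (u y)); first exact: H.
by apply/funext => y; rewrite (vE (g y) (u y)).
Qed.

Lemma descend2 (T : variety k) (xi xi' : T -> prodv V1 V2) (Psi : E -> E -> k) (v : T -> k) :
  morphism xi -> morphism xi' ->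
  (forall t, W (xi t).1) -> (forall t, Y (xi t).2) ->
  (forall t, W (xi' t).1) -> (forall t, Y (xi' t).2) ->
  (forall (T' : variety k) (u u' : T' -> E), plot u -> plot u' -> (forall t, P (u t)) -> (forall t, P (u' t)) ->
     (forall t, exists t0, tproj (u t) = xi t0 /\ tproj (u' t) = xi' t0) -> regular (fun t => Psi (u t) (u' t))) ->
  (forall t e e', P e -> P e' -> tproj e = xi t -> tproj e' = xi' t -> Psi e e' = v t) -> regular v.
Proof.
move=> mxi mxi' Wxi Yxi Wxi' Yxi' H vE; have [T' [g [u [eg sg pu Eu Pu]]]] := Plift mxi Wxi Yxi.
apply: (regular_descent eg sg); have mg : morphism g by case: eg.
have [T'' [g' [u' [eg' sg' pu' Eu' Pu']]]] := Plift (morphism_comp mxi' mg) (fun t => Wxi' (g t)) (fun t => Yxi' (g t)).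
apply: (regular_descent eg' sg'); have mg' : morphism g' by case: eg'.
rewrite (_ : (fun y => v (g (g' y))) = fun y => Psi (u (g' y)) (u' y)); last first.
  by apply/funext => y; rewrite (vE (g (g' y)) (u (g' y)) (u' y)).
apply: H => //; first exact: (plot_comp mg' pu).
by move=> t; exists (g (g' t)).
Qed.

Section ASFunction.
Variable F : E -> k.
Hypothesis asF : as_function p iota W Y sigma F.

(** Points over [(w, y)] and [(w', y)] are chosen; by [defect1E] the choice is immaterial, as the
    contributions of [iota] cancel. *)
Definition defect1 w w' y : k :=
  if pselect (exists ee : E * E, [/\ P ee.1, P ee.2, tproj ee.1 = (w, y) & tproj ee.2 = (w', y)]) is left h
  then let ee := sval (cid h) in F (ee.1 *1 ee.2) - F ee.1 - F ee.2 else 0.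

Lemma as_move e e' : P e -> P e' -> tproj e = tproj e' -> exists a, [/\ a *+ p = 0, e' = act a e & F e' = F e + iota a].
Proof.
move=> Pe Pe' ee'; exists (tdiff e e').
have ap := ptors_tdiff Pe Pe' ee'.
by split; rewrite -?tdiffE// {1}(tdiffE ee'); case: asF => H _; rewrite H.
Qed.

Lemma defect1E e e' : P e -> P e' -> q2 e = q2 e' -> defect1 (q1 e) (q1 e') (q2 e) = F (e *1 e') - F e - F e'.
Proof.
move=> Pe Pe' ee'; rewrite /defect1; case: pselect => [h|[]]; last first.
  by exists (e, e'); split=> //=; [rewrite -surjective_pairing|rewrite ee' -surjective_pairing].
case: (cid h) => -[d d'] /= [Pd Pd' Ed Ed'].
have [|a [ap -> ->]] := as_move Pe Pd; first by rewrite Ed -surjective_pairing.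
have [|a' [ap' -> ->]] := as_move Pe' Pd'; first by rewrite Ed' ee' -surjective_pairing.
have Pee := Pmul Pe Pe' ee'.
rewrite act_mul//; case: asF => H1 _; rewrite (H1 _ _ Pee); last by rewrite mulrnDl ap ap' addr0.
by rewrite iotaD//; ring.
Qed.

Lemma defect1_regular (T : variety k) (x x' : T -> V1) (y : T -> V2) : morphism x -> morphism x' -> morphism y ->
  (forall t, W (x t)) -> (forall t, W (x' t)) -> (forall t, Y (y t)) -> regular (fun t => defect1 (x t) (x' t) (y t)).
Proof.
move=> mx mx' my Wx Wx' Yy.
apply: (descend2 (xi := fun t => (x t, y t)) (xi' := fun t => (x' t, y t))
   (Psi := fun e e' => F (e *1 e') - F e - F e')) => //; [exact: morphism_pair|exact: morphism_pair| |].
- move=> T' u u' pu pu' Pu Pu' H; have uu t : q2 (u t) = q2 (u' t).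
    by have [t0 [-> ->]] := H t.
  case: asF => _ H'; apply: regB; [apply: regB|]; apply: H' => //.
    by apply: rmul_plot.
  by move=> t; apply: Pmul.
- by move=> t e e' Pe Pe' Ee Ee'; rewrite -defect1E ?Ee ?Ee'.
Qed.

Lemma as_function_sub (h : prodv V1 V2 -> k) : regular h -> as_function p iota W Y sigma (fun e => F e - h (tproj e)).
Proof.
move=> Oh; case: asF => H1 H2; split=> [a e Pe ap|T u pu Pu].
  by rewrite H1// tproj_act addrAC.
by apply: regB; [exact: H2|exact: (plot_proj pu Oh)].
Qed.

Lemma as_function_frob n : as_function p iota W Y sigma (fun e => F e ^+ (p ^ n)).
Proof.
case: asF => H1 H2; split=> [a e Pe ap|T u pu Pu]; last by apply: regX; exact: H2.
by rewrite H1// (frobD _ _ _ chp) (frob_fixed_root _ (iotaF ap)).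
Qed.

Lemma as_function_wp e e' : P e -> P e' -> tproj e = tproj e' -> F e ^+ p - F e = F e' ^+ p - F e'.
Proof.
move=> Pe Pe' ee'; have [a [ap _ ->]] := as_move Pe Pe' ee'.
have := frobD 1 (F e) (iota a) chp; rewrite expn1 => ->.
by rewrite iotaF//; ring.
Qed.

(** Translation by [sigma] changes [F] by a cocycle of [ker pi] with parameter [y]. Shifting this
    cocycle by [w0] alters it by the coboundary of [defect1 w0], because the law is commutative; so
    [cocycle_boundary] applies. *)
Lemma as_function_invariant : exists2 h, @regular k (prodv V1 V2) h &
  forall e w, P e -> W' w -> F (sigma w (q2 e) *1 e) - h (tproj (sigma w (q2 e) *1 e)) = F e - h (tproj e).
Proof.
pose c s w y := defect1 s w y + F (sigma s y).
have cE s e : W' s -> P e -> c s (q1 e) (q2 e) = F (sigma s (q2 e) *1 e) - F e.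
  move=> Ws Pe; have Ye : Y (q2 e) by case: Pe.
  have := defect1E (Psig Ws Ye) Pe; rewrite !sP//= /c => ->//.
  by rewrite addrAC subrK.
have mulP s e : W' s -> P e -> P (sigma s (q2 e) *1 e) /\ tproj (sigma s (q2 e) *1 e) = (q1 e + s, q2 e).
  move=> Ws Pe; have Ye : Y (q2 e) by case: Pe.
  split; first by apply: Pmul; rewrite ?sP//; exact: Psig.
  by rewrite mul1_proj ?sP//= addrC.
have [||w0 Ww0|h Oh Eh] := @cocycle_boundary k U1 uG W W' V2 Y c sW dW sW' W'W.
- pose Z : set (prodv V1 (prodv V1 V2)) := [set z | W' z.1 /\ (W z.2.1 /\ Y z.2.2)].
  have m1 := @morphism_fst k V1 (prodv V1 V2).
  have m2 := @morphism_snd k V1 (prodv V1 V2).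
  have cZ : zclosed Z.
    apply: zclosedI; first exact: (zclosed_preim m1 (zsubgroup_closed sW')).
    exact: (zclosed_preim m2 cWY).
  have mZ := morphism_sval cZ.
  have [|g Og Eg] := @regular_extend k _ Z cZ (fun z => c z.1 z.2.1 z.2.2).
  + apply: regD.
      apply: (defect1_regular (x := fun z : subv cZ => (sval z).1) (x' := fun z : subv cZ => (sval z).2.1) (y := fun z : subv cZ => (sval z).2.2)).
      * exact: (morphism_comp m1 mZ).
      * exact: (morphism_comp (@morphism_fst k V1 V2) (morphism_comp m2 mZ)).
      * exact: (morphism_comp (@morphism_snd k V1 V2) (morphism_comp m2 mZ)).
      * by move=> z; have [/W'W] := svalP z.
      * by move=> z; have [_ []] := svalP z.
      * by move=> z; have [_ []] := svalP z.
    case: asF => _; apply.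
      case: trs => _ _ _; apply.
      * exact: (morphism_comp m1 mZ).
      * exact: (morphism_comp (@morphism_snd k V1 V2) (morphism_comp m2 mZ)).
      * by move=> z; have [] := svalP z.
      * by move=> z; have [_ []] := svalP z.
    by move=> z; have [Wz [_ Yz]] := svalP z; exact: Psig.
  + by exists g => // s w y Ws Ww Yy; rewrite Eg.
- move=> s t w y Ws Wt Ww Yy; have [e Pe Ee] := ptors_exists Ww Yy.
  have := cE (s + t) e (zsubgroupD sW' Ws Wt) Pe; rewrite Ee /= => ->.
  have [] := mulP s e Ws Pe; rewrite Ee /= => Pse Ese.
  have := cE t _ Wt Pse; rewrite Ese /= => ->.
  have := cE s e Ws Pe; rewrite Ee /= => ->.
  rewrite [s + t]addrC sD1// -rmulA ?sP ?Ee//.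
  by rewrite addrA subrK.
- have [|m Om Em] := @regular_extend k _ _ cWY (fun z => defect1 w0 z.1 z.2).
    apply: (defect1_regular (x := fun=> w0) (x' := fun z : subv cWY => (sval z).1) (y := fun z : subv cWY => (sval z).2)).
    * exact: morphism_cst.
    * exact: (morphism_comp (@morphism_fst k V1 V2) (morphism_sval cWY)).
    * exact: (morphism_comp (@morphism_snd k V1 V2) (morphism_sval cWY)).
    * by [].
    * by move=> z; have [] := svalP z.
    * by move=> z; have [] := svalP z.
  exists m => // s w y Ws Ww Yy.
  rewrite (Em (w + s, y)); last by split=> //=; apply: zsubgroupD => //; exact: W'W.
  rewrite (Em (w, y))//=.
  have [e Pe Ee] := ptors_exists Ww Yy.
  have [e0 Pe0 Ee0] := ptors_exists Ww0 Yy.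
  have [] := mulP s e Ws Pe; rewrite Ee /= => Pse Ese.
  have Pe0e : P (e0 *1 e) by apply: Pmul; rewrite ?Ee ?Ee0.
  have Ee0e : tproj (e0 *1 e) = (w + w0, y) by rewrite mul1_proj ?Ee ?Ee0//= addrC.
  have := cE s _ Ws Pe0e; rewrite Ee0e /= => ->.
  have := cE s _ Ws Pe; rewrite Ee /= => ->.
  have := defect1E Pe0 Pse; rewrite Ee0 Ese /= => ->//.
  have := defect1E Pe0 Pe; rewrite Ee Ee0 /= => ->//.
  have -> : e0 *1 (sigma s y *1 e) = sigma s y *1 (e0 *1 e).
    by rewrite !rmulA ?sP ?Ee ?Ee0//= (comm1 (e := e0))// sP// Ee0.
  ring.
- exists h => // e w Pe Ww; have [_ ->] := mulP w e Ww Pe.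
  have [We Ye _] := Pe; have := cE w e Ww Pe; rewrite Eh// => Ec.
  rewrite [tproj e]surjective_pairing; move: Ec.
  set a := h _; set b := h _; set x := F (_ *1 _) => Ec.
  have -> : x = a - b + F e by rewrite Ec subrK.
  ring.
Qed.

End ASFunction.

(** For an invariant [F], the function [F ^+ p - F] lives on the base and is constant on the fibres
    of [pi], so a Frobenius power makes it a polynomial in [pi]. Subtracting the value of [F] on
    [sigma 0 y] removes the constant term. *)
Lemma polynomial_form : exists F m (c : 'I_m -> U2 -> k), [/\ as_function p iota W Y sigma F,
  forall i, @regular k V2 (c i), forall e w, P e -> W' w -> F (sigma w (q2 e) *1 e) = F e,
  forall w y, W' w -> Y y -> F (sigma w y) = 0 &
  forall e, P e -> F e ^+ p - F e = \sum_(i < m) c i (q2 e) * pi (q1 e) ^+ i.+1].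
Proof.
have [F asF] := as_function_exists chp Adiv iotaD iotaF sW sY kill_p trs.
have [h0 Oh0 inv0] := as_function_invariant asF.
set F0 := fun e => F e - h0 (tproj e) in inv0.
have as0 : as_function p iota W Y sigma F0 by exact: as_function_sub.
have {inv0} inv0 e w : P e -> W' w -> F0 (sigma w (q2 e) *1 e) = F0 e by exact: inv0.
have /choice[phi0 Ephi0] : forall z : U1 * U2, exists c, forall e, P e -> tproj e = z -> F0 e ^+ p - F0 e = c.
  move=> z; have [[e Pe Ee]|ne] := pselect (exists2 e, P e & tproj e = z).
    by exists (F0 e ^+ p - F0 e) => e' Pe' Ee'; apply: (as_function_wp as0) => //; rewrite Ee Ee'.
  by exists 0 => e Pe Ee; case: ne; exists e.
have [|Phi OPhi EPhi] := @regular_extend k _ _ cWY phi0.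
  apply: (descend1 (xi := fun z : subv cWY => sval z) (Psi := fun e => F0 e ^+ p - F0 e)).
  - exact: morphism_sval.
  - by move=> z; have [] := svalP z.
  - by move=> z; have [] := svalP z.
  - by move=> T' u pu Pu; case: as0 => _ H; apply: regB; [apply: regX|]; exact: H.
  - by move=> z e Pe Ee; rewrite (Ephi0 (sval z)).
have PhiE e : P e -> F0 e ^+ p - F0 e = Phi (tproj e).
  by move=> Pe; have [We Ye _] := Pe; rewrite EPhi//; apply: Ephi0.
have [w u y Ww Wu Yy wu|n [m [c [Oc Ec]]]] := fibre_const_family (V := V2) (Y := Y) chp sW dW Opi api ipi OPhi.
  have [e Pe Ee] := ptors_exists Wu Yy.
  have Wwu : W' (w - u).
    by split; [exact: zsubgroupB|rewrite (additive_onB sW)// wu subrr].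
  have Pe' : P (sigma (w - u) y *1 e) by apply: Pmul; rewrite ?sP ?Ee//; exact: Psig.
  have Ee' : tproj (sigma (w - u) y *1 e) = (w, y) by rewrite mul1_proj ?sP ?Ee//= subrK.
  have i0 := inv0 e (w - u) Pe Wwu; rewrite Ee /= in i0.
  by rewrite -Ee -Ee' -!PhiE// i0.
have as1 := as_function_frob as0 n; set F1 := fun e => F0 e ^+ (p ^ n) in as1.
have F1E e : P e -> F1 e ^+ p - F1 e = \sum_(i < m) c i (q2 e) * pi (q1 e) ^+ i.
  move=> Pe; have [We Ye _] := Pe; rewrite -Ec// -surjective_pairing -PhiE//.
  by rewrite (frobB _ _ _ chp) -!exprM mulnC.
have inv1 e w : P e -> W' w -> F1 (sigma w (q2 e) *1 e) = F1 e by move=> Pe Ww; rewrite /F1 inv0.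
have [|g Og Eg] := @regular_extend k _ _ cY (fun y => F1 (sigma 0 y)).
  case: as1 => _; apply; last by move=> z; apply: Psig => //; exact: (svalP z).
  case: trs => _ _ _; apply.
  - exact: morphism_cst.
  - exact: morphism_sval.
  - by [].
  - by move=> z; exact: (svalP z).
have pi0 : pi 0 = 0 := additive_on0 sW api.
pose F2 e := F1 e - g (q2 e).
have s0 y : Y y -> sigma 0 y = rone (lawG E) y.
  move=> Yy; apply: (@section0 _ _ _ _ E W' (fun x => sigma x y) y sW').
    by move=> x Wx; exact: sP.
  by move=> x x' Wx Wx'; exact: sD1.
have [m' [c' [Oc' Ec']]] : exists m' (c' : 'I_m' -> U2 -> k), (forall i, @regular k V2 (c' i)) /\
    forall w y, \sum_(i < m) c i y * pi w ^+ i - \sum_(i < m) c i y * 0 ^+ i = \sum_(i < m') c' i y * pi w ^+ i.+1.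
  clear -Oc; case: m c Oc => [|m] c Oc.
    by exists 0, (fun _ _ => 0); split=> [[]//|w y]; rewrite !big_ord0 subrr.
  exists m, (fun i => c (fintype.lift ord0 i)); split=> // w y.
  rewrite !big_ord_recl /= !expr0 [X in _ - (_ + X)]big1 ?addr0; last first.
    by move=> i _; rewrite expr0n /= mulr0.
  by rewrite addrAC subrr add0r.
exists F2, m', c'; split=> //.
- exact: (as_function_sub as1 (prod_regularr (X := V1) (Y := V2) Og)).
- move=> e w Pe Ww; have [_ Ye _] := Pe; rewrite /F2 inv1//.
  by rewrite mul1_proj ?sP.
- move=> w y Ww Yy; rewrite /F2 sP//= Eg//.
  have P0 := Psig W'0 Yy.
  have := inv1 _ _ P0 Ww; rewrite sP//= => <-.
  have -> : sigma w y *1 sigma 0 y = sigma w y by rewrite -sD1// addr0.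
  by rewrite subrr.
move=> e Pe; have [_ Ye _] := Pe.
have P0 := Psig W'0 Ye.
have := F1E _ P0; rewrite sP//= pi0 -Eg// => Eg0.
rewrite -Ec' -Eg0 -F1E// /F2.
have := frobB 1 (F1 e) (g (q2 e)) chp; rewrite expn1 => ->.
by ring.
Qed.

(** [artin_schreier_linear] with parameter in [Y]; the [d] it asks for is the additivity defect of
    [F] in [w]. Subtracting [h] from [F] leaves one monomial. *)
Lemma normal_form_weak : exists F M (alpha : U2 -> k), [/\ as_function p iota W Y sigma F,
  @regular k V2 alpha, forall w y, W' w -> Y y -> F (sigma w y) = 0 &
  forall e, P e -> F e ^+ p - F e = alpha (q2 e) * pi (q1 e) ^+ (p ^ M)].
Proof.
have [F [m [c [asF Oc inv F0 FE]]]] := polynomial_form.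
pose cY' (i : 'I_m) (y : subv cY) := c i (sval y).
have Oc' i : regular (cY' i) by exact: (morphism_sval cY (Oc i)).
have [[y Yy] u Wu|M [al [h [Oal Oh hf h0 hE]]]] := artin_schreier_linear chp sW dW Opi api ipi Oc'.
  have [|d Od Ed] := @regular_extend k _ _ cWc (fun w => defect1 F w u y).
    apply: (defect1_regular asF (x := fun z : subv cWc => sval z) (x' := fun=> u) (y := fun=> y)) => //.
    - exact: morphism_sval.
    - exact: morphism_cst.
    - exact: morphism_cst.
    - by move=> z; exact: (svalP z).
  have [eu Peu Eeu] := ptors_exists Wu Yy.
  exists d; split=> //.
  - move=> w v Ww Wv wv; rewrite !Ed//.
    have [e Pe Ee] := ptors_exists Wv Yy.
    have Wwv : W' (w - v).
      by split; [exact: zsubgroupB|rewrite (additive_onB sW)// wv subrr].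
    have Pe' : P (sigma (w - v) y *1 e) by apply: Pmul; rewrite ?sP ?Ee//; exact: Psig.
    have Ee' : tproj (sigma (w - v) y *1 e) = (w, y) by rewrite mul1_proj ?sP ?Ee//= subrK.
    have := defect1E asF Pe' Peu; rewrite Ee' Eeu /= => ->//.
    have := defect1E asF Pe Peu; rewrite Ee Eeu /= => ->//.
    have := inv e (w - v) Pe Wwv; rewrite Ee /= => ->.
    rewrite -rmulA ?sP ?Ee ?Eeu//.
    have Peeu : P (e *1 eu) by apply: Pmul; rewrite ?Ee ?Eeu.
    have Eeeu : tproj (e *1 eu) = (v + u, y) by rewrite mul1_proj ?Ee ?Eeu.
    by have := inv (e *1 eu) (w - v) Peeu Wwv; rewrite Eeeu /= => ->.
  - move=> w Ww; rewrite Ed//; have [e Pe Ee] := ptors_exists Ww Yy.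
    have Peeu : P (e *1 eu) by apply: Pmul; rewrite ?Ee ?Eeu.
    have Eeeu : tproj (e *1 eu) = (w + u, y) by rewrite mul1_proj ?Ee ?Eeu.
    have := defect1E asF Pe Peu; rewrite Ee Eeu /= => ->//.
    have := FE _ Peeu; have := FE _ Pe; have := FE _ Peu; rewrite Ee Eeu Eeeu /= => <- <- <-.
    have fB (a b : k) : (a - b) ^+ p = a ^+ p - b ^+ p by have := frobB 1 a b chp; rewrite expn1.
    by rewrite !fB; ring.
have [|al' Oal' Eal] := @regular_extend k _ _ cY (fun y => if pselect (Y y) is left Yy then al (exist _ y Yy) else 0).
  rewrite (_ : (fun _ => _) = al)//; apply/funext => -[y Yy] /=.
  by case: pselect => // Yy'; congr al; exact: eq_exist.
have {}Eal y (Yy : Y y) : al' y = al (exist _ y Yy).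
  by rewrite Eal//; case: pselect => // Yy'; congr al; exact: eq_exist.
have [J [a [b [Oa Ob Eab]]]] := prod_regularP Oh.
have /choice[b' Hb'] : forall j, exists b', @regular k V2 b' /\ forall y (Yy : Y y), b' y = b j (exist _ y Yy).
  move=> j; have [b' Ob' Eb'] := Ob j; exists b'; split=> // y Yy.
  by have := congr1 (fun u => u (exist _ y Yy)) Eb' => /= ->.
pose H (z : prodv V1 V2) := \sum_j a j z.1 * b' j z.2.
have OH : regular H by apply: prod_regular_sum => // j; have [] := Hb' j.
have HE w y (Yy : Y y) : H (w, y) = h w (exist _ y Yy).
  by rewrite /H (Eab w (exist _ y Yy)); apply: eq_bigr => j _; have [_ ->] := Hb' j.
exists (fun e => F e - H (tproj e)), M, al'; split=> //.
- exact: as_function_sub.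
- by move=> w y Ww Yy; rewrite F0// sP// HE h0 ?subrr//; case: Ww.
move=> e Pe; have [We Ye _] := Pe.
have fB (x z : k) : (x - z) ^+ p = x ^+ p - z ^+ p by have := frobB 1 x z chp; rewrite expn1.
rewrite fB {1 2}[tproj e]surjective_pairing HE Eal.
have := hE (q1 e) (exist _ (q2 e) Ye); rewrite -FE//=.
set x := h _ _; set z := _ * _ ^+ (_ ^ _) => Ex.
rewrite -[in LHS](subrK (x ^+ p - x + z) (F e ^+ p)).
have -> : z = F e ^+ p - F e - (x ^+ p - x) by rewrite Ex; ring.
ring.
Qed.

Definition normal_form F M (alpha : U2 -> k) :=
  [/\ [/\ as_function p iota W Y sigma F, @regular k V2 alpha & additive_on Y alpha],
  forall e e', P e -> P e' -> q2 e = q2 e' -> F (e *1 e') = F e + F e',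
  forall e e', P e -> P e' -> q1 e = q1 e' -> F (e *2 e') = F e + F e',
  forall w y, W' w -> Y y -> F (sigma w y) = 0 &
  forall e, P e -> F e ^+ p - F e = alpha (q2 e) * pi (q1 e) ^+ (p ^ M)].

(** The defect of [F] for the first law is fixed by Frobenius, hence constant, and zero on [sigma].
    For fixed [y] and [y'], the defect [d] for the second law depends only on [w], is additive by
    the interchange law, vanishes with [pi], and solves an Artin-Schreier equation whose right side
    is the defect of [alpha] times [pi ^+ (p ^ M)]; both are zero by [artin_schreier_trivial]. *)
Lemma normal_form_exists : exists F M alpha, normal_form F M alpha.
Proof.
have [F [M [al [asF Oal F0 FE]]]] := normal_form_weak.
have fB (a b : k) : (a - b) ^+ p = a ^+ p - b ^+ p by have := frobB 1 a b chp; rewrite expn1.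
have fD (a b : k) : (a + b) ^+ (p ^ M) = a ^+ (p ^ M) + b ^+ (p ^ M) by exact: frobD.
have s0 y : Y y -> sigma 0 y = rone (lawG E) y.
  move=> Yy; apply: (@section0 _ _ _ _ E W' (fun x => sigma x y) y sW').
    by move=> x Wx; exact: sP.
  by move=> x x' Wx Wx'; exact: sD1.
have F1 e e' : P e -> P e' -> q2 e = q2 e' -> F (e *1 e') = F e + F e'.
  move=> Pe Pe' ee'; have [We Ye _] := Pe; have [We' Ye' _] := Pe'.
  have [|d Od Ed] := @regular_extend k _ _ cWc (fun w => defect1 F w (q1 e') (q2 e')).
    apply: (defect1_regular asF (x := fun z : subv cWc => sval z) (x' := fun=> q1 e') (y := fun=> q2 e')) => //.
    - exact: morphism_sval.
    - exact: morphism_cst.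
    - exact: morphism_cst.
    - by move=> z; exact: (svalP z).
  have dE e1 : P e1 -> q2 e1 = q2 e' -> d (q1 e1) = F (e1 *1 e') - F e1 - F e'.
    by move=> Pe1 h1; have [We1 _ _] := Pe1; rewrite Ed// -h1 defect1E.
  have d0 : d 0 = 0.
    have := dE _ (Psig W'0 Ye'); rewrite sP//= => ->//.
    by rewrite F0// s0// rmul1e subr0 subrr.
  have dp w : W w -> d w ^+ p = d w.
    move=> Ww; have [e1 Pe1 Ee1] := ptors_exists Ww Ye'.
    have Pe1e : P (e1 *1 e') by apply: Pmul; rewrite ?Ee1.
    have := dE e1 Pe1; rewrite Ee1 /= => ->//.
    have := FE _ Pe1e; have := FE _ Pe1; have := FE _ Pe'.
    rewrite mul1_proj ?Ee1//= api// fD mulrDr => <- <- Ex.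
    apply/eqP; rewrite -subr_eq0; apply/eqP; rewrite !fB.
    rewrite (_ : _ - _ = F (e1 *1 e') ^+ p - F (e1 *1 e') - (F e1 ^+ p - F e1 + (F e' ^+ p - F e'))); last by ring.
    by rewrite Ex subrr.
  have := frob_fixed_const chp dW Od dp We W0; rewrite d0 dE// => /eqP.
  by rewrite subr_eq0 subr_eq addrC => /eqP.
have F2 y y' : Y y -> Y y' -> (forall e e', P e -> P e' -> q1 e = q1 e' -> q2 e = y -> q2 e' = y' -> F (e *2 e') = F e + F e')
   /\ al (y + y') = al y + al y'.
  move=> Yy Yy'.
  have /choice[D ED] : forall w, exists c, forall e e', P e -> P e' -> tproj e = (w, y) -> tproj e' = (w, y') ->
     F (e *2 e') - F e - F e' = c.
    move=> w; have [[e [e' [Pe Pe' Ee Ee']]]|ne] := pselect (exists e e', [/\ P e, P e', tproj e = (w, y) & tproj e' = (w, y')]).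
      exists (F (e *2 e') - F e - F e') => e1 e1' Pe1 Pe1' Ee1 Ee1'.
      have [|a [ap -> ->]] := as_move asF Pe Pe1; first by rewrite Ee1.
      have [|a' [ap' -> ->]] := as_move asF Pe' Pe1'; first by rewrite Ee1'.
      have ee' : q1 e = q1 e' by rewrite Ee Ee'.
      have Pee := Pmul2 Pe Pe' ee'.
      rewrite act_mul//; case: asF => H1 _; rewrite (H1 _ _ Pee); last by rewrite mulrnDl ap ap' addr0.
      by rewrite iotaD//; ring.
    by exists 0 => e e' Pe Pe' Ee Ee'; case: ne; exists e, e'.
  have [|d Od Ed] := @regular_extend k _ _ cWc D.
    apply: (descend2 (xi := fun z : subv cWc => (sval z, y)) (xi' := fun z : subv cWc => (sval z, y'))
      (Psi := fun e e' => F (e *2 e') - F e - F e')) => //.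
    - by apply: morphism_pair; [exact: morphism_sval|exact: morphism_cst].
    - by apply: morphism_pair; [exact: morphism_sval|exact: morphism_cst].
    - by move=> z; exact: (svalP z).
    - by move=> z; exact: (svalP z).
    - move=> T' u u' pu pu' Pu Pu' H; have uu t : q1 (u t) = q1 (u' t).
        by have [t0 [-> ->]] := H t.
      case: asF => _ H'; apply: regB; [apply: regB|]; apply: H' => //.
        by apply: rmul_plot.
      by move=> t; apply: Pmul2.
    - by move=> t e e' Pe Pe' Ee Ee'; rewrite (ED (sval t)).
  have dE e e' : P e -> P e' -> q1 e = q1 e' -> q2 e = y -> q2 e' = y' -> F (e *2 e') - F e - F e' = d (q1 e).
    move=> Pe Pe' ee' ey ey'; have [We _ _] := Pe.
    rewrite Ed//; apply: ED => //; apply: tproj_eq => //.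
  have api_d : additive_on W d.
    move=> w1 w2 Ww1 Ww2.
    have [e1 Pe1 Ee1] := ptors_exists Ww1 Yy; have [e1' Pe1' Ee1'] := ptors_exists Ww1 Yy'.
    have [e2 Pe2 Ee2] := ptors_exists Ww2 Yy; have [e2' Pe2' Ee2'] := ptors_exists Ww2 Yy'.
    have PA : P (e1 *1 e2) by apply: Pmul; rewrite ?Ee1 ?Ee2.
    have PB : P (e1' *1 e2') by apply: Pmul; rewrite ?Ee1' ?Ee2'.
    have PC : P (e1 *2 e1') by apply: Pmul2; rewrite ?Ee1 ?Ee1'.
    have PD : P (e2 *2 e2') by apply: Pmul2; rewrite ?Ee2 ?Ee2'.
    have EA : tproj (e1 *1 e2) = (w1 + w2, y) by rewrite mul1_proj ?Ee1 ?Ee2.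
    have EB : tproj (e1' *1 e2') = (w1 + w2, y') by rewrite mul1_proj ?Ee1' ?Ee2'.
    have := dE _ _ PA PB; rewrite EA EB /= => <-//.
    have := dE _ _ Pe1 Pe1'; rewrite Ee1 Ee1' /= => <-//.
    have := dE _ _ Pe2 Pe2'; rewrite Ee2 Ee2' /= => <-//.
    rewrite Defs.interchange ?Ee1 ?Ee1' ?Ee2 ?Ee2'// F1//; last by rewrite !mul2_proj ?Ee1 ?Ee1' ?Ee2 ?Ee2'.
    by rewrite !F1 ?Ee1 ?Ee1' ?Ee2 ?Ee2'//; ring.
  have dpi w : W w -> pi w = 0 -> d w = 0.
    move=> Ww w0; have Wp : W' w by split.
    have := dE _ _ (Psig Wp Yy) (Psig Wp Yy'); rewrite !sP//= => <-//.
    by rewrite -sD2// !F0//; [rewrite !subr0|exact: zsubgroupD].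
  have dp w : W w -> d w ^+ p - d w = (al (y + y') - al y - al y') * pi w ^+ (p ^ M).
    move=> Ww; have [e Pe Ee] := ptors_exists Ww Yy; have [e' Pe' Ee'] := ptors_exists Ww Yy'.
    have Pee : P (e *2 e') by apply: Pmul2; rewrite ?Ee ?Ee'.
    have := dE _ _ Pe Pe'; rewrite Ee Ee' /= => <-//.
    have := FE _ Pee; have := FE _ Pe; have := FE _ Pe'; rewrite mul2_proj ?Ee ?Ee'//= => E1 E2 E3.
    by rewrite !mulrBl -E1 -E2 -E3 !fB; ring.
  have pM : (0 < p ^ M)%N by rewrite expn_gt0 prime_gt0.
  have [dz cz] := artin_schreier_trivial pp pM cW Od api_d dp dpi.
  split.
    move=> e e' Pe Pe' ee' ey ey'; have [We _ _] := Pe.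
    have := dE _ _ Pe Pe' ee' ey ey'; rewrite dz// => /eqP.
    by rewrite subr_eq0 subr_eq addrC => /eqP.
  have [w Ww w1] := additive_surj sW Opi api ipi 1.
  by have := cz w Ww; rewrite w1 expr1n mulr1 -addrA -opprD => /eqP; rewrite subr_eq0 => /eqP.
exists F, M, al; split=> //; first by split=> // y y' Yy Yy'; have [_] := F2 y y' Yy Yy'.
move=> e e' Pe Pe' ee'; have [_ Ye _] := Pe; have [_ Ye' _] := Pe'.
by have [H _] := F2 _ _ Ye Ye'; exact: H.
Qed.

End NormalForm.

(** * Induction along the filtration *)

Section Swap.
Variables (k : closedFieldType) (U1 U2 : calg_group k) (A : zmodType) (E : biextension U1 U2 A).
Local Notation V1 := (cag_var U1).
Local Notation V2 := (cag_var U2).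

Definition swap_proj (e : E) : prodv V2 V1 := ((tproj e).2, (tproj e).1).

Lemma morphism_swap : @morphism k (prodv V2 V1) (prodv V1 V2) (fun z => (z.2, z.1)).
Proof. by apply: morphism_pair; [exact: morphism_snd|exact: morphism_fst]. Qed.

Lemma swap_simply_transitive e e' : swap_proj e = swap_proj e' -> exists! a, e' = act a e.
Proof.
move=> [h2 h1]; apply: act_simply_transitive.
by rewrite [LHS]surjective_pairing h1 h2 -surjective_pairing.
Qed.

Lemma swap_plot_proj (T : variety k) (s : T -> E) : plot s -> morphism (swap_proj \o s).
Proof.
move=> ps; have mp := plot_proj ps; apply: morphism_pair.
  exact: (morphism_comp (@morphism_snd k V1 V2) mp).
exact: (morphism_comp (@morphism_fst k V1 V2) mp).
Qed.

Lemma swap_locally_trivial : exists (C : Defs.cover (prodv V2 V1)) (s : C -> E),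
  [/\ set_surj setT setT (@cov_map _ _ C), plot s & forall c, swap_proj (s c) = cov_map c].
Proof.
have [T [g [u [eg sg pu Eu]]]] := torsor_lift E morphism_swap.
exists (Cover eg), u; split=> // t.
by rewrite /swap_proj Eu /= -surjective_pairing.
Qed.

Definition swap_torsor : torsor (prodv V2 V1) A :=
  @Torsor k (prodv V2 V1) A E (@plot _ _ _ E) swap_proj (@act _ _ _ E) (@act0 _ _ _ E) (@actD _ _ _ E)
    (fun a e => congr1 (fun z : prodv V1 V2 => (z.2, z.1)) (tproj_act a e)) swap_simply_transitive swap_plot_proj
    (@plot_comp _ _ _ E) (@plot_descent _ _ _ E) (@plot_act _ _ _ E) (@plot_diff _ _ _ E) swap_locally_trivial.

Definition swap_lawG : @relative_extension k (prodv V2 V1) V1 U2 A swap_torsor fst snd :=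
  let L := lawH E in
  @RelativeExtension k (prodv V2 V1) V1 U2 A swap_torsor fst snd (rmul L) (rone L) (rinv L)
   (rmul_base L) (rmul_proj L) (rone_base L) (rone_proj L) (rinv_base L) (rmulA L) (rmul1e L)
   (rmule1 L) (rmulVe L) (rmuleV L) (rmul_actl L) (rmul_actr L) (rmul_plot L) (rone_plot L) (rinv_plot L).

Definition swap_lawH : @relative_extension k (prodv V2 V1) V2 U1 A swap_torsor snd fst :=
  let L := lawG E in
  @RelativeExtension k (prodv V2 V1) V2 U1 A swap_torsor snd fst (rmul L) (rone L) (rinv L)
   (rmul_base L) (rmul_proj L) (rone_base L) (rone_proj L) (rinv_base L) (rmulA L) (rmul1e L)
   (rmule1 L) (rmulVe L) (rmuleV L) (rmul_actl L) (rmul_actr L) (rmul_plot L) (rone_plot L) (rinv_plot L).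

Definition swap_biextension : biextension U2 U1 A.
Proof.
refine (@Biextension k U2 U1 A swap_torsor swap_lawG swap_lawH _) => e1 e2 e3 e4 h12 h34 h13 h24.
exact: (esym (@Defs.interchange _ _ _ _ E e1 e3 e2 e4 h13 h24 h12 h34)).
Defined.

Lemma swap_trivializes L M (s : U1 -> U2 -> E) : trivializes L M s ->
  trivializes (E := swap_biextension) M L (fun y x => s x y).
Proof.
case=> sP sD1 sD2 splot; split=> //.
- by move=> y x My Lx; rewrite /= /swap_proj sP.
- by move=> y y' x My My' Lx; exact: sD2.
- by move=> y x x' My Lx Lx'; exact: sD1.
- by move=> T v u mv mu Mv Lu; exact: (splot T u v).
Qed.

End Swap.

Section Uniqueness.
Variables (k : closedFieldType) (U1 U2 : calg_group k) (A : zmodType) (E : biextension U1 U2 A).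
Local Notation V1 := (cag_var U1).
Local Notation V2 := (cag_var U2).
Hypotheses (uG1 : unipotent U1) (uG2 : unipotent U2).

Lemma trivializes_sub L L' M M' (s : U1 -> U2 -> E) : L' `<=` L -> M' `<=` M ->
  trivializes L M s -> trivializes L' M' s.
Proof.
move=> LL MM [sP sD1 sD2 splot]; split.
- by move=> x y /LL Lx /MM My; exact: sP.
- by move=> x x' y /LL Lx /LL Lx' /MM My; exact: sD1.
- by move=> x y y' /LL Lx /MM My /MM My'; exact: sD2.
- by move=> T u v mu mv Lu Mv; apply: splot => // t; [exact/LL/Lu|exact/MM/Mv].
Qed.

(** Only [L] has to be connected: the comparison is made for each [y] separately. *)
Lemma trivializes_eq1 (L : set U1) (M : set U2) (s s' : U1 -> U2 -> E) : conn L ->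
  trivializes L M s -> trivializes L M s' -> forall x y, L x -> M y -> s x y = s' x y.
Proof.
move=> cL [sP sD1 sD2 splot] [sP' sD1' sD2' splot'] x y Lx My.
have [sL _] := cL; have clL : @zclosed k V1 L := zsubgroup_closed sL.
have ps (r : U1 -> U2 -> E) : (forall (T : variety k) (u : T -> V1) (v : T -> V2),
    morphism u -> morphism v -> (forall t, L (u t)) -> (forall t, M (v t)) -> plot (fun t => r (u t) (v t))) ->
    plot (fun t : subv clL => r (sval t) y).
  move=> H; apply: (H _ (fun t : subv clL => sval t) (fun=> y)) => //.
  - exact: morphism_sval.
  - exact: morphism_cst.
  - by move=> t; exact: (svalP t).
apply: (@section_unique _ _ _ _ E L clL (fun x => s x y) (fun x => s' x y) y sL (conn_domain uG1 cL)) => //.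
- exact: ps.
- exact: ps.
- by move=> z Lz; exact: sP.
- by move=> z Lz; exact: sP'.
- by move=> z z' Lz Lz'; exact: sD1.
- by move=> z z' Lz Lz'; exact: sD1'.
Qed.

End Uniqueness.

Lemma trivializes_eq2 (k : closedFieldType) (U1 U2 : calg_group k) (A : zmodType) (E : biextension U1 U2 A)
    (L : set U1) (M : set U2) (s s' : U1 -> U2 -> E) : unipotent U2 -> conn M ->
  trivializes L M s -> trivializes L M s' -> forall x y, L x -> M y -> s x y = s' x y.
Proof.
move=> uG2 cM /swap_trivializes ts /swap_trivializes ts' x y Lx My.
exact: (trivializes_eq1 uG2 cM ts ts' My Lx).
Qed.

(** The naturals below [p] already give [p] roots of ['X^p - 'X]. *)
Lemma frob_fixed_nat (k : fieldType) p (x : k) : p \in [pchar k] -> x ^+ p = x -> exists j : nat, x = j%:R.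
Proof.
move=> chp xp; have pp := pcharf_prime chp.
pose P : {poly k} := 'X^p - 'X.
have sP : size P = p.+1.
  by rewrite size_polyDl ?size_polyXn// size_polyN size_polyX ltnS prime_gt1.
pose s := [seq j%:R | j <- iota 0 p] : seq k.
have us : uniq s.
  rewrite map_inj_in_uniq ?iota_uniq// => i j; rewrite !mem_iota !add0n /= => ip jp.
  wlog ij : i j ip jp / (i <= j)%N.
    by move=> H; case/orP: (leq_total i j) => h ?; [|symmetry]; apply: H.
  move=> /esym/eqP; rewrite -subr_eq0 -natrB// -(dvdn_pcharf chp) => d.
  have := leq_ltn_trans (leq_subr i j) jp; move: d; case E : (j - i)%N => [|n] d.
    by move=> _; apply/eqP; rewrite eqn_leq ij /= -subn_eq0 E.
  by move=> h; have := dvdn_leq (ltn0Sn n) d; rewrite leqNgt h.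
have [/mapP[j _ ->]|xs] := boolP (x \in s); first by exists j.
have rP : all (root P) (x :: s).
  rewrite /= rootE !hornerE xp subrr eqxx /=; apply/allP => _ /mapP[j _ ->].
  have jF : (j%:R : k) ^+ p = j%:R by have := rmorph_nat (pFrobenius_aut chp) j.
  by rewrite rootE !hornerE jF subrr.
have := max_poly_roots (p := P) _ rP; rewrite sP /= xs us /= size_map size_iota ltnn.
by move=> /(_ _ isT); rewrite -size_poly_gt0 sP => /(_ isT).
Qed.

Section SubClosed.
Variables (H V : zmodType) (Q : set H) (f : H -> V).
Hypothesis QB : forall y y', Q y -> Q y' -> Q (y - y').
Hypothesis fB : forall y y', Q y -> Q y' -> f (y - y') = f y - f y'.

Lemma sub_closed0 y : Q y -> Q 0. Proof. by move=> Qy; rewrite -(subrr y); exact: QB. Qed.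

Lemma sub_closedN y : Q y -> Q (- y).
Proof. by move=> Qy; rewrite -sub0r; apply: QB => //; exact: (sub_closed0 Qy). Qed.

Lemma sub_closedD y y' : Q y -> Q y' -> Q (y + y').
Proof. by move=> Qy Qy'; rewrite -[y']opprK; apply: QB => //; exact: sub_closedN. Qed.

Lemma sub_closedMn y n : Q y -> Q (y *+ n).
Proof.
move=> Qy; elim: n => [|n IHn]; first by rewrite mulr0n; exact: (sub_closed0 Qy).
by rewrite mulrSr; exact: sub_closedD.
Qed.

Lemma sub_additiveN y : Q y -> f (- y) = - f y.
Proof.
move=> Qy; have Q0 := sub_closed0 Qy.
by rewrite -[- y]sub0r fB// -(subrr (0 : H)) fB// subrr sub0r.
Qed.

Lemma sub_additiveD y y' : Q y -> Q y' -> f (y + y') = f y + f y'.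
Proof.
move=> Qy Qy'; have QN := sub_closedN Qy'.
by rewrite -{1}[y']opprK fB// sub_additiveN// opprK.
Qed.

Lemma sub_additiveMn y n : Q y -> f (y *+ n) = f y *+ n.
Proof.
move=> Qy; elim: n => [|n IHn]; last by rewrite !mulrSr sub_additiveD ?IHn//; exact: sub_closedMn.
by rewrite !mulr0n -(subrr y) fB// subrr.
Qed.

End SubClosed.

(* Duality over the prime field: a functional vanishing on the common kernel of the
   [b x] is one of them on any finite set. *)
Lemma realize_functional (k : fieldType) (p : nat) (G H : zmodType) (X : set G) (Y : set H) (b : G -> H -> k) (f : H -> k)
    (s : seq H) : p \in [pchar k] ->
  X 0 -> (forall x x', X x -> X x' -> X (x - x')) ->
  (forall y y', Y y -> Y y' -> Y (y - y')) ->
  (forall x x' y, X x -> X x' -> Y y -> b (x - x') y = b x y - b x' y) ->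
  (forall x y y', X x -> Y y -> Y y' -> b x (y - y') = b x y - b x y') ->
  (forall y y', Y y -> Y y' -> f (y - y') = f y - f y') ->
  (forall x y, X x -> Y y -> b x y ^+ p = b x y) -> (forall y, Y y -> f y ^+ p = f y) ->
  (forall y, Y y -> (forall x, X x -> b x y = 0) -> f y = 0) ->
  exists2 x, X x & forall y, y \in s -> Y y -> b x y = f y.
Proof.
move=> chp; elim: s X f => [|y1 s IH] X f X0 XB YB bB1 bB2 fB bp fp bf; first by exists 0.
have [Y1|Y1] := pselect (Y y1); last first.
  have [x Xx Ex] := IH X f X0 XB YB bB1 bB2 fB bp fp bf.
  by exists x => // y; rewrite inE => /orP[/eqP->|ys] Yy; [by case: Y1|exact: Ex].
have [[x1 [Xx1 nz]]|b1] := pselect (exists x, X x /\ b x y1 != 0); last first.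
  have b10 x : X x -> b x y1 = 0.
    by move=> Xx; apply/eqP/negPn/negP => nz; apply: b1; exists x.
  have [x Xx Ex] := IH X f X0 XB YB bB1 bB2 fB bp fp bf.
  exists x => // y; rewrite inE => /orP[/eqP->|ys] Yy; [by rewrite b10// bf|exact: Ex].
have XMn x n : X x -> X (x *+ n) by exact: sub_closedMn.
have YMn y n : Y y -> Y (y *+ n) by exact: sub_closedMn.
have XN x : X x -> X (- x) by exact: sub_closedN.
have bMn x y n : X x -> Y y -> b (x *+ n) y = b x y *+ n.
  by move=> Xx Yy; apply: (sub_additiveMn (Q := X) (f := b^~ y)) => // x' x'' Xx' Xx''; exact: bB1.
have bN x y : X x -> Y y -> b (- x) y = - b x y.
  by move=> Xx Yy; apply: (sub_additiveN (Q := X) (f := b^~ y)) => // x' x'' Xx' Xx''; exact: bB1.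
have b0x y : Y y -> b 0 y = 0 by move=> Yy; rewrite -(subrr (0 : G)) bB1// subrr.
have bMn2 x y n : X x -> Y y -> b x (y *+ n) = b x y *+ n.
  by move=> Xx Yy; apply: (sub_additiveMn (Q := Y) (f := b x)) => // y' y'' Yy' Yy''; exact: bB2.
have fMn y n : Y y -> f (y *+ n) = f y *+ n by exact: sub_additiveMn.
(* The value at [y1] lies in the prime field, so a multiple of [x1] normalizes it to 1. *)
have {x1 Xx1 nz} [x1 Xx1 x11] : exists2 x1, X x1 & b x1 y1 = 1.
  have bip : (b x1 y1)^-1 ^+ p = (b x1 y1)^-1 by rewrite exprVn bp.
  have [j Ej] := frob_fixed_nat chp bip.
  exists (x1 *+ j); first exact: XMn.
  by rewrite bMn// -mulr_natr -Ej divff.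
have [j Ej] := frob_fixed_nat chp (fp _ Y1).
(* After subtracting the part of [f] along [y1], the rest is realized inside the annihilator of
   [y1]. *)
pose f' y := f y - b (x1 *+ j) y.
have Xj : X (x1 *+ j) by exact: XMn.
have f'1 : f' y1 = 0 by rewrite /f' bMn// x11 -Ej subrr.
have frB (u v : k) : (u - v) ^+ p = u ^+ p - v ^+ p by have := frobB 1 u v chp; rewrite expn1.
have f'B y y' : Y y -> Y y' -> f' (y - y') = f' y - f' y'.
  by move=> Yy Yy'; rewrite /f' fB// bB2//; ring.
have [|||||||||x [Xx x1y] Ex] := IH [set x | X x /\ b x y1 = 0] f'.
- by split=> //; exact: b0x.
- by move=> x x' [Xx xy] [Xx' xy']; split; [exact: XB|rewrite bB1// xy xy' subrr].
- by [].
- by move=> x x' y [Xx _] [Xx' _]; exact: bB1.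
- by move=> x y y' [Xx _]; exact: bB2.
- by [].
- by move=> x y [Xx _]; exact: bp.
- by move=> y Yy; rewrite /f' frB fp// bp.
(* [y - y1 *+ n] is orthogonal to [x1] as well as to the annihilator of [y1], hence to all of [X],
   so [f] kills it. *)
- move=> y Yy Hy; have [n En] := frob_fixed_nat chp (bp _ _ Xx1 Yy).
  have Yn : Y (y1 *+ n) by exact: YMn.
  have Y' : Y (y - y1 *+ n) by exact: YB.
  have fy' : f (y - y1 *+ n) = 0.
    apply: bf => // x Xx; have [m Em] := frob_fixed_nat chp (bp _ _ Xx Y1).
    have Xm : X (x1 *+ m) by exact: XMn.
    have h : b (x - x1 *+ m) y = 0.
      by apply: Hy; split; [exact: XB|rewrite bB1// bMn// x11 Em subrr].
    move: h; rewrite bB1// bMn// En => /eqP; rewrite subr_eq0 => /eqP h.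
    by rewrite bB2// bMn2// h Em -[n%:R *+ m]mulr_natr -[m%:R *+ n]mulr_natr mulrC subrr.
  have : f' (y - y1 *+ n) = 0.
    rewrite /f' fy' bMn// bB2// bMn2// x11 En subrr mul0rn subrr//.
  rewrite f'B// => /eqP; rewrite subr_eq0 => /eqP ->.
  by rewrite /f' fMn// bMn2// -mulrnBl -/(f' y1) f'1 mul0rn.
exists (x + x1 *+ j).
  by rewrite -[x1 *+ j]opprK; apply: (XB) => //; exact: XN.
have bD y : Y y -> b (x + x1 *+ j) y = b x y + b (x1 *+ j) y.
  move=> Yy; rewrite -[x1 *+ j in LHS]opprK bB1 ?bN ?opprK//; exact: XN.
move=> y; rewrite inE => /orP[/eqP->|ys] Yy; rewrite bD//.
  by rewrite x1y add0r bMn// x11 -Ej.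
by rewrite Ex// /f' subrK.
Qed.

Section Difference.
Variables (k : closedFieldType) (U1 U2 : calg_group k) (A : zmodType) (E : biextension U1 U2 A).
Variables (L : set U1) (M : set U2) (s s' : U1 -> U2 -> E).
Hypotheses (sL : zsubgroup L) (sM : zsubgroup M) (trs : trivializes L M s) (trs' : trivializes L M s').

Definition trdiff x y := tdiff (s x y) (s' x y).

Lemma trdiffE x y : L x -> M y -> s' x y = act (trdiff x y) (s x y).
Proof. by move=> Lx My; apply: tdiffE; case: trs => -> //; case: trs' => ->. Qed.

Lemma trdiff_eq0 x y : L x -> M y -> trdiff x y = 0 <-> s' x y = s x y.
Proof.
move=> Lx My; split=> [e0|E0]; first by rewrite trdiffE// e0 act0.
by apply: (@act_inj _ _ _ _ (s x y)); rewrite -trdiffE// act0.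
Qed.

Lemma trdiffD1 x x' y : L x -> L x' -> M y -> trdiff (x + x') y = trdiff x y + trdiff x' y.
Proof.
move=> Lx Lx' My; apply: (@act_inj _ _ _ _ (s (x + x') y)).
rewrite -trdiffE//; last exact: zsubgroupD.
case: trs => P D1 _ _; case: trs' => _ D1' _ _; rewrite D1' ?D1// !trdiffE//.
by rewrite act_mul// !P.
Qed.

Lemma trdiffD2 x y y' : L x -> M y -> M y' -> trdiff x (y + y') = trdiff x y + trdiff x y'.
Proof.
move=> Lx My My'; apply: (@act_inj _ _ _ _ (s x (y + y'))).
rewrite -trdiffE//; last exact: zsubgroupD.
case: trs => P _ D2 _; case: trs' => _ _ D2' _; rewrite D2' ?D2// !trdiffE//.
by rewrite act_mul// !P.
Qed.

Lemma trdiffB1 x x' y : L x -> L x' -> M y -> trdiff (x - x') y = trdiff x y - trdiff x' y.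
Proof.
move=> Lx Lx' My; have := trdiffD1 (zsubgroupB sL Lx Lx') Lx' My.
by rewrite subrK => ->; rewrite addrK.
Qed.

Lemma trdiffB2 x y y' : L x -> M y -> M y' -> trdiff x (y - y') = trdiff x y - trdiff x y'.
Proof.
move=> Lx My My'; have := trdiffD2 Lx (zsubgroupB sM My My') My'.
by rewrite subrK => ->; rewrite addrK.
Qed.

End Difference.

Lemma trivial_trivializes (k : closedFieldType) (U1 U2 : calg_group k) (A : zmodType) (E : biextension U1 U2 A) :
  trivializes [set 0] setT (fun _ y => rone (lawG E) y).
Proof.
split.
- move=> x y -> _; apply: tproj_eq; [exact: (rone_proj (lawG E))|exact: (rone_base (lawG E))].
- move=> x x' y _ _ _.
  by have := rmule1 (lawG E) (rone (lawG E) y); rewrite (rone_base (lawG E)) => ->.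
- by move=> x y y' _ _ _; exact: one1_mul2.
- by move=> T u v _ mv _ _; exact: (rone_plot (lawG E) mv).
Qed.

Section Extension.
Variables (k : closedFieldType) (U1 U2 : calg_group k) (A : zmodType) (E : biextension U1 U2 A).
Local Notation V1 := (cag_var U1).
Local Notation V2 := (cag_var U2).
Local Notation q1 e := ((@tproj _ _ _ E e).1 : U1).
Local Notation q2 e := ((@tproj _ _ _ E e).2 : U2).
Local Notation "e *1 e'" := (rmul (lawG E) e e') (at level 50).
Local Notation "e *2 e'" := (rmul (lawH E) e e') (at level 50).

Variables (p : nat) (iota : A -> k).
Hypothesis chp : p \in [pchar k].
Hypothesis Adiv : forall a : A, exists b, b *+ p = a.
Hypothesis iotaD : forall a b : A, a *+ p = 0 -> b *+ p = 0 -> iota (a + b) = iota a + iota b.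
Hypothesis iota_inj : forall a : A, a *+ p = 0 -> iota a = 0 -> a = 0.
Hypothesis iotaF : forall a : A, a *+ p = 0 -> iota a ^+ p = iota a.
Hypothesis iota_surj : forall x : k, x ^+ p = x -> exists2 a, a *+ p = 0 & iota a = x.
Hypotheses (uG1 : unipotent U1) (uG2 : unipotent U2).
Hypotheses (c1 : conn [set: U1]) (c2 : conn [set: U2]).
Variables (K : set U1) (sigma1 : U1 -> U2 -> E).
Hypotheses (sK : zsubgroup K) (tr1 : trivializes K setT sigma1).

Let pp : prime p. Proof. exact: pcharf_prime chp. Qed.
Let irr1 : irreducible_variety V1.
Proof. by apply: irreducible_domain; exact: conn_domain. Qed.

(** The induction statement. Its third clause forces [Y] to be the whole locus where [E] splits over
    [W]; the last is quantified over all values [a], [b], [c], [u] because dimension is a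
    relation. *)
Definition level (W : set U1) (Y : set U2) (sigma : U1 -> U2 -> E) :=
  [/\ zsubgroup Y, trivializes W Y sigma,
  forall y (s : U1 -> E) (clW : @zclosed k V1 W), plot (fun t : subv clW => s (sval t)) ->
    (forall x, W x -> tproj (s x) = (x, y)) ->
    (forall x x', W x -> W x' -> s (x + x') = s x *1 s x') -> Y y &
  forall a b c u, hasdim W a -> hasdim (id_comp Y) b -> hasdim (id_comp (K `&` W)) c -> hasdim [set: U2] u ->
    (c + u <= a + b)%N /\ ((c + u = a + b)%N -> forall x, K x -> W x ->
       (forall y, Y y -> sigma1 x y = sigma x y) -> id_comp (K `&` W) x)].

Lemma conn_triv (G : calg_group k) : conn [set (0 : G)].
Proof.
split; first exact: zsubgroup_triv.
by move=> H sH _ _ x ->; exact: zsubgroup0.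
Qed.

Lemma level0 : level [set 0] setT (fun _ y => rone (lawG E) y).
Proof.
split.
- exact: zsubgroupT.
- exact: trivial_trivializes.
- by [].
have -> : K `&` [set 0] = [set 0].
  by apply/seteqP; split=> [x []//|x ->]; split=> //; exact: zsubgroup0.
move=> a b c u; rewrite (id_comp_conn uG1 (conn_triv U1)) (id_comp_conn uG2 c2) => ha hb hc hu.
have -> : c = 0%N := hasdim_unique uG1 hc (hasdim0 _).
by rewrite (hasdim_unique uG2 hu hb) leq_addl; split=> // _ x _ ->.
Qed.

(** * The induction step from the kernel of [pi] to [W] *)

Section Step.
Variables (W : set U1) (pi : U1 -> k) (Y : set U2) (sigma : U1 -> U2 -> E).
Notation W' := (ker_on W pi).
Hypotheses (cW : conn W) (Opi : @regular k V1 pi) (api : additive_on W pi) (ipi : infinite_image W pi).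
Hypotheses (cW' : conn W') (lev : level W' Y sigma).

Let sW : zsubgroup W. Proof. by case: cW. Qed.
Let sW' : zsubgroup W'. Proof. by case: cW'. Qed.
Let W'W : W' `<=` W. Proof. by move=> x []. Qed.
Let sY : zsubgroup Y. Proof. by case: lev. Qed.
Let trs : trivializes W' Y sigma. Proof. by case: lev. Qed.
Let sP x y : W' x -> Y y -> tproj (sigma x y) = (x, y). Proof. by case: trs => H _ _ _; exact: H. Qed.
Notation P := (ptors p W Y sigma).
Let Psig x y : W' x -> Y y -> P (sigma x y).
Proof. exact: (ptors_sigma p sW' W'W trs). Qed.
Let kill w : W w -> W' (w *+ p).
Proof. by move=> Ww; exact: (kill_p chp cW api). Qed.

Variables (F : E -> k) (M : nat) (alpha : U2 -> k).
Hypothesis nF : normal_form p iota W Y sigma pi F M alpha.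
Let asF : as_function p iota W Y sigma F. Proof. by case: nF => -[]. Qed.
Let Oal : @regular k V2 alpha. Proof. by case: nF => -[]. Qed.
Let aal : additive_on Y alpha. Proof. by case: nF => -[]. Qed.
Let F1 e e' : P e -> P e' -> q2 e = q2 e' -> F (e *1 e') = F e + F e'.
Proof. by case: nF => _ H _ _ _; exact: H. Qed.
Let F2 e e' : P e -> P e' -> q1 e = q1 e' -> F (e *2 e') = F e + F e'.
Proof. by case: nF => _ _ H _ _; exact: H. Qed.
Let Fs w y : W' w -> Y y -> F (sigma w y) = 0.
Proof. by case: nF => _ _ _ H _; exact: H. Qed.
Let FE e : P e -> F e ^+ p - F e = alpha (q2 e) * pi (q1 e) ^+ (p ^ M).
Proof. by case: nF => _ _ _ _ H; exact: H. Qed.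
Let pM : (0 < p ^ M)%N. Proof. by rewrite expn_gt0 prime_gt0. Qed.
Let Y' := ker_on Y alpha.
Let sY' : zsubgroup Y'. Proof. exact: zsubgroup_ker. Qed.
Let Y'Y : Y' `<=` Y. Proof. by move=> y []. Qed.

Lemma zero_section_unique e e' : P e -> P e' -> tproj e = tproj e' -> F e = 0 -> F e' = 0 -> e = e'.
Proof.
move=> Pe Pe' ee' Fe Fe'; have [a [ap Ee Ea]] := as_move asF Pe Pe' ee'; rewrite Ee.
by rewrite (iota_inj ap) ?act0//; move: Ea; rewrite Fe Fe' add0r.
Qed.

(** Over [ker alpha] the function [F] takes values in the prime field, so exactly one point of each
    fibre of [ptors] has [F = 0]; biadditivity of [F] makes these points a trivialization. *)
Lemma zero_section : exists sg : U1 -> U2 -> E, [/\ trivializes W Y' sg,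
  forall w y, W w -> Y' y -> F (sg w y) = 0 &
  forall w y, W' w -> Y' y -> sg w y = sigma w y].
Proof.
have fix0 e : P e -> Y' (q2 e) -> F e ^+ p = F e.
  by move=> Pe [_ a0]; apply/eqP; rewrite -subr_eq0 FE// a0 mul0r.
have /choice[iv Hiv] : forall x : k, exists a : A, x ^+ p = x -> a *+ p = 0 /\ iota a = - x.
  move=> x; have [xp|nx] := pselect (x ^+ p = x); last by exists 0.
  have [|a ap ax] := iota_surj (x := - x); last by exists a.
  by have := frobN 1 x chp; rewrite expn1 xp.
have zero e : P e -> Y' (q2 e) -> P (act (iv (F e)) e) /\ F (act (iv (F e)) e) = 0.
  move=> Pe Ye; have [ap aE] := Hiv _ (fix0 e Pe Ye); split; first exact: ptors_act.
  by case: asF => -> // _; rewrite aE subrr.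
have /choice[sg Hsg] : forall z : U1 * U2, exists e, W z.1 -> Y' z.2 -> [/\ P e, tproj e = z & F e = 0].
  move=> [w y]; have [[Ww Yy]|nz] := pselect (W w /\ Y' y); last first.
    by exists (rone (lawG E) y) => Ww Yy; case: nz.
  have [e Pe Ee] := ptors_exists chp Adiv cW api trs Ww (Y'Y Yy).
  have [|Pz Fz] := zero e Pe; first by rewrite Ee.
  by exists (act (iv (F e)) e); split; rewrite ?tproj_act.
have sgP w y : W w -> Y' y -> P (sg (w, y)) by move=> Ww Yy; have [] := Hsg (w, y) Ww Yy.
have sgE w y : W w -> Y' y -> tproj (sg (w, y)) = (w, y) by move=> Ww Yy; have [] := Hsg (w, y) Ww Yy.
have sgF w y : W w -> Y' y -> F (sg (w, y)) = 0 by move=> Ww Yy; have [] := Hsg (w, y) Ww Yy.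
exists (fun w y => sg (w, y)); split=> //; last first.
  move=> w y Ww Yy; apply: zero_section_unique.
  - by apply: sgP => //; exact: W'W.
  - by apply: Psig => //; exact: Y'Y.
  - by rewrite sgE ?sP//; [exact: Y'Y|exact: W'W].
  - by apply: sgF => //; exact: W'W.
  - by apply: Fs => //; exact: Y'Y.
split=> //.
- move=> x x' y Wx Wx' Yy; have Wxx := zsubgroupD sW Wx Wx'.
  have Px := sgP _ _ Wx Yy; have Px' := sgP _ _ Wx' Yy.
  have qq : q2 (sg (x, y)) = q2 (sg (x', y)) by rewrite !sgE.
  apply: zero_section_unique; first exact: sgP.
  - exact: (ptors_mul1 irr1 sW kill trs).
  - by rewrite mul1_proj// !sgE.
  - exact: sgF.
  - by rewrite F1// !sgF// addr0.
- move=> x y y' Wx Yy Yy'; have Yyy := zsubgroupD sY' Yy Yy'.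
  have Py := sgP _ _ Wx Yy; have Py' := sgP _ _ Wx Yy'.
  have qq : q1 (sg (x, y)) = q1 (sg (x, y')) by rewrite !sgE.
  apply: zero_section_unique; first exact: sgP.
  - exact: (ptors_mul2 sY kill trs).
  - by rewrite mul2_proj// !sgE.
  - exact: sgF.
  - by rewrite F2// !sgF// addr0.
move=> T u v mu mv Wu Yv.
have [T' [g [r [eg sg' pr Er Pr]]]] := ptors_lift Adiv kill trs (morphism_pair mu mv) Wu (fun t => Y'Y (Yv t)).
apply: (plot_descent eg sg').
have Yr t : Y' (q2 (r t)) by rewrite Er; exact: Yv.
have -> : (fun t => sg (u t, v t)) \o g = fun t => act (iv (F (r t))) (r t).
  apply/funext => t /=; have [Pz Fz] := zero _ (Pr t) (Yr t).
  apply: zero_section_unique => //; first exact: sgP.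
    by rewrite sgE// tproj_act Er.
  exact: sgF.
apply: (plot_act pr); apply: (locally_constant_map iv); apply: (regular_frob_lc chp).
  by case: asF => _; apply.
by move=> t; exact: fix0.
Qed.

Variable sg : U1 -> U2 -> E.
Hypothesis trg : trivializes W Y' sg.
Hypotheses (Fg : forall w y, W w -> Y' y -> F (sg w y) = 0)
  (gE : forall w y, W' w -> Y' y -> sg w y = sigma w y).

Let dW' : domain_on W'. Proof. exact: conn_domain. Qed.
Let pi_onto c : exists2 w, W w & pi w = c. Proof. exact: additive_surj. Qed.

(** By uniqueness the splitting agrees with [sigma] on [ker pi], so its values are in [ptors]. Then
    [F] along it is an additive solution of the Artin-Schreier equation vanishing with [pi], which
    forces [alpha y = 0]. *)
Lemma step_split y (s : U1 -> E) (clW : @zclosed k V1 W) : plot (fun t : subv clW => s (sval t)) ->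
  (forall x, W x -> tproj (s x) = (x, y)) ->
  (forall x x', W x -> W x' -> s (x + x') = s x *1 s x') -> Y' y.
Proof.
move=> ps Ps sD; have clW' : @zclosed k V1 W' := zsubgroup_closed sW'.
pose incl (t : subv clW') : subv clW := exist _ (sval t) (W'W (svalP t)).
have mincl : morphism incl by apply: morphism_sub; exact: morphism_sval.
have ps' : plot (fun t : subv clW' => s (sval t)) := plot_comp mincl ps.
have Yy : Y y.
  case: lev => _ _ H _; apply: (H y s clW') => //.
  - by move=> x /W'W; exact: Ps.
  - by move=> x x' /W'W Wx /W'W Wx'; exact: sD.
have sE x : W' x -> s x = sigma x y.
  apply: (@section_unique _ _ _ _ E W' clW' s (fun x => sigma x y) y sW' dW') => //.
  - case: trs => _ _ _; apply.
    + exact: morphism_sval.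
    + exact: morphism_cst.
    + by move=> t; exact: (svalP t).
    + by [].
  - by move=> z /W'W; exact: Ps.
  - by move=> z Wz; exact: sP.
  - by move=> z z' /W'W Wz /W'W Wz'; exact: sD.
  - by move=> z z' Wz Wz'; case: trs => _ H _ _; exact: H.
have PsP x : W x -> P (s x).
  move=> Wx; split; rewrite ?Ps// -sE; last exact: kill.
  apply: (@morph_nmul _ _ _ _ _ _ _ _ (lawG E) p U1 s W y) => //.
  - by move=> *; exact: zsubgroupD.
  - exact: zsubgroup0.
  - by move=> z Wz; rewrite Ps.
have [|h Oh Eh] := @regular_extend k _ _ clW (fun x => F (s x)).
  by case: asF => _; apply => // t; apply: PsP; exact: (svalP t).
have [|||_ al0] := @artin_schreier_trivial k U1 p (p ^ M) W pi h (alpha y) pp pM cW Oh.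
- by move=> x x' Wx Wx'; rewrite !Eh ?sD ?F1 ?Ps//; [exact: PsP|exact: PsP|exact: zsubgroupD].
- by move=> x Wx; rewrite Eh// FE ?Ps//; exact: PsP.
- by move=> x Wx px; rewrite Eh// sE// Fs//; split.
split=> //; have [w Ww w1] := pi_onto 1.
by have := al0 w Ww; rewrite w1 expr1n mulr1.
Qed.

Let KW := K `&` W.
Let KW' := K `&` W'.
Let sKW : zsubgroup KW. Proof. exact: zsubgroupI. Qed.
Let sKW' : zsubgroup KW'. Proof. exact: zsubgroupI. Qed.
Let C := id_comp KW.
Let Y0 := id_comp Y.
Let cC : conn C. Proof. by have [] := id_compP uG1 sKW. Qed.
Let CKW : C `<=` KW. Proof. by have [] := id_compP uG1 sKW. Qed.
Let cY0 : conn Y0. Proof. by have [] := id_compP uG2 sY. Qed.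
Let Y0Y : Y0 `<=` Y. Proof. by have [] := id_compP uG2 sY. Qed.
Let C'C : id_comp KW' `<=` C.
Proof. by apply: (id_comp_sub uG1) => // x [Kx [Wx _]]. Qed.

Lemma ptors_sigma1 x y : KW x -> Y y -> sigma1 (x *+ p) y = sigma (x *+ p) y -> P (sigma1 x y).
Proof.
move=> [Kx Wx] Yy Ex; case: tr1 => sP1 sD1 _ _; split; rewrite ?sP1//= -Ex.
apply: (@morph_nmul _ _ _ _ _ _ _ _ (lawG E) p U1 (fun x => sigma1 x y) K y) => //.
- by move=> *; exact: zsubgroupD.
- exact: zsubgroup0.
- by move=> z Kz; rewrite sP1.
- by move=> z z' Kz Kz'; exact: sD1.
Qed.

Lemma sigma1_Y0 x y : KW' x -> Y0 y -> sigma1 x y = sigma x y.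
Proof.
have t1 : trivializes KW' Y0 sigma1 by apply: (trivializes_sub _ _ tr1) => // z [].
have t2 : trivializes KW' Y0 sigma by apply: (trivializes_sub _ _ trs) => // z [].
exact: (trivializes_eq2 uG2 cY0 t1 t2).
Qed.

Let kill_KW x : KW x -> KW' (x *+ p).
Proof. by move=> [Kx Wx]; split; [exact: zsubgroupMn|exact: kill]. Qed.

Lemma P_Y0 x y : KW x -> Y0 y -> P (sigma1 x y).
Proof.
move=> KWx Yy; apply: ptors_sigma1 => //; first exact: Y0Y.
by apply: sigma1_Y0 => //; exact: kill_KW.
Qed.

Let sigma1P x y : K x -> tproj (sigma1 x y) = (x, y). Proof. by move=> Kx; case: tr1 => -> //. Qed.

(** [F] along [sigma1] is an additive solution of the Artin-Schreier equation on the connected group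
    [C]. *)
Lemma sigma1_C y : Y y -> (forall x, C x -> P (sigma1 x y)) ->
  (forall x, C x -> pi x = 0 -> F (sigma1 x y) = 0) -> forall x, C x -> alpha y * pi x ^+ (p ^ M) = 0.
Proof.
move=> Yy PC F0 x Cx; have [sC _] := cC.
have [|h Oh Eh] := @regular_extend k _ _ (zsubgroup_closed sC) (fun x => F (sigma1 x y)).
  case: asF => _; apply; last by move=> t; apply: PC; exact: (svalP t).
  case: tr1 => _ _ _; apply.
  + exact: morphism_sval.
  + exact: morphism_cst.
  + by move=> t; have [] := CKW (svalP t).
  + by [].
have KC z : C z -> K z by move=> /CKW[].
have [|||_] := @artin_schreier_trivial k U1 p (p ^ M) C pi h (alpha y) pp pM cC Oh; last exact.
- move=> z z' Cz Cz'; have Czz := zsubgroupD sC Cz Cz'.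
  rewrite !Eh//; case: tr1 => _ -> //; [|exact: KC|exact: KC].
  by rewrite F1 ?sigma1P//; first [exact: PC|exact: KC].
- by move=> z Cz; rewrite Eh// FE ?sigma1P//; [exact: KC|exact: PC].
- by move=> z Cz pz; rewrite Eh// F0.
Qed.

(** The same argument in the variable [y], with [alpha] and [pi] exchanging roles. *)
Lemma sigma1_Y x : KW x -> (forall y, Y' y -> sigma1 x y = sg x y) ->
  forall y, Y0 y -> pi x ^+ (p ^ M) * alpha y = 0.
Proof.
move=> KWx E1 y Yy; have [sY0 _] := cY0; have [Kx Wx] := KWx.
have [|h Oh Eh] := @regular_extend k V2 _ (zsubgroup_closed sY0) (fun y => F (sigma1 x y)).
  case: asF => _; apply; last by move=> t; apply: P_Y0 => //; exact: (svalP t).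
  case: tr1 => _ _ _; apply.
  + exact: morphism_cst.
  + exact: morphism_sval.
  + by [].
  + by [].
have [|||_ H] := @artin_schreier_trivial k U2 p 1 Y0 alpha h (pi x ^+ (p ^ M)) pp isT cY0 Oh.
- move=> z z' Yz Yz'; have Yzz := zsubgroupD sY0 Yz Yz'.
  rewrite !Eh//; case: tr1 => _ _ -> // _.
  by rewrite F2 ?sigma1P//; exact: P_Y0.
- by move=> z Yz; rewrite Eh// FE ?sigma1P//=; [rewrite expr1 mulrC|exact: P_Y0].
- move=> z Yz az; have Y'z : Y' z by split=> //; exact: Y0Y.
  by rewrite Eh// E1// Fg.
by have := H y Yy; rewrite expr1.
Qed.

(** The source of the inequality: either [pi] vanishes on [C] or [alpha] vanishes on [Y0], so [C]
    can gain a dimension only if [Y] loses none. *)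
Lemma step_constraint x y : C x -> Y0 y -> alpha y * pi x ^+ (p ^ M) = 0.
Proof.
move=> Cx Yy; apply: sigma1_C Cx; first exact: Y0Y.
  by move=> z Cz; apply: P_Y0 => //; exact: CKW.
move=> z Cz pz; have [Kz Wz] := CKW Cz; rewrite sigma1_Y0//; first by rewrite Fs//; exact: Y0Y.
Qed.

Let pi0C : (forall x, C x -> pi x = 0) -> C = id_comp KW'.
Proof.
move=> p0; apply/seteqP; split=> //; apply: conn_sub_id_comp => //.
by move=> x Cx; have [Kx Wx] := CKW Cx; split=> //; split=> //; exact: p0.
Qed.

Let act_F e a : P e -> a *+ p = 0 -> F (act a e) = F e + iota a.
Proof. by case: asF => H _; exact: H. Qed.

Lemma sigma1_sg x y : C x -> Y' y -> sigma1 x y = sg x y.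
Proof.
have t1 : trivializes C Y' sigma1 by apply: (trivializes_sub _ _ tr1) => // z /CKW[].
have t2 : trivializes C Y' sg by apply: (trivializes_sub _ _ trg) => // z /CKW[].
exact: (trivializes_eq1 uG1 cC t1 t2).
Qed.

Let trK1 : trivializes KW' Y sigma1. Proof. by apply: (trivializes_sub _ _ tr1) => // z []. Qed.
Let trKs : trivializes KW' Y sigma. Proof. by apply: (trivializes_sub _ _ trs) => // z []. Qed.

(** Here [y] ranges over all of [Y], where only connectedness in [x] is at hand: the difference is
    locally constant along [C] and zero at 0. *)
Lemma sigma1_Cp x y : C x -> Y y -> sigma1 (x *+ p) y = sigma (x *+ p) y.
Proof.
move=> Cx Yy; have [sC _] := cC; have clC := zsubgroup_closed sC.
have KC z : C z -> KW' (z *+ p) by move=> Cz; apply: kill_KW; exact: CKW.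
have mp : @morphism k (subv clC) V1 (fun t => sval t *+ p).
  exact: (morphism_comp (morphism_mulrn p) (morphism_sval clC)).
have [_ _ _ spl1] := trK1; have [_ _ _ spls] := trKs.
have lc : locally_constant (fun t : subv clC => trdiff sigma sigma1 (sval t *+ p) y).
  apply: tdiff_locally_constant.
  - by apply: spls => // [|t]; [exact: morphism_cst|exact: KC (svalP t)].
  - by apply: spl1 => // [|t]; [exact: morphism_cst|exact: KC (svalP t)].
  - move=> t; have Kt := KC _ (svalP t).
    by case: trK1 => -> // _ _ _; case: trKs => ->.
have irrC : irreducible_variety (subv clC) by apply: irreducible_sub; exact: conn_domain.
have C0 : C 0 by exact: zsubgroup0.
have := locally_constant_const irrC lc (exist _ x Cx) (exist _ 0 C0) => /= E1.
apply/(trdiff_eq0 trKs trK1) => //; first exact: KC.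
have K0 : KW' 0 by exact: zsubgroup0.
by rewrite E1 mul0rn -(subrr (0 : U1)) (trdiffB1 sKW' trKs trK1)// subrr.
Qed.

(** [beta] compares the two trivializations. Here it has [p]-torsion values and vanishes on [Y0], so
    points give functionals on the finite group [Y / Y0]. If [y] is killed by all points of [C] in
    [ker pi], then [alpha y = 0] by [sigma1_C], and [x] kills [y] too; so the functional of [x] is
    that of some such point. *)
Lemma step_realize x : KW' x -> infinite_image C pi -> (forall y, Y0 y -> alpha y = 0) ->
  (forall y, Y' y -> sigma1 x y = sigma x y) ->
  exists2 x', C x' /\ W' x' & forall y, Y y -> sigma1 (x - x') y = sigma (x - x') y.
Proof.
move=> KWx ipC al0 Ex; have [sC _] := cC.
pose X0 := C `&` W'; have sX0 : zsubgroup X0 by exact: zsubgroupI.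
have X0K z : X0 z -> KW' z by move=> [/CKW[Kz _] Wz].
pose beta := trdiff sigma sigma1.
have be0 z y : KW' z -> Y y -> beta z y = 0 <-> sigma1 z y = sigma z y by exact: trdiff_eq0.
have beB1 z z' y : KW' z -> KW' z' -> Y y -> beta (z - z') y = beta z y - beta z' y by exact: trdiffB1.
have beB2 z y y' : KW' z -> Y y -> Y y' -> beta z (y - y') = beta z y - beta z y' by exact: trdiffB2.
(* [alpha] is additive in characteristic [p]; this is why [beta] has [p]-torsion values. *)
have pY y : Y y -> Y' (y *+ p).
  move=> Yy; split; first exact: zsubgroupMn.
  have YB y' y'' : Y y' -> Y y'' -> Y (y' - y'') by exact: zsubgroupB.
  rewrite (sub_additiveMn YB (fun y' y'' Yy' Yy'' => additive_onB sY aal Yy' Yy''))//.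
  by rewrite mulrn_pchar.
pose good z := KW' z /\ forall y, Y' y -> sigma1 z y = sigma z y.
have good_tors z y : good z -> Y y -> beta z y *+ p = 0.
  move=> [Kz gz] Yy; have YB y' y'' : Y y' -> Y y'' -> Y (y' - y'') by exact: zsubgroupB.
  rewrite -(sub_additiveMn YB (fun y' y'' Yy' Yy'' => beB2 z y' y'' Kz Yy' Yy''))//.
  by apply/be0 => //; [exact: zsubgroupMn|apply: gz; exact: pY].
have goodX z : X0 z -> good z.
  move=> Xz; split; first exact: X0K.
  by move=> y Yy; have [Cz Wz] := Xz; rewrite sigma1_sg// gE.
have goodx : good x by split.
have iotaN a : a *+ p = 0 -> iota (- a) = - iota a.
  move=> ap; have nap : (- a) *+ p = 0 by rewrite mulNrn ap oppr0.
  have i0 : iota 0 = 0.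
    by have := iotaD (mul0rn A p) (mul0rn A p); rewrite addr0 => /eqP; rewrite -subr_eq0 opprD addNKr oppr_eq0 => /eqP.
  by apply/eqP; rewrite -addr_eq0 -iotaD// addNr i0.
have iotaB a b : a *+ p = 0 -> b *+ p = 0 -> iota (a - b) = iota a - iota b.
  by move=> ap bp; rewrite iotaD ?iotaN// mulNrn bp oppr0.
have [s Hs] : finite_index Y0 Y by have [] := id_compP uG2 sY.
have Y0Y' y : Y0 y -> Y' y by move=> Yy; split; [exact: Y0Y|exact: al0].
have [|||||||||x' Xx' Ex'] := @realize_functional k p U1 U2 X0 Y (fun z y => iota (beta z y)) (fun y => iota (beta x y)) s chp.
- exact: zsubgroup0.
- by move=> z z'; exact: zsubgroupB.
- by move=> y y'; exact: zsubgroupB.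
- move=> z z' y Xz Xz' Yy; rewrite beB1 ?iotaB//; try exact: X0K.
  + by apply: good_tors => //; exact: goodX.
  + by apply: good_tors => //; exact: goodX.
- move=> z y y' Xz Yy Yy'; rewrite beB2 ?iotaB//; try exact: X0K.
  + by apply: good_tors => //; exact: goodX.
  + by apply: good_tors => //; exact: goodX.
- by move=> y y' Yy Yy'; rewrite beB2 ?iotaB//; exact: good_tors.
- by move=> z y Xz Yy; apply: iotaF; apply: good_tors => //; exact: goodX.
- by move=> y Yy; apply: iotaF; exact: good_tors.
- move=> y Yy Hy; have [w Cw w1] := additive_surj sC Opi (additive_on_sub (fun z Cz => (CKW Cz).2) api) ipC 1.
  have : alpha y * pi w ^+ (p ^ M) = 0.
    apply: sigma1_C => //.
      by move=> z Cz; apply: ptors_sigma1 => //; [exact: CKW|exact: sigma1_Cp].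
    move=> z Cz pz; have Wz : W' z by split=> //; have [] := CKW Cz.
    have Xz : X0 z by [].
    rewrite (trdiffE trKs trK1 (X0K _ Xz) Yy) act_F; last 2 first.
    + exact: Psig.
    + by apply: good_tors => //; exact: goodX.
    by rewrite Fs// add0r; exact: Hy.
  rewrite w1 expr1n mulr1 => a0.
  have -> : beta x y = 0 by apply/be0 => //; apply: Ex; split.
  by rewrite -(subrr (0 : A)) iotaB ?mul0rn// subrr.
exists x' => // y Yy; have [a sa Ya] := Hs y Yy.
have Yaa : Y a by rewrite -[a](subKr y); apply: zsubgroupB => //; exact: Y0Y.
have Kx' := X0K _ Xx'.
apply/be0 => //; first exact: zsubgroupB.
have be_a z : good z -> beta z y = beta z a.
  move=> [Kz gz]; apply/eqP; rewrite -subr_eq0 -beB2//; apply/eqP; apply/be0 => //; first exact: zsubgroupB.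
  by apply: gz; exact: Y0Y'.
rewrite beB1// !be_a//; last exact: goodX.
have gt1 := good_tors _ _ goodx Yaa; have gt2 := good_tors _ _ (goodX _ Xx') Yaa.
by apply: iota_inj; [rewrite mulrnBl gt1 gt2 subrr|rewrite iotaB// Ex'// subrr].
Qed.

(** From [ker pi] to [W], [a] grows by 1. If [alpha] is nonzero on [Y0], then [b] drops by 1 and [c]
    stays. If [alpha] vanishes on [Y0] and [pi] on [C], only [a] moves and equality is excluded. If
    [alpha] vanishes but [pi] does not, [c] grows by 1. *)
Lemma step_dim a b c u : hasdim W a -> hasdim (id_comp Y') b -> hasdim C c -> hasdim [set: U2] u ->
    (c + u <= a + b)%N /\ ((c + u = a + b)%N -> forall x, K x -> W x ->
       (forall y, Y' y -> sigma1 x y = sg x y) -> C x).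
Proof.
move=> ha hb hc hu; have [sC _] := cC.
have [m Ea] := hasdim_ker uG1 ha Opi api ipi; rewrite (id_comp_conn uG1 cW') => ha'.
have [b' hb'] := hasdim_exists uG2 cY0.
have cC' : conn (id_comp KW') by have [] := id_compP uG1 sKW'.
have [c' hc'] := hasdim_exists uG1 cC'.
have [le' eq'] : (c' + u <= m + b')%N /\ ((c' + u = m + b')%N -> forall x, K x -> W' x ->
       (forall y, Y y -> sigma1 x y = sigma x y) -> id_comp KW' x).
  by case: lev => _ _ _; apply.
have aal0 : additive_on Y0 alpha := additive_on_sub Y0Y aal.
have apC : additive_on C pi := additive_on_sub (fun z Cz => (CKW Cz).2) api.
have [ial|al0] := infinite_or_zero cY0 Oal aal0.
  have [y1 Yy1 al1] := additive_surj (proj1 cY0) Oal aal0 ial 1.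
  have p0 x : C x -> pi x = 0.
    move=> Cx; have := step_constraint Cx Yy1; rewrite al1 mul1r => /eqP.
    by rewrite expf_eq0 => /andP[_ /eqP].
  have EC := pi0C p0.
  have Ec : c = c' by apply: (hasdim_unique uG1 hc); rewrite EC.
  have [b'' Eb'] := hasdim_ker uG2 hb' Oal aal0 ial.
  rewrite (id_comp_kerE uG2 sY Oal aal) => hb''.
  have Ebb : b = b'' by exact: (hasdim_unique uG2 hb hb'').
  split; first lia.
  move=> Eq x Kx Wx Ex; rewrite EC; have KWx : KW x by [].
  have px : pi x = 0.
    have := sigma1_Y KWx Ex Yy1; rewrite al1 mulr1 => /eqP.
    by rewrite expf_eq0 => /andP[_ /eqP].
  have W'x : W' x by [].
  apply: eq' => //; first lia.
  (* [alpha] being onto on [Y0], [y] is the sum of a point of [Y'] and a point of [Y0]; the two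
     trivializations agree on both. *)
  move=> y Yy; have [y0 Yy0 ay0] := additive_surj (proj1 cY0) Oal aal0 ial (alpha y).
  have Y00 := Y0Y Yy0.
  have Yd : Y' (y - y0) by split; [exact: zsubgroupB|rewrite (additive_onB sY)// ay0 subrr].
  have KWx' : KW' x by [].
  apply/(trdiff_eq0 trKs trK1) => //.
  rewrite -[y](subrK y0) (trdiffD2 sY trKs trK1)//; last exact: Y'Y.
  have -> : trdiff sigma sigma1 x (y - y0) = 0.
    by apply/(trdiff_eq0 trKs trK1) => //; [exact: Y'Y|rewrite Ex// gE].
  have -> : trdiff sigma sigma1 x y0 = 0.
    by apply/(trdiff_eq0 trKs trK1) => //; exact: sigma1_Y0.
  by rewrite addr0.
have EY : id_comp Y' = Y0.
  apply/seteqP; split; first exact: (id_comp_sub uG2).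
  by apply: conn_sub_id_comp => // y Yy; split; [exact: Y0Y|exact: al0].
have Eb : b = b' by apply: (hasdim_unique uG2 hb); rewrite EY.
have [ipC|p0] := infinite_or_zero cC Opi apC; last first.
  have EC := pi0C p0.
  have Ec : c = c' by apply: (hasdim_unique uG1 hc); rewrite EC.
  by split; lia.
have [c'' Ec] := hasdim_ker uG1 hc Opi apC ipC.
rewrite (id_comp_kerE uG1 sKW Opi (additive_on_sub (fun z (KWz : KW z) => KWz.2) api)).
have -> : ker_on KW pi = KW'.
  by apply/seteqP; split=> x; [move=> [[Kx Wx] px]|move=> [Kx [Wx px]]].
move=> hc''; have Ecc : c' = c'' by exact: (hasdim_unique uG1 hc' hc'').
split; first lia.
move=> Eq x Kx Wx Ex.
(* A point of [C] moves [x] into [ker pi], and [step_realize] corrects the functional that remains;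
   both corrections lie in [C]. *)
have [x0 Cx0 px0] := additive_surj sC Opi apC ipC (pi x).
have [Kx0 Wx0] := CKW Cx0.
have KWx : KW' (x - x0).
  by split; [exact: zsubgroupB|split; [exact: zsubgroupB|rewrite (additive_onB sW)// px0 subrr]].
have Ex' y : Y' y -> sigma1 (x - x0) y = sigma (x - x0) y.
  move=> Yy; rewrite -gE//; last by case: KWx.
  have t1 : trivializes KW Y' sigma1 by apply: (trivializes_sub _ _ tr1) => // z [].
  have t2 : trivializes KW Y' sg by apply: (trivializes_sub _ _ trg) => // z [].
  have KWx1 : KW x by []. have KWx0 : KW x0 by [].
  apply/(trdiff_eq0 t2 t1) => //; first exact: zsubgroupB.
  rewrite (trdiffB1 sKW t2 t1)//.
  have -> : trdiff sg sigma1 x y = 0 by apply/(trdiff_eq0 t2 t1) => //; exact: Ex.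
  have -> : trdiff sg sigma1 x0 y = 0 by apply/(trdiff_eq0 t2 t1) => //; exact: sigma1_sg.
  by rewrite subrr.
have [x' [Cx' W'x'] Hx'] := step_realize KWx ipC al0 Ex'.
have [Kx' _] := CKW Cx'.
have : id_comp KW' (x - x0 - x').
  apply: eq'; [lia| | |exact: Hx'].
  - by have [Kd _] := KWx; exact: zsubgroupB.
  - by have [_ Wd] := KWx; exact: zsubgroupB.
move=> /C'C Cd.
have -> : x = x - x0 - x' + x' + x0 by rewrite !subrK.
exact: (zsubgroupD sC (zsubgroupD sC Cd Cx') Cx0).
Qed.

Lemma level_step : level W Y' sg.
Proof.
split=> //; last exact: step_dim.
exact: step_split.
Qed.

End Step.

Lemma level_exists W n : conn W -> hasdim W n -> exists Y sigma, level W Y sigma.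
Proof.
have zero (N : set U1) : conn N -> ~ (exists2 x, N x & x != 0) -> N = [set 0].
  move=> [sN _] N0; apply/seteqP; split=> [x Nx|x ->]; last exact: zsubgroup0.
  by apply/eqP/negPn/negP => xn0; apply: N0; exists x.
elim: n W => [|n IH] W cW hW; have [[x Wx xn0]|W0] := pselect (exists2 x, W x & x != 0).
- have [f [Of af inf _]] := exists_conn_kernel chp uG1 cW (ex_intro2 _ _ x Wx xn0).
  by have [m] := hasdim_ker uG1 hW Of af inf.
- by rewrite (zero W)//; exists setT, (fun _ y => rone (lawG E) y); exact: level0.
- have [f [Of af inf cW']] := exists_conn_kernel chp uG1 cW (ex_intro2 _ _ x Wx xn0).
  have [m [<-]] := hasdim_ker uG1 hW Of af inf; rewrite (id_comp_conn uG1 cW') => hW'.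
  have [Y [sigma lev]] := IH _ cW' hW'.
  have [sY trs _ _] := lev.
  have [F [M [al nF]]] := normal_form_exists chp Adiv iotaD iotaF uG1 irr1 cW Of af inf sY trs.
  have [sg [trg Fg gE]] := zero_section cW af cW' lev nF.
  exists (ker_on Y al), sg.
  exact: (level_step cW Of af inf cW' lev nF trg Fg gE).
- by rewrite (zero W)//; exists setT, (fun _ y => rone (lawG E) y); exact: level0.
Qed.

End Extension.

(** * Torsion in Qp/Zp and connected components *)

Section Padic.
Variables (R : realType) (p : nat) (hp : prime p) (Q : padic_field R p).
Local Notation N := (@Qp_norm R p Q).
Let pR : 1 < p%:R :> R. Proof. by rewrite ltr1n prime_gt1. Qed.
Let pi1 : p%:R^-1 < 1 :> R. Proof. by rewrite invf_lt1// (lt_trans ltr01). Qed.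
Let pi0 : 0 < p%:R^-1 :> R. Proof. by rewrite invr_gt0 (lt_trans ltr01). Qed.

(** [N 0 = N (0 * p) = N 0 / p]. *)
Lemma padic_norm0 : N 0 = 0.
Proof.
have H := Qp_normM (0 : Q) p%:R; rewrite mul0r Qp_normp in H.
apply/eqP/negPn/negP => n0.
have : N 0 * p%:R^-1 < N 0 by rewrite gtr_pMr// lt_neqAle eq_sym n0 Qp_norm_ge0.
by rewrite -H ltxx.
Qed.

Lemma padic_norm_p0 : (p%:R : Q) != 0.
Proof. by apply/eqP => p0; have := Qp_normp Q; rewrite p0 padic_norm0 => /eqP; rewrite eq_sym gt_eqF. Qed.

Lemma padic_norm1 : N 1 = 1.
Proof.
have H := Qp_normM (1 : Q) 1; rewrite mul1r in H.
have n0 : N 1 != 0 by apply/eqP => /Qp_norm_eq0/eqP; rewrite oner_eq0.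
by apply: (mulfI n0); rewrite mulr1.
Qed.

Lemma padic_normN x : N (- x) = N x.
Proof.
rewrite -mulN1r Qp_normM; have : N (-1) ^+ 2 = 1 by rewrite expr2 -Qp_normM mulrNN mulr1 padic_norm1.
move=> /eqP; rewrite sqrf_eq1 => /orP[/eqP->|/eqP n1]; first by rewrite mul1r.
by have := Qp_norm_ge0 (-1 : Q); rewrite n1 oppr_ge0 leNgt ltr01.
Qed.

Lemma padic_normD_le x y c : N x <= c -> N y <= c -> N (x + y) <= c.
Proof. by move=> xc yc; apply: le_trans (Qp_normD _ _) _; rewrite ge_max xc. Qed.

Lemma padic_normB_le x y c : N x <= c -> N y <= c -> N (x - y) <= c.
Proof. by move=> xc yc; apply: padic_normD_le; rewrite ?padic_normN. Qed.

Lemma padic_norm_nat n : N n%:R <= 1.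
Proof.
by elim: n => [|n IH]; rewrite ?padic_norm0// mulrS padic_normD_le// padic_norm1.
Qed.

Lemma padic_norm_int (z : int) : N z%:~R <= 1.
Proof. by case: z => n; [exact: padic_norm_nat|rewrite NegzE mulrNz padic_normN; exact: padic_norm_nat]. Qed.

Lemma padic_norm_mulp x : N x <= 1 -> N (x * p%:R) <= p%:R^-1.
Proof. by move=> x1; rewrite Qp_normM Qp_normp ler_piMl// ltW. Qed.

Lemma padic_norm_unit (z : int) : coprimez z p -> N z%:~R = 1.
Proof.
move=> /coprimezP[[u v] /= E]; apply/eqP; rewrite eq_le padic_norm_int /= leNgt; apply/negP => z1.
have : N ((u * z + v * p)%:~R) < 1.
  rewrite intrD !intrM; apply: le_lt_trans (Qp_normD _ _) _; rewrite gt_max; apply/andP; split.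
    by rewrite Qp_normM; apply: le_lt_trans z1; rewrite ler_piMl ?Qp_norm_ge0 ?padic_norm_int.
  by apply: le_lt_trans pi1; apply: padic_norm_mulp; exact: padic_norm_int.
by rewrite E padic_norm1 ltxx.
Qed.

Lemma padic_dvd_coprime (z : int) : ~~ (p %| `|z|)%N -> coprimez z p.
Proof. by move=> npz; rewrite /coprimez /gcdz /= eqz_nat -/(coprime _ _) coprime_sym prime_coprime. Qed.

Lemma padic_norm_dvd n : N n%:R <= p%:R^-1 -> (p %| n)%N.
Proof.
move=> n1; apply/negPn/negP => pn; have := padic_norm_unit (z := n) (padic_dvd_coprime (z := n) pn).
by move=> E; move: n1; rewrite -[N _]/(N (n : int)%:~R) E leNgt pi1.
Qed.

Lemma padic_int_neq0 (z : int) : z != 0 -> (z%:~R : Q) != 0.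
Proof.
rewrite -absz_gt0 => z0; have [m pm E] := pfactor_coprime hp z0.
have zE : N z%:~R = N (`|z|%N)%:R.
  by case: z {z0 E} => n; rewrite ?NegzE ?mulrNz ?padic_normN.
apply/eqP => h; move: zE; rewrite h padic_norm0 E natrM Qp_normM natrX.
have pm' : ~~ (p %| `|m : int|)%N by rewrite /= -prime_coprime.
have -> : N m%:R = 1 := padic_norm_unit (z := m) (padic_dvd_coprime (z := m) pm').
rewrite mul1r => /esym /Qp_norm_eq0 /eqP; rewrite expf_eq0 (negPf padic_norm_p0).
by rewrite andbF.
Qed.

(** Approximate [x] by a rational [a / d] with [d] prime to [p], and take [j] congruent modulo [p]
    to [a] times an inverse of [d]. *)
Lemma padic_residue x : N x <= 1 -> exists j : nat, N (x - j%:R) <= p%:R^-1.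
Proof.
move=> x1; have [q Hq] := Qp_dense x pi0; set y : Q := ratr q in Hq.
have y1 : N y <= 1.
  rewrite (_ : y = x - (x - y)); last by rewrite subKr.
  by apply: padic_normB_le => //; apply: ltW; apply: lt_trans Hq pi1.
set a := numq q; set d := denq q.
have d0 : (d%:~R : Q) != 0 by apply: padic_int_neq0; exact: denq_neq0.
have yE : y * d%:~R = a%:~R by rewrite /y /ratr divfK.
(* If [p] divided [d] it would not divide [a]; yet [a = y * d] would have norm at most [1 / p]. *)
have npd : ~~ (p %| `|d|)%N.
  apply/negP => pd; have pa : ~~ (p %| `|a|)%N.
    apply/negP => pa; have := coprime_num_den q; rewrite /coprime => /eqP E.
    have := dvdn_gcd p `|a| `|d|; rewrite pa pd E dvdn1 /=.
    by case: eqP hp => [->|].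
  have : N a%:~R <= p%:R^-1.
    have [e Ed] := dvdnP pd.
    have dE : d = (e%:Z * p%:Z) by rewrite -PoszM -Ed gez0_abs// ltW// denq_gt0.
    rewrite -yE dE intrM mulrA; apply: padic_norm_mulp.
    by rewrite Qp_normM mulr_ile1 ?Qp_norm_ge0 ?padic_norm_int.
  by rewrite padic_norm_unit ?padic_dvd_coprime// leNgt pi1.
have nd : N d%:~R = 1 by apply: padic_norm_unit; exact: padic_dvd_coprime.
have /coprimezP[[u v] /= E] := padic_dvd_coprime npd.
pose j0 := a * u; pose r := (j0 %% p)%Z.
have p0 : (p%:Z != 0) by rewrite eqz_nat -lt0n prime_gt0.
have r0 : r = `|r|%N :> int by rewrite gez0_abs// modz_ge0.
exists `|r|%N.
have -> : x - `|r|%N%:R = (x - y) + ((y - j0%:~R) + ((j0 %/ p)%Z%:~R * p%:R)).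
  have -> : (`|r|%N%:R : Q) = r%:~R by rewrite {2}r0.
  have Ej : j0%:~R = (j0 %/ p)%Z%:~R * p%:R + r%:~R :> Q.
    by rewrite {1}(divz_eq j0 p) intrD intrM.
  by rewrite Ej; ring.
apply: padic_normD_le; first exact: ltW.
apply: padic_normD_le; last by apply: padic_norm_mulp; exact: padic_norm_int.
have -> : N (y - j0%:~R) = N ((y - j0%:~R) * d%:~R) by rewrite Qp_normM nd mulr1.
have -> : (y - j0%:~R) * d%:~R = (a * v)%:~R * p%:R.
  rewrite mulrBl yE -intrM -[p%:R]/((p%:Z)%:~R) -intrM -intrB; congr (_%:~R).
  rewrite -[a in a - _]mulr1 -E /j0; ring.
by apply: padic_norm_mulp; exact: padic_norm_int.
Qed.

End Padic.

Section TorsionCharacter.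
Variables (R : realType) (p : nat) (hp : prime p) (A : QpmodZp R p) (k : closedFieldType).
Hypothesis chp : p \in [pchar k].
Local Notation N := (@Qp_norm R p (QZ_Qp A)).
Local Notation pr := (QZ_proj A).

Lemma QpmodZp_div (a : A) : exists b : A, b *+ p = a.
Proof.
have [x <-] := QZ_surj a; exists (pr (x / p%:R)).
by rewrite -raddfMn -[_ / _ *+ p]mulr_natr divfK// padic_norm_p0.
Qed.

(** The generator [a0] is the class of [1 / p]. *)
Lemma QpmodZp_torsion : exists a0 : A, a0 *+ p = 0 /\
  (forall a, a *+ p = 0 -> exists j : nat, a = a0 *+ j) /\ (forall j : nat, a0 *+ j = 0 -> (p %| j)%N).
Proof.
have p0 := padic_norm_p0 hp (QZ_Qp A).
have Np x : N (x / p%:R) = N x * p%:R.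
  have H := Qp_normM (x / p%:R) p%:R; rewrite divfK// Qp_normp in H.
  by rewrite H mulfVK// pnatr_eq0 -lt0n prime_gt0.
have pR0 : 0 < p%:R :> R by rewrite ltr0n prime_gt0.
exists (pr (p%:R^-1)); split; last split.
- rewrite -raddfMn -[_^-1 *+ p]mulr_natr mulVf//; apply/QZ_ker.
  by rewrite padic_norm1.
- move=> a; have [x <-] := QZ_surj a; rewrite -raddfMn => /QZ_ker.
  rewrite -[x *+ p]mulr_natr => /(padic_residue hp)[j Hj]; exists j.
  apply/eqP; rewrite -subr_eq0 -raddfMn -raddfB; apply/eqP/QZ_ker.
  have -> : x - p%:R^-1 *+ j = (x * p%:R - j%:R) / p%:R by rewrite mulrBl mulfK// mulr_natl.
  by rewrite Np -ler_pdivlMr// mul1r.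
- move=> j; rewrite -raddfMn => /QZ_ker; rewrite -[_ *+ j]mulr_natl Np -ler_pdivlMr// mul1r.
  exact: padic_norm_dvd.
Qed.

(** [a0 *+ j] is sent to [j]; values off the [p]-torsion are arbitrary. *)
Lemma torsion_character : exists iota : A -> k,
  [/\ forall a b : A, a *+ p = 0 -> b *+ p = 0 -> iota (a + b) = iota a + iota b,
      forall a : A, a *+ p = 0 -> iota a = 0 -> a = 0,
      forall a : A, a *+ p = 0 -> iota a ^+ p = iota a &
      forall x : k, x ^+ p = x -> exists2 a : A, a *+ p = 0 & iota a = x].
Proof.
have [a0 [a0p [gen ord]]] := QpmodZp_torsion.
have dvd0 j : (p %| j)%N -> a0 *+ j = 0.
  by move=> /dvdnP[m ->]; rewrite mulnC mulrnA a0p mul0rn.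
have eqj i j : a0 *+ i = a0 *+ j -> i%:R = j%:R :> k.
  wlog ij : i j / (i <= j)%N.
    by move=> H E; case/orP: (leq_total i j) => h; [|symmetry]; apply: H.
  move=> /esym/eqP; rewrite -subr_eq0 -mulrnBr// => /eqP/ord; rewrite (dvdn_pcharf chp) natrB//.
  by rewrite subr_eq0 => /eqP.
have /choice[nn Hn] : forall a : A, exists j : nat, a *+ p = 0 -> a = a0 *+ j.
  move=> a; have [ap|nap] := pselect (a *+ p = 0); last by exists 0%N.
  by have [j ->] := gen a ap; exists j.
exists (fun a => (nn a)%:R); split.
- move=> a b ap bp; rewrite -natrD; apply: eqj.
  by rewrite mulrnDr -!Hn// mulrnDl ap bp addr0.
- move=> a ap; rewrite (Hn a ap) => /eqP; rewrite -(dvdn_pcharf chp) => d.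
  by apply: dvd0; move: d; rewrite -(Hn a ap).
- by move=> a _; have := rmorph_nat (pFrobenius_aut chp) (nn a).
- move=> x /(frob_fixed_nat chp)[j ->]; exists (a0 *+ j).
    by rewrite -mulrnA mulnC mulrnA a0p mul0rn.
  by apply: eqj; rewrite -Hn// -mulrnA mulnC mulrnA a0p mul0rn.
Qed.

End TorsionCharacter.

(** * Algebraic and topological connectedness *)

Section Components.
Variables (k : closedFieldType) (G : calg_group k).
Notation O := (@regular k (cag_var G)).
Implicit Types (H N D : set G).

(** Inside [N], the complement of a coset is the union of the finitely many others. *)
Lemma coset_complement H N x : zsubgroup H -> finite_index H N ->
  exists Z : set G, @zclosed k (cag_var G) Z /\ forall z, N z -> Z z <-> ~ H (z - x).
Proof.
move=> sH [s Hs].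
have HE a z : H (z - a) -> H (z - x) <-> H (a - x).
  move=> za; split=> h.
    have -> : a - x = (z - x) - (z - a) by rewrite opprB [RHS]addrC addrA subrK.
    exact: zsubgroupB.
  have -> : z - x = (z - a) + (a - x) by rewrite addrA subrK.
  exact: zsubgroupD.
exists [set z | exists2 a, a \in s & ~ H (a - x) /\ H (z - a)]; split; last first.
  move=> z Nz; split=> [[a _ [na za]]|nz]; first by rewrite (HE a).
  by have [a sa za] := Hs z Nz; exists a => //; rewrite -(HE a z).
elim: s {Hs} => [|a s IH].
  rewrite (_ : [set z | _] = [set z : G | (1 : k) = 0]); first by apply: zclosed0; exact: reg_cst.
  by apply/seteqP; split=> z /= => [[]//|/eqP]; rewrite oner_eq0.
have [ha|na] := pselect (H (a - x)).
  rewrite (_ : [set z | _] = [set z | exists2 a, a \in s & ~ H (a - x) /\ H (z - a)])//.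
  apply/seteqP; split=> z [b]; first by rewrite inE => /orP[/eqP-> []|bs Hb] //; exists b.
  by move=> bs Hb; exists b => //; rewrite inE bs orbT.
rewrite (_ : [set z | _] = [set z | H (z - a)] `|` [set z | exists2 a, a \in s & ~ H (a - x) /\ H (z - a)]).
  by apply: zclosedU => //; apply: zclosed_shift; exact: zsubgroup_closed.
apply/seteqP; split=> z.
  by move=> [b]; rewrite inE => /orP[/eqP-> [_]|bs Hb]; [left|right; exists b].
by move=> [za|[b bs Hb]]; [exists a; rewrite ?mem_head|exists b; rewrite // inE bs orbT].
Qed.

(** Cosets of a closed subgroup of finite index are open and closed in [N]. *)
Lemma connected_coset (H N : set G) (D : set (zariski (cag_var G))) (x y : G) : zsubgroup H -> finite_index H N ->
  D `<=` N -> connected D -> D x -> D y -> H (y - x).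
Proof.
move=> sH fH DN cD Dx Dy; have [Z [clZ ZE]] := coset_complement x sH fH.
have : D `&` [set z | H (z - x)] = D.
  apply: cD.
  - by exists x; split=> //=; rewrite subrr; exact: zsubgroup0.
  - exists (~` Z); first by apply/zariski_openP; rewrite setCK.
    apply/seteqP; split=> z [Dz Hz]; split=> //.
      by move=> Zz; have [/(_ Zz)] := ZE z (DN z Dz).
    by apply: contrapT => nHz; have [_ /(_ nHz)] := ZE z (DN z Dz).
  - exists [set z | H (z - x)] => //; rewrite -[X in closed X]setCK; apply: open_closedC.
    apply/zariski_openP; rewrite setCK; apply: zclosed_shift; exact: zsubgroup_closed.
by move=> E; have : D y by []; rewrite -E => -[].
Qed.

Lemma connected_group_conn : connected_group G -> conn [set: G].
Proof.
move=> cG; split; first exact: zsubgroupT.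
move=> H sH _ fH x _; rewrite -[x]subr0.
by apply: (connected_coset sH fH _ cG).
Qed.

(** A proper nonempty part that is open and closed would give two functions, neither zero on [D],
    with product zero. *)
Lemma domain_connected (D : set G) : domain_on D -> connected (D : set (zariski (cag_var G))).
Proof.
move=> dD B [x1 Bx1] [C1 oC1 E1] [C2 cC2 E2].
have clC2 : @zclosed k (cag_var G) C2 by have := closed_openC cC2 => /zariski_openP; rewrite setCK.
have clC1 := (zariski_openP _).1 oC1.
apply: contrapT => nBD.
have [x2 Dx2 nBx2] : exists2 x2, D x2 & ~ B x2.
  apply: contrapT => h; apply: nBD; apply/seteqP; split; first by rewrite E1 => z [].
  by move=> z Dz; apply: contrapT => nBz; apply: h; exists z.
have [f [Of f0 fx1]] : exists f, [/\ O f, forall z, ~ C1 z -> f z = 0 & f x1 != 0].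
  apply: contrapT => h; have : (~` C1) x1; last by apply; move: Bx1; rewrite E1 => -[].
  apply: clC1 => f Of f0; apply/eqP/negPn/negP => nf; apply: h; exists f; split=> //.
have [g [Og g0 gx2]] : exists g, [/\ O g, forall z, C2 z -> g z = 0 & g x2 != 0].
  apply: contrapT => h; have : C2 x2; last by move=> C2x; apply: nBx2; rewrite E2; split.
  by apply: clC2 => g Og g0; apply/eqP/negPn/negP => ng; apply: h; exists g; split.
have [z Dz|fz|gz] := dD f g Of Og.
- have [Bz|nBz] := pselect (B z).
    by rewrite g0 ?mulr0//; move: Bz; rewrite E2 => -[].
  by rewrite f0 ?mul0r// => C1z; apply: nBz; rewrite E1; split.
- by move: fx1; rewrite fz ?eqxx//; move: Bx1; rewrite E1 => -[].
- by move: gx2; rewrite gz ?eqxx.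
Qed.

End Components.

Section Kernels.
Variables (k : closedFieldType) (A : zmodType) (p : nat) (iota : A -> k).
Hypothesis chp : p \in [pchar k].
Hypothesis Adiv : forall a : A, exists b, b *+ p = a.
Hypothesis iotaD : forall a b : A, a *+ p = 0 -> b *+ p = 0 -> iota (a + b) = iota a + iota b.
Hypothesis iota_inj : forall a : A, a *+ p = 0 -> iota a = 0 -> a = 0.
Hypothesis iotaF : forall a : A, a *+ p = 0 -> iota a ^+ p = iota a.
Hypothesis iota_surj : forall x : k, x ^+ p = x -> exists2 a, a *+ p = 0 & iota a = x.

(** At [W = U1], the splitting clause of [level] identifies [Y] with [K2]. *)
Lemma kernel_level (U1 U2 : calg_group k) (E : biextension U1 U2 A) (K : set U1) (sigma1 : U1 -> U2 -> E) :
  unipotent U1 -> unipotent U2 -> conn [set: U1] -> conn [set: U2] ->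
  zsubgroup K -> trivializes K setT sigma1 ->
  exists sigma, level K sigma1 setT (K2 E) sigma.
Proof.
move=> u1 u2 c1 c2 sK tr1; have [n hn] := hasdim_exists u1 c1.
have [Y [sg lev]] := level_exists chp Adiv iotaD iota_inj iotaF iota_surj u1 u2 c1 c2 sK tr1 c1 hn.
suff <- : Y = K2 E by exists sg.
have [_ trg spl _] := lev.
apply/seteqP; split=> y.
  move=> Yy; exists (fun x => sg x y); case: trg => gP gD _ gplot; split.
  - by apply: gplot => //; exact: morphism_cst.
  - by move=> x; exact: gP.
  - by move=> x x'; exact: gD.
move=> [s [ps Ps sD]]; apply: (spl y s (@zclosedT k (cag_var U1))) => //.
exact: (plot_comp (morphism_sval _) ps).
Qed.

(** Closedness of [K2] comes out of the induction itself, run with the trivial subgroup as [K]. *)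
Lemma K2_zsubgroup (U1 U2 : calg_group k) (E : biextension U1 U2 A) :
  unipotent U1 -> unipotent U2 -> conn [set: U1] -> conn [set: U2] -> zsubgroup (K2 E : set U2).
Proof.
move=> u1 u2 c1 c2.
have [sg []] := kernel_level u1 u2 c1 c2 (@zsubgroup_triv k U1) (trivial_trivializes E).
by [].
Qed.

Lemma K2_swap (U1 U2 : calg_group k) (E : biextension U1 U2 A) : K2 (swap_biextension E) = K1 E.
Proof.
apply/seteqP; split=> x [s [ps Ps sD]]; exists s; split=> // y.
  by have [h1 h2] := Ps y; rewrite [LHS]surjective_pairing h1 h2.
by rewrite /= /swap_proj Ps.
Qed.

Lemma K1_zsubgroup (U1 U2 : calg_group k) (E : biextension U1 U2 A) :
  unipotent U1 -> unipotent U2 -> conn [set: U1] -> conn [set: U2] -> zsubgroup (K1 E : set U1).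
Proof. by move=> u1 u2 c1 c2; rewrite -K2_swap; exact: K2_zsubgroup. Qed.

(* The two inequalities of [level], for [E] and for its swap, are opposite to
   each other, hence equalities. *)
Lemma pairing_kernels (U1 U2 : calg_group k) (E : biextension U1 U2 A) (sigma1 sigma2 : U1 -> U2 -> E) :
  unipotent U1 -> unipotent U2 -> conn [set: U1] -> conn [set: U2] ->
  trivializes (K1 E) setT sigma1 -> trivializes setT (K2 E) sigma2 ->
  (forall x, K1 E x -> (forall y, K2 E y -> sigma1 x y = sigma2 x y) -> id_comp (K1 E : set U1) x) /\
  (forall y, K2 E y -> (forall x, K1 E x -> sigma1 x y = sigma2 x y) -> id_comp (K2 E : set U2) y).
Proof.
move=> u1 u2 c1 c2 tr1 tr2.
have s1 := K1_zsubgroup E u1 u2 c1 c2; have s2 := K2_zsubgroup E u1 u2 c1 c2.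
have [sg [_ trg _ dim]] := kernel_level u1 u2 c1 c2 s1 tr1.
have [sg' [_ trg' _ dim']] := kernel_level u2 u1 c2 c1 s2 (swap_trivializes tr2).
rewrite K2_swap in trg' dim'.
rewrite !setIT in dim dim'.
have [c1' _ _] := id_compP u1 s1; have [c2' _ _] := id_compP u2 s2.
have [a ha] := hasdim_exists u1 c1; have [b hb] := hasdim_exists u2 c2'.
have [c hc] := hasdim_exists u1 c1'; have [u hu] := hasdim_exists u2 c2.
(* With [a], [u] the dimensions of [U1], [U2] and [c], [b] those of [K1], [K2], these read
   [c + u <= a + b] and [b + a <= u + c]. *)
have [le1 eq1] := dim _ _ _ _ ha hb hc hu.
have [le2 eq2] := dim' _ _ _ _ hu hc hb ha.
split.
- move=> x Kx Hx; apply: eq1 => //; first lia.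
  move=> y Ky; rewrite Hx//.
  exact: (trivializes_eq1 u1 c1 tr2 trg).
- move=> y Ky Hy; apply: eq2 => //; first lia.
  move=> x Kx; rewrite -Hy//.
  exact: (trivializes_eq1 u2 c2 (swap_trivializes tr1) trg').
Qed.

End Kernels.

Theorem corollary1p4 (R : realType) (p l : nat) (k : closedFieldType)
  (hp : prime p) (hk : p \in [pchar k]) (hl : prime l) (hlp : l <> p)
  (A : QpmodZp R p) (F : Qlbar R l)
  (psi : A -> F) (hpsi : injective_character psi)
  (U1 U2 : calg_group k)
  (hU1 : unipotent U1) (hU2 : unipotent U2)
  (hc1 : connected_group U1) (hc2 : connected_group U2)
  (L : @local_system k R l F (prodv (cag_var U1) (cag_var U2)) (0 : U1, 0 : U2))
  (hL : bimultiplicative L)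
  (E : biextension U1 U2 A) (hE : induced_local_system psi E L)
  (sigma1 sigma2 : U1 -> U2 -> E)
  (hs1 : trivializes (K1 E) [set: U2] sigma1)
  (hs2 : trivializes [set: U1] (K2 E) sigma2) :
  exists B : pi0 (K1 E) -> pi0 (K2 E) -> A,
    [/\ associated_pairing B sigma1 sigma2,
        biadditive_pairing B & nondegenerate_pairing B].
Proof.
have c1 := connected_group_conn hc1; have c2 := connected_group_conn hc2.
have [iota [iotaD iota_inj iotaF iota_surj]] := torsion_character hp A hk.
have Adiv := QpmodZp_div hp (A := A).
have s1 := K1_zsubgroup hk Adiv iotaD iota_inj iotaF iota_surj E hU1 hU2 c1 c2.
have s2 := K2_zsubgroup hk Adiv iotaD iota_inj iotaF iota_surj E hU1 hU2 c1 c2.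
have [ker1 ker2] := pairing_kernels hk Adiv iotaD iota_inj iotaF iota_surj hU1 hU2 c1 c2 hs1 hs2.
have t1 : trivializes (K1 E) (K2 E) sigma1 by exact: trivializes_sub hs1.
have t2 : trivializes (K1 E) (K2 E) sigma2 by exact: trivializes_sub hs2.
(* The order of the arguments gives [sigma1 = act beta sigma2]. Uniqueness of trivializations over a
   connected factor makes [beta] vanish on either identity component, so it descends to
   components. *)
pose beta := trdiff sigma2 sigma1.
have [cD1 D1K fD1] := id_compP hU1 s1; have [cD2 D2K fD2] := id_compP hU2 s2.
have [sD1 _] := cD1; have [sD2 _] := cD2.
have b1 x y : id_comp (K1 E : set U1) x -> K2 E y -> beta x y = 0.
  move=> Dx Ky; apply/(trdiff_eq0 t2 t1) => //; first exact: D1K.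
  have h1 := trivializes_sub D1K (@subset_refl _ _) t1.
  have h2 := trivializes_sub D1K (@subset_refl _ _) t2.
  exact: (trivializes_eq1 hU1 cD1 h1 h2).
have b2 x y : K1 E x -> id_comp (K2 E : set U2) y -> beta x y = 0.
  move=> Kx Dy; apply/(trdiff_eq0 t2 t1) => //; first exact: D2K.
  have h1 := trivializes_sub (@subset_refl _ _) D2K t1.
  have h2 := trivializes_sub (@subset_refl _ _) D2K t2.
  exact: (trivializes_eq2 hU2 cD2 h1 h2).
(* A connected subset of [K1] lies in one coset of the identity component. *)
have comp1 (x x' : {x | K1 E x}) : pi0_class x = pi0_class x' -> id_comp (K1 E : set U1) (sval x - sval x').
  move=> /(congr1 sval) /= Ec.
  have Cx : connected_component (K1 E : set (zariski (cag_var U1))) (sval x') (sval x).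
    by rewrite -Ec; apply: connected_component_refl; exact: (svalP x).
  have Cx' : connected_component (K1 E : set (zariski (cag_var U1))) (sval x') (sval x').
    by apply: connected_component_refl; exact: (svalP x').
  exact: (connected_coset sD1 fD1 (@connected_component_sub _ _ _) (@component_connected _ _ _) Cx' Cx).
have comp2 (y y' : {y | K2 E y}) : pi0_class y = pi0_class y' -> id_comp (K2 E : set U2) (sval y - sval y').
  move=> /(congr1 sval) /= Ec.
  have Cy : connected_component (K2 E : set (zariski (cag_var U2))) (sval y') (sval y).
    by rewrite -Ec; apply: connected_component_refl; exact: (svalP y).
  have Cy' : connected_component (K2 E : set (zariski (cag_var U2))) (sval y') (sval y').
    by apply: connected_component_refl; exact: (svalP y').
  exact: (connected_coset sD2 fD2 (@connected_component_sub _ _ _) (@component_connected _ _ _) Cy' Cy).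
(* [B] is defined on chosen representatives of the components; [BE] shows that the choice is
   immaterial. *)
have /choice[r1 Hr1] : forall c : pi0 (K1 E), exists x : {x | K1 E x}, pi0_class x = c.
  move=> [C [x Kx EC]]; exists (exist _ x Kx); exact: eq_exist.
have /choice[r2 Hr2] : forall c : pi0 (K2 E), exists y : {y | K2 E y}, pi0_class y = c.
  move=> [C [y Ky EC]]; exists (exist _ y Ky); exact: eq_exist.
pose B c d := beta (sval (r1 c)) (sval (r2 d)).
have BE (x : {x | K1 E x}) (y : {y | K2 E y}) : B (pi0_class x) (pi0_class y) = beta (sval x) (sval y).
  have Kx := svalP x; have Ky := svalP y.
  have Kx' := svalP (r1 (pi0_class x)); have Ky' := svalP (r2 (pi0_class y)).
  transitivity (beta (sval x) (sval (r2 (pi0_class y)))).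
    apply/eqP; rewrite -subr_eq0 -(trdiffB1 s1 t2 t1)//; apply/eqP; apply: b1 => //.
    by apply: comp1; rewrite Hr1.
  apply/eqP; rewrite -subr_eq0 -(trdiffB2 s2 t2 t1)//; apply/eqP; apply: b2 => //.
  by apply: comp2; rewrite Hr2.
exists B; split.
- by move=> x y; rewrite BE; apply: (trdiffE t2 t1); [exact: (svalP x)|exact: (svalP y)].
- split=> [x x' x'' d Ex|c y y' y'' Ey].
    rewrite -(Hr2 d) !BE Ex; apply: (trdiffD1 s1 t2 t1); exact: svalP.
  rewrite -(Hr1 c) !BE Ey; apply: (trdiffD2 s2 t2 t1); exact: svalP.
have top1 := domain_connected (conn_domain hU1 cD1).
have top2 := domain_connected (conn_domain hU2 cD2).
split=> [c Hc|d Hd].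
(* Orthogonality to all of [K2] says that [sigma1] and [sigma2] agree at the representative, so
   [ker1] puts it in the algebraic identity component, which is connected and contains 0. *)
- have Dx : id_comp (K1 E : set U1) (sval (r1 c)).
    apply: ker1 => [|y Ky]; first exact: svalP.
    apply/(trdiff_eq0 t2 t1) => //; first exact: svalP.
    by have := Hc (pi0_class (exist _ y Ky)); rewrite -(Hr1 c) BE Hr1.
  rewrite -[in LHS](Hr1 c) /=; apply/esym/same_connected_component.
  exact (@connected_component_max (zariski (cag_var U1)) (K1 E) (id_comp (K1 E : set U1)) (0 : U1) (zsubgroup0 sD1) D1K top1 _ Dx).
- have Dy : id_comp (K2 E : set U2) (sval (r2 d)).
    apply: ker2 => [|x Kx]; first exact: svalP.
    apply/(trdiff_eq0 t2 t1) => //; first exact: svalP.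
    by have := Hd (pi0_class (exist _ x Kx)); rewrite -(Hr2 d) BE Hr2.
  rewrite -[in LHS](Hr2 d) /=; apply/esym/same_connected_component.
  exact (@connected_component_max (zariski (cag_var U2)) (K2 E) (id_comp (K2 E : set U2)) (0 : U2) (zsubgroup0 sD2) D2K top2 _ Dy).
Qed.
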